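(* Let $C=V(x^2+y^2+z^2)\subset \mathbb{P}^2_\mathbb{R}$. Let $U_1=D_+(z)$ and $U_2=D_+(y)$ be the given basic opens of $C$, which cover $C$, and write $R_1=\Gamma(U_1,\mathcal{O}_{U_1})$, $R_2=\Gamma(U_2,\mathcal{O}_{U_2})$ and $R_{12}=\Gamma(U_1\cap U_2,\mathcal{O}_{U_1\cap U_2})$ for the associated coordinate rings. (1) Any vector bundle $\mathcal{V}$ on $C$ is describable by a canonical transition matrix $M(\mathcal{V})$ on $U_1\cap U_2$ which is a block sum $M(\mathcal{V})=\bigoplus_{i\in \mathbb{Z}} M_i^{\oplus m_i}$, for uniquely determined integers $m_i\geq 0$ (all but finitely many zero), where $$M_i= (-y/z)^{i/2} \ \text{ (a } 1\times 1 \text{ block) if } i\equiv 0 \pmod 2,$$ $$M_i=\begin{bmatrix} (-y/z)^{(i+1)/2} & (x/z)(-y/z)^{(i-1)/2} \\ 0 & (-y/z)^{(i-1)/2} \end{bmatrix}\ \text{ if } i\equiv 1 \pmod 2.$$ (2) There is an algorithm which, given $n\ge 1$ and any transition matrix $M\in \mathrm{GL}_n(R_{12})$ describing a rank $n$ vector bundle $\mathcal{V}$ on $C$, computes a block diagonal matrix $M(\mathcal{V})$ of the form in (1) for which there exist multipliers $L\in \mathrm{GL}_n(R_2)$ and $R\in \mathrm{GL}_n(R_1)$ satisfying $LMR=M(\mathcal{V})$, and which uses a number of field operations that is bounded by a polynomial in $n$ and $d$, where $d=d_w(\phi^{-1}(M))$. (3) Multipliers $L\in \mathrm{GL}_n(R_2)$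 and $R\in \mathrm{GL}_n(R_1)$ with $LMR=M(\mathcal{V})$ can similarly be found by an algorithm using a number of field operations bounded by a polynomial in $n$ and $d$.
   Context: Explicitly, $R_1=\mathbb{R}[\frac{x}{z},\frac{y}{z}]/((\frac{x}{z})^2+(\frac{y}{z})^2+1)$, $R_2=\mathbb{R}[\frac{x}{y},\frac{z}{y}]/((\frac{x}{y})^2+(\frac{z}{y})^2+1)$, and $R_{12}=R_2[(\frac{z}{y})^{-1}]=R_1[(\frac{y}{z})^{-1}]$ (all inside the function field of $C$). Every vector bundle on $C$ is trivial on $U_1$ and on $U_2$. A matrix $M\in\mathrm{GL}_n(R_{12})$ describes (is a transition matrix of) the rank $n$ bundle obtained by gluing $\mathcal{O}_{U_1}^n$ and $\mathcal{O}_{U_2}^n$ along $U_1\cap U_2$ via $M$, viewed as the map from the trivialization over $U_1$ to that over $U_2$. Two matrices $M,N\in \mathrm{GL}_n(R_{12})$ describe isomorphic bundles if and only if $V_2MV_1=N$ for some $V_2\in\mathrm{GL}_n(R_2)$ and $V_1\in\mathrm{GL}_n(R_1)$. Over $\mathbb{C}$ there is an isomorphism $\phi:\mathbb{P}^1_\mathbb{C}\to C_\mathbb{C}$, $[u:v]\mapsto [i(u^2-2uv+2v^2): 2v(u-v): u(2v-u)]$. With $w=u/v$, pulling back along $\phi$ means substituting $\frac{x}{y} = \frac{i(w^2-2w+2)}{2(w-1)}$ and $-\frac{z}{y} = \frac{w^2-2w}{2(w-1)}$; for $M\in \mathrm{GL}_n(R_{12})$ the resulting matrix in $\mathrm{GL}_n(\mathbb{C}(w))$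 is denoted $\phi^{-1}(M)$. For an $n\times n$ matrix $A$ over $\mathbb{C}(w)$ put $d_w(A)=\max_{i,j}\deg_w(A_{i,j})$, where for a rational function $p=f/g$ with $f,g\in\mathbb{C}[w]$ (in lowest terms) $\deg_w(p)=\max\{\deg f,\deg g\}$. Complexity is algebraic complexity: the number of operations in the coefficient field ($\mathbb{R}$, or its quadratic extension $\mathbb{C}$). *)

(* Defs.v *)
From HB Require Import structures.
From mathcomp Require Import all_boot all_order all_algebra.
From mathcomp Require Import qfpoly finmap complex boolp reals.

Set Implicit Arguments.
Unset Strict Implicit.
Unset Printing Implicit Defensive.

Import Order.TTheory GRing.Theory Num.Theory.

Local Open Scope ring_scope.

Section Conic.
Variable R : realType.

(* The function field of C = V(x^2 + y^2 + z^2).  With t = y/z and s = x/z it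
   is the fraction field of R[s, t]/(s^2 + t^2 + 1), that is R(t)[s] with
   s^2 = - (t^2 + 1). *)

Definition conic_poly : {poly {fraction {poly R}}} :=
  'X^2 + (FracField.tofrac ('X^2 + 1))%:P.

Lemma conic_poly_irreducible : monic_irreducible_poly conic_poly.
Proof.
have szp : size conic_poly = 3%N.
  rewrite /conic_poly size_polyDl ?size_polyXn //.
  by rewrite ltnS (leq_trans (size_polyC_leq1 _)).
split; last first.
  rewrite monicE /conic_poly lead_coefDl ?lead_coefXn //.
  by rewrite size_polyXn ltnS (leq_trans (size_polyC_leq1 _)).
apply: cubic_irreducible; first by rewrite szp.
move=> x; apply/negP; rewrite rootE /conic_poly !hornerE.
elim/quotW: x => r /eqP.
set y := \pi_{fraction {poly R}}%qT r.
have yE : y * FracField.tofrac \d_r = FracField.tofrac \n_r.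
  rewrite /y; apply/eqP.
  change (FracField.mul (\pi_{fraction {poly R}}%qT r) (FracField.tofrac \d_r) ==
          FracField.tofrac \n_r).
  rewrite piE FracField.equivfE /FracField.mulf.
  rewrite !numden_Ratio ?mulf_neq0 ?oner_eq0 ?denom_ratioP //.
  by rewrite !mulr1 mulrC.
move=> h; have /eqP : \n_r ^+ 2 + ('X^2 + 1) * \d_r ^+ 2 == 0.
  rewrite -tofrac_eq0 tofracD tofracXn tofracM tofracXn -yE exprMn -mulrDl.
  by rewrite h mul0r.
move/eqP; rewrite addr_eq0 => /eqP /(congr1 (fun p => lead_coef p)).
rewrite lead_coefN lead_coef_exp lead_coefM lead_coef_exp lead_coefDl ?lead_coefXn; last first.
  by rewrite size_polyXn size_poly1.
rewrite mul1r => /eqP; rewrite -addr_eq0 paddr_eq0 ?sqr_ge0 // => /andP[_].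
by rewrite sqrf_eq0 lead_coef_eq0 (negPf (denom_ratioP r)).
Qed.

Definition ffield : fieldType := {poly %/ conic_poly with conic_poly_irreducible}.

Definition cst : {rmorphism R -> ffield} :=
  in_alg ffield \o @FracField.tofrac {poly R} \o polyC.

Definition x_z : ffield := in_qpoly conic_poly 'X.
Definition y_z : ffield := (FracField.tofrac 'X)%:A.
Definition x_y : ffield := x_z / y_z.
Definition z_y : ffield := y_z^-1.

(* The value P(a, b) of a polynomial P(A, B), read as a polynomial in A with
   coefficients in R[B]. *)
Definition eval2 (a b : ffield) (P : {poly {poly R}}) : ffield :=
  (map_poly (horner_eval b \o map_poly cst) P).[a].

(* Gamma(U_1) = R[x/z, y/z], Gamma(U_2) = R[x/y, z/y] and
   Gamma(U_1 :&: U_2) = R[x/z, y/z][(y/z)^-1] inside the function field. *)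
Definition R1 : {pred ffield} :=
  fun f => `[< exists P, f = eval2 x_z y_z P >].
Definition R2 : {pred ffield} :=
  fun f => `[< exists P, f = eval2 x_y z_y P >].
Definition R12 : {pred ffield} :=
  fun f => `[< exists k : nat, f * y_z ^+ k \in R1 >].

Lemma y_z_neq0 : y_z != 0.
Proof. by rewrite scaler_eq0 oner_eq0 orbF tofrac_eq0 polyX_eq0. Qed.

Lemma eval2_subring (a b : ffield) :
  subring_closed (fun f => `[< exists P, f = eval2 a b P >]).
Proof.
split=> [|f g /asboolP[P ->] /asboolP[Q ->]|f g /asboolP[P ->] /asboolP[Q ->]].
- by apply/asboolP; exists 1; rewrite /eval2 rmorph1 hornerC.
- by apply/asboolP; exists (P - Q); rewrite /eval2 rmorphB hornerD hornerN.
- by apply/asboolP; exists (P * Q); rewrite /eval2 rmorphM hornerM.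
Qed.

HB.instance Definition _ :=
  GRing.isSubringClosed.Build ffield R1 (eval2_subring x_z y_z).
HB.instance Definition _ :=
  GRing.isSubringClosed.Build ffield R2 (eval2_subring x_y z_y).

Lemma y_z_R1 : y_z \in R1.
Proof.
apply/asboolP; exists ('X%:P); rewrite /eval2 map_polyC hornerC /=.
by rewrite map_polyX /horner_eval hornerX.
Qed.

Lemma x_z_R1 : x_z \in R1.
Proof.
by apply/asboolP; exists 'X; rewrite /eval2 map_polyX hornerX.
Qed.

Lemma cst_R1 c : cst c \in R1.
Proof.
apply/asboolP; exists (c%:P%:P); rewrite /eval2 map_polyC hornerC /=.
by rewrite map_polyC /horner_eval hornerC.
Qed.

Lemma R12_subring : subring_closed R12.
Proof.
split=> [|f g /asboolP[k hf] /asboolP[l hg]|f g /asboolP[k hf] /asboolP[l hg]].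
- by apply/asboolP; exists 0%N; rewrite mulr1 rpred1.
- apply/asboolP; exists (k + l)%N; rewrite mulrBl exprD mulrA.
  by rewrite [y_z ^+ k * _]mulrC mulrA rpredB // rpredM // rpredX // y_z_R1.
- by apply/asboolP; exists (k + l)%N; rewrite exprD mulrACA rpredM.
Qed.

HB.instance Definition _ := GRing.isSubringClosed.Build ffield R12 R12_subring.

Lemma R1_R12 : {subset R1 <= R12}.
Proof. by move=> f hf; apply/asboolP; exists 0%N; rewrite mulr1. Qed.

Lemma z_y_R12 : z_y \in R12.
Proof. by apply/asboolP; exists 1%N; rewrite mulVf ?y_z_neq0 ?rpred1. Qed.

Lemma R2_R12 : {subset R2 <= R12}.
Proof.
move=> f /asboolP[P ->]; rewrite /eval2 horner_coef rpred_sum // => i _.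
rewrite rpredM ?rpredX //; last by rewrite rpredM ?z_y_R12 // R1_R12 ?x_z_R1.
rewrite coef_map /= /horner_eval horner_coef rpred_sum // => j _.
by rewrite rpredM ?rpredX ?z_y_R12 // coef_map R1_R12 ?cst_R1.
Qed.

Definition ring1 : Type := {f : ffield | f \in R1}.
HB.instance Definition _ := [isSub of ring1 for @proj1_sig _ _].
HB.instance Definition _ := [Choice of ring1 by <:].
HB.instance Definition _ := [SubChoice_isSubComNzRing of ring1 by <:].

Definition ring2 : Type := {f : ffield | f \in R2}.
HB.instance Definition _ := [isSub of ring2 for @proj1_sig _ _].
HB.instance Definition _ := [Choice of ring2 by <:].
HB.instance Definition _ := [SubChoice_isSubComNzRing of ring2 by <:].

Definition ring12 : Type := {f : ffield | f \in R12}.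
HB.instance Definition _ := [isSub of ring12 for @proj1_sig _ _].
HB.instance Definition _ := [Choice of ring12 by <:].
HB.instance Definition _ := [SubChoice_isSubComNzRing of ring12 by <:].

Definition iota1 (f : ring1) : ring12 := Sub (val f) (R1_R12 (valP f)).
Definition iota2 (f : ring2) : ring12 := Sub (val f) (R2_R12 (valP f)).

Lemma iota1_zmod_morphism : zmod_morphism iota1.
Proof. by move=> f g; apply: val_inj. Qed.
Lemma iota1_monoid_morphism : monoid_morphism iota1.
Proof. by split=> [|f g]; apply: val_inj. Qed.
HB.instance Definition _ :=
  GRing.isZmodMorphism.Build ring1 ring12 iota1 iota1_zmod_morphism.
HB.instance Definition _ :=
  GRing.isMonoidMorphism.Build ring1 ring12 iota1 iota1_monoid_morphism.

Lemma iota2_zmod_morphism : zmod_morphism iota2.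
Proof. by move=> f g; apply: val_inj. Qed.
Lemma iota2_monoid_morphism : monoid_morphism iota2.
Proof. by split=> [|f g]; apply: val_inj. Qed.
HB.instance Definition _ :=
  GRing.isZmodMorphism.Build ring2 ring12 iota2 iota2_zmod_morphism.
HB.instance Definition _ :=
  GRing.isMonoidMorphism.Build ring2 ring12 iota2 iota2_monoid_morphism.

Definition y_z1 : ring1 := Sub y_z y_z_R1.
Lemma z_y_R2 : z_y \in R2.
Proof.
apply/asboolP; exists ('X%:P); rewrite /eval2 map_polyC hornerC /=.
by rewrite map_polyX /horner_eval hornerX.
Qed.
Definition z_y2 : ring2 := Sub z_y z_y_R2.

(* For B = A[1/f]: the map of modules P -> Q is the localization at f. *)
Definition is_localization (A B : comNzRingType) (iota : {rmorphism A -> B})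
    (f : A) (P : lmodType A) (Q : lmodType B)
    (res : {linear P -> Q | iota \; *:%R}) : Prop :=
  (forall w : Q, exists (k : nat) (v : P), iota f ^+ k *: w = res v) /\
  (forall v : P, res v = 0 -> exists k : nat, f ^+ k *: v = 0).

(* The images of the e_i form a basis of P[1/f] over A[1/f]. *)
Definition basis_after_inverting (A : comNzRingType) (P : lmodType A) (f : A)
    (n : nat) (e : 'I_n -> P) : Prop :=
  (forall v : P, exists (k : nat) (c : 'I_n -> A),
     f ^+ k *: v = \sum_i c i *: e i) /\
  (forall c : 'I_n -> A, \sum_i c i *: e i = 0 ->
     exists k : nat, forall i, f ^+ k * c i = 0).

(* Free of finite rank on each member of a finite cover of Spec A by basic
   opens D(f_j); the cover condition is that the f_j generate the unit ideal.
   Every basis of P[1/f] can be scaled by a power of f into the image of P. *)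
Definition locally_free (A : comNzRingType) (P : lmodType A) : Prop :=
  exists (r : nat) (f : 'I_r -> A),
    (exists c : 'I_r -> A, \sum_j c j * f j = 1) /\
    (forall j, exists (n : nat) (e : 'I_n -> P), basis_after_inverting (f j) e).

(* A vector bundle on C as a locally free sheaf of finite rank, given by its
   modules of sections over U_1, U_2 and U_1 :&: U_2 with the restriction maps.
   Quasi-coherence says that the restrictions are the localizations at y/z and
   z/y; since U_1 and U_2 are affine and cover C, these data are equivalent to
   the sheaf. *)
Record vector_bundle := VectorBundle {
  sec1 : lmodType ring1;
  sec2 : lmodType ring2;
  sec12 : lmodType ring12;
  res1 : {linear sec1 -> sec12 | iota1 \; *:%R};
  res2 : {linear sec2 -> sec12 | iota2 \; *:%R};
  res1_loc : is_localization y_z1 res1;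
  res2_loc : is_localization z_y2 res2;
  sec1_locally_free : locally_free sec1;
  sec2_locally_free : locally_free sec2
}.

Definition module_basis (A : comNzRingType) (P : lmodType A) (n : nat)
    (e : 'I_n -> P) : Prop :=
  forall v : P, exists! c : 'rV[A]_n, v = \sum_i c 0 i *: e i.

(* There are trivializations of V over U_1 and U_2 such that over U_1 :&: U_2
   the section with U_1-coordinate column v has U_2-coordinate column M v. *)
Definition describes (n : nat) (M : 'M[ffield]_n) (V : vector_bundle) : Prop :=
  exists (M12 : 'M[ring12]_n) (e1 : 'I_n -> sec1 V) (e2 : 'I_n -> sec2 V),
    [/\ M = map_mx val M12, module_basis e1, module_basis e2 &
        forall j, res1 V (e1 j) = \sum_i M12 i j *: res2 V (e2 i)].

(* GL_n(S) for a subring S of the function field. *)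
Definition GL (n : nat) (S : {pred ffield}) (M : 'M[ffield]_n) : Prop :=
  [/\ M \in unitmx, forall i j, M i j \in S & forall i j, invmx M i j \in S].

Definition block_size (i : int) : nat := if (2 %| i)%Z then 1%N else 2%N.

Definition block (i : int) : 'M[ffield]_(block_size i) :=
  if (2 %| i)%Z as b return 'M[ffield]_(if b then 1%N else 2%N) then
    ((- y_z) ^ (i %/ 2)%Z)%:M
  else
    block_mx ((- y_z) ^ ((i + 1) %/ 2)%Z)%:M
             (x_z * (- y_z) ^ ((i - 1) %/ 2)%Z)%:M
             0
             ((- y_z) ^ ((i - 1) %/ 2)%Z)%:M
    : 'M[ffield]_(1 + 1).

(* The block indices in increasing order, i being repeated m_i times. *)
Definition block_indices (m : {fsfun int -> nat with 0%N}) : seq int :=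
  flatten [seq nseq (m i) i | i <- sort <=%R (finsupp m)].

Definition canonical_size (m : {fsfun int -> nat with 0%N}) : nat :=
  \sum_(k < size (block_indices m)) block_size (block_indices m)`_k.

Definition canonical_mx (m : {fsfun int -> nat with 0%N}) :
    'M[ffield]_(canonical_size m) :=
  \mxdiag_(k < size (block_indices m)) block (block_indices m)`_k.

(* C(w), and the images in it of x/y and z/y under pullback along phi. *)
Definition Cw : fieldType := {fraction {poly R[i]}}.
Definition w : Cw := FracField.tofrac 'X.
Definition cstC (c : R[i]) : Cw := FracField.tofrac c%:P.
Definition phi_x_y : Cw := cstC 'i%C * (w ^+ 2 - 2 * w + 2) / (2 * (w - 1)).
Definition phi_z_y : Cw := - ((w ^+ 2 - 2 * w) / (2 * (w - 1))).

Definition subst (p : {poly R}) (u : Cw) : Cw :=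
  (map_poly (fun c : R => cstC (c%:C)%C) p).[u].

Definition subst_frac (a : {fraction {poly R}}) (u : Cw) : Cw :=
  subst \n_(repr a) u / subst \d_(repr a) u.

(* A function is uniquely A(y/z) + B(y/z) * (x/z) with A, B in R(t). *)
Definition phi_pull (f : ffield) : Cw :=
  subst_frac (polyn f)`_0 phi_z_y^-1 +
  subst_frac (polyn f)`_1 phi_z_y^-1 * (phi_x_y / phi_z_y).

Definition deg_w (p : Cw) : nat :=
  let g := gcdp \n_(repr p) \d_(repr p) in
  maxn (size (\n_(repr p) %/ g)).-1 (size (\d_(repr p) %/ g)).-1.

Definition d_w (n : nat) (A : 'M[Cw]_n) : nat := \max_i \max_j deg_w (A i j).

End Conic.

(* A random access machine over a field F.  It has countably many arrays of
   natural numbers and countably many arrays of field elements, all addressed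
   indirectly; the only constants of F available are 0 and 1, and F is accessed
   only through the field operations and the test for zero; x / 0 is 0, as in
   [fieldType].  Operations on natural numbers are not counted. *)

Inductive nat_expr :=
  | NConst of nat
  | NRead of nat & nat_expr
  | NAdd of nat_expr & nat_expr
  | NSub of nat_expr & nat_expr
  | NMul of nat_expr & nat_expr
  | NDiv of nat_expr & nat_expr.

Inductive field_expr :=
  | FZero
  | FOne
  | FRead of nat & nat_expr
  | FAdd of field_expr & field_expr
  | FSub of field_expr & field_expr
  | FMul of field_expr & field_expr
  | FDiv of field_expr & field_expr.

Inductive test :=
  | TLeq of nat_expr & nat_expr
  | TZero of field_expr.

Inductive program :=
  | Skip
  | NSet of nat & nat_expr & nat_expr
  | FSet of nat & nat_expr & field_expr
  | Seq of program & program
  | If of test & program & program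
  | While of test & program.

Section Machine.
Variable F : fieldType.

Record memory := Memory {
  nmem : nat -> nat -> nat;
  fmem : nat -> nat -> F
}.

Definition update (T : Type) (s : nat -> nat -> T) (a k : nat) (v : T) :=
  fun a' k' => if (a' == a) && (k' == k) then v else s a' k'.

Fixpoint neval (s : memory) (e : nat_expr) : nat :=
  match e with
  | NConst k => k
  | NRead a e1 => nmem s a (neval s e1)
  | NAdd e1 e2 => (neval s e1 + neval s e2)%N
  | NSub e1 e2 => (neval s e1 - neval s e2)%N
  | NMul e1 e2 => (neval s e1 * neval s e2)%N
  | NDiv e1 e2 => (neval s e1 %/ neval s e2)%N
  end.

Fixpoint feval (s : memory) (e : field_expr) : F :=
  match e with
  | FZero => 0
  | FOne => 1
  | FRead a e1 => fmem s a (neval s e1)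
  | FAdd e1 e2 => feval s e1 + feval s e2
  | FSub e1 e2 => feval s e1 - feval s e2
  | FMul e1 e2 => feval s e1 * feval s e2
  | FDiv e1 e2 => feval s e1 / feval s e2
  end.

Fixpoint fcost (e : field_expr) : nat :=
  match e with
  | FZero | FOne | FRead _ _ => 0%N
  | FAdd e1 e2 | FSub e1 e2 | FMul e1 e2 | FDiv e1 e2 =>
      (fcost e1 + fcost e2).+1
  end.

Definition teval (s : memory) (b : test) : bool :=
  match b with
  | TLeq e1 e2 => (neval s e1 <= neval s e2)%N
  | TZero e => feval s e == 0
  end.

Definition tcost (b : test) : nat :=
  match b with
  | TLeq _ _ => 0%N
  | TZero e => (fcost e).+1
  end.

(* [exec p s k s']: p started in s halts in s' after exactly k field
   operations, zero tests included. *)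
Inductive exec : program -> memory -> nat -> memory -> Prop :=
  | exec_skip s : exec Skip s 0 s
  | exec_nset a e1 e2 s :
      exec (NSet a e1 e2) s 0
        (Memory (update (nmem s) a (neval s e1) (neval s e2)) (fmem s))
  | exec_fset a e1 e2 s :
      exec (FSet a e1 e2) s (fcost e2)
        (Memory (nmem s) (update (fmem s) a (neval s e1) (feval s e2)))
  | exec_seq p q s k s' l s'' :
      exec p s k s' -> exec q s' l s'' -> exec (Seq p q) s (k + l) s''
  | exec_if b p q s k s' :
      exec (if teval s b then p else q) s k s' ->
      exec (If b p q) s (tcost b + k) s'
  | exec_while b p s k s' :
      exec (if teval s b then Seq p (While b p) else Skip) s k s' ->
      exec (While b p) s (tcost b + k) s'.

End Machine.

Section Encoding.
Variable R : realType.

(* The q-th matrix in memory.  The (y/z)^k and (x/z)(y/z)^k, k in Z, form a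
   basis of R_12 over R; the coefficients for -e <= k <= e of the entry (i, j)
   are consecutive in the field arrays 2q and 2q + 1, and e is the entry q of
   the array 1 of natural numbers. *)
Definition stores (s : memory R) (q n : nat) (M : 'M[ffield R]_n) : Prop :=
  let e := nmem s 1 q in
  forall i j : 'I_n,
    M i j = \sum_(k < (2 * e).+1)
      let pos := ((i * n + j) * (2 * e).+1 + k)%N in
      (cst R (fmem s (2 * q) pos) + cst R (fmem s (2 * q).+1 pos) * x_z R)
        * y_z R ^ (k%:Z - e%:Z).

(* An entry of M in R_12 with pole order a along y = 0 and b along z = 0 has
   its exponents in [- a, b], and its pullback along phi has degree
   2 (a + b) in w; so [- d, d] is always wide enough for d = d_w.
   Memory not holding the input is arbitrary. *)
Definition input (n : nat) (M : 'M[ffield R]_n) (s : memory R) : Prop :=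
  [/\ nmem s 0 0 = n, nmem s 1 0 = d_w (map_mx (@phi_pull R) M) & stores s 0 M].

End Encoding.

(* Main.v *)
Require Import Defs.
From HB Require Import structures.
From mathcomp Require Import all_boot all_order all_algebra.
From mathcomp Require Import qfpoly finmap complex boolp reals.
From mathcomp Require Import zify ring.

Set Implicit Arguments.
Unset Strict Implicit.
Unset Printing Implicit Defensive.

Import Order.TTheory GRing.Theory Num.Theory.

Local Open Scope ring_scope.

(* The sections of a bundle over the two charts form a graded module G over the
   ring generated by x, y, z with x^2 + y^2 + z^2 = 0: degree k consists of the
   pairs (v, w) with t^D v = t^k w on the overlap, where t = y/z and D is so
   large that G_0 = 0.  Let Q_k = x G_(k-1) + y G_(k-1) + z G_(k-1), and let P_k
   be the set of u in G_k with x u in y G_k + z G_k; then Q_k <= P_k <= G_k.  If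
   x a = y b + z d in G_k, then a, b, d and a fourth section e span a space with
   an action of the quaternions, so that P_k / Q_k is a quaternionic vector
   space.  Lifts of a basis of each P_k / Q_k over the quaternions and of each
   G_k / P_k over the reals give bases on both charts; a quaternionic basis
   vector contributes the block of an odd index and a real one the block of an
   even index.  Conversely the indices are determined, because there is no
   nonzero homomorphism from the block j to the block i when j < i.

   For the bundle of a matrix M with exponents in [- d, d], G_k is the set of v
   in R_1^n such that t^(d + 1) M v has pole order at most k.  All the generators
   lie in degrees at most 2 h + 1 with h = n (2 d + 2), and their coefficients
   have bounded degree, so each P_k, Q_k and G_k is found by linear algebra of
   polynomial size over the ground field, one equation at a time.  The rows of
   the left multiplier are the solutions of the dual systems. *)

(** * Arithmetic of the function field and pole orders along z = 0 *)

Section FunctionField.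
Variable R : realType.
Local Notation K := (ffield R).
Local Notation s := (x_z R).
Local Notation t := (y_z R).

(** The conic has no real point, so no parametrization is available over the reals, and the blocks
    of odd index have rank 2. No descent from the complex numbers is made: what the reals contribute
    to independence is that p^2 + q^2 + r^2 + w^2 has no nontrivial zero, so that a quaternionic
    multiple of a generator lying in a span can be divided back to the generator. Freeness on a
    chart rests on the regularity of the sequence y, z on G, which is the gluing of sections. A
    relation over the chart ring is reduced modulo y and homogenized with z, and its top degree is
    separated by P and Q. Exchanging y and z gives the other chart. Generators are chosen greedily;
    their number is at most the rank, so the choice stops without any dimension count. The constants
    of the algorithm have one source: t^(d + 1) M is inverted up to t^(2 h) by a matrix of pole
    order at most 4 h, built from the adjugate and the conjugate over R(t). Every loop is cut off at
    a fixed polynomial in n and d, which separates cost from correctness. One elimination step on a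
    square matrix serves both to impose an equation and to enlarge a span. *)

Definition pol : {rmorphism {poly R} -> K} :=
  in_alg (ffield R) \o @FracField.tofrac {poly R}.

Lemma polC c : pol c%:P = cst R c. Proof. by []. Qed.
Lemma polX : pol 'X = t. Proof. by []. Qed.

(** Coordinates of R_1 as a free R[t]-module on 1 and s; see [R1P] and [emb_inj]. *)
Definition emb (a b : {poly R}) : K := pol a + pol b * s.

Lemma size_conic : size (conic_poly R) = 3%N.
Proof.
rewrite /conic_poly size_polyDl ?size_polyXn //.
by rewrite ltnS (leq_trans (size_polyC_leq1 _)).
Qed.

Lemma conic_monic : conic_poly R \is monic.
Proof. by case: (conic_poly_irreducible R). Qed.

Lemma mk_monic_conic : mk_monic (conic_poly R) = conic_poly R.
Proof. by rewrite /mk_monic size_conic conic_monic. Qed.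

Lemma val_emb a b : polyn (emb a b) =
  (FracField.tofrac a)%:P + FracField.tofrac b *: 'X.
Proof.
have small (p : {poly {fraction {poly R}}}) : (size p <= 2)%N -> polyn (in_qpoly (conic_poly R) p) = p.
  by move=> h; rewrite in_qpoly_small // mk_monic_conic size_conic.
have -> : emb a b = in_qpoly (conic_poly R)
    ((FracField.tofrac a)%:P + FracField.tofrac b *: 'X).
  rewrite in_qpolyD in_qpolyZ /emb /pol /=; congr (_ + _).
    by rewrite -[X in in_qpoly _ X]mulr1 mul_polyC in_qpolyZ in_qpoly1.
  by rewrite -scalerAl mul1r.
rewrite small // (leq_trans (size_polyD _ _)) // geq_max.
rewrite (leq_trans (size_polyC_leq1 _)) //=.
by rewrite (leq_trans (size_scale_leq _ _)) // size_polyX.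
Qed.

Lemma linear_poly_inj (F : fieldType) (a b a' b' : F) :
  a%:P + b *: 'X = a'%:P + b' *: 'X -> a = a' /\ b = b'.
Proof.
move=> h; have hi i := congr1 (fun p : {poly _} => p`_i) h.
have := hi 0%N; have := hi 1%N; rewrite !coefD !coefZ !coefC !coefX /=.
by rewrite !add0r !mulr1 !mulr0 !addr0.
Qed.

Lemma emb_inj a b a' b' : emb a b = emb a' b' -> a = a' /\ b = b'.
Proof.
move/(congr1 (fun f : {poly %/ conic_poly R} => polyn f)); rewrite !val_emb.
by move/linear_poly_inj => [/eqP + /eqP]; rewrite !tofrac_eq => /eqP -> /eqP ->.
Qed.

Lemma conic_s : s ^+ 2 = - (1 + t ^+ 2).
Proof.
apply/eqP; rewrite -addr_eq0; apply/eqP.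
have -> : s ^+ 2 + (1 + t ^+ 2) = in_qpoly (conic_poly R) (conic_poly R).
  rewrite {2}/conic_poly in_qpolyD expr2 -in_qpolyM -expr2; congr (_ + _).
  rewrite -polX -rmorphXn -(rmorph1 pol) -rmorphD /= addrC.
  by rewrite -[X in in_qpoly _ X]mulr1 mul_polyC in_qpolyZ in_qpoly1.
by apply: val_inj; rewrite /= mk_monic_conic Pdiv.RingMonic.rmodpp ?conic_monic.
Qed.

Lemma emb0 : emb 0 0 = 0.
Proof. by rewrite /emb rmorph0 mul0r addr0. Qed.
Lemma emb1 : emb 1 0 = 1.
Proof. by rewrite /emb rmorph0 mul0r addr0 rmorph1. Qed.
Lemma embD a b a' b' : emb a b + emb a' b' = emb (a + a') (b + b').
Proof. by rewrite /emb !rmorphD mulrDl addrACA. Qed.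
Lemma embN a b : - emb a b = emb (- a) (- b).
Proof. by rewrite /emb !rmorphN mulNr opprD. Qed.

Lemma conic_mul (A : comNzRingType) (x a b c d q : A) :
  x ^+ 2 = - q -> (a + b * x) * (c + d * x) = (a * c - q * b * d) + (a * d + b * c) * x.
Proof.
by move=> h; ring: h.
Qed.

Lemma embM a b c d : emb a b * emb c d =
  emb (a * c - (1 + 'X^2) * b * d) (a * d + b * c).
Proof.
rewrite /emb (conic_mul _ _ _ _ (q := pol (1 + 'X^2))); last first.
  by rewrite conic_s rmorphD rmorphXn rmorph1.
by rewrite !(rmorphD, rmorphN, rmorphM).
Qed.

Lemma emb_eq0 a b : emb a b = 0 -> a = 0 /\ b = 0.
Proof. by rewrite -emb0 => /emb_inj. Qed.

Lemma emb_sum I r (P : pred I) a b :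
  \sum_(i <- r | P i) emb (a i) (b i) = emb (\sum_(i <- r | P i) a i) (\sum_(i <- r | P i) b i).
Proof. by rewrite /emb big_split -mulr_suml !rmorph_sum. Qed.

Lemma embMpol p a b : pol p * emb a b = emb (p * a) (p * b).
Proof. by rewrite /emb mulrDr !rmorphM mulrA. Qed.

Lemma embMX p a b : emb a b * pol p = emb (p * a) (p * b).
Proof. by rewrite mulrC embMpol. Qed.

Lemma emb_t k a b : emb a b * t ^+ k = emb ('X^k * a) ('X^k * b).
Proof. by rewrite -polX -rmorphXn embMX. Qed.

Lemma emb_s a b : emb a b * s = emb (- ((1 + 'X^2) * b)) a.
Proof.
have -> : s = emb 0 1 by rewrite /emb rmorph0 add0r rmorph1 mul1r.
by rewrite embM mulr0 add0r !mulr1 mulr0 addr0.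
Qed.

Lemma embX : s = emb 0 1.
Proof. by rewrite /emb rmorph0 add0r rmorph1 mul1r. Qed.
Lemma emby : t = emb 'X 0.
Proof. by rewrite /emb rmorph0 mul0r addr0 polX. Qed.
Lemma embC c : cst R c = emb c%:P 0.
Proof. by rewrite /emb rmorph0 mul0r addr0 polC. Qed.

Lemma t_neq0 : t != 0. Proof. exact: y_z_neq0. Qed.

Lemma eval2_horner p (b : K) : (map_poly (cst R) p).[b] = \sum_(i < size p) cst R p`_i * b ^+ i.
Proof.
rewrite (@horner_coef_wide _ (size p)) ?size_poly //.
by apply: eq_bigr => i _; rewrite coef_map.
Qed.

Lemma pol_horner p : pol p = (map_poly (cst R) p).[t].
Proof.
rewrite eval2_horner -[p in LHS]coefK poly_def rmorph_sum; apply: eq_bigr => i _.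
by rewrite -mul_polyC rmorphM rmorphXn polX polC.
Qed.

Lemma R1P f : reflect (exists a b, f = emb a b) (f \in @R1 R).
Proof.
apply: (iffP (asboolP (exists P, f = eval2 _ _ P))) => [[P ->]|[a [b ->]]].
  rewrite /eval2 horner_coef.
  elim/big_ind: _ => [|_ _ [a [b ->]] [c [d ->]]|i _].
  - by exists 0, 0; rewrite emb0.
  - by exists (a + c), (b + d); rewrite embD.
  rewrite coef_map /= /horner_eval -pol_horner.
  suff [a [b ->]] : exists a b, s ^+ i = emb a b.
    by rewrite embMpol; eexists; eexists.
  elim: (i : nat) => [|k [a [b IH]]]; first by exists 1, 0; rewrite emb1.
  by rewrite exprSr IH emb_s; eexists; eexists.
exists (a%:P + b *: 'X).
rewrite /eval2 rmorphD /= map_polyC linearZ /= map_polyX hornerD hornerC hornerZ hornerX.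
by rewrite /emb /= /horner_eval -!pol_horner.
Qed.

(** The functions regular on U_1 with pole order at most k along z = 0, where t and s both have
    simple poles. The bound on b is one lower because of the factor s. *)
Definition Fil (k : nat) (f : K) : Prop :=
  exists a b, [/\ f = emb a b, (size a <= k.+1)%N & (size b <= k)%N].

Lemma Fil_R1 k f : Fil k f -> f \in @R1 R.
Proof. by case=> a [b [-> _ _]]; apply/R1P; exists a, b. Qed.

Lemma R1_Fil f : f \in @R1 R -> exists k, Fil k f.
Proof.
move/R1P => [a [b ->]]; exists (maxn (size a) (size b)), a, b; split => //.
  exact: leqW (leq_maxl _ _).
exact: leq_maxr.
Qed.

Lemma Fil0 k : Fil k 0.
Proof. by exists 0, 0; rewrite emb0 size_poly0. Qed.

Lemma FilD k f g : Fil k f -> Fil k g -> Fil k (f + g).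
Proof.
move=> [a [b [-> ha hb]]] [c [d [-> hc hd]]]; exists (a + c), (b + d).
by rewrite embD; split; rewrite // (leq_trans (size_polyD _ _)) // geq_max ?ha ?hb.
Qed.

Lemma FilN k f : Fil k f -> Fil k (- f).
Proof. by move=> [a [b [-> ha hb]]]; exists (- a), (- b); rewrite embN !size_polyN. Qed.

Lemma Fil_le k l f : (k <= l)%N -> Fil k f -> Fil l f.
Proof.
move=> kl [a [b [-> ha hb]]]; exists a, b; split=> //.
  by rewrite (leq_trans ha).
exact: leq_trans hb kl.
Qed.

Lemma Fil_sum k I r (P : pred I) f :
  (forall i, P i -> Fil k (f i)) -> Fil k (\sum_(i <- r | P i) f i).
Proof. by move=> h; elim/big_ind: _ => //; [apply: Fil0 | apply: FilD]. Qed.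

Lemma size_mul_le (p q : {poly R}) (k l : nat) : (size p <= k.+1)%N -> (size q <= l)%N ->
  (size (p * q)%R <= k + l)%N.
Proof.
move=> hp hq; apply: leq_trans (size_polyMleq _ _) _.
by move: hp hq; lia.
Qed.

Lemma size_1X2 : size (1 + 'X^2 : {poly R}) = 3%N.
Proof. by rewrite addrC size_polyDl ?size_polyXn ?size_poly1. Qed.

(** The product of the two s-parts acquires the factor 1 + t^2, and the lower bounds on the s-parts
    compensate for its degree. For k = 0 or l = 0 one s-part is zero, which the arithmetic of sizes
    does not cover. *)
Lemma FilM k l f g : Fil k f -> Fil l g -> Fil (k + l) (f * g).
Proof.
move=> [a [b [-> ha hb]]] [c [d [-> hc hd]]]; rewrite embM; eexists; eexists; split; first by [].
- rewrite (leq_trans (size_polyD _ _)) // geq_max size_polyN -addnS size_mul_le //=.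
  rewrite -mulrA; case: k hb ha => [|k] hb _.
    by move: hb; rewrite leqn0 size_poly_eq0 => /eqP ->; rewrite mul0r mulr0 size_poly0.
  case: l hd hc => [|l] hd _.
    by move: hd; rewrite leqn0 size_poly_eq0 => /eqP ->; rewrite !mulr0 size_poly0.
  have -> : (k.+1 + l.+2 = 2 + (k + l.+1))%N by rewrite addnC !addSn addnC addnS.
  by rewrite size_mul_le ?size_1X2 // size_mul_le.
rewrite (leq_trans (size_polyD _ _)) // geq_max size_mul_le //= mulrC addnC.
by rewrite size_mul_le.
Qed.

Lemma Fil_cst c : Fil 0 (cst R c).
Proof. by exists c%:P, 0; rewrite embC size_poly0 size_polyC_leq1. Qed.
Lemma Fil_1 : Fil 0 1.
Proof. by rewrite -(rmorph1 (cst R)); apply: Fil_cst. Qed.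
Lemma Fil_t : Fil 1 t.
Proof. by exists 'X, 0; rewrite emby size_polyX size_poly0. Qed.
Lemma Fil_s : Fil 1 s.
Proof. by exists 0, 1; rewrite embX size_poly0 size_poly1. Qed.
Lemma Fil_exp k f m : Fil k f -> Fil (m * k) (f ^+ m).
Proof.
move=> h; elim: m => [|m IH]; first exact: Fil_1.
by rewrite exprS mulSn; apply: FilM.
Qed.
Lemma Fil_tX k : Fil k (t ^+ k).
Proof. by rewrite -[X in Fil X]muln1; apply: Fil_exp; apply: Fil_t. Qed.

Lemma Fil_divt m k f : f \in @R1 R -> Fil (m + k) (f * t ^+ m) -> Fil k f.
Proof.
move=> /R1P[a [b ->]]; rewrite emb_t => -[c [d [/emb_inj[<- <-]]]].
rewrite -addnS => h1 h2; exists a, b.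
have hs (p : {poly R}) : (size ('X^m * p)%R <= m + k)%N -> (size p <= k)%N.
  by have [->|p0] := eqVneq p 0; rewrite ?size_poly0 // mulrC size_mulXn // leq_add2l.
split=> //; last exact: hs.
have [->|p0] := eqVneq a 0; first by rewrite size_poly0.
by move: h1; rewrite mulrC size_mulXn // leq_add2l.
Qed.

Lemma R12P f : reflect (exists k, f * t ^+ k \in @R1 R) (f \in @R12 R).
Proof. exact: asboolP. Qed.

(** The generators x/y = s/t and z/y = 1/t of R_2 become elements of [Fil 1] after multiplication by
    t. Conversely a/t^k and b s/t^k are polynomials in them once deg a <= k and deg b < k. So R_2 is
    the union of the t^(-k) [Fil k], and one filtration describes both charts. *)
Lemma R2P f : reflect (exists k, Fil k (f * t ^+ k)) (f \in @R2 R).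
Proof.
have tk k : t ^+ k != 0 by rewrite expf_neq0 // t_neq0.
apply: (iffP (asboolP (exists P, f = eval2 _ _ P))) => [[P ->]|[k [a [b [hf ha hb]]]]].
  have FD f1 g : (exists k, Fil k (f1 * t ^+ k)) -> (exists k, Fil k (g * t ^+ k)) ->
      exists k, Fil k ((f1 + g) * t ^+ k).
    move=> [k hf] [l hg]; exists (k + l)%N; rewrite mulrDl exprD.
    apply: FilD; first by rewrite mulrA; apply: FilM => //; apply: Fil_tX.
    by rewrite mulrCA; apply: FilM => //; apply: Fil_tX.
  have FM f1 g : (exists k, Fil k (f1 * t ^+ k)) -> (exists k, Fil k (g * t ^+ k)) ->
      exists k, Fil k ((f1 * g) * t ^+ k).
    by move=> [k hf] [l hg]; exists (k + l)%N; rewrite exprD mulrACA; apply: FilM.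
  have FX f1 m : (exists k, Fil k (f1 * t ^+ k)) -> exists k, Fil k (f1 ^+ m * t ^+ k).
    move=> [k hf]; elim: m => [|m IH]; first by exists 0%N; rewrite !mulr1; apply: Fil_1.
    by rewrite exprS; apply: FM => //; exists k.
  have F0 : exists k, Fil k (0 * t ^+ k) by exists 0%N; rewrite mul0r; apply: Fil0.
  rewrite /eval2 horner_coef; elim/big_ind: _ => // i _; apply/FM; last first.
    by apply/FX; exists 1%N; rewrite /x_y expr1 divfK ?t_neq0 //; apply: Fil_s.
  rewrite coef_map /= /horner_eval eval2_horner; elim/big_ind: _ => // j _; apply/FM.
    by exists 0%N; rewrite mulr1; apply: Fil_cst.
  by apply/FX; exists 1%N; rewrite /z_y expr1 mulVf ?t_neq0 //; apply: Fil_le Fil_1.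
have FC c : cst R c \in @R2 R.
  apply/asboolP; exists (c%:P%:P); rewrite /eval2 map_polyC hornerC /=.
  by rewrite map_polyC /horner_eval hornerC.
have FX : x_y R \in @R2 R.
  by apply/asboolP; exists 'X; rewrite /eval2 map_polyX hornerX.
have R2c i c : cst R c * z_y R ^+ i \in @R2 R.
  by rewrite rpredM ?FC // rpredX // z_y_R2.
have tz i m : (i <= m)%N -> t ^+ i / t ^+ m = z_y R ^+ (m - i).
  move=> im; rewrite /z_y exprVn; apply: (canLR (mulfK (tk _))); apply: (canRL (mulKf (tk _))).
  by rewrite -exprD subnK.
have pd (p : {poly R}) m : (size p <= m.+1)%N -> pol p / t ^+ m \in @R2 R.
  move=> hp; rewrite -(coefK p) poly_def rmorph_sum mulr_suml rpred_sum // => i _.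
  have -> : pol (p`_i *: 'X^i) = cst R p`_i * t ^+ i.
    by rewrite -mul_polyC rmorphM rmorphXn polX polC.
  rewrite -mulrA tz ?R2c //; by rewrite -ltnS (leq_trans _ hp).
suff -> : f = pol a / t ^+ k + (pol b * s) / t ^+ k.
  apply/asboolP; rewrite -[asbool _]/(_ \in @R2 R) rpredD ?pd //.
  case: k {hf ha} hb => [|k] hb.
    move: hb; rewrite leqn0 size_poly_eq0 => /eqP ->; rewrite rmorph0 !mul0r.
    exact: rpred0.
  by rewrite exprSr -mulf_div rpredM ?pd.
by rewrite -mulrDl -/(emb a b) -hf mulfK.
Qed.

End FunctionField.

(** * Consequences of degree, and inverses of bounded pole order *)

Section Degrees.
Variable R : realType.
Local Notation K := (ffield R).
Local Notation s := (x_z R).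
Local Notation t := (y_z R).

Lemma tX_neq0 k : t ^+ k != 0. Proof. by rewrite expf_neq0 // t_neq0. Qed.

(** The function g has no pole along z = 0, so the poles of f there come from t^k. *)
Lemma R1_tR2 k f g : f \in @R1 R -> g \in @R2 R -> f = g * t ^+ k -> Fil k f.
Proof.
move=> f1 /R2P[m hg] fE; apply: (@Fil_divt _ m) => //.
by rewrite fE mulrAC; apply: FilM => //; apply: Fil_tX.
Qed.

(** Such an f has no poles at all and vanishes along z = 0: a bundle of negative degree has no
    sections. One surplus factor t is enough, which is the margin of one in the later choices of a
    twist. *)
Lemma R1_divt_R2 k f g : f \in @R1 R -> g \in @R2 R -> f * t ^+ k.+1 = g -> f = 0.
Proof.
move=> /R1P[a [b ->]] /R2P[m +] gE; rewrite -gE -mulrA -exprD emb_t.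
have hs (p : {poly R}) : (size ('X^(k.+1 + m) * p)%R <= m.+1)%N -> p = 0.
  have [->//|p0] := eqVneq p 0; rewrite mulrC size_mulXn //.
  by move: p0; rewrite -size_poly_gt0; lia.
move=> [c [d [/emb_inj[<- <-] h1 h2]]].
by rewrite (hs a) // (hs b) ?emb0 // (leq_trans h2).
Qed.

Lemma Fil0_cst f : Fil 0 f -> exists c, f = cst R c.
Proof.
move=> [a [b [-> ha]]]; rewrite leqn0 size_poly_eq0 => /eqP ->.
by exists a`_0; rewrite embC [in LHS](size1_polyC ha).
Qed.

Lemma R1_R2_cst f : f \in @R1 R -> f \in @R2 R -> exists c, f = cst R c.
Proof.
move=> h1 h2; apply: Fil0_cst.
by apply: R1_tR2 h1 h2 _; rewrite mulr1.
Qed.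

Lemma dvdp_Xn (p : {poly R}) n : p %| 'X^n -> exists2 c, c != 0 & exists j, p = c *: 'X^j.
Proof.
have -> : 'X^n = ('X - 0%:P) ^+ n :> {poly R} by rewrite subr0.
move/dvdp_exp_XsubCP => [j _]; rewrite subr0 => /eqpf_eq[c c0 ->].
by exists c => //; exists j.
Qed.

(** Multiplicativity of the norm down to R(t), for a product without s-part. *)
Lemma norm_mul (A : comNzRingType) (a b c d q x : A) :
  a * c - q * b * d = x -> a * d + b * c = 0 ->
  (a ^+ 2 + q * b ^+ 2) * (c ^+ 2 + q * d ^+ 2) = x ^+ 2.
Proof.
move=> <- h.
have -> : (a ^+ 2 + q * b ^+ 2) * (c ^+ 2 + q * d ^+ 2) =
  (a * c - q * b * d) ^+ 2 + q * (a * d + b * c) ^+ 2 by ring.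
by rewrite h expr0n mulr0 addr0.
Qed.

(* The conjugate of f over R(t), scaled, inverts f up to a power of t. *)
Lemma monomial_cofactor k f g m : Fil k f -> g \in @R1 R -> f * g = t ^+ m ->
  exists h j, [/\ Fil k h, (j <= 2 * k)%N & f * h = t ^+ j].
Proof.
move=> [a [b [-> ha hb]]] /R1P[c [d ->]].
have tE j : t ^+ j = emb 'X^j 0 by rewrite -polX -rmorphXn /emb rmorph0 mul0r addr0.
rewrite embM tE => /emb_inj[e1 e2].
have NN := norm_mul e1 e2; rewrite -exprM in NN.
(* The norm of f divides t^(2 m), hence is a scalar times t^j; the degree of the norm gives j <= 2
   k. *)
have [u u0 [j Nj]] := dvdp_Xn (dvdp_trans (dvdp_mulr _ (dvdpp _)) (eq_ind _ (fun p => _ %| p) (dvdpp _) _ NN)).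
exists (cst R u^-1 * emb a (- b)), j; split.
- by rewrite -[k]add0n; apply: FilM; [apply: Fil_cst | exists a, (- b); rewrite size_polyN].
- have : (size (a ^+ 2 + (1 + 'X^2) * b ^+ 2)%R <= 2 * k + 1)%N.
    rewrite (leq_trans (size_polyD _ _)) // geq_max expr2 (leq_trans (size_mul_le ha ha)) ?mul2n -?addnn ?addn1 ?addnS //.
    case: k hb {ha} => [|k] hb.
      by move: hb; rewrite leqn0 size_poly_eq0 => /eqP ->; rewrite expr0n mulr0 size_poly0.
    have -> : ((k.+1 + k.+1).+1 = 2 + (k + k.+1))%N by lia.
    by rewrite size_mul_le ?size_1X2 // expr2 size_mul_le.
  by rewrite Nj size_scale // size_polyXn; lia.
- rewrite mulrCA embM tE -polC embMpol; congr emb; last by rewrite mulrN [b * a]mulrC addNr mulr0.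
  have -> : a * a - (1 + 'X^2) * b * - b = u *: 'X^j by rewrite -Nj mulrN opprK !expr2 mulrA.
  by rewrite mul_polyC scalerA mulVf // scale1r.
Qed.

Lemma Fil_prod (I : Type) (r : seq I) (f : I -> K) e :
  (forall i, Fil e (f i)) -> Fil (size r * e) (\prod_(i <- r) f i).
Proof.
move=> h; elim: r => [|i r IH]; first by rewrite big_nil; apply: Fil_1.
by rewrite big_cons mulSn; apply: FilM.
Qed.

Lemma Fil_det n (A : 'M[K]_n) e : (forall i j, Fil e (A i j)) -> Fil (n * e) (\det A).
Proof.
move=> h; apply: Fil_sum => p _; rewrite -[(n * e)%N]add0n; apply: FilM.
  by case: perm.odd_perm; rewrite ?expr1 ?expr0; [apply: FilN|]; apply: Fil_1.
have := @Fil_prod _ (enum 'I_n) (fun i => A i (perm.fun_of_perm p i)) e.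
by rewrite size_enum_ord big_enum; apply.
Qed.

Lemma Fil_adj n (A : 'M[K]_n) e i j : (forall i j, Fil e (A i j)) -> Fil (n * e) ((\adj A) i j).
Proof.
case: n A i j => [A [] //|n] A i j h; rewrite mxE /cofactor.
apply: (@Fil_le _ (0 + n * e)); first by rewrite mulSn leq_addl.
apply: FilM; last by apply: Fil_det => k l; rewrite !mxE.
by rewrite -signr_odd; case: odd; rewrite ?expr1 ?expr0; [apply: FilN|]; apply: Fil_1.
Qed.

Lemma det_R1 n (B : 'M[K]_n) : (forall i j, B i j \in @R1 R) -> \det B \in @R1 R.
Proof. by move=> h; rewrite rpred_sum // => p _; rewrite rpredMsign rpred_prod. Qed.

(** The determinant of A divides a power of t, so [monomial_cofactor] inverts it up to some t^j with
    j <= 2 n e. The new inverse is adj A times this cofactor and t^(2 n e - j); its pole order is at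
    most 2 n e + n e + n e, whatever the size of B. *)
Lemma inverse_bound n (A B : 'M[K]_n) e m : (forall i j, Fil e (A i j)) ->
  (forall i j, B i j \in @R1 R) -> A *m B = (t ^+ m)%:M ->
  exists B' : 'M[K]_n, (forall i j, Fil (4 * (n * e)) (B' i j)) /\
    A *m B' = (t ^+ (2 * (n * e)))%:M.
Proof.
move=> hA hB AB.
have dd : \det A * \det B = t ^+ (m * n) by rewrite -det_mulmx AB det_scalar exprM.
have [h [j [hh hj fh]]] := monomial_cofactor (Fil_det hA) (det_R1 hB) dd.
exists ((t ^+ (2 * (n * e) - j) * h) *: \adj A); split.
  move=> i k; rewrite mxE.
  apply: (@Fil_le _ ((2 * (n * e) - j) + n * e + n * e)); first by lia.
  apply: FilM; last exact: Fil_adj.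
  by apply: FilM hh; apply: Fil_tX.
rewrite -scalemxAr mul_mx_adj scale_scalar_mx -mulrA [h * _]mulrC fh -exprD subnK //.
Qed.
End Degrees.

(** * A reflexive tactic for linear identities in a module *)

Inductive lexpr (A : Type) :=
  | LVar of nat
  | LZero
  | LAdd of lexpr A & lexpr A
  | LOpp of lexpr A
  | LScale of A & lexpr A.

Section LinearExpressions.
Variables (A : pzRingType) (X : lmodType A).

Fixpoint leval (env : seq X) (e : lexpr A) : X :=
  match e with
  | LVar i => nth 0 env i
  | LZero => 0
  | LAdd e1 e2 => leval env e1 + leval env e2
  | LOpp e1 => - leval env e1
  | LScale a e1 => a *: leval env e1
  end.

Fixpoint lcoef (e : lexpr A) (i : nat) : A :=
  match e with
  | LVar j => if i == j then 1 else 0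
  | LZero => 0
  | LAdd e1 e2 => lcoef e1 i + lcoef e2 i
  | LOpp e1 => - lcoef e1 i
  | LScale a e1 => a * lcoef e1 i
  end.

Lemma levalE env e : leval env e = \sum_(i < size env) lcoef e i *: nth 0 env i.
Proof.
elim: e => /= [j||e1 -> e2 ->|e ->|a e ->].
- have [j_lt|j_ge] := ltnP j (size env).
    rewrite (bigD1 (Ordinal j_lt)) //= eqxx scale1r big1 ?addr0 // => i.
    by rewrite -val_eqE /= => /negPf ->; rewrite scale0r.
  rewrite nth_default // big1 // => i _; case: eqP => [e|_]; last exact: scale0r.
  by move: (ltn_ord i); rewrite e ltnNge j_ge.
- by rewrite big1 // => i _; rewrite scale0r.
- by rewrite -big_split; apply: eq_bigr => i _; rewrite scalerDl.
- by rewrite -sumrN; apply: eq_bigr => i _; rewrite scaleNr.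
- by rewrite scaler_sumr; apply: eq_bigr => i _; rewrite scalerA.
Qed.

(** The hypothesis is a [foldr] over a list of indices so that it unfolds by computation into one
    ring identity per vector. *)
Lemma leval_eq env e1 e2 :
  foldr (fun i p => lcoef e1 i = lcoef e2 i /\ p) True (iota 0 (size env)) ->
  leval env e1 = leval env e2.
Proof.
move=> h; rewrite !levalE; apply: eq_bigr => i _; congr (_ *: _).
have : nat_of_ord i \in iota 0 (size env) by rewrite mem_iota add0n ltn_ord.
elim: (iota _ _) h => //= j l IH [h1 h2]; rewrite inE => /orP[/eqP ->|] //.
exact: IH.
Qed.
End LinearExpressions.

Ltac lin_mem v l :=
  match l with
  | nil => constr:(false)
  | cons v _ => constr:(true)
  | cons _ ?l' => lin_mem v l'
  end.
Ltac lin_index v l :=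
  match l with
  | cons v _ => constr:(0%N)
  | cons _ ?l' => let n := lin_index v l' in constr:(n.+1)
  end.
Ltac lin_vars e l :=
  match e with
  | @GRing.add _ ?a ?b => let l1 := lin_vars a l in lin_vars b l1
  | @GRing.opp _ ?a => lin_vars a l
  | @GRing.scale _ _ _ ?a => lin_vars a l
  | @GRing.zero _ => l
  | _ => match lin_mem e l with true => l | false => constr:(cons e l) end
  end.
Ltac lin_reify T e l :=
  match e with
  | @GRing.add _ ?a ?b =>
      let a' := lin_reify T a l in let b' := lin_reify T b l in constr:(LAdd a' b')
  | @GRing.opp _ ?a => let a' := lin_reify T a l in constr:(LOpp a')
  | @GRing.scale _ _ ?k ?a => let a' := lin_reify T a l in constr:(@LScale T k a')
  | @GRing.zero _ => constr:(@LZero T)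
  | _ => let n := lin_index e l in constr:(@LVar T n)
  end.
(* Proves an identity between linear combinations by comparing coefficients. *)
Ltac lmod A X :=
  match goal with
  | |- ?a = ?b =>
    let l0 := lin_vars a (@nil X) in let l := lin_vars b l0 in
    let a' := lin_reify (GRing.PzRing.sort A) a l in
    let b' := lin_reify (GRing.PzRing.sort A) b l in
    refine (@leval_eq A X l a' b' _); cbn [foldr iota lcoef size eq_op eqn Equality.sort];
    repeat split; rewrite /=; ring
  end.

(** * The graded module of a bundle *)

Section Graded.
Variables (F : realFieldType) (A : comNzRingType) (c : {rmorphism F -> A}).
Variables (X : lmodType A).

(* A homogeneous generator of the graded module: a single section, or an
   odd generator together with its images under the quaternions. *)
Record item := Item { lev : nat; isodd : bool; g0 : X; g1 : X; g2 : X; g3 : X }.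

(** All that the two charts have to supply. [G0] starts the inductions on the degree, and [Greg]
    says that y, z is a regular sequence; for a bundle this is the gluing of a section over U_1 with
    one over U_2. *)
Record graded := Graded {
  gx : A; gy : A; gz : A;
  gconic : gx ^+ 2 + gy ^+ 2 + gz ^+ 2 = 0;
  G : nat -> X -> Prop;
  G0 : forall u, G 0 u -> u = 0;
  Glin : forall k a u v, G k u -> G k v -> G k (c a *: u + v);
  Gz0 : forall k, G k 0;
  Gx : forall k u, G k u -> G k.+1 (gx *: u);
  Gy : forall k u, G k u -> G k.+1 (gy *: u);
  Gz : forall k u, G k u -> G k.+1 (gz *: u);
  Greg : forall k u v, G k.+1 u -> G k.+1 v -> gy *: u = gz *: v ->
    exists w, [/\ G k w, u = gz *: w & v = gy *: w]
}.

Lemma gconic_swap_proof S : gx S ^+ 2 + gz S ^+ 2 + gy S ^+ 2 = 0.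
Proof. by rewrite addrAC gconic. Qed.

Lemma greg_swap_proof S k u v : G S k.+1 u -> G S k.+1 v -> gz S *: u = gy S *: v ->
    exists w, [/\ G S k w, u = gy S *: w & v = gz S *: w].
Proof. by move=> hu hv /esym /(Greg hv hu)[w [? ? ?]]; exists w. Qed.

(** Exchanging y and z turns the chart z = 1 into the chart y = 1, so the theorems about a chart are
    proved once. *)
Definition gswap S := Graded (gconic_swap_proof S) (@G0 S) (@Glin S) (@Gz0 S)
  (@Gx S) (@Gz S) (@Gy S) (@greg_swap_proof S).

(** The sign of g3 changes because the two operators behind [quad] anticommute. *)
Definition iswap (i : item) := Item (lev i) (isodd i) (g0 i) (g2 i) (g1 i) (- g3 i).

Section Fixed.
Variable S : graded.
Local Notation x := (gx S).
Local Notation y := (gy S).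
Local Notation z := (gz S).
Local Notation Gk := (G S).
Local Notation "a ** u" := (c a *: u) (at level 40).

Lemma GD k u v : Gk k u -> Gk k v -> Gk k (u + v).
Proof. by move=> hu hv; have := Glin 1 hu hv; rewrite rmorph1 scale1r. Qed.
Lemma GZ k a u : Gk k u -> Gk k (a ** u).
Proof. by move=> hu; have := Glin a hu (Gz0 S k); rewrite addr0. Qed.
Lemma GN k u : Gk k u -> Gk k (- u).
Proof. by move=> /(GZ (-1)); rewrite rmorphN rmorph1 scaleN1r. Qed.
Lemma GB k u v : Gk k u -> Gk k v -> Gk k (u - v).
Proof. by move=> hu /GN; apply: GD. Qed.
Lemma Gsum k I r (P : pred I) (f : I -> X) :
  (forall i, P i -> Gk k (f i)) -> Gk k (\sum_(i <- r | P i) f i).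
Proof. by move=> h; elim/big_ind: _ => //; [apply: Gz0 | apply: GD]. Qed.

Definition Q k u := match k with
  | 0 => u = 0
  | k'.+1 => exists a b d, [/\ Gk k' a, Gk k' b, Gk k' d & u = x *: a + y *: b + z *: d]
  end.
Definition P k u := Gk k u /\ exists u' u'', [/\ Gk k u', Gk k u'' & x *: u = y *: u' + z *: u''].

(** On the quadruple x acts as y I + z J, where I a = b, J a = d and J b = e. The signs say that I^2
    = J^2 = - 1 and I J = - J I, so that (y I + z J)^2 = - y^2 - z^2, as the conic demands. *)
Definition quad k a b d e := [/\ Gk k a, Gk k b, Gk k d & Gk k e] /\
  [/\ x *: a = y *: b + z *: d, x *: b = - (y *: a) + z *: e,
      x *: d = - (y *: e) - z *: a & x *: e = y *: d - z *: b].

Lemma conicZ (u : X) : x *: (x *: u) = - (y *: (y *: u)) - z *: (z *: u).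
Proof.
apply/eqP; rewrite -subr_eq0 opprD !opprK addrA !scalerA -!expr2 -!scalerDl gconic.
by rewrite scale0r.
Qed.

(** Regularity applied to y u = z 0 gives u = z w with y w = 0 one degree lower, down to G 0. *)
Lemma yinj k u : Gk k u -> y *: u = 0 -> u = 0.
Proof.
elim: k u => [|l IH] u hl; first by move=> _; apply: G0 hl.
rewrite -(scaler0 X z) => /(Greg hl (Gz0 _ _))[w [hw -> /esym/IH ->//]].
Qed.

(** Multiplying x a = y b + z d by x gives y (x b + y a) = - z (x d + z a), and regularity produces
    e. The relation for x e is checked after multiplication by y. *)
Lemma quad_complete k a b d : Gk k a -> Gk k b -> Gk k d -> x *: a = y *: b + z *: d ->
  exists e, quad k a b d e.
Proof.
move=> ha hb hd e1.
have e2 : y *: (x *: b + y *: a) = z *: (- (x *: d + z *: a)).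
  apply/eqP; rewrite -subr_eq0; apply/eqP.
  have -> : y *: (x *: b + y *: a) - z *: (- (x *: d + z *: a)) =
    x *: (y *: b + z *: d) - (- (y *: (y *: a)) - z *: (z *: a)) by lmod A X.
  by rewrite -e1 -conicZ subrr.
have hu : Gk k.+1 (x *: b + y *: a) by apply: GD; [apply: Gx | apply: Gy].
have hv : Gk k.+1 (- (x *: d + z *: a)) by apply: GN; apply: GD; [apply: Gx | apply: Gz].
have [e [he h1 h2]] := Greg hu hv e2.
have e3 : x *: b = - (y *: a) + z *: e by rewrite -h1; lmod A X.
have e4 : x *: d = - (y *: e) - z *: a by rewrite -h2; lmod A X.
exists e; split=> //; split=> //.
apply/eqP; rewrite -subr_eq0; apply/eqP; apply: (yinj (k := k.+1)).
  by apply: GB; [apply: Gx | apply: GB; [apply: Gy | apply: Gz]].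
have -> : y *: (x *: e - (y *: d - z *: b)) =
  x *: (- (- (y *: e) - z *: a)) - z *: (x *: a - (y *: b + z *: d)) - (y *: (y *: d) + z *: (z *: d)) by lmod A X.
by rewrite -e4 e1 scalerN conicZ; lmod A X.
Qed.

Lemma QD k u v : Q k u -> Q k v -> Q k (u + v).
Proof.
case: k => [-> ->|k [a [b [d [ha hb hd ->]]]] [a' [b' [d' [ha' hb' hd' ->]]]]].
  exact: addr0.
exists (a + a'), (b + b'), (d + d'); split; try exact: GD.
lmod A X.
Qed.
Lemma QZ k a u : Q k u -> Q k (a ** u).
Proof.
case: k => [->|k [e [b [d [he hb hd ->]]]]]; first exact: scaler0.
by exists (a ** e), (a ** b), (a ** d); split; try exact: GZ; lmod A X.
Qed.
Lemma Q0 k : Q k 0.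
Proof.
case: k => [//|k]; exists 0, 0, 0; rewrite !scaler0 !addr0; split=> //; exact: Gz0.
Qed.
Lemma Q_G k u : Q k u -> Gk k u.
Proof.
case: k => [->|k [a [b [d [ha hb hd ->]]]]]; first exact: Gz0.
by apply: GD; [apply: GD; [apply: Gx|apply: Gy]|apply: Gz].
Qed.

(** By the equation of the conic, x (x a) lies in y G + z G. *)
Lemma Q_P k u : Q k u -> P k u.
Proof.
move=> hq; split; first exact: Q_G.
case: k hq => [->|k [a [b [d [ha hb hd ->]]]]].
  by exists 0, 0; split; try exact: Gz0; rewrite !scaler0 addr0.
exists (x *: b - y *: a), (x *: d - z *: a); split.
- by apply: GB; [apply: Gx | apply: Gy].
- by apply: GB; [apply: Gx | apply: Gz].
rewrite !scalerDr conicZ; lmod A X.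
Qed.

Lemma PD k u v : P k u -> P k v -> P k (u + v).
Proof.
move=> [hu [u' [u'' [h1 h2 h3]]]] [hv [v' [v'' [h4 h5 h6]]]]; split; first exact: GD.
exists (u' + v'), (u'' + v''); split; try exact: GD.
by rewrite scalerDr h3 h6; lmod A X.
Qed.
Lemma PZ k a u : P k u -> P k (a ** u).
Proof.
move=> [hu [u' [u'' [h1 h2 h3]]]]; split; first exact: GZ.
exists (a ** u'), (a ** u''); split; try exact: GZ.
have -> : x *: (a ** u) = a ** (x *: u) by lmod A X.
by rewrite h3; lmod A X.
Qed.
Lemma PB k u v : P k u -> P k v -> P k (u - v).
Proof. by move=> hu /(PZ (-1)); rewrite rmorphN1 scaleN1r; apply: PD. Qed.
Lemma P0 k : P k 0.
Proof. exact: Q_P (Q0 k). Qed.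

Lemma quad_P k a b d e : quad k a b d e -> [/\ P k a, P k b, P k d & P k e].
Proof.
move=> [[ha hb hd he] [h1 h2 h3 h4]]; split; split=> //.
- by exists b, d.
- by exists (- a), e; split=> //; [apply: GN | rewrite h2; lmod A X].
- by exists (- e), (- a); split; [apply: GN | apply: GN | rewrite h3; lmod A X].
- by exists d, (- b); split=> //; [apply: GN | rewrite h4; lmod A X].
Qed.

(* Multiplication of the quadruple by the quaternion p + q i + r j + w k. *)
Lemma quad_rot k a b d e (p q r w : F) : quad k a b d e ->
  quad k (p ** a + q ** b + r ** d + w ** e) (- q ** a + p ** b + w ** d + - r ** e)
    (- r ** a + - w ** b + p ** d + q ** e) (- w ** a + r ** b + - q ** d + p ** e).
Proof.
move=> [[ha hb hd he] [h1 h2 h3 h4]].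
have sc (v : X) : forall l : F, x *: (l ** v) = l ** (x *: v) by move=> l; lmod A X.
split; first by split; do 3?[apply: GD]; apply: GZ.
by split; rewrite !scalerDr !sc h1 h2 h3 h4; lmod A X.
Qed.

Lemma quadD k a b d e a' b' d' e' : quad k a b d e -> quad k a' b' d' e' ->
  quad k (a + a') (b + b') (d + d') (e + e').
Proof.
move=> [[ha hb hd he] [h1 h2 h3 h4]] [[ha' hb' hd' he'] [h1' h2' h3' h4']].
split; first by split; apply: GD.
by split; rewrite scalerDr ?h1 ?h2 ?h3 ?h4 ?h1' ?h2' ?h3' ?h4'; lmod A X.
Qed.

Lemma quad0 k : quad k 0 0 0 0.
Proof. by split; [split; apply: Gz0 | split; lmod A X]. Qed.

Lemma quadN k a b d e : quad k a b d e -> quad k (- a) (- b) (- d) (- e).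
Proof.
move=> [[ha hb hd he] [h1 h2 h3 h4]]; split; first by split; apply: GN.
by split; rewrite scalerN ?h1 ?h2 ?h3 ?h4; lmod A X.
Qed.

(** This makes the quaternions act on P_k / Q_k. Substituting a = x u + y v + z w in x a = y b + z d
    gives a relation between a multiple of y and a multiple of z; regularity solves it for b and
    d. *)
Lemma quad_Q k a b d e : quad k a b d e -> Q k a -> [/\ Q k b, Q k d & Q k e].
Proof.
have main a' b' d' e' : quad k a' b' d' e' -> Q k a' -> Q k b' /\ Q k d'.
  move=> [[ha hb hd he] [h1 h2 h3 h4]].
  case: k h1 ha hb hd he => [h1 ha hb hd he _|k h1 ha hb hd he [u [v [w [hu hv hw aE]]]]].
    by split; [apply: G0 hb | apply: G0 hd].
  have e1 : y *: (b' - (x *: v - y *: u)) = z *: (x *: w - z *: u - d').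
    apply/eqP; rewrite -subr_eq0; apply/eqP.
    have -> : y *: (b' - (x *: v - y *: u)) - z *: (x *: w - z *: u - d') =
      y *: b' + z *: d' - (x *: (y *: v + z *: w) + (- (y *: (y *: u)) - z *: (z *: u))) by lmod A X.
    by rewrite -conicZ -h1 aE; lmod A X.
  have hb1 : Gk k.+1 (b' - (x *: v - y *: u)).
    by apply: GB => //; apply: GB; [apply: Gx | apply: Gy].
  have hd1 : Gk k.+1 (x *: w - z *: u - d').
    by apply: GB => //; apply: GB; [apply: Gx | apply: Gz].
  have [h [hh e2 e3]] := Greg hb1 hd1 e1.
  split.
    exists v, (- u), h; split=> //; first exact: GN.
    by rewrite -e2; lmod A X.
  exists w, (- h), (- u); split=> //; try exact: GN.
  by rewrite scalerN -e3; lmod A X.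
move=> hq ha; have [hb hd] := main _ _ _ _ hq ha; split=> //.
(* The rotation by i gives the quadruple (b, - a, e, - d), where e has the third place and b is
   already known to be in Q. *)
have := quad_rot 0 1 0 0 hq.
rewrite !rmorphN !rmorph0 !rmorph1 !oppr0 !scale0r !scale1r !scaleN1r !add0r !addr0.
by case/main.
Qed.

Implicit Types (it : nat -> item).

Definition valid (i : item) : Prop :=
  if isodd i then quad (lev i) (g0 i) (g1 i) (g2 i) (g3 i) else Gk (lev i) (g0 i).

Lemma valid_g0 i : valid i -> Gk (lev i) (g0 i).
Proof. by rewrite /valid; case: ifP => // _ [[]]. Qed.
Lemma valid_g2 i : valid i -> isodd i -> Gk (lev i) (g2 i).
Proof. by move=> + ho; rewrite /valid ho => -[[]]. Qed.
Lemma valid_x i : valid i -> isodd i -> x *: g0 i = y *: g1 i + z *: g2 i.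
Proof. by move=> + ho; rewrite /valid ho => -[_ []]. Qed.

Definition ocomb (i : item) (q : nat -> F) : X :=
  q 0%N ** g0 i + q 1%N ** g1 i + q 2%N ** g2 i + q 3%N ** g3 i.

Definition osum it k r (q : nat -> nat -> F) : X :=
  \sum_(i < r) (if isodd (it i) && (lev (it i) == k) then ocomb (it i) (q i) else 0).
Definition esum it k r (q : nat -> F) : X :=
  \sum_(i < r) (if ~~ isodd (it i) && (lev (it i) == k) then q i ** g0 (it i) else 0).

(** The span of Q_k and of the quaternionic multiples of the odd items of level k among the first r;
    in [Weven], of P_k and the real multiples of the even ones. *)
Definition Wodd it k r u := exists q, Q k (u - osum it k r q).
Definition Weven it k r u := exists q, P k (u - esum it k r q).

(** Each item is new at its level modulo the earlier ones. For an odd item it suffices to test g0,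
    since the odd spans are stable under the quaternions. *)
Definition good (it : nat -> item) (N : nat) := forall i, (i < N)%N ->
  valid (it i) /\ (if isodd (it i) then ~ Wodd it (lev (it i)) i (g0 (it i))
                   else ~ Weven it (lev (it i)) i (g0 (it i))).
Definition full (it : nat -> item) (N : nat) := forall k u,
  (P k u -> Wodd it k N u) /\ (Gk k u -> Weven it k N u).

Lemma osum_lin it k r a q q' :
  osum it k r (fun i j => a * q i j + q' i j) = a ** osum it k r q + osum it k r q'.
Proof.
rewrite /osum scaler_sumr -big_split; apply: eq_bigr => i _ /=.
by case: ifP => _; rewrite ?scaler0 ?addr0 // /ocomb; lmod A X.
Qed.
Lemma esum_lin it k r a q q' :
  esum it k r (fun i => a * q i + q' i) = a ** esum it k r q + esum it k r q'.
Proof.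
rewrite /esum scaler_sumr -big_split; apply: eq_bigr => i _ /=.
by case: ifP => _; rewrite ?scaler0 ?addr0 //; lmod A X.
Qed.

Lemma osum0 it k r : osum it k r (fun _ _ => 0) = 0.
Proof.
by apply: big1 => i _; case: ifP => // _; rewrite /ocomb rmorph0 !scale0r !addr0.
Qed.
Lemma esum0 it k r : esum it k r (fun _ => 0) = 0.
Proof. by apply: big1 => i _; case: ifP => // _; rewrite rmorph0 scale0r. Qed.

Lemma Wodd_lin it k r a u v : Wodd it k r u -> Wodd it k r v -> Wodd it k r (a ** u + v).
Proof.
move=> [q hq] [q' hq']; exists (fun i j => a * q i j + q' i j); rewrite osum_lin.
have -> : a ** u + v - (a ** osum it k r q + osum it k r q') =
  a ** (u - osum it k r q) + (v - osum it k r q') by lmod A X.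
by apply: QD => //; apply: QZ.
Qed.
Lemma Q_Wodd it k r u : Q k u -> Wodd it k r u.
Proof.
move=> hu; by exists (fun _ _ => 0); rewrite osum0 subr0.
Qed.
Lemma WoddZ it k r a u : Wodd it k r u -> Wodd it k r (a ** u).
Proof. by move=> h; have := Wodd_lin a h (Q_Wodd it r (Q0 k)); rewrite addr0. Qed.
Lemma Weven_lin it k r a u v : Weven it k r u -> Weven it k r v -> Weven it k r (a ** u + v).
Proof.
move=> [q hq] [q' hq']; exists (fun i => a * q i + q' i); rewrite esum_lin.
have -> : a ** u + v - (a ** esum it k r q + esum it k r q') =
  a ** (u - esum it k r q) + (v - esum it k r q') by lmod A X.
by apply: PD => //; apply: PZ.
Qed.
Lemma P_Weven it k r u : P k u -> Weven it k r u.
Proof.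
move=> hu; by exists (fun _ => 0); rewrite esum0 subr0.
Qed.
Lemma WevenZ it k r a u : Weven it k r u -> Weven it k r (a ** u).
Proof. by move=> h; have := Weven_lin a h (P_Weven it r (P0 k)); rewrite addr0. Qed.

(** The three coefficient lists are the remaining components in [quad_rot]. *)
Lemma osum_quad it k r q : (forall i, (i < r)%N -> valid (it i)) ->
  exists q1 q2 q3, quad k (osum it k r q) (osum it k r q1) (osum it k r q2) (osum it k r q3).
Proof.
move=> hv.
exists (fun i j => nth 0 [:: - q i 1%N; q i 0%N; q i 3%N; - q i 2%N] j),
  (fun i j => nth 0 [:: - q i 2%N; - q i 3%N; q i 0%N; q i 1%N] j),
  (fun i j => nth 0 [:: - q i 3%N; q i 2%N; - q i 1%N; q i 0%N] j).
elim: r hv => [|r IH] hv; first by rewrite /osum !big_ord0; apply: quad0.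
rewrite /osum !big_ord_recr /=; apply: quadD; first by apply: IH => i /ltnW; apply: hv.
have [/andP[h1 /eqP <-]|_] := ifP; last exact: quad0.
have := hv r (ltnSn r); rewrite /valid h1 => /(quad_rot (q r 0%N) (q r 1%N) (q r 2%N) (q r 3%N)).
by rewrite /ocomb.
Qed.

Lemma Wodd_quad it k r a b d e : (forall i, (i < r)%N -> valid (it i)) ->
  quad k a b d e -> Wodd it k r a -> [/\ Wodd it k r b, Wodd it k r d & Wodd it k r e].
Proof.
move=> hv hq [q ha]; have [q1 [q2 [q3 hs]]] := osum_quad k q hv.
have [h1 h2 h3] := quad_Q (quadD hq (quadN hs)) ha.
by split; [exists q1 | exists q2 | exists q3].
Qed.

(** If q g lies in the span of the earlier items, then so does its product with the conjugate of q,
    which is |q|^2 g. Over an ordered field |q|^2 vanishes only for q = 0; otherwise g itself would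
    not be new. *)
Lemma odd_indep it N k q : good it N -> forall r, (r <= N)%N -> Q k (osum it k r q) ->
  forall i j, (i < r)%N -> (j < 4)%N -> isodd (it i) -> lev (it i) = k -> q i j = 0.
Proof.
move=> hg; elim=> [//|r IH] rN hQ.
suff hr : isodd (it r) -> lev (it r) = k -> forall j, (j < 4)%N -> q r j = 0.
  move=> i j; rewrite ltnS leq_eqVlt => /orP[/eqP -> j4 ho hl|]; first exact: hr.
  apply: IH; first exact: ltnW.
  move: hQ; rewrite /osum big_ord_recr /=; case: ifP => [/andP[ho /eqP hl]|_]; last by rewrite addr0.
  by rewrite /ocomb !hr // rmorph0 !scale0r !addr0.
move=> ho hl.
have [hv] := hg _ rN; rewrite ho hl => hW; rewrite /valid ho hl in hv.
set p := q r 0%N; set q1 := q r 1%N; set q2 := q r 2%N; set q3 := q r 3%N.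
have hvs i : (i < r)%N -> valid (it i) by move=> ir; case: (hg i (ltn_trans ir rN)).
have W0 : Wodd it k r (ocomb (it r) (q r)).
  exists (fun i j => (-1) * q i j + 0).
  rewrite osum_lin osum0.
  by move: hQ; rewrite /osum big_ord_recr /= ho hl eqxx addr0 rmorphN1 scaleN1r opprK addrC.
have hq := quad_rot p q1 q2 q3 hv.
have [W1 W2 W3] := Wodd_quad hvs hq W0.
(* The coefficients p, - q1, - q2, - q3 are those of the conjugate quaternion. *)
have := Wodd_lin (- q3) W3 (Wodd_lin (- q2) W2 (Wodd_lin (- q1) W1 (WoddZ p W0))).
rewrite /ocomb -/p -/q1 -/q2 -/q3.
set n := p ^+ 2 + q1 ^+ 2 + q2 ^+ 2 + q3 ^+ 2.
set v := (X in Wodd _ _ _ X); have -> : v = n ** g0 (it r) by rewrite /v /n; lmod A X.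
have [n0 _|n0 /(WoddZ n^-1)] := eqVneq n 0; last by rewrite scalerA -rmorphM mulVf // rmorph1 scale1r.
move: n0; rewrite /n; move/eqP; rewrite !paddr_eq0 ?addr_ge0 ?sqr_ge0 // !sqrf_eq0.
by move=> /andP[/andP[/andP[/eqP ? /eqP ?] /eqP ?] /eqP ?] [|[|[|[|]]]].
Qed.

Lemma even_indep it N k q : good it N -> forall r, (r <= N)%N -> P k (esum it k r q) ->
  forall i, (i < r)%N -> ~~ isodd (it i) -> lev (it i) = k -> q i = 0.
Proof.
move=> hg; elim=> [//|r IH] rN hQ.
suff hr : ~~ isodd (it r) -> lev (it r) = k -> q r = 0.
  move=> i; rewrite ltnS leq_eqVlt => /orP[/eqP -> ho hl|]; first exact: hr.
  apply: IH; first exact: ltnW.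
  move: hQ; rewrite /esum big_ord_recr /=; case: ifP => [/andP[ho /eqP hl]|_]; last by rewrite addr0.
  by rewrite !hr // rmorph0 !scale0r !addr0.
move=> ho hl; have [hv] := hg _ rN; rewrite (negPf ho) hl => hW.
have W0 : Weven it k r (q r ** g0 (it r)).
  exists (fun i => (-1) * q i + 0).
  rewrite esum_lin esum0.
  by move: hQ; rewrite /esum big_ord_recr /= ho hl eqxx addr0 rmorphN1 scaleN1r opprK addrC.
apply/eqP; apply: contrapT => /negP q0; case: hW.
by have := WevenZ (q r)^-1 W0; rewrite scalerA -rmorphM mulVf // rmorph1 scale1r.
Qed.

Lemma good_lev it N i : good it N -> (i < N)%N -> (0 < lev (it i))%N.
Proof.
move=> hg iN; have [hv hW] := hg i iN; rewrite lt0n; apply/eqP => l0; move: hv hW.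
rewrite /valid l0; case: ifP => _.
  by move=> [[/G0 -> _ _ _] _]; case; apply/Q_Wodd/Q0.
by move=> /G0 ->; case; apply/P_Weven/P0.
Qed.

(** Generators over the polynomials in y, over which the chart ring is spanned by 1 and x. For an
    even item they are g0 and x g0, the latter one degree higher; for an odd item g2 and g3 replace
    x g0 and x g1 and stay in the same degree. *)
Definition gen it i j : X :=
  if isodd (it i) then nth 0 [:: g0 (it i); g1 (it i); g2 (it i); g3 (it i)] j
  else nth 0 [:: g0 (it i); x *: g0 (it i)] j.
Definition glev it i j : nat := lev (it i) + (~~ isodd (it i) && (j == 1%N)).

Lemma gen_G it N i j : good it N -> (i < N)%N -> Gk (glev it i j) (gen it i j).
Proof.
move=> hg iN; have [hv _] := hg i iN; move: hv; rewrite /valid /gen /glev.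
case: ifP => _ /=; first by rewrite addn0 => -[[? ? ? ?] _]; case: j => [|[|[|[|j]]]] //=; rewrite ?nth_nil; apply: Gz0.
case: j => [|[|j]] //= h; rewrite ?addn0 ?addn1 ?nth_nil //; [exact: Gx | exact: Gz0].
Qed.

(** Write the sum as O + E + x E', with O odd and E even of degree k + 1 and E' even of degree k.
    Then O + E is in Q and O in P, so E is in P and vanishes; now O is in Q and vanishes; finally x
    E' in y G + z G puts E' in P. *)
Lemma top_level it N k q a b : good it N -> Gk k a -> Gk k b ->
  (forall i j, ~~ isodd (it i) -> (2 <= j)%N -> q i j = 0) ->
  \sum_(i < N) \sum_(j < 4) (if glev it i j == k.+1 then q i j else 0) ** gen it i j = y *: a + z *: b ->
  forall i j, (i < N)%N -> (j < 4)%N -> glev it i j = k.+1 -> q i j = 0.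
Proof.
move=> hg ha hb adm hs.
set O := osum it k.+1 N q; set E := esum it k.+1 N (fun i => q i 0%N).
set E' := esum it k N (fun i => q i 1%N).
have sE : O + E + x *: E' = y *: a + z *: b.
  rewrite -hs /O /E /E' /osum /esum scaler_sumr -!big_split; apply: eq_bigr => i _ /=.
  rewrite !big_ord_recl big_ord0 /= /bump /= /glev /gen /ocomb !addn0.
  case: (isodd (it i)) => /=.
    by rewrite !addn0; case: ifP => _; rewrite ?rmorph0; lmod A X.
  rewrite !addn0 addn1 eqSS !scaler0.
  by case: ifP => _; case: ifP => _; rewrite ?rmorph0; lmod A X.
have hv i : (i < N)%N -> valid (it i) by move=> /hg[].
have OP : P k.+1 O by have [q1 [q2 [q3 /quad_P[]]]] := osum_quad k.+1 q hv.
have E'G : Gk k E'.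
  apply: Gsum => i _; case: ifP => [/andP[h1 /eqP <-]|_]; last exact: Gz0.
  by apply: GZ; have := hv i (ltn_ord i); rewrite /valid (negPf h1).
have QOE : Q k.+1 (O + E).
  exists (- E'), a, b; split=> //; first exact: GN.
  by rewrite -addrA -sE; lmod A X.
have EP : P k.+1 E by rewrite -[E](addKr O) addrC; apply: PB => //; apply: Q_P.
have hE := even_indep hg (leqnn N) EP.
have E0 : E = 0.
  apply: big1 => i _; case: ifP => // /andP[h1 /eqP h2].
  by rewrite hE // rmorph0 scale0r.
rewrite E0 addr0 in QOE sE; have hO := odd_indep hg (leqnn N) QOE.
have O0 : O = 0.
  apply: big1 => i _; case: ifP => // /andP[h1 /eqP h2].
  by rewrite /ocomb !hO // rmorph0 !scale0r !addr0.
have hE' : forall i, (i < N)%N -> ~~ isodd (it i) -> lev (it i) = k -> q i 1%N = 0.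
  apply: (even_indep hg (leqnn N)); split=> //; exists a, b; split=> //.
  by rewrite -sE O0 add0r.
move=> i j iN j4; rewrite /glev; have [ho|ho] := boolP (isodd (it i)).
  by rewrite addn0 => hl; apply: hO.
case: j j4 => [|[|j]] _ /=; [rewrite addn0; exact: hE | | by move=> _; apply: adm].
by rewrite addn1 => -[]; apply: hE'.
Qed.

(** * Freeness and generation on the chart z = 1 *)

Section Chart.
Variables (B : comNzRingType) (M : lmodType B) (pi : {rmorphism A -> B}).
Variable pr : X -> M.
Hypothesis prD : forall a u v, pr (a *: u + v) = pi a *: pr u + pr v.
Hypothesis piz : pi z = 1.
Hypothesis cover : forall v, exists k u, Gk k u /\ pr u = v.
Hypothesis prinj : forall k u, Gk k u -> pr u = 0 -> u = 0.

Definition evpoly (p : {poly F}) : B := (map_poly (pi \o c) p).[pi y].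
Hypothesis gens : forall b, exists p q, b = evpoly p + evpoly q * pi x.

Lemma pr0 : pr 0 = 0.
Proof.
by have := prD 1 0 0; rewrite scaler0 addr0 rmorph1 scale1r => /eqP; rewrite -subr_eq0 opprD addNKr oppr_eq0 => /eqP.
Qed.
Lemma prZ a u : pr (a *: u) = pi a *: pr u.
Proof. by rewrite -[a *: u]addr0 prD pr0 addr0. Qed.
Lemma prA u v : pr (u + v) = pr u + pr v.
Proof. by rewrite -{1}[u]scale1r prD rmorph1 scale1r. Qed.
Lemma prB u v : pr (u - v) = pr u - pr v.
Proof. by rewrite addrC -scaleN1r prD rmorphN1 scaleN1r addrC. Qed.
Lemma pr_sum I r (f : I -> X) : pr (\sum_(i <- r) f i) = \sum_(i <- r) pr (f i).
Proof. by elim/big_rec2: _ => [|i u v _ <-]; [apply: pr0 | apply: prA]. Qed.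
Lemma prz j u : pr (z ^+ j *: u) = pr u.
Proof. by rewrite prZ rmorphXn piz expr1n scale1r. Qed.

Lemma GzX k j u : Gk k u -> Gk (j + k) (z ^+ j *: u).
Proof.
by elim: j => [|j IH] hu; rewrite ?scale1r // exprS -scalerA; apply: Gz; apply: IH.
Qed.

Lemma y_torsion_free (v : M) : pi y *: v = 0 -> v = 0.
Proof.
have [k [u [hu <-]]] := cover v; rewrite -prZ => h.
have hy : y *: u = 0 by apply: (prinj (k := k.+1)) h; apply: Gy.
by rewrite (yinj hu hy) pr0.
Qed.

(** On the chart the quotient u' may have any degree m. While m is too large, regularity writes u' =
    z w with w of degree one less and the same image; when m is small enough, a power of z raises
    it. *)
Lemma y_divides k m u u' : Gk k u -> Gk m u' -> pr u = pi y *: pr u' ->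
  exists2 u'', Gk k.-1 u'' & u = y *: u''.
Proof.
case: k => [/G0 -> _ _|k hu]; first by exists 0; rewrite ?scaler0 //; apply: Gz0.
elim: m u' => [|m IH] u' hu'.
  rewrite (G0 hu') pr0 scaler0 => h; exists 0; first exact: Gz0.
  by rewrite (prinj hu h) scaler0.
move=> h; have [mk|km] := leqP m.+1 k.
  exists (z ^+ (k - m.+1) *: u'); first by rewrite -[k in Gk k](subnK mk); apply: GzX.
  apply/eqP; rewrite -subr_eq0; apply/eqP; apply: (prinj (k := k.+1)).
    by apply: GB => //; apply: Gy; rewrite -[k in Gk k](subnK mk); apply: GzX.
  by rewrite prB prZ prz h subrr.
have e1 : y *: u' = z *: (z ^+ (m - k) *: u).
  apply/eqP; rewrite -subr_eq0; apply/eqP; apply: (prinj (k := m.+2)).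
    apply: GB; first exact: Gy.
    by apply: Gz; have := GzX (m - k) hu; rewrite addnS subnK.
  by rewrite prB !prZ rmorphXn piz expr1n !scale1r h subrr.
have hz : Gk m.+1 (z ^+ (m - k) *: u) by have := GzX (m - k) hu; rewrite addnS subnK.
have [w [hw u'E _]] := Greg hu' hz e1.
by apply: (IH w hw); rewrite h u'E prZ piz scale1r.
Qed.

Definition adm it (T : nmodType) (q : nat -> nat -> T) :=
  forall i j, ~~ isodd (it i) -> (2 <= j)%N -> q i j = 0.

(** Homogenized with powers of z to its top degree, the combination is y u''. Its terms of lower
    degree are multiples of z, so [top_level] kills those of top degree, and the top degree
    descends. *)
Lemma indep_mod_y it N (q : nat -> nat -> F) (w : M) : good it N -> adm it q ->
  \sum_(i < N) \sum_(j < 4) pi (c (q i j)) *: pr (gen it i j) = pi y *: w ->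
  forall i j, (i < N)%N -> (j < 4)%N -> q i j = 0.
Proof.
move=> hg ha hw.
suff main K : (forall i j, (i < N)%N -> (j < 4)%N -> q i j != 0 -> (glev it i j < K)%N) ->
  forall i j, (i < N)%N -> (j < 4)%N -> q i j = 0.
  apply: (main (\max_(i < N) \max_(j < 4) glev it i j).+1) => i j iN j4 _; rewrite ltnS.
  apply: (leq_trans _ (leq_bigmax_cond (Ordinal iN) _)) => //.
  exact: (leq_bigmax_cond (Ordinal j4)).
elim: K => [|k IH] hK.
  by move=> i j iN j4; apply/eqP; apply: contrapT => /negP /(hK i j iN j4).
apply: IH => i j iN j4 qn0; have := hK i j iN j4 qn0; rewrite ltnS leq_eqVlt => /orP[|//].
move=> /eqP hl; case/eqP: qn0.
have glev0 : (0 < glev it i j)%N by rewrite /glev addn_gt0 (good_lev hg).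
case: k hl hK => [hl|k hl hK]; first by move: glev0; rewrite hl.
set u := \sum_(i < N) \sum_(j < 4) q i j ** (z ^+ (k.+1 - glev it i j) *: gen it i j).
have term_G i' j' l : (i' < N)%N -> (j' < 4)%N -> (glev it i' j' <= l)%N ->
    Gk l (q i' j' ** (z ^+ (l - glev it i' j') *: gen it i' j')).
  move=> iN' j4' hl'; apply: GZ; rewrite -[X in Gk X](subnK hl'); apply: GzX.
  exact: (gen_G _ hg).
have hu : Gk k.+1 u.
  apply: Gsum => i' _; apply: Gsum => j' _; have [->|q0] := eqVneq (q i' j') 0.
    by rewrite rmorph0 scale0r; apply: Gz0.
  by apply: term_G => //; rewrite -ltnS hK.
have [m [u' [hu' wE]]] := cover w.
have pru : pr u = pi y *: pr u'.
  rewrite wE -hw pr_sum; apply: eq_bigr => i' _; rewrite pr_sum; apply: eq_bigr => j' _.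
  by rewrite prZ prz.
have [u'' hu'' uE] := y_divides hu hu' pru.
(* The lower terms with one factor z removed: the part of top degree is y u'' - z l. *)
set l := \sum_(i < N) \sum_(j < 4) (if glev it i j == k.+1 then 0 else
    q i j ** (z ^+ (k - glev it i j) *: gen it i j)).
have hlow : Gk k l.
  apply: Gsum => i' _; apply: Gsum => j' _; case: eqP => [_|/eqP ne]; first exact: Gz0.
  have [->|q0] := eqVneq (q i' j') 0; first by rewrite rmorph0 scale0r; apply: Gz0.
  by apply: term_G => //; rewrite -ltnS ltn_neqAle ne -ltnS hK.
apply: (top_level hg hu'' (GN hlow) ha) => //.
rewrite -uE scalerN; apply/eqP; rewrite -subr_eq0 opprB addrA subr_eq add0r addrC; apply/eqP.
rewrite /u /l scaler_sumr -big_split; apply: eq_bigr => i' _.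
rewrite scaler_sumr -big_split; apply: eq_bigr => j' _ /=.
have [->|q0] := eqVneq (q i' j') 0; first by rewrite rmorph0 !scale0r !if_same rmorph0 scale0r scaler0 addr0.
case: ifP => [/eqP ->|/eqP/eqP ne]; first by rewrite subnn scale1r scaler0 add0r.
rewrite rmorph0 scale0r addr0 subSn; last by rewrite -ltnS ltn_neqAle ne -ltnS hK.
by rewrite exprS; lmod A X.
Qed.

Lemma evpolyE p : evpoly p = pi (c p`_0) + pi y * evpoly (drop_poly 1 p).
Proof.
rewrite /evpoly -{1}[p](poly_take_drop 1) expr1 rmorphD rmorphM /= map_polyX hornerD hornerMX.
rewrite mulrC; congr (_ + _); rewrite (_ : take_poly 1 p = (p`_0)%:P) ?map_polyC ?hornerC //.
by apply/polyP => i; rewrite coef_take_poly coefC; case: i.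
Qed.

Lemma evpolyD p q : evpoly (p + q) = evpoly p + evpoly q.
Proof. by rewrite /evpoly rmorphD hornerD. Qed.
Lemma evpolyN p : evpoly (- p) = - evpoly p.
Proof. by rewrite /evpoly rmorphN hornerN. Qed.
Lemma evpolyX p : evpoly ('X * p) = pi y * evpoly p.
Proof. by rewrite /evpoly rmorphM /= map_polyX mulrC hornerMX mulrC. Qed.

(** Induction on the degree in y: the constant terms form a real combination divisible by y and
    vanish, and then y can be cancelled. *)
Lemma poly_indep it N (q : nat -> nat -> {poly F}) : good it N -> adm it q ->
  \sum_(i < N) \sum_(j < 4) evpoly (q i j) *: pr (gen it i j) = 0 ->
  forall i j, (i < N)%N -> (j < 4)%N -> q i j = 0.
Proof.
move=> hg; have [d] : exists d, forall i j, (i < N)%N -> (j < 4)%N -> (size (q i j) <= d)%N.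
  exists (\max_(i < N) \max_(j < 4) size (q i j)) => i j iN j4.
  apply: (leq_trans _ (leq_bigmax_cond (Ordinal iN) _)) => //.
  exact: (leq_bigmax_cond (Ordinal j4)).
elim: d q => [|d IH] q hd ha hs i j iN j4.
  by apply/eqP; rewrite -size_poly_eq0 -leqn0 hd.
have hs' : \sum_(i < N) \sum_(j < 4) pi (c (q i j)`_0) *: pr (gen it i j) =
    pi y *: - \sum_(i < N) \sum_(j < 4) evpoly (drop_poly 1 (q i j)) *: pr (gen it i j).
  apply/eqP; rewrite scalerN -addr_eq0; apply/eqP; apply: etrans hs.
  rewrite scaler_sumr -big_split; apply: eq_bigr => i' _.
  rewrite scaler_sumr -big_split; apply: eq_bigr => j' _ /=.
  by rewrite (evpolyE (q i' j')) scalerDl scalerA.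
have h0 := @indep_mod_y it N (fun i j => (q i j)`_0) _ hg _ hs'.
have {}h0 : forall i j, (i < N)%N -> (j < 4)%N -> (q i j)`_0 = 0.
  by apply: h0 => i' j' ho hj; rewrite ha // coef0.
have h1 : drop_poly 1 (q i j) = 0.
  apply: (IH (fun i j => drop_poly 1 (q i j))) => //.
  - by move=> i' j' iN' j4'; rewrite size_drop_poly leq_subLR add1n hd.
  - by move=> i' j' ho hj; rewrite ha // drop_poly0r.
  apply: y_torsion_free; apply/eqP; rewrite -oppr_eq0 -scalerN -hs'; apply/eqP.
  by apply: big1 => i' _; apply: big1 => j' _; rewrite h0 // !rmorph0 scale0r.
rewrite -[q i j](poly_take_drop 1) h1 mul0r addr0.
by apply/polyP => k; rewrite coef_take_poly coef0; case: k => //=; rewrite h0.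
Qed.

Lemma pr_g23 i : valid i -> isodd i ->
  pr (g2 i) = pi x *: pr (g0 i) + (- pi y) *: pr (g1 i) /\
  pr (g3 i) = pi x *: pr (g1 i) + pi y *: pr (g0 i).
Proof.
move=> + ho; rewrite /valid ho => -[_ [e1 e2 _ _]]; split.
  by have := congr1 pr e1; rewrite prA !prZ piz scale1r => ->; lmod B M.
by have := congr1 pr e2; rewrite prA -scaleN1r !prZ rmorphN1 piz scale1r => ->; lmod B M.
Qed.

Theorem good_free it N (a b : nat -> B) : good it N -> (forall i, ~~ isodd (it i) -> b i = 0) ->
  \sum_(i < N) (a i *: pr (g0 (it i)) + b i *: pr (g1 (it i))) = 0 ->
  forall i, (i < N)%N -> a i = 0 /\ b i = 0.
Proof.
move=> hg hb hs.
have [p /boolp.choice[q hpq]] := boolp.choice (fun i => gens (a i)).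
have [r /boolp.choice[l hrl]] := boolp.choice (fun i => gens (b i)).
(* For z = 1 the identities x g0 = g2 + y g1 and x g1 = g3 - y g0 express (p + q x) g0 + (r + l x)
   g1 in the four generators. *)
pose Q4 i j : {poly F} := if isodd (it i)
  then nth 0 [:: p i - 'X * l i; r i + 'X * q i; q i; l i] j
  else nth 0 [:: p i; q i] j.
have hz : \sum_(i < N) \sum_(j < 4) evpoly (Q4 i j) *: pr (gen it i j) = 0.
  apply: etrans hs; apply: eq_bigr => i _; rewrite !big_ord_recl big_ord0 /= /Q4 /gen.
  have [ho|he] := boolP (isodd (it i)) => /=; last first.
    rewrite hb // scale0r /bump /= !addr0 prZ hpq scalerDl scalerA.
    have -> : evpoly 0 = 0 by rewrite /evpoly rmorph0 horner0.
    by rewrite !scale0r !addr0.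
  have [hv _] := hg i (ltn_ord i); have [e3 e4] := pr_g23 hv ho; rewrite e3 e4.
  rewrite hpq hrl !evpolyD evpolyN !evpolyX /bump /= addr0.
  by lmod B M.
have h0 := poly_indep hg _ hz.
have {}h0 : forall i j, (i < N)%N -> (j < 4)%N -> Q4 i j = 0.
  by apply: h0 => i [|[|j]] //= ho _; rewrite /Q4 (negPf ho) /= nth_nil.
move=> i iN; have := h0 i; rewrite /Q4 hpq.
have ev0 : evpoly 0 = 0 by rewrite /evpoly rmorph0 horner0.
have [ho|he] := boolP (isodd (it i)) => /= h.
  have q0 : q i = 0 by apply: (h 2%N).
  have l0 : l i = 0 by apply: (h 3%N).
  have := h 0%N iN isT; have := h 1%N iN isT; rewrite /= q0 l0 mulr0 addr0 subr0 => r0 p0.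
  by rewrite hrl p0 r0 ?q0 l0 ev0 mul0r addr0.
by have /= -> := h 0%N iN isT; have /= -> := h 1%N iN isT; rewrite (hb _ he) ev0 mul0r addr0.
Qed.

(** Induction on the degree of a lift: subtracting an even and then an odd combination leaves an
    element of Q_k, that is x a + y b + z d with a, b, d one degree lower. *)
Theorem full_span it N : good it N -> full it N -> forall v : M, exists a b : nat -> B,
  (forall i, ~~ isodd (it i) -> b i = 0) /\
  v = \sum_(i < N) (a i *: pr (g0 (it i)) + b i *: pr (g1 (it i))).
Proof.
move=> hg hf v; have [k [u [hu <-]]] := cover v.
pose Sp (v : M) := exists a b : nat -> B, (forall i, ~~ isodd (it i) -> b i = 0) /\
  v = \sum_(i < N) (a i *: pr (g0 (it i)) + b i *: pr (g1 (it i))).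
have SpD a v1 v2 : Sp v1 -> Sp v2 -> Sp (a *: v1 + v2).
  move=> [a1 [b1 [h1 ->]]] [a2 [b2 [h2 ->]]].
  exists (fun i => a * a1 i + a2 i), (fun i => a * b1 i + b2 i); split.
    by move=> i hi; rewrite h1 // h2 // mulr0 addr0.
  by rewrite scaler_sumr -big_split; apply: eq_bigr => i _ /=; lmod B M.
have Sp0 : Sp 0.
  exists (fun _ => 0), (fun _ => 0); split=> //.
  by rewrite big1 // => i _; rewrite !scale0r addr0.
have SpA v1 v2 : Sp v1 -> Sp v2 -> Sp (v1 + v2).
  by move=> h1 h2; rewrite -[v1]scale1r; apply: SpD.
have SpZ a v1 : Sp v1 -> Sp (a *: v1).
  by move=> h1; rewrite -[_ *: _]addr0; apply: SpD.
have Sp_g0 i : (i < N)%N -> Sp (pr (g0 (it i))).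
  move=> iN; exists (fun j => (j == i)%:R), (fun _ => 0); split=> //.
  rewrite (bigD1 (Ordinal iN)) //= eqxx scale1r scale0r addr0 big1 ?addr0 // => j.
  by rewrite -val_eqE /= => /negPf ->; rewrite !scale0r addr0.
have Sp_g1 i : (i < N)%N -> isodd (it i) -> Sp (pr (g1 (it i))).
  move=> iN ho; exists (fun _ => 0), (fun j => (j == i)%:R); split.
    by move=> j; case: eqP => // ->; rewrite ho.
  rewrite (bigD1 (Ordinal iN)) //= eqxx scale1r scale0r add0r big1 ?addr0 // => j.
  by rewrite -val_eqE /= => /negPf ->; rewrite !scale0r addr0.
have Sp_sum I r (f : I -> X) : (forall i, Sp (pr (f i))) -> Sp (pr (\sum_(i <- r) f i)).
  move=> h; rewrite pr_sum; elim/big_rec: _ => // i v1 _; exact: SpA.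
rewrite -/(Sp (pr u)) {v}.
elim/ltn_ind: k u hu => k IH u hu.
have [_ /(_ hu)[q hP]] := hf k u.
have [/(_ hP)[q' hQ] _] := hf k (u - esum it k N q).
have SB v1 v2 : Sp (pr v2) -> Sp (pr (v1 - v2)) -> Sp (pr v1).
  by move=> h1 h2; rewrite -[v1](subrK v2) prA; apply: SpA.
apply: (SB _ (esum it k N q)).
  apply: Sp_sum => i; case: ifP => _; last by rewrite pr0.
  by rewrite prZ; apply/SpZ/Sp_g0.
apply: (SB _ (osum it k N q')).
  apply: Sp_sum => i; case: ifP => [/andP[ho _]|_]; last by rewrite pr0.
  have [hv _] := hg i (ltn_ord i); have [e3 e4] := pr_g23 hv ho.
  rewrite /ocomb !prA !prZ.
  have h0 := Sp_g0 i (ltn_ord i); have h1 := Sp_g1 i (ltn_ord i) ho.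
  by rewrite e3 e4; do 3?[apply/SpA]; apply/SpZ => //; apply/SpA; apply/SpZ.
case: k IH hQ {hP hf hu SB} => [|k] IH; first by move=> ->; rewrite pr0.
move=> [a [b [d [ha hb hd ->]]]]; rewrite !prA !prZ.
by do 2?[apply/SpA]; apply/SpZ/(IH k).
Qed.
End Chart.
End Fixed.

(** * Growing a family of items; exchange of the charts *)

Lemma good_extend S it it' N : (forall i, (i < N)%N -> it i = it' i) -> good S it N -> good S it' N.
Proof.
move=> e hg i iN; rewrite -e //; have [h1 h2] := hg i iN; split=> //; move: h2.
have eo k q : osum it k i q = osum it' k i q.
  by apply: eq_bigr => j _; rewrite e // (ltn_trans _ iN).
have ee k q : esum it k i q = esum it' k i q.
  by apply: eq_bigr => j _; rewrite e // (ltn_trans _ iN).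
case: ifP => _ h [q hq]; apply: h; exists q; by rewrite ?eo ?ee.
Qed.

(** A missing element of G_k is a new even item. A missing element of P_k comes with a relation that
    completes it to a quadruple, a new odd item. *)
Lemma not_full_extend S it N : good S it N -> ~ full S it N ->
  exists x, good S (fun i => if i == N then x else it i) N.+1.
Proof.
move=> hg nf.
have [x [hv hx]] : exists x, valid S x /\
    if isodd x then ~ Wodd S it (lev x) N (g0 x) else ~ Weven S it (lev x) N (g0 x).
  move/boolp.existsNP: nf => [k /boolp.existsNP[u /boolp.not_andP[]]] /boolp.not_implyP[h1 h2].
    have [hu [b [e [hb he xu]]]] := h1.
    by have [f hq] := quad_complete hu hb he xu; exists (Item k true u b e f).
  by exists (Item k false u 0 0 0).
exists x; set it' := fun i => _.
have e i : (i < N)%N -> it i = it' i by move=> iN; rewrite /it' ltn_eqF.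
move=> i; rewrite ltnS leq_eqVlt => /orP[/eqP -> {i}|iN]; last exact: (good_extend e hg).
have -> : it' N = x by rewrite /it' eqxx.
split=> //; move: hx.
have eo k q : osum it k N q = osum it' k N q by apply: eq_bigr => j _; rewrite e.
have ee k q : esum it k N q = esum it' k N q by apply: eq_bigr => j _; rewrite e.
by case: ifP => _ h [q hq]; apply: h; exists q; rewrite ?eo ?ee.
Qed.

(** Greedy extension ends by the bound on the size of good families. The given family stays an
    initial segment; this is used to show that a computed family is already full. *)
Theorem full_exists S n : (forall it N, good S it N -> (N <= n)%N) ->
  forall it N, good S it N -> exists it' N',
    [/\ (N <= N')%N, forall i, (i < N)%N -> it i = it' i, good S it' N' & full S it' N'].
Proof.
move=> bnd it N hg; have := bnd _ _ hg; move: {1}(n - N)%N (erefl (n - N)%N) => d.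
elim: d it N hg => [|d IH] it N hg hd hn; have [hf|nf] := boolp.pselect (full S it N);
  try by exists it, N; split.
  by have [x hx] := not_full_extend hg nf; have := bnd _ _ hx; lia.
have [x hx] := not_full_extend hg nf.
have [||it' [N' [h1 h2 h3 h4]]] := IH _ _ hx; [lia | exact: bnd hx |].
exists it', N'; split=> //; first exact: ltnW.
by move=> i iN; rewrite -h2 ?ltn_eqF // ltnW.
Qed.

Lemma swap_P S k u : P (gswap S) k u <-> P S k u.
Proof. by split=> -[hu [a [b [ha hb e]]]]; split=> //; exists b, a; split=> //; rewrite e addrC. Qed.
Lemma swap_Q S k u : Q (gswap S) k u <-> Q S k u.
Proof.
case: k => [//|k]; split=> -[a [b [d [ha hb hd ->]]]];
  by exists a, d, b; split=> //; rewrite addrAC.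
Qed.
Lemma swap_osum it k r q : osum (iswap \o it) k r q =
  osum it k r (fun i j => nth 0 [:: q i 0%N; q i 2%N; q i 1%N; - q i 3%N] j).
Proof.
apply: eq_bigr => i _ /=; case: ifP => // _; rewrite /ocomb /=.
by lmod A X.
Qed.
Lemma swap_quad S k a b d e : quad S k a b d e -> quad (gswap S) k a d b (- e).
Proof.
move=> [[ha hb hd he] [h1 h2 h3 h4]]; split; first by split=> //; apply: (GN (S := S)).
by split; rewrite /= ?scalerN ?h1 ?h2 ?h3 ?h4; lmod A X.
Qed.
Lemma swap_Weven S it k r u : Weven (gswap S) (iswap \o it) k r u <-> Weven S it k r u.
Proof. by split=> -[q hq]; exists q; move: hq; rewrite swap_P. Qed.
Lemma swap_Wodd S it k r u : Wodd (gswap S) (iswap \o it) k r u <-> Wodd S it k r u.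
Proof.
split=> -[q]; first by rewrite swap_osum => /swap_Q; eexists; eassumption.
move=> hq; exists (fun i j => nth 0 [:: q i 0%N; q i 2%N; q i 1%N; - q i 3%N] j).
apply/swap_Q; rewrite swap_osum; move: hq; congr (Q _ _ (_ - _)); apply: eq_bigr => i _.
by rewrite /ocomb /= opprK.
Qed.
Lemma swap_good S it N : good S it N -> good (gswap S) (iswap \o it) N.
Proof.
move=> hg i iN; have [hv hw] := hg i iN; split.
  by move: hv; rewrite /valid /=; case: ifP => // _; apply: swap_quad.
by move: hw; rewrite /=; case: ifP => _; rewrite ?swap_Wodd ?swap_Weven.
Qed.
Lemma swap_full S it N : full S it N -> full (gswap S) (iswap \o it) N.
Proof.
by move=> hf k u; have [h1 h2] := hf k u; split; rewrite ?swap_P ?swap_Wodd ?swap_Weven.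
Qed.
End Graded.

(** * The graded module of two glued chart modules *)

Section Glue.
Variable R : realType.
Local Notation K := (ffield R).
Local Notation s := (x_z R).
Local Notation t := (y_z R).

Lemma denominator (f : K) : exists2 d, d != 0 & exists a b, pol R d * f = emb a b.
Proof.
have fr (r : {fraction {poly R}}) : exists2 d, d != 0 & exists a, FracField.tofrac d * r = FracField.tofrac a.
  elim/quotW: r => r; exists \d_r; first exact: denom_ratioP.
  exists \n_r; rewrite mulrC; set y := \pi_{fraction {poly R}}%qT r; apply/eqP.
  change (FracField.mul (\pi_{fraction {poly R}}%qT r) (FracField.tofrac \d_r) ==
          FracField.tofrac \n_r).
  rewrite piE FracField.equivfE /FracField.mulf.
  rewrite !numden_Ratio ?mulf_neq0 ?oner_eq0 ?denom_ratioP //.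
  by rewrite !mulr1 mulrC.
have [d d0 [a da]] := fr (polyn f)`_0.
have [e e0 [b eb]] := fr (polyn f)`_1.
exists (d * e); first exact: mulf_neq0.
exists (e * a), (d * b).
suff E : polyn (pol R (d * e) * f) = polyn (emb (e * a) (d * b)) by apply: val_inj E.
rewrite val_emb.
have -> : pol R (d * e) * f = FracField.tofrac (d * e) *: f :> {poly %/ conic_poly R}.
  by rewrite /pol /= -scalerAl mul1r.
rewrite /=; apply/polyP => i; rewrite coefZ coefD coefC coefZ coefX.
case: i => [|[|i]] /=; rewrite ?mulr0 ?mulr1 ?addr0 ?add0r !tofracM.
- by rewrite [FracField.tofrac d * _]mulrC -mulrA da.
- by rewrite -mulrA eb.
- rewrite [X in _ * X]nth_default ?mulr0 //.
  have h3 : size (mk_monic (conic_poly R)) = 3%N by rewrite mk_monic_conic size_conic.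
  by rewrite -ltnS (leq_trans (size_mk_monic f)) // h3.
Qed.

Lemma common_denominator (I : finType) (f : I -> K) :
  exists2 h, h != 0 & h \in @R1 R /\ forall i, h * f i \in @R1 R.
Proof.
have /boolp.choice[d hd] (i : I) : exists d : {poly R}, d != 0 /\ exists a b, pol R d * f i = emb a b.
  by have [d d0 h] := denominator (f i); exists d.
have polR1 p : pol R p \in @R1 R by apply/R1P; exists p, 0; rewrite /emb rmorph0 mul0r addr0.
exists (pol R (\prod_i d i)).
  rewrite /pol /= scaler_eq0 oner_eq0 orbF tofrac_eq0; apply/prodf_neq0 => i _.
  by case: (hd i).
split; first exact: polR1.
have aux p q g : pol R p * g \in @R1 R -> pol R (p * q) * g \in @R1 R.
  by move=> h; rewrite [p * q]mulrC rmorphM -mulrA rpredM.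
move=> i; rewrite (bigD1 i) //; apply: aux.
by have [_ h] := hd i; apply/R1P.
Qed.

Lemma s_t_x_y : s = t * x_y R.
Proof. by rewrite /x_y mulrC divfK // t_neq0. Qed.
Lemma t_z_y : t * z_y R = 1.
Proof. by rewrite /z_y divff // t_neq0. Qed.

Definition cst1 (r : R) : ring1 R := Sub (cst R r) (cst_R1 r).
Lemma cst_R2 (r : R) : cst R r \in @R2 R.
Proof. by apply/R2P; exists 0%N; rewrite mulr1; apply: Fil_cst. Qed.
Definition cst2 (r : R) : ring2 R := Sub (cst R r) (cst_R2 r).
Definition s1 : ring1 R := Sub s (x_z_R1 R).
Lemma x_y_R2 : x_y R \in @R2 R.
Proof. by apply/R2P; exists 1%N; rewrite expr1 divfK ?t_neq0 //; apply: Fil_s. Qed.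
Definition s2 : ring2 R := Sub (x_y R) x_y_R2.
Local Notation t1 := (y_z1 R).
Local Notation t2 := (z_y2 R).

(** Both charts at once: a homogeneous coordinate is the pair of its quotients by z and by y. Thus x
    is (x/z, x/y), y is (y/z, 1) and z is (1, z/y). *)
Definition ring_pair : comNzRingType := (ring1 R * ring2 R)%type.
Definition cpair (r : R) : ring_pair := (cst1 r, cst2 r).
Lemma cpair_zmod_morphism : zmod_morphism cpair.
Proof. by move=> a b; congr pair; apply: val_inj; apply: (rmorphB (cst R)). Qed.
Lemma cpair_monoid_morphism : monoid_morphism cpair.
Proof.
split=> [|a b]; congr pair; apply: val_inj; rewrite /=.
- exact: (rmorph1 (cst R)).
- exact: (rmorph1 (cst R)).
- exact: (rmorphM (cst R)).
- exact: (rmorphM (cst R)).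
Qed.
HB.instance Definition _ := GRing.isZmodMorphism.Build R ring_pair cpair cpair_zmod_morphism.
HB.instance Definition _ := GRing.isMonoidMorphism.Build R ring_pair cpair cpair_monoid_morphism.

Variables (P1 : lmodType (ring1 R)) (P2 : lmodType (ring2 R)).

(** A type of its own, because here the product of the two modules carries an action of the product
    ring. *)
Definition pairmod : Type := (P1 * P2)%type.
HB.instance Definition _ := GRing.Zmodule.on pairmod.
Definition pair_scale (a : ring_pair) (u : pairmod) : pairmod := (a.1 *: u.1, a.2 *: u.2).
Lemma pair_scaleA a b u : pair_scale a (pair_scale b u) = pair_scale (a * b) u.
Proof. by rewrite /pair_scale /= !scalerA. Qed.
Lemma pair_scale1 : left_id 1 pair_scale.
Proof. by case=> u v; rewrite /pair_scale /= !scale1r. Qed.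
Lemma pair_scaleDr : right_distributive pair_scale +%R.
Proof. by move=> a u v; rewrite /pair_scale /= !scalerDr. Qed.
Lemma pair_scaleDl u : {morph pair_scale^~ u : a b / a + b}.
Proof. by move=> a b; rewrite /pair_scale /= !scalerDl. Qed.
HB.instance Definition _ := GRing.Zmodule_isLmodule.Build ring_pair pairmod
  pair_scaleA pair_scale1 pair_scaleDr pair_scaleDl.

Variables (n : nat) (k1 : P1 -> 'cV[K]_n) (k2 : P2 -> 'cV[K]_n) (D : nat).

(** Two chart modules embedded in one vector space over the function field. [loc12] and [loc21] say
    that they agree on the overlap, and [nosec] that the twist by - D has no sections. *)
Record gluing := Gluing {
  k1D : forall a u v, k1 (a *: u + v) = val a *: k1 u + k1 v;
  k2D : forall a u v, k2 (a *: u + v) = val a *: k2 u + k2 v;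
  k1inj : forall u, k1 u = 0 -> u = 0;
  k2inj : forall u, k2 u = 0 -> u = 0;
  loc12 : forall v, exists k w, k1 v = t ^+ k *: k2 w;
  loc21 : forall w, exists k v, t ^+ k *: k2 w = k1 v;
  nosec : forall v w, t ^+ D *: k1 v = k2 w -> v = 0
}.
Variable H : gluing.

Definition glued (k : nat) (u : pairmod) : Prop := t ^+ D *: k1 u.1 = t ^+ k *: k2 u.2.
Definition px : ring_pair := (s1, s2).
Definition py : ring_pair := (t1, 1).
Definition pz : ring_pair := (1, t2).

Lemma conic_eq1 (A : comNzRingType) (a b : A) : a ^+ 2 = - (1 + b ^+ 2) -> a * a + b * b + 1 * 1 = 0.
Proof. by move=> h; rewrite -(expr2 a) h; ring. Qed.
Lemma conic_eq2 (A : fieldType) (a b : A) : b != 0 -> a ^+ 2 = - (1 + b ^+ 2) ->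
  (a / b) * (a / b) + 1 * 1 + b^-1 * b^-1 = 0.
Proof.
move=> b0 h; have -> : (a / b) * (a / b) = a ^+ 2 / b ^+ 2 by field.
by rewrite h; field.
Qed.

Lemma pconic : px ^+ 2 + py ^+ 2 + pz ^+ 2 = 0.
Proof.
have e1 : s1 * s1 + t1 * t1 + 1 * 1 = 0.
  apply: val_inj; change (s * s + t * t + 1 * 1 = 0 :> K).
  exact: conic_eq1 (conic_s R).
have e2 : s2 * s2 + 1 * 1 + t2 * t2 = 0.
  apply: val_inj; change (x_y R * x_y R + 1 * 1 + z_y R * z_y R = 0 :> K).
  exact: conic_eq2 (t_neq0 R) (conic_s R).
by rewrite !expr2; congr pair.
Qed.

Lemma k10 : k1 0 = 0.
Proof. by have := k1D H 1 0 0; rewrite scaler0 addr0 /= scale1r => /eqP; rewrite -subr_eq0 opprD addNKr oppr_eq0 => /eqP. Qed.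
Lemma k20 : k2 0 = 0.
Proof. by have := k2D H 1 0 0; rewrite scaler0 addr0 /= scale1r => /eqP; rewrite -subr_eq0 opprD addNKr oppr_eq0 => /eqP. Qed.
Lemma k1Z a u : k1 (a *: u) = val a *: k1 u.
Proof. by rewrite -[a *: u]addr0 (k1D H) k10 addr0. Qed.
Lemma k2Z a u : k2 (a *: u) = val a *: k2 u.
Proof. by rewrite -[a *: u]addr0 (k2D H) k20 addr0. Qed.

Lemma pairZ (a : ring1 R) (b : ring2 R) (v : P1) (w : P2) :
  ((a, b) : ring_pair) *: ((v, w) : pairmod) = (a *: v, b *: w).
Proof. by []. Qed.

Lemma gluedE k v w : glued k (v, w) = (t ^+ D *: k1 v = t ^+ k *: k2 w).
Proof. by []. Qed.

Lemma glued0 u : glued 0 u -> u = 0.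
Proof.
case: u => v w; rewrite gluedE expr0 scale1r => h; have v0 := nosec H h.
by move: h; rewrite v0 k10 scaler0 => /esym /(k2inj H) ->.
Qed.
Lemma scale_tM (F : fieldType) m (a b p q r : F) (v w : 'cV[F]_m) :
  p *: v = q *: w -> a = r * b -> p *: (a *: v) = (r * q) *: (b *: w).
Proof.
move=> h ->; have -> : p *: ((r * b) *: v) = (r * b) *: (p *: v) by rewrite !scalerA mulrC.
rewrite h !scalerA; congr (_ *: _).
by rewrite mulrAC.
Qed.
Lemma scale_lin (F : fieldType) m (p q : F) (v w v' w' : 'cV[F]_m) :
  p *: v = q *: w -> p *: v' = q *: w' -> p *: (v + v') = q *: (w + w').
Proof. by move=> h1 h2; rewrite !scalerDr h1 h2. Qed.
Lemma scale_divt (F : fieldType) m (p q b r : F) (v w : 'cV[F]_m) :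
  p *: v = q *: (b *: w) -> q * b = r -> p *: v = r *: w.
Proof. by move=> -> <-; rewrite scalerA. Qed.



Lemma glued_scale k j (a : ring1 R) (b : ring2 R) v w : val a = t ^+ j * val b ->
  glued k (v, w) -> glued (j + k) (a *: v, b *: w).
Proof.
move=> e h.
rewrite gluedE.
rewrite k1Z.
rewrite k2Z.
rewrite exprD.
exact: scale_tM h e.
Qed.

Lemma gluedD k u v : glued k u -> glued k v -> glued k (u + v).
Proof.
case: u v => [u1 u2] [v1 v2]; rewrite -[_ + _]/(u1 + v1, u2 + v2) !gluedE => h1 h2.
have e1 := k1D H 1 u1 v1; have e2 := k2D H 1 u2 v2; rewrite !scale1r in e1 e2.
rewrite e1 e2.
exact: scale_lin h1 h2.
Qed.

Lemma glued_lin k a u v : glued k u -> glued k v -> glued k (cpair a *: u + v).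
Proof.
move=> h1 h2; apply: gluedD h2; case: u h1 => u1 u2 h1.
rewrite -[k]add0n; have e : val (cst1 a) = t ^+ 0 * val (cst2 a) by rewrite expr0 mul1r.
exact: glued_scale e h1.
Qed.
Lemma glued_0 k : glued k 0.
Proof. by rewrite -[0]/(0, 0) gluedE k10 k20 !scaler0. Qed.
Lemma glued_x k u : glued k u -> glued k.+1 (px *: u).
Proof.
case: u => v w; apply: (@glued_scale k 1 s1 s2); rewrite expr1.
exact: s_t_x_y.
Qed.
Lemma glued_y k u : glued k u -> glued k.+1 (py *: u).
Proof.
case: u => v w; apply: (@glued_scale k 1 t1 1); rewrite expr1.
by change (t = t * 1); rewrite mulr1.
Qed.
Lemma glued_z k u : glued k u -> glued k.+1 (pz *: u).
Proof.
case: u => v w; apply: (@glued_scale k 1 1 t2); rewrite expr1.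
exact/esym/t_z_y.
Qed.
Lemma glued_reg k u v : glued k.+1 u -> glued k.+1 v -> py *: u = pz *: v ->
  exists w, [/\ glued k w, u = pz *: w & v = py *: w].
Proof.
case: u v => [u1 u2] [v1 v2] hu hv; rewrite !pairZ !scale1r => -[e1 e2].
(* From t u1 = v1 and u2 = (z/y) v2: the section sought is u over U_1 and v over U_2. *)
exists (u1, v2); rewrite !pairZ !scale1r e1 -e2; split; [|by []|by []].
move: hu; rewrite !gluedE e2 k2Z => h; apply: scale_divt h _.
by change (t ^+ k.+1 * z_y R = t ^+ k); rewrite exprSr -mulrA t_z_y mulr1.
Qed.

Definition glue_graded : graded cpair pairmod :=
  Graded pconic glued0 glued_lin glued_0 glued_x glued_y glued_z glued_reg.

Definition pi1 : {rmorphism ring_pair -> ring1 R} := fst.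
Definition pi2 : {rmorphism ring_pair -> ring2 R} := snd.

Lemma chart1_cover (v : P1) : exists k u, G glue_graded k u /\ u.1 = v.
Proof.
have [k [w h]] := loc12 H v; exists (D + k)%N, (v, w); split=> //.
by change (glued (D + k) (v, w)); rewrite gluedE h scalerA exprD.
Qed.
Lemma chart2_cover (w : P2) : exists k u, G (gswap glue_graded) k u /\ u.2 = w.
Proof.
have [k [v h]] := loc21 H w; exists (D + k)%N, (v, w); split=> //.
by change (glued (D + k) (v, w)); rewrite gluedE -h scalerA exprD.
Qed.
Lemma chart1_inj k u : G glue_graded k u -> u.1 = 0 -> u = 0.
Proof.
case: u => [v w] h v0; move: h; rewrite -[G _ _ _]/(glued k (v, w)) gluedE; rewrite /= in v0; rewrite v0 k10 scaler0 => /esym/eqP.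
by rewrite scaler_eq0 (negPf (tX_neq0 _ _)) /= => /eqP /(k2inj H) ->.
Qed.
Lemma chart2_inj k u : G (gswap glue_graded) k u -> u.2 = 0 -> u = 0.
Proof.
case: u => [v w] h w0; move: h; rewrite -[G _ _ _]/(glued k (v, w)) gluedE; rewrite /= in w0; rewrite w0 k20 scaler0 => /eqP.
by rewrite scaler_eq0 (negPf (tX_neq0 _ _)) /= => /eqP /(k1inj H) ->.
Qed.

Lemma val_evpoly1 p : val (evpoly glue_graded pi1 p) = pol R p.
Proof.
rewrite pol_horner /evpoly -(horner_map (val : ring1 R -> K)) -map_poly_comp.
by congr (_.[_]); apply: eq_map_poly.
Qed.
Lemma val_evpoly2 p : val (evpoly (gswap glue_graded) pi2 p) = (map_poly (cst R) p).[z_y R].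
Proof.
rewrite /evpoly -(horner_map (val : ring2 R -> K)) -map_poly_comp.
by congr (_.[_]); apply: eq_map_poly.
Qed.

Lemma chart1_gens (b : ring1 R) : exists p q,
  b = evpoly glue_graded pi1 p + evpoly glue_graded pi1 q * pi1 (gx glue_graded).
Proof.
have [p [q hpq]] := elimT (R1P _) (valP b); exists p, q; apply: val_inj.
change (val b = val (evpoly glue_graded pi1 p) + val (evpoly glue_graded pi1 q) * s).
by rewrite !val_evpoly1 hpq.
Qed.

Lemma eval_linear (A F : comNzRingType) (f : {rmorphism A -> F}) (a b : F) (P : {poly {poly A}}) :
  a ^+ 2 = - (1 + b ^+ 2) -> exists p q,
  (map_poly (horner_eval b \o map_poly f) P).[a] = (map_poly f p).[b] + (map_poly f q).[b] * a.
Proof.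
move=> h; rewrite horner_coef.
elim/big_ind: _ => [|_ _ [p [q ->]] [p' [q' ->]]|i _].
- by exists 0, 0; rewrite rmorph0 !horner0 mul0r addr0.
- by exists (p + p'), (q + q'); rewrite !rmorphD !hornerD mulrDl addrACA.
rewrite coef_map /= /horner_eval; move: (P`_i) => Q.
elim: (i : nat) => [|k [p [q IH]]].
  by exists Q, 0; rewrite expr0 mulr1 rmorph0 horner0 mul0r addr0.
exists (- ((1 + 'X^2) * q)), p; rewrite exprSr mulrA IH mulrDl -mulrA -expr2 h.
rewrite rmorphN hornerN rmorphM hornerM rmorphD hornerD rmorph1 hornerC /= map_polyXn hornerXn.
by rewrite addrC mulrN [_ * (1 + _)]mulrC.
Qed.

Lemma chart2_gens (b : ring2 R) : exists p q,
  b = evpoly (gswap glue_graded) pi2 p + evpoly (gswap glue_graded) pi2 q * pi2 (gx (gswap glue_graded)).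
Proof.
have /boolp.asboolP[P hP] := valP b.
have e : x_y R ^+ 2 = - (1 + z_y R ^+ 2).
  rewrite /x_y /z_y expr_div_n conic_s mulNr mulrDl mul1r divff ?tX_neq0 // exprVn.
  by rewrite addrC.
have [p [q hpq]] := eval_linear (cst R) P e; exists p, q; apply: val_inj.
change (val b = val (evpoly (gswap glue_graded) pi2 p) + val (evpoly (gswap glue_graded) pi2 q) * x_y R).
by rewrite !val_evpoly2 -[RHS]hpq.
Qed.

Lemma pr1D (a : ring_pair) (u v : pairmod) : (a *: u + v).1 = pi1 a *: u.1 + v.1.
Proof. by []. Qed.
Lemma pr2D (a : ring_pair) (u v : pairmod) : (a *: u + v).2 = pi2 a *: u.2 + v.2.
Proof. by []. Qed.

Definition chart1_free := good_free pr1D (erefl : pi1 (gz glue_graded) = 1)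
  chart1_cover chart1_inj chart1_gens.
Definition chart1_span := full_span pr1D (erefl : pi1 (gz glue_graded) = 1)
  chart1_cover.
Definition chart2_free := good_free pr2D (erefl : pi2 (gz (gswap glue_graded)) = 1)
  chart2_cover chart2_inj chart2_gens.
Definition chart2_span := full_span pr2D (erefl : pi2 (gz (gswap glue_graded)) = 1)
  chart2_cover.

Lemma k1_sum (I : Type) (r : seq I) (a : I -> ring1 R) (v : I -> P1) :
  k1 (\sum_(i <- r) a i *: v i) = \sum_(i <- r) val (a i) *: k1 (v i).
Proof. by elim/big_rec2: _ => [|i u v1 _ <-]; [apply: k10 | apply: (k1D H)]. Qed.
(** A dependence over the function field becomes one over R_1 after clearing denominators. This
    bound is what stops the greedy choice. *)
Lemma free_rank N (v : 'I_N -> P1) :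
  (forall a, \sum_i a i *: v i = 0 -> forall i, a i = 0) -> (N <= n)%N.
Proof.
move=> hv; pose A : 'M[K]_(N, n) := \matrix_(i, j) k1 (v i) j 0.
suff : row_free A by move=> /eqP <-; apply: rank_leq_col.
rewrite -kermx_eq0; apply/eqP/row_matrixP => i; rewrite row0.
set u := row i (kermx A).
have uA : u *m A = 0 by rewrite /u -row_mul mulmx_ker row0.
have [h h0 [h1 hu]] := common_denominator (fun j => u 0 j).
pose a j : ring1 R := Sub (h * u 0 j) (hu j).
have a0 : \sum_j a j *: v j = 0.
  apply: (k1inj H); rewrite k1_sum; apply/matrixP => j k; rewrite ord1 summxE mxE.
  have := congr1 (fun w : 'rV[K]_n => h * w 0 j) uA; rewrite !mxE mulr0 mulr_sumr => {2}<-.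
  by apply: eq_bigr => l _; rewrite mxE [A _ _]mxE mulrA.
apply/rowP => j; rewrite [RHS]mxE; have /(congr1 val) := hv a a0 j.
by move=> /= /eqP; rewrite mulf_eq0 (negPf h0) /= => /eqP.
Qed.

Lemma good_bound it N : good glue_graded it N -> (N <= n)%N.
Proof.
move=> hg; apply: (@free_rank N (fun i => (g0 (it i)).1)) => a ha i.
pose a' j := if insub j is Some j then a j else 0.
have a'E (j : 'I_N) : a' j = a j by rewrite /a' valK.
have [||e _] := chart1_free (a := a') (b := fun _ => 0) hg _ _ (ltn_ord i) => //.
  by rewrite -[RHS]ha; apply: eq_bigr => j _; rewrite a'E scale0r addr0.
by rewrite -a'E.
Qed.
End Glue.

(** * Finite generation and torsion-freeness of locally free modules *)

Section LocallyFree.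
Variables (A : comNzRingType) (P : lmodType A).

Definition submodule (S : P -> Prop) : Prop :=
  S 0 /\ forall a u v, S u -> S v -> S (a *: u + v).

Lemma submoduleZ S a u : submodule S -> S u -> S (a *: u).
Proof. by move=> [h0 h] hu; have := h a _ _ hu h0; rewrite addr0. Qed.

Lemma submodule_sum S I (r : seq I) (F : I -> P) : submodule S -> (forall i, S (F i)) ->
  S (\sum_(i <- r) F i).
Proof.
move=> [h0 h] hF; elim/big_ind: _ => // u v hu hv.
by rewrite -[u]scale1r; apply/h.
Qed.

(** In each term of the binomial expansion one of the two exponents is large enough. *)
Lemma submodule_expD S a b m l v : submodule S -> S (a ^+ m *: v) -> S (b ^+ l *: v) ->
  S ((a + b) ^+ (m + l) *: v).
Proof.
move=> hS ha hb; rewrite exprDn scaler_suml; apply: submodule_sum => // i.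
rewrite -mulr_natl -scalerA; apply: submoduleZ => //.
have [li|il] := leqP l i.
  by rewrite -(subnK li) exprD mulrA -scalerA; apply: submoduleZ.
have -> : (m + l - i = (l - i) + m)%N by lia.
by rewrite exprD mulrAC -scalerA; apply: submoduleZ.
Qed.

(** A power of the combination of the f_j that equals 1 sends v into S. *)
Lemma submodule_cover S r (f : 'I_r -> A) v : submodule S ->
  (exists c : 'I_r -> A, \sum_j c j * f j = 1) ->
  (forall j, exists k, S (f j ^+ k *: v)) -> S v.
Proof.
move=> hS [c hc] hf.
suff [k] : exists k, S ((\sum_j c j * f j) ^+ k *: v) by rewrite hc expr1n scale1r.
elim/big_ind: _ => [|a b [m ha] [l hb]|j _].
- by exists 1%N; rewrite expr0n scale0r; case: hS.
- by exists (m + l)%N; apply: submodule_expD.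
have [k hk] := hf j; exists k.
by rewrite exprMn -scalerA; apply: submoduleZ.
Qed.

(** Finite generation as an induction principle; it will be applied to the regularity of
    coordinates. *)
Lemma locally_free_ind : locally_free P -> exists (I : finType) (g : I -> P),
  forall S, submodule S -> (forall i, S (g i)) -> forall v, S v.
Proof.
move=> [r [f [hc hb]]].
have /boolp.choice[e he] (j : 'I_r) : exists e : {n & 'I_n -> P},
    basis_after_inverting (f j) (projT2 e).
  by have [n [e he]] := hb j; exists (existT _ n e).
exists {j : 'I_r & 'I_(projT1 (e j))}, (fun i => projT2 (e (tag i)) (tagged i)) => S hS hg v.
apply: (@submodule_cover S r f v hS hc) => j.
have [/(_ v)[k [c hk]] _] := he j; exists k.
have -> : f j ^+ k *: v = \sum_i c i *: projT2 (e j) i by exact: hk.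
apply: submodule_sum => // i; apply: submoduleZ => //.
exact: (hg (Tagged (fun j => 'I_(projT1 (e j))) i)).
Qed.

(** After inverting f_j a torsion element has zero coordinates, so a power of f_j kills it, and the
    f_j generate the unit ideal. *)
Lemma locally_free_torsion : (forall a b : A, a * b = 0 -> a = 0 \/ b = 0) ->
  locally_free P -> forall a (v : P), a != 0 -> a *: v = 0 -> v = 0.
Proof.
move=> hA [r [f [hc hb]]] a v a0 av.
have hS : submodule (fun u : P => u = 0).
  by split=> // b _ _ -> ->; rewrite scaler0 addr0.
apply: (@submodule_cover _ r f v hS hc) => j.
have [fj|fj] := eqVneq (f j) 0; first by exists 1%N; rewrite fj expr1 scale0r.
have reg k b : f j ^+ k * b = 0 -> b = 0.
  elim: k => [|k IH]; first by rewrite mul1r.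
  by rewrite exprS -mulrA => /hA[/eqP|/IH //]; rewrite (negPf fj).
have [n [e [h1 h2]]] := hb j; have [k [c hk]] := h1 v; exists k; rewrite hk.
have /h2[m hm] : \sum_i (a * c i) *: e i = 0.
  under eq_bigr do rewrite -scalerA.
  by rewrite -scaler_sumr -hk scalerA mulrC -scalerA av scaler0.
rewrite big1 // => i _.
by have /reg/hA[/eqP|->] := hm i; rewrite ?(negPf a0) // scale0r.
Qed.
End LocallyFree.

(** * Coordinates of a bundle over the function field *)

Lemma clear_eq (F : fieldType) (a b p q t k : F) : p != 0 -> q != 0 ->
  (a * (b * k)) * t ^+ 1 = (b / p) * (a * (t * (p * q) * k) / q).
Proof. by move=> p0 q0; field; rewrite p0 q0. Qed.

Section Bundle.
Variable R : realType.
Local Notation K := (ffield R).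
Local Notation t := (y_z R).
Variable V : vector_bundle R.

Lemma val1_mul (a b : ring1 R) : val (a * b) = val a * val b. Proof. by []. Qed.
Lemma ring1_domain (a b : ring1 R) : a * b = 0 -> a = 0 \/ b = 0.
Proof.
move/(congr1 val); rewrite val1_mul => /eqP; rewrite mulf_eq0 => /orP[] /eqP h; [left|right];
  by apply: val_inj; rewrite h.
Qed.
Lemma val2_mul (a b : ring2 R) : val (a * b) = val a * val b. Proof. by []. Qed.
Lemma ring2_domain (a b : ring2 R) : a * b = 0 -> a = 0 \/ b = 0.
Proof.
move/(congr1 val); rewrite val2_mul => /eqP; rewrite mulf_eq0 => /orP[] /eqP h; [left|right];
  by apply: val_inj; rewrite h.
Qed.

Definition tf1 := locally_free_torsion ring1_domain (sec1_locally_free V).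
Definition tf2 := locally_free_torsion ring2_domain (sec2_locally_free V).

Lemma val1_tX k : val (y_z1 R ^+ k) = t ^+ k.
Proof. by rewrite rmorphXn. Qed.
Lemma val2_tX k : val (z_y2 R ^+ k) = (t ^+ k)^-1.
Proof. by rewrite rmorphXn -exprVn. Qed.
Lemma iota1_tX k : iota1 (y_z1 R) ^+ k = iota1 (y_z1 R ^+ k).
Proof. by rewrite rmorphXn. Qed.
Lemma iota1M (a b : ring1 R) : iota1 (a * b) = iota1 a * iota1 b.
Proof. exact: val_inj. Qed.
Lemma res1Z a (v : sec1 V) : res1 V (a *: v) = iota1 a *: res1 V v.
Proof. exact: linearZ_LR. Qed.
Lemma res2Z a (v : sec2 V) : res2 V (a *: v) = iota2 a *: res2 V v.
Proof. exact: linearZ_LR. Qed.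
Lemma t1_neq0 k : y_z1 R ^+ k != 0.
Proof.
apply/eqP => /(congr1 val); rewrite val1_tX => /eqP.
exact/negP/tX_neq0.
Qed.
Lemma t2_neq0 k : z_y2 R ^+ k != 0.
Proof.
apply/eqP => /(congr1 val); rewrite val2_tX => /eqP.
by rewrite invr_eq0 (negPf (tX_neq0 R k)).
Qed.

Lemma res1_inj (v : sec1 V) : res1 V v = 0 -> v = 0.
Proof. by case: (res1_loc V) => _ h /h[k]; apply/tf1/t1_neq0. Qed.
Lemma res2_inj (v : sec2 V) : res2 V v = 0 -> v = 0.
Proof. by case: (res2_loc V) => _ h /h[k]; apply/tf2/t2_neq0. Qed.

Lemma iota1_t_unit k : exists a : ring12 R, a * iota1 (y_z1 R) ^+ k = 1.
Proof.
exists ((Sub (z_y R) (z_y_R12 R) : ring12 R) ^+ k); rewrite -exprMn.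
have -> : (Sub (z_y R) (z_y_R12 R) : ring12 R) * iota1 (y_z1 R) = 1; last exact: expr1n.
by apply: val_inj; rewrite -[RHS]/(1 : K) -(t_z_y R) mulrC.
Qed.

Section Coordinates.
Variables (n : nat) (e : 'I_n -> sec1 V).

(** Coordinates of a section over the overlap in the basis of a localization, as a relation in which
    h clears the denominators. Existence, uniqueness and linearity are proved afterwards, so no
    module of fractions is constructed. *)
Definition coords (u : sec12 V) (y : 'cV[K]_n) : Prop :=
  exists (h : ring1 R) (c : 'I_n -> ring1 R), [/\ h != 0,
    iota1 h *: u = \sum_i iota1 (c i) *: res1 V (e i) &
    forall i, val h * y i 0 = val (c i)].

Lemma neq0_val (h : ring1 R) : h != 0 -> val h != 0.
Proof. by apply: contraNneq => h0; apply/eqP/val_inj. Qed.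

Lemma ring1_mulf_neq0 (a b : ring1 R) : a != 0 -> b != 0 -> a * b != 0.
Proof. by move=> a0 b0; apply/eqP => /ring1_domain[] /eqP; apply/negP. Qed.

Lemma ring12_num (a : ring12 R) : exists k (b : ring1 R), iota1 (y_z1 R) ^+ k * a = iota1 b.
Proof.
have /boolp.asboolP[k hk] := valP a; exists k, (Sub (val a * t ^+ k) hk : ring1 R); apply: val_inj.
change (val (iota1 (y_z1 R) ^+ k) * val a = val a * t ^+ k).
by rewrite mulrC rmorphXn.
Qed.

Lemma scale_clear (A : comNzRingType) (X : lmodType A) (a b h h' p : A) (u u' : X) : p * a = b ->
  (h * h' * p) *: (a *: u + u') = (b * h') *: (h *: u) + (p * h) *: (h' *: u').
Proof. by move=> <-; lmod A X. Qed.
Lemma mul_clear (F : fieldType) (a b h h' p y y' : F) : a * p = b ->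
  (h * h' * p) * (a * y + y') = b * h' * (h * y) + p * h * (h' * y').
Proof. by move=> <-; ring. Qed.

Lemma coords_lin a u u' y y' : coords u y -> coords u' y' ->
  coords (a *: u + u') (val a *: y + y').
Proof.
move=> [h [c [h0 hu hy]]] [h' [c' [h0' hu' hy']]].
have [k [b hb]] := ring12_num a.
exists (h * h' * y_z1 R ^+ k), (fun i => b * h' * c i + y_z1 R ^+ k * h * c' i).
split; first by do 2?[apply: ring1_mulf_neq0] => //; apply: t1_neq0.
- transitivity ((iota1 h * iota1 h' * iota1 (y_z1 R) ^+ k) *: (a *: u + u')).
    by congr (_ *: _); rewrite -rmorphXn -!rmorphM.
  rewrite (scale_clear _ _ _ _ hb) hu hu' !scaler_sumr -big_split; apply: eq_bigr => i _ /=.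
  by rewrite !scalerA -rmorphXn -!rmorphM -scalerDl -rmorphD.
move=> i; rewrite !mxE.
have va : val a * t ^+ k = val b.
  transitivity (val (iota1 (y_z1 R) ^+ k * a)); last by rewrite hb.
  change (val a * t ^+ k = val (iota1 (y_z1 R) ^+ k) * val a).
  by rewrite mulrC rmorphXn.
change (val h * val h' * val (y_z1 R ^+ k) * (val a * y i 0 + y' i 0) =
  val b * val h' * val (c i) + val (y_z1 R ^+ k) * val h * val (c' i)).
by rewrite -hy -hy' val1_tX; apply: mul_clear.
Qed.

Lemma coords_inj u : coords u 0 -> u = 0.
Proof.
move=> [h [c [h0 hu hy]]].
have c0 i : c i = 0 by apply: val_inj; rewrite -hy mxE mulr0.
have {}hu : iota1 h *: u = 0.
  by rewrite hu big1 // => i _; rewrite c0 rmorph0 scale0r.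
have [/(_ u)[k [v huv]] _] := res1_loc V.
have v0 : v = 0.
  apply: (tf1 h0); apply: res1_inj; rewrite res1Z -huv scalerA mulrC -scalerA hu.
  by rewrite scaler0.
have [a ha] := iota1_t_unit k.
by rewrite -[u]scale1r -ha -scalerA huv v0 linear0 scaler0.
Qed.
Variable f : ring1 R.
Hypotheses (f0 : f != 0) (he : basis_after_inverting f e).

Lemma coords_exists u : exists y, coords u y.
Proof.
have [/(_ u)[k [v huv]] _] := res1_loc V; have [/(_ v)[m [c hc]] _] := he.
have fm0 : f ^+ m != 0.
  by elim: m {hc} => [|m IH]; [apply: oner_neq0 | rewrite exprS ring1_mulf_neq0].
have h0 := ring1_mulf_neq0 fm0 (t1_neq0 k).
exists (\col_i (val (c i) / val (f ^+ m * y_z1 R ^+ k))), (f ^+ m * y_z1 R ^+ k), c.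
split=> //; last by move=> i; rewrite mxE mulrC divfK // neq0_val.
transitivity (iota1 (f ^+ m) *: res1 V v).
  by rewrite -huv scalerA; congr (_ *: _); rewrite iota1M -iota1_tX.
rewrite -res1Z hc linear_sum; apply: eq_bigr => i _; exact: res1Z.
Qed.

Lemma coords0 y : coords 0 y -> y = 0.
Proof.
move=> [h [c [h0 + hy]]]; rewrite scaler0 => hs.
have /res1_inj : res1 V (\sum_i c i *: e i) = 0.
  by rewrite linear_sum [RHS]hs; apply: eq_bigr => i _; exact: res1Z.
case: he => _ /[apply] -[k hk]; apply/matrixP => i j; rewrite ord1 mxE.
have c0 : c i = 0.
  have := hk i; elim: k {hk} => [|k IH]; first by rewrite mul1r.
  by rewrite exprS -mulrA => /ring1_domain[/eqP|/IH //]; rewrite (negPf f0).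
have := hy i; rewrite c0 => /eqP; rewrite -[val 0]/(0 : K) mulf_eq0 (negPf (neq0_val h0)) /=.
by move/eqP.
Qed.

End Coordinates.

(** Some f_j is nonzero because together they generate the unit ideal; over the function field its
    local basis serves the whole bundle. *)
Lemma coordinates : exists n (k12 : sec12 V -> 'cV[K]_n),
  (forall a u v, k12 (a *: u + v) = val a *: k12 u + k12 v) /\
  (forall u, k12 u = 0 -> u = 0).
Proof.
have [r [f [[c hc] hb]]] := sec1_locally_free V.
have [j fj] : exists j, f j != 0.
  apply/existsP; apply: contraT; rewrite negb_exists => /forallP h.
  have : (1 : ring1 R) != 0 by apply: oner_neq0.
  rewrite -hc big1 ?eqxx // => i _; have := h i; rewrite negbK => /eqP ->.
  by rewrite mulr0.
have [n [e he]] := hb j.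
have /boolp.choice[k12 hk] := coords_exists fj he.
exists n, k12; split=> [a u v|u u0]; last by have := hk u; rewrite u0; apply: coords_inj.
have h1 := coords_lin a (hk u) (hk v).
have := coords_lin (-1) h1 (hk (a *: u + v)).
rewrite !scaleN1r addNr => /(coords0 fj he)/eqP.
by rewrite addrC subr_eq0 => /eqP.
Qed.

(** The twist comes from two denominators. The first, h1 of pole order a, makes the coordinates of
    sections over U_1 regular there; the second, h2, makes those over U_2 regular there after
    division by t^m. Then D = a + m + 1, where the 1 makes the degree negative. *)
Theorem bundle_gluing : exists n (k12 : sec12 V -> 'cV[K]_n) D,
  [/\ forall a u v, k12 (a *: u + v) = val a *: k12 u + k12 v,
      forall u, k12 u = 0 -> u = 0 &
      gluing (fun v => k12 (res1 V v)) (fun w => k12 (res2 V w)) D].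
Proof.
have [n [k12 [kD kinj]]] := coordinates.
have kZ a u : k12 (a *: u) = val a *: k12 u.
  have k0 : k12 0 = 0.
    by have := kD 1 0 0; rewrite scaler0 addr0 (_ : val (1 : ring12 R) = 1) // scale1r => /eqP; rewrite -subr_eq0 opprD addNKr oppr_eq0 => /eqP.
  by have := kD a u 0; rewrite k0 !addr0.
have k1D a u v : k12 (res1 V (a *: u + v)) = val a *: k12 (res1 V u) + k12 (res1 V v).
  by rewrite linearD res1Z kD.
have k2D a u v : k12 (res2 V (a *: u + v)) = val a *: k12 (res2 V u) + k12 (res2 V v).
  by rewrite linearD res2Z kD.
have k10 : k12 (res1 V 0) = 0 by rewrite linear0 -(scale0r 0) kZ scale0r.
have k20 : k12 (res2 V 0) = 0 by rewrite linear0 -(scale0r 0) kZ scale0r.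
have [I1 [gs1 ind1]] := locally_free_ind (sec1_locally_free V).
have [I2 [gs2 ind2]] := locally_free_ind (sec2_locally_free V).
have [h1 h10 [h1R hg1]] := common_denominator (fun i : I1 * 'I_n => k12 (res1 V (gs1 i.1)) i.2 0).
have [h2 h20 [h2R hg2]] := common_denominator (fun i : I2 * 'I_n => k12 (res2 V (gs2 i.1)) i.2 0).
have [a ha] := R1_Fil h1R.
have {ind1}int1 v i : h1 * k12 (res1 V v) i 0 \in @R1 R.
  apply: (ind1 (fun v => h1 * k12 (res1 V v) i 0 \in @R1 R)); last by move=> l; apply: (hg1 (l, i)).
  split; first by rewrite k10 mxE mulr0 rpred0.
  move=> b u u' hu hu'; rewrite k1D !mxE mulrDr mulrCA rpredD // rpredM //; exact: (valP b).
have [m hm] : exists m, forall i, Fil m (h2 * k12 (res2 V (gs2 i.1)) i.2 0).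
  have /boolp.choice[m hm] := fun i => R1_Fil (hg2 i).
  exists (\max_i m i) => i; apply: Fil_le (hm i); exact: leq_bigmax.
have divF k f : Fil k f -> f / t ^+ k \in @R2 R.
  by move=> hf; apply/R2P; exists k; rewrite divfK ?tX_neq0.
have {ind2}int2 w i : h2 * k12 (res2 V w) i 0 / t ^+ m \in @R2 R.
  apply: (ind2 (fun w => h2 * k12 (res2 V w) i 0 / t ^+ m \in @R2 R)); last by move=> l; apply/divF/(hm (l, i)).
  split; first by rewrite k20 mxE mulr0 mul0r rpred0.
  move=> b u u' hu hu'; rewrite k2D !mxE mulrDr mulrDl rpredD ?hu' //.
  by rewrite mulrCA -mulrA rpredM ?hu //; case: (b).
exists n, k12, (a + m).+1; split=> //; split=> //.
- by move=> u /kinj/res1_inj.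
- by move=> u /kinj/res2_inj.
- move=> v; have [/(_ (res1 V v))[k [w hw]] _] := res2_loc V; exists k, w.
  rewrite -hw kZ scalerA (_ : val _ = (t ^+ k)^-1); first by rewrite divff ?tX_neq0 // scale1r.
  by rewrite rmorphXn -exprVn.
- move=> w; have [/(_ (res2 V w))[k [v hv]] _] := res1_loc V; exists k, v.
  rewrite -hv kZ; congr (_ *: _).
  by rewrite rmorphXn.
move=> v w e; apply: res1_inj; apply: kinj; apply/matrixP => i j; rewrite ord1 mxE.
(* On the left, the cofactor of t is regular on U_1; the right side is regular on U_2. So
   [R1_divt_R2] applies. *)
have key : (h2 * (h1 * k12 (res1 V v) i 0)) * t ^+ 1 = (h1 / t ^+ a) * (h2 * k12 (res2 V w) i 0 / t ^+ m).
  have := congr1 (fun y : 'cV[K]_n => y i 0) e; rewrite [LHS]mxE => <-.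
  rewrite [t ^+ (a + m).+1]exprS exprD; move: (tX_neq0 R a) (tX_neq0 R m); move: (t ^+ a) (t ^+ m) => p q p0 q0.
  exact: clear_eq.
have hl : h2 * (h1 * k12 (res1 V v) i 0) \in @R1 R by rewrite rpredM.
have hr : (h1 / t ^+ a) * (h2 * k12 (res2 V w) i 0 / t ^+ m) \in @R2 R.
  by rewrite rpredM // divF.
have /eqP := R1_divt_R2 hl hr key.
by rewrite !mulf_eq0 (negPf h10) (negPf h20) /= => /eqP.
Qed.
End Bundle.

(** * Block sums, the canonical matrix and its list of indices *)

Section BlockSums.
Variable l : seq int.
Local Notation p := (fun k : 'I_(size l) => block_size l`_k).

Definition csz : nat := \sum_(k < size l) block_size l`_k.
Definition item_of (x : 'I_csz) : 'I_(size l) := @tagnat.sig1 _ p x.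
Definition part_of (x : 'I_csz) : nat := @tagnat.sig2 _ p x.
Definition pos_of (k : 'I_(size l)) (j : 'I_(block_size l`_k)) : 'I_csz := @tagnat.Rank _ p k j.

Lemma item_pos k j : item_of (@pos_of k j) = k.
Proof. exact: tagnat.Rank1K. Qed.
Lemma part_pos k j : part_of (@pos_of k j) = j.
Proof.
have h : @tagnat.sig _ p (@pos_of k j) = Tagged _ j by apply: tagnat.rankK.
exact: (congr1 (fun s : {k & 'I_(p k)} => nat_of_ord (tagged s)) h).
Qed.
Lemma pos_exists (x : 'I_csz) : exists k j, x = @pos_of k j.
Proof. by exists (@tagnat.sig1 _ p x), (@tagnat.sig2 _ p x); rewrite /pos_of tagnat.sig2K. Qed.

Lemma sum_pos (V : nmodType) (F : 'I_csz -> V) :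
  \sum_x F x = \sum_(k < size l) \sum_(j < block_size l`_k) F (pos_of j).
Proof.
rewrite (reindex (@tagnat.rank _ p)) /=; last exact: tagnat.rank_bij_on.
rewrite [RHS]sig_big_dep /=.
by apply: eq_bigr => -[k j] _; rewrite tagnat.rankE.
Qed.

(** Access by natural numbers with default z, which frees sums over blocks from dependent index
    types. *)
Definition at_pos (T : Type) (z : T) (c : 'I_csz -> T) (k j : nat) : T :=
  if insub k is Some k' then
    if insub j is Some j' then c (@pos_of k' j') else z
  else z.

Lemma at_posE (T : Type) (z : T) (c : 'I_csz -> T) (k : 'I_(size l)) (j : 'I_(block_size l`_k)) : at_pos z c k j = c (@pos_of k j).
Proof. by rewrite /at_pos !valK. Qed.

Variables (A : comNzRingType) (P : lmodType A) (odd : nat -> bool) (u : nat -> nat -> P).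
Variable c : nat -> nat -> A.
Hypothesis c2 : forall k j, c k j * c k j = 1.
Hypothesis size_odd : forall k, (k < size l)%N -> block_size l`_k = (odd k).+1.
Let N := size l.

(** Passes from sums over items, with one or two coefficients each, to a basis indexed by the rows
    of the block sum. The factors c of square 1 will be signs. *)
Lemma basis_of_free_span :
  (forall a b : nat -> A, (forall i, ~~ odd i -> b i = 0) ->
    \sum_(i < N) (a i *: u i 0%N + b i *: u i 1%N) = 0 ->
    forall i, (i < N)%N -> a i = 0 /\ b i = 0) ->
  (forall v, exists a b : nat -> A, (forall i, ~~ odd i -> b i = 0) /\
    v = \sum_(i < N) (a i *: u i 0%N + b i *: u i 1%N)) ->
  module_basis (fun x : 'I_csz =>
    c (item_of x) (part_of x) *: u (item_of x) (part_of x)).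
Proof.
move=> hfree hspan.
pose cf (d : 'rV[A]_csz) k j := at_pos 0 (fun x => d 0 x) k j * c k j.
have sumE (d : 'rV[A]_csz) : \sum_x d 0 x *: (c (item_of x) (part_of x) *: u (item_of x) (part_of x)) =
    \sum_(i < N) (cf d i 0%N *: u i 0%N + (if odd i then cf d i 1%N else 0) *: u i 1%N).
  rewrite sum_pos; apply: eq_bigr => k _.
  transitivity (\sum_(j < block_size l`_k) cf d k j *: u k j).
    by apply: eq_bigr => j _; rewrite item_pos part_pos scalerA /cf at_posE.
  rewrite size_odd //; case: (odd k); rewrite !big_ord_recl big_ord0 /=.
    by rewrite addr0.
  by rewrite scale0r.
have oddK (d : 'rV[A]_csz) : forall i, ~~ odd i -> (if odd i then cf d i 1%N else 0) = 0.
  by move=> i /negPf ->.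
move=> v; have [a [b [hb vE]]] := hspan v.
pose d : 'rV[A]_csz := \row_x ((if part_of x == 0%N then a (item_of x) else b (item_of x)) * c (item_of x) (part_of x)).
have dE (k : 'I_(size l)) (j : 'I_(block_size l`_k)) : cf d k j = if j == 0%N :> nat then a k else b k.
  rewrite /cf at_posE mxE item_pos part_pos -mulrA c2 mulr1; by [].
have dv : v = \sum_x d 0 x *: (c (item_of x) (part_of x) *: u (item_of x) (part_of x)).
  rewrite sumE vE; apply: eq_bigr => k _.
  have k0 : (0 < block_size l`_k)%N by rewrite size_odd.
  rewrite (dE k (Ordinal k0)) /=; congr (_ + _).
  have [ho|ho] := boolP (odd k); last by rewrite hb.
  have k1 : (1 < block_size l`_k)%N by rewrite size_odd // ho.
  by rewrite (dE k (Ordinal k1)).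
exists d; split=> // d' hd'; apply/rowP => x.
have [k [j ->]] := pos_exists x.
have := hfree (fun i => cf d i 0%N - cf d' i 0%N)
  (fun i => (if odd i then cf d i 1%N else 0) - (if odd i then cf d' i 1%N else 0)).
case/(_ _ _ k (ltn_ord k)).
- by move=> i hi; rewrite !oddK // subrr.
- transitivity (\sum_(i < N) (cf d i 0%N *: u i 0%N + (if odd i then cf d i 1%N else 0) *: u i 1%N) -
    \sum_(i < N) (cf d' i 0%N *: u i 0%N + (if odd i then cf d' i 1%N else 0) *: u i 1%N)).
    by rewrite -sumrB; apply: eq_bigr => i _; lmod A P.
  by rewrite -!sumE -dv -hd' subrr.
move=> /subr0_eq e0 /subr0_eq e1.
suff : cf d k j = cf d' k j.
  by rewrite /cf !at_posE => /(congr1 (fun a => a * c k j)); rewrite -!mulrA c2 !mulr1.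
case: j => [[|j] hj] //=.
have : (j.+1 < (odd k).+1)%N by rewrite -size_odd.
by case: (odd k) e1 => //; case: j {hj}.
Qed.
End BlockSums.

Section CanonicalMatrix.
Variable R : realType.
Local Notation K := (ffield R).
Local Notation s := (x_z R).
Local Notation t := (y_z R).

(** Natural indices avoid the type of [block], which depends on the parity of i; [blockE] is the
    link. *)
Definition block_entry (i : int) (a b : nat) : K :=
  if (2 %| i)%Z then (- t) ^ (i %/ 2)%Z
  else if a == 0%N then
    if b == 0%N then (- t) ^ ((i + 1) %/ 2)%Z else s * (- t) ^ ((i - 1) %/ 2)%Z
  else if b == 0%N then 0 else (- t) ^ ((i - 1) %/ 2)%Z.

Lemma blockE i (a b : 'I_(block_size i)) : block R i a b = block_entry i a b.
Proof.
rewrite /block_entry; move: a b; rewrite /block /block_size; case: (2 %| i)%Z => a b.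
  by rewrite !ord1 mxE eqxx mulr1n.
have ord2 (x : 'I_(1 + 1)) : x = if x == 0%N :> nat then lshift 1 0 else rshift 1 0.
  by apply: val_inj; case: x => [[|[|]]].
have e00 (c : K) : (c%:M : 'M_1) 0 0 = c by rewrite mxE eqxx mulr1n.
rewrite [a in LHS]ord2 [b in LHS]ord2; case: (nat_of_ord a) => [|a']; case: (nat_of_ord b) => [|b'] /=.
- by apply: etrans (block_mxEul _ _ _ _ 0 0) _; rewrite e00.
- by apply: etrans (block_mxEur _ _ _ _ 0 0) _; rewrite e00.
- by apply: etrans (block_mxEdl _ _ _ _ 0 0) _; rewrite mxE.
- by apply: etrans (block_mxEdr _ _ _ _ 0 0) _; rewrite e00.
Qed.

Definition cmx (l : seq int) : 'M[K]_(csz l) := \mxdiag_(k < size l) block R l`_k.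

Lemma cmx_canonical m : cmx (block_indices m) = canonical_mx R m.
Proof. by []. Qed.

Lemma cmxE l (k k' : 'I_(size l)) j j' : cmx l (pos_of (k := k) j) (pos_of (k := k') j') =
  if k == k' then block_entry l`_k j j' else 0.
Proof.
have -> : cmx l (pos_of j) (pos_of j') = submxblock (cmx l) k k' j j' by rewrite [RHS]mxE.
rewrite /cmx /mxdiag mxblockK; case: eqP => [e|_]; last by rewrite mxE.
by move: j j'; rewrite -{k'}e => j j'; rewrite conform_mx_id blockE.
Qed.
End CanonicalMatrix.

Section BlockIndices.
Implicit Types m : {fsfun int -> nat with 0%N}.

Lemma count_block_indices m i : count_mem i (block_indices m) = m i.
Proof.
rewrite /block_indices count_flatten -map_comp sumnE big_map.
have uq : uniq (sort <=%R (finsupp m)) by rewrite sort_uniq fset_uniq.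
have [im|im] := boolP (i \in finsupp m); last first.
  rewrite fsfun_dflt // big_seq big1 // => j; rewrite mem_sort => jm /=.
  by rewrite count_nseq /=; case: eqP => // e; rewrite -e jm in im.
rewrite (bigD1_seq i) //= ?mem_sort // count_nseq /= eqxx mul1n big1 ?addn0 // => j /negPf ji.
by rewrite count_nseq /= ji.
Qed.

Lemma block_indices_exists (l : seq int) : exists m, perm_eq (block_indices m) l.
Proof.
exists [fsfun i in [fset x in l]%fset => count_mem i l | 0%N].
apply/allP => i _ /=; rewrite count_block_indices fsfun_fun; apply/eqP.
case: ifPn => // /negP h; apply/esym/eqP; rewrite -leqn0 leqNgt -has_count; apply/negP.
by move=> /hasP[j jl /eqP ji]; apply: h; rewrite !inE -ji.
Qed.

Lemma block_indices_inj m m' : perm_eq (block_indices m) (block_indices m') -> m = m'.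
Proof.
by move=> h; apply/fsfunP => i; rewrite -!count_block_indices; apply/permP.
Qed.

Lemma block_indices_sorted m : sorted <=%R (block_indices m).
Proof.
rewrite /block_indices; have : sorted <=%R (sort <=%R (finsupp m)) by apply: sort_le_sorted.
elim: (sort _ _) => //= i s IH hs.
have {}IH := IH (path_sorted hs).
have hi : all (>= i) (flatten [seq nseq (m j) j | j <- s]).
  apply/allP => j /flattenP[_ /mapP[k ks ->]]; rewrite mem_nseq => /andP[_ /eqP ->].
  by have := order_path_min le_trans hs => /allP; apply.
elim: (m i) => //= n IHn; rewrite path_min_sorted // all_cat hi andbT.
by apply/allP => j; rewrite mem_nseq => /andP[_ /eqP ->].
Qed.

Lemma block_indices_sort (l : seq int) : sorted <=%R l -> exists m, block_indices m = l.
Proof.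
move=> hl; have [m hm] := block_indices_exists l; exists m.
by apply: (sorted_eq le_trans le_anti) => //; apply: block_indices_sorted.
Qed.
End BlockIndices.

(** * From homogeneous generators to the canonical matrix *)

Section Families.
Variable R : realType.
Local Notation K := (ffield R).
Local Notation s := (x_z R).
Local Notation t := (y_z R).
Variables (P1 : lmodType (ring1 R)) (P2 : lmodType (ring2 R)).
Local Notation item := (item (pairmod P1 P2)).

(** An odd item contributes g0, g1 over U_1 and g0, g2 over U_2, because the exchange of y and z
    exchanges g1 and g2. *)
Definition spanning (it : nat -> item) (N : nat) : Prop :=
  (forall v : P1, exists a b : nat -> ring1 R, (forall i, ~~ isodd (it i) -> b i = 0) /\
    v = \sum_(i < N) (a i *: (g0 (it i)).1 + b i *: (g1 (it i)).1)) /\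
  (forall v : P2, exists a b : nat -> ring2 R, (forall i, ~~ isodd (it i) -> b i = 0) /\
    v = \sum_(i < N) (a i *: (g0 (it i)).2 + b i *: (g2 (it i)).2)).
Definition independent (it : nat -> item) (N : nat) : Prop :=
  (forall a b : nat -> ring1 R, (forall i, ~~ isodd (it i) -> b i = 0) ->
    \sum_(i < N) (a i *: (g0 (it i)).1 + b i *: (g1 (it i)).1) = 0 ->
    forall i, (i < N)%N -> a i = 0 /\ b i = 0) /\
  (forall a b : nat -> ring2 R, (forall i, ~~ isodd (it i) -> b i = 0) ->
    \sum_(i < N) (a i *: (g0 (it i)).2 + b i *: (g2 (it i)).2) = 0 ->
    forall i, (i < N)%N -> a i = 0 /\ b i = 0).

Lemma sum_perm (V : nmodType) (N : nat) (f : nat -> nat) (F : nat -> V) :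
  perm_eq [seq f i | i <- iota 0 N] (iota 0 N) -> \sum_(i < N) F (f i) = \sum_(i < N) F i.
Proof.
move=> hp; rewrite -(big_mkord xpredT (fun i => F (f i))) -(big_mkord xpredT F).
by rewrite /index_iota subn0 -(big_map f xpredT F); apply: perm_big.
Qed.

Lemma independent_perm it N f : perm_eq [seq f i | i <- iota 0 N] (iota 0 N) ->
  independent it N -> independent (it \o f) N.
Proof.
move=> hp; have fN i : (i < N)%N -> (f i < N)%N.
  by move=> iN; have := perm_mem hp (f i); rewrite mem_iota /= add0n => <-; apply: map_f; rewrite mem_iota.
have [g fK] : exists g, forall i, (i < N)%N -> g (f i) = i.
  exists (fun j => index j [seq f i | i <- iota 0 N]) => i iN.
  have uq : uniq [seq f i | i <- iota 0 N] by rewrite (perm_uniq hp) iota_uniq.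
  rewrite -[X in index X _](_ : nth 0%N [seq f i | i <- iota 0 N] i = f i).
    by rewrite index_uniq // size_map size_iota.
  by rewrite (nth_map 0%N) ?size_iota // nth_iota.
have main (A : comNzRingType) (P : lmodType A) (u v : item -> P) :
  (forall a b : nat -> A, (forall i, ~~ isodd (it i) -> b i = 0) ->
    \sum_(i < N) (a i *: u (it i) + b i *: v (it i)) = 0 ->
    forall i, (i < N)%N -> a i = 0 /\ b i = 0) ->
  (forall a b : nat -> A, (forall i, ~~ isodd (it (f i)) -> b i = 0) ->
    \sum_(i < N) (a i *: u (it (f i)) + b i *: v (it (f i))) = 0 ->
    forall i, (i < N)%N -> a i = 0 /\ b i = 0).
  move=> h a b hb hs i iN.
  have := h (fun j => a (g j)) (fun j => if isodd (it j) then b (g j) else 0).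
  case/(_ _ _ (f i) (fN i iN)); first by move=> j /negPf ->.
    have e := sum_perm (fun j => a (g j) *: u (it j) + (if isodd (it j) then b (g j) else 0) *: v (it j)) hp.
    rewrite -[LHS]e -[RHS]hs; apply: eq_bigr => j _; rewrite fK //.
    by case: ifPn => // /hb ->.
  by rewrite fK //; case: ifPn => // /hb ->.
by move=> [h1 h2]; split; [apply: (main _ _ (fun x => (g0 x).1) (fun x => (g1 x).1)) |
  apply: (main _ _ (fun x => (g0 x).2) (fun x => (g2 x).2))].
Qed.

Lemma spanning_perm it N f : perm_eq [seq f i | i <- iota 0 N] (iota 0 N) ->
  spanning it N -> spanning (it \o f) N.
Proof.
move=> hp [h1 h2]; split=> v.
  have [a [b [hb ->]]] := h1 v; exists (a \o f), (b \o f); split=> [i|]; first exact: hb.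
  by symmetry; apply: (sum_perm (fun i => a i *: (g0 (it i)).1 + b i *: (g1 (it i)).1) hp).
have [a [b [hb ->]]] := h2 v; exists (a \o f), (b \o f); split=> [i|]; first exact: hb.
by symmetry; apply: (sum_perm (fun i => a i *: (g0 (it i)).2 + b i *: (g2 (it i)).2) hp).
Qed.
Variables (n : nat) (k1 : P1 -> 'cV[K]_n) (k2 : P2 -> 'cV[K]_n) (D : nat).
Variable H : gluing k1 k2 D.
Local Notation S := (glue_graded H).

Lemma good_independent it N : good S it N -> independent it N.
Proof.
move=> hg; split=> a b; first exact: (@chart1_free _ _ _ _ _ _ _ H it N a b hg).
exact: (@chart2_free _ _ _ _ _ _ _ H (@iswap _ _ \o it) N a b (swap_good hg)).
Qed.
Lemma full_spanning it N : good S it N -> full S it N -> spanning it N.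
Proof.
move=> hg hf; split; first exact: (chart1_span hg hf).
exact: (chart2_span (swap_good hg) (swap_full hf)).
Qed.

(** A section of degree k satisfies v = t^(k - D) w on the overlap. For an even item k - D is the
    exponent i/2; for an odd item it is the larger exponent (i + 1)/2 of the block. *)
Definition item_index (x : item) : int :=
  if isodd x then 2 * (lev x)%:Z - 2 * D%:Z - 1 else 2 * (lev x)%:Z - 2 * D%:Z.

Lemma index_even (x : item) : (2 %| item_index x)%Z = ~~ isodd x.
Proof.
rewrite /item_index; case: (isodd x) => /=; first by apply/negbTE; lia.
lia.
Qed.

(** The blocks are written in powers of - y/z; this sign turns t^(k - D) into (- t)^(k - D). *)
Definition sgn2 (x : item) : ring2 R := (-1) ^+ (lev x + D).
Definition uvec (x : item) (j : nat) : P1 := if j == 0%N then (g0 x).1 else - (g1 x).1.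
Definition wvec (x : item) (j : nat) : P2 := if j == 0%N then sgn2 x *: (g0 x).2 else - (sgn2 x *: (g2 x).2).

Lemma sgn2_sq x : sgn2 x * sgn2 x = 1.
Proof. by rewrite /sgn2 -expr2 sqrr_sign. Qed.

Lemma tau_sign (F : fieldType) (x : F) (l d : nat) : x != 0 ->
  (- x) ^ (l%:Z - d%:Z) * (-1) ^+ (l + d) = x ^+ l / x ^+ d.
Proof.
move=> x0; have nx0 : - x != 0 by rewrite oppr_eq0.
rewrite expfzDr // -invr_expz -!exprnP -[- x]mulN1r !exprMn invfM exprD.
have s0 j : ((-1) ^+ j)^-1 = (-1) ^+ j :> F by rewrite -exprVn invrN1.
rewrite s0; move: (x ^+ l) (x ^+ d)^-1 => p q.
have e j : (-1) ^+ j * (-1) ^+ j = 1 :> F by rewrite -expr2 sqrr_sign.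
transitivity (((-1) ^+ l * (-1) ^+ l) * ((-1) ^+ d * (-1) ^+ d) * (p * q)); last by rewrite !e !mul1r.
by ring.
Qed.

Lemma gluing_tau (F : fieldType) m (x : F) (l d : nat) (v w : 'cV[F]_m) : x != 0 ->
  x ^+ d *: v = x ^+ l *: w ->
  v = (- x) ^ (l%:Z - d%:Z) *: ((-1) ^+ (l + d) *: w).
Proof.
move=> x0 h; rewrite scalerA tau_sign // mulrC -scalerA -h scalerA mulVf ?scale1r //.
by rewrite expf_neq0.
Qed.

Lemma odd_column (F : fieldType) m (x y p q : F) (v a b : 'cV[F]_m) : x != 0 ->
  x *: v = y *: (p *: a) - p *: b -> p = - x * q -> - v = (y * q) *: a - q *: b.
Proof.
move=> x0 h pE; apply: (scalerI x0); rewrite scalerN h pE scalerBr !scalerA !mulNr !mulrN.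
by rewrite !scaleNr opprB opprK addrC mulrCA.
Qed.

Lemma k1_of_glued k (u : pairmod P1 P2) : glued k1 k2 D k u ->
  k1 u.1 = (- t) ^ (k%:Z - D%:Z) *: k2 ((-1) ^+ (k + D) *: u.2).
Proof.
case: u => v w; rewrite gluedE (k2Z H) => h.
have -> : val ((-1) ^+ (k + D) : ring2 R) = (-1) ^+ (k + D).
  by rewrite rmorphXn rmorphN1.
exact: gluing_tau (t_neq0 R) h.
Qed.

Lemma k1_uvec0 x : valid S x ->
  k1 (uvec x 0) = (- t) ^ ((lev x)%:Z - D%:Z) *: k2 (wvec x 0).
Proof. by move=> hv; apply: (k1_of_glued (valid_g0 hv)). Qed.

Lemma k1N v : k1 (- v) = - k1 v.
Proof. by rewrite -[- v]scaleN1r (k1Z H) rmorphN1 scaleN1r. Qed.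
Lemma k2N v : k2 (- v) = - k2 v.
Proof. by rewrite -[- v]scaleN1r (k2Z H) rmorphN1 scaleN1r. Qed.

Lemma pairD (a c : P1) (b d : P2) : ((a, b) : pairmod P1 P2) + (c, d) = (a + c, b + d).
Proof. by []. Qed.
Lemma pair_x1 (u v w : pairmod P1 P2) : px R *: u = py R *: v + pz R *: w ->
  s1 R *: u.1 = y_z1 R *: v.1 + w.1.
Proof.
case: u v w => [a b] [c d] [e f]; rewrite !pairZ !scale1r pairD => -[h _].
exact: h.
Qed.

(** The second column of an odd block. Over U_1 one has t g1 = s g0 - g2, where g0 and g2 are (-
    t)^(k - D) times their signed values over U_2; dividing by - t lowers the exponent by one in
    both entries. *)
Lemma k1_uvec1 x : valid S x -> isodd x ->
  k1 (uvec x 1) = (s * (- t) ^ ((lev x)%:Z - D%:Z - 1)) *: k2 (wvec x 0) +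
    (- t) ^ ((lev x)%:Z - D%:Z - 1) *: k2 (wvec x 1).
Proof.
move=> hv ho; have e0 := k1_uvec0 hv.
have e2 := k1_of_glued (valid_g2 hv ho).
have e3 := pair_x1 (valid_x hv ho).
have /(congr1 k1) : y_z1 R *: (g1 x).1 + (g2 x).1 = s1 R *: (g0 x).1 by rewrite e3.
rewrite (k1D H) (k1Z H) => /(canRL (addrK _)) e1.
rewrite e2 -[(g0 x).1]/(uvec x 0) e0 in e1.
have nt0 : - t != 0 by rewrite oppr_eq0 t_neq0.
have pE : (- t) ^ ((lev x)%:Z - D%:Z) = - t * (- t) ^ ((lev x)%:Z - D%:Z - 1).
  by rewrite -{2}[- t]expr1z -expfzDr //; congr (_ ^ _); lia.
have := odd_column (t_neq0 R) e1 pE.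
by rewrite /uvec /wvec k1N k2N scalerN.
Qed.

Lemma index_odd1 x : isodd x -> ((item_index x + 1) %/ 2)%Z = (lev x)%:Z - D%:Z.
Proof. by move=> ho; rewrite /item_index ho; lia. Qed.
Lemma index_odd2 x : isodd x -> ((item_index x - 1) %/ 2)%Z = (lev x)%:Z - D%:Z - 1.
Proof. by move=> ho; rewrite /item_index ho; lia. Qed.
Lemma index_even1 x : ~~ isodd x -> (item_index x %/ 2)%Z = (lev x)%:Z - D%:Z.
Proof. by move=> /negPf ho; rewrite /item_index ho; lia. Qed.

Lemma block_size_index x : block_size (item_index x) = (isodd x).+1.
Proof. by rewrite /block_size index_even; case: (isodd x). Qed.

Section Describe.
Variables (it : nat -> item) (N : nat) (l : seq int).
Hypothesis lE : l = [seq item_index (it i) | i <- iota 0 N].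

Lemma size_l : size l = N. Proof. by rewrite lE size_map size_iota. Qed.
Lemma nth_l k : (k < N)%N -> l`_k = item_index (it k).
Proof. by move=> kN; rewrite lE (nth_map 0%N) ?size_iota // nth_iota. Qed.
Lemma size_odd_l k : (k < size l)%N -> block_size l`_k = (isodd (it k)).+1.
Proof. by rewrite size_l => kN; rewrite nth_l // block_size_index. Qed.

Definition basis1 (x : 'I_(csz l)) : P1 := uvec (it (item_of x)) (part_of x).
Definition basis2 (x : 'I_(csz l)) : P2 := wvec (it (item_of x)) (part_of x).

Lemma basis1_basis : independent it N -> spanning it N -> module_basis basis1.
Proof.
move=> [hi _] [hs _].
have c2 (k j : nat) : (if j == 0%N then 1 else -1) * (if j == 0%N then 1 else -1) = 1 :> ring1 R.
  by case: eqP; rewrite ?mulrNN mulr1.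
have h := @basis_of_free_span l (ring1 R) P1 (fun i => isodd (it i))
  (fun i j => if j == 0%N then (g0 (it i)).1 else (g1 (it i)).1)
  (fun i j => if j == 0%N then 1 else -1) c2 size_odd_l.
rewrite -size_l in hi hs => v; have [d [h1 h2]] := h hi hs v.
have E x : basis1 x = (if part_of x == 0%N then 1 else -1) *:
    (if part_of x == 0%N then (g0 (it (item_of x))).1 else (g1 (it (item_of x))).1).
  by rewrite /basis1 /uvec; case: ifP; rewrite ?scale1r ?scaleN1r.
by exists d; split=> [|d' hd']; [rewrite h1 | apply: h2; rewrite hd']; apply: eq_bigr => x _; rewrite E.
Qed.

Lemma basis2_basis : independent it N -> spanning it N -> module_basis basis2.
Proof.
move=> [_ hi] [_ hs].
have c2 (k j : nat) : (if j == 0%N then sgn2 (it k) else - sgn2 (it k)) *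
    (if j == 0%N then sgn2 (it k) else - sgn2 (it k)) = 1.
  by case: eqP; rewrite ?mulrNN sgn2_sq.
have h := @basis_of_free_span l (ring2 R) P2 (fun i => isodd (it i))
  (fun i j => if j == 0%N then (g0 (it i)).2 else (g2 (it i)).2)
  (fun i j => if j == 0%N then sgn2 (it i) else - sgn2 (it i)) c2 size_odd_l.
rewrite -size_l in hi hs => v; have [d [h1 h2]] := h hi hs v.
have E x : basis2 x = (if part_of x == 0%N then sgn2 (it (item_of x)) else - sgn2 (it (item_of x))) *:
    (if part_of x == 0%N then (g0 (it (item_of x))).2 else (g2 (it (item_of x))).2).
  by rewrite /basis2 /wvec; case: ifP; rewrite ?scaleNr.
by exists d; split=> [|d' hd']; [rewrite h1 | apply: h2; rewrite hd']; apply: eq_bigr => x _; rewrite E.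
Qed.

Lemma basis_transition : (forall i, (i < N)%N -> valid S (it i)) -> forall y,
  k1 (basis1 y) = \sum_x cmx R l x y *: k2 (basis2 x).
Proof.
move=> hv y; have [k [j ->]] := pos_exists y.
rewrite sum_pos (bigD1 k) //= [X in _ + X]big1 ?addr0; last first.
  move=> k' /negPf kk; apply: big1 => j' _.
  by rewrite cmxE kk scale0r.
transitivity (\sum_(j' < block_size l`_k) block_entry R l`_k j' j *: k2 (wvec (it k) j')); last first.
  by apply: eq_bigr => j' _; rewrite cmxE eqxx /basis2 item_pos part_pos.
rewrite /basis1 item_pos part_pos.
have kN : (k < N)%N by rewrite -size_l.
have hvk := hv k kN.
have := ltn_ord j; move: (nat_of_ord j) => {j} j.
rewrite size_odd_l // /block_entry nth_l // index_even.
have [ho|ho] := boolP (isodd (it k)) => /=; rewrite !big_ord_recl big_ord0 /= addr0; last first.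
  by rewrite index_even1 // ltnS leqn0 => /eqP ->; apply: k1_uvec0.
rewrite index_odd1 // index_odd2 //.
case: j => [|[|//]] _ /=; first by rewrite scale0r addr0; apply: k1_uvec0.
by apply: k1_uvec1.
Qed.
End Describe.

End Families.

Theorem splitting_exists (R : realType) (V : vector_bundle R) :
  exists m, describes (canonical_mx R m) V.
Proof.
have [n [k12 [D [kD kinj H]]]] := bundle_gluing V.
have hg0 : good (glue_graded H) (fun _ => Item 0 false 0 0 0 0) 0 by [].
have [it [N [_ _ hg hf]]] := full_exists (@good_bound _ _ _ _ _ _ _ H) hg0.
have [m hm] := block_indices_exists [seq item_index D (it i) | i <- iota 0 N].
(* [canonical_mx] lists its indices in increasing order, so the items are permuted accordingly. *)
have /(perm_iotaP 0)[Is hIs hl] := hm.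
rewrite size_map size_iota in hIs.
pose f i := nth 0%N Is i.
have fE : [seq f i | i <- iota 0 N] = Is.
  by rewrite map_nth_iota0 ?take_oversize // (perm_size hIs) size_iota.
have hp : perm_eq [seq f i | i <- iota 0 N] (iota 0 N) by rewrite fE.
have lE : block_indices m = [seq item_index D ((it \o f) i) | i <- iota 0 N].
  rewrite hl -fE -map_comp; apply/eq_in_map => i; rewrite mem_iota /= add0n => iN.
  have fi : (f i < N)%N.
    by have := perm_mem hp (f i); rewrite mem_iota /= add0n => <-; apply: map_f; rewrite mem_iota.
  by rewrite /= (nth_map 0%N) ?size_iota // nth_iota.
have hi := independent_perm hp (good_independent hg).
have hs := spanning_perm hp (full_spanning hg hf).
have hv i : (i < N)%N -> valid (glue_graded H) ((it \o f) i).
  move=> iN; have fi : (f i < N)%N.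
    by have := perm_mem hp (f i); rewrite mem_iota /= add0n => <-; apply: map_f; rewrite mem_iota.
  by case: (hg _ fi).
have c12 i j : canonical_mx R m i j \in @R12 R.
  have tin k : (- y_z R) ^ k \in @R12 R.
    have ht : - y_z R \in @R12 R by rewrite rpredN R1_R12 // y_z_R1.
    have hz : (- y_z R)^-1 \in @R12 R by rewrite invrN rpredN z_y_R12.
    by case: k => k; rewrite ?NegzE -?invr_expz -exprnP -?exprVn rpredX.
  rewrite -cmx_canonical; have [k [a ->]] := pos_exists i; have [k' [b ->]] := pos_exists j.
  rewrite cmxE; case: eqP => _; last exact: rpred0.
  rewrite /block_entry; case: ifP => _; first exact: tin.
  case: ifP => _; case: ifP => _; try exact: tin; try exact: rpred0.
  by rewrite rpredM ?tin // R1_R12 // x_z_R1.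
exists m; exists (\matrix_(i, j) (Sub (canonical_mx R m i j) (c12 i j) : ring12 R)).
exists (@basis1 R _ _ (it \o f) (block_indices m)), (@basis2 R _ _ D (it \o f) (block_indices m)).
split.
- by apply/matrixP => i j; rewrite [RHS]mxE [X in val X]mxE.
- exact: basis1_basis lE hi hs.
- exact: basis2_basis lE hi hs.
have k0 : k12 0 = 0.
  by have := kD 1 0 0; rewrite scaler0 addr0 (_ : val (1 : ring12 R) = 1) // scale1r => /eqP; rewrite -subr_eq0 opprD addNKr oppr_eq0 => /eqP.
have ksum (I : Type) (r : seq I) (a : I -> ring12 R) (v : I -> sec12 V) :
    k12 (\sum_(i <- r) a i *: v i) = \sum_(i <- r) val (a i) *: k12 (v i).
  by elim/big_rec2: _ => [//|i u v1 _ <-]; apply: kD.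
move=> j; apply/eqP; rewrite -subr_eq0 addrC -scaleN1r; apply/eqP/kinj.
rewrite kD ksum rmorphN1 scaleN1r; apply/eqP; rewrite addrC subr_eq0; apply/eqP.
have e := basis_transition lE hv j; apply: etrans e _.
by apply: eq_bigr => i _; rewrite mxE.
Qed.

(** * Uniqueness of the splitting *)

Section Uniqueness.
Variable R : realType.
Local Notation K := (ffield R).
Local Notation s := (x_z R).
Local Notation t := (y_z R).

Lemma ntX_neq0 (p : int) : (- t) ^ p != 0.
Proof. by rewrite expfz_neq0 // oppr_eq0 t_neq0. Qed.

Lemma mulX_sign (F : fieldType) (x u : F) k : u * x ^+ k = (-1) ^+ k * ((- x) ^+ k * u).
Proof. by rewrite (exprNn x) -mulrA signrMK mulrC. Qed.

(** A morphism from a line bundle of higher degree to one of lower degree is zero. *)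
Lemma tau_vanish (p q : int) (u w : K) : u \in @R1 R -> w \in @R2 R -> q < p ->
  (- t) ^ p * u = w * (- t) ^ q -> u = 0.
Proof.
move=> hu hw qp h.
have [k pE] : exists k : nat, p = k.+1%:Z + q.
  by exists (absz (p - q)).-1; lia.
have {}h : (- t) ^+ k.+1 * u = w.
  move: h; rewrite pE expfzDr ?oppr_eq0 ?t_neq0 // mulrAC => /(mulIf (ntX_neq0 q)) <-.
  by rewrite -exprnP.
have h2 : u * t ^+ k.+1 = (-1) ^+ k.+1 * w.
  by rewrite -h; apply: mulX_sign.
by apply: R1_divt_R2 hu _ h2; rewrite rpredMsign.
Qed.

Lemma tau_const (p : int) (u w : K) : u \in @R1 R -> w \in @R2 R ->
  (- t) ^ p * u = w * (- t) ^ p -> exists2 c, u = cst R c & w = cst R c.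
Proof.
move=> hu hw; rewrite mulrC => /(mulIf (ntX_neq0 p)) uw.
have [c uc] : exists c, u = cst R c by apply: R1_R2_cst => //; rewrite uw.
by exists c; rewrite -?uw.
Qed.

Lemma polX_inj (a b : {poly R}) c d : 'X * a = c%:P -> 'X * b = d%:P -> a = 0 /\ b = 0.
Proof.
have main (p : {poly R}) e : 'X * p = e%:P -> p = 0.
  move=> h; apply/polyP => i; have := congr1 (fun q : {poly R} => q`_i.+1) h.
  by rewrite coefXM coefC /= coef0.
by move=> /main -> /main ->.
Qed.

(** The function is regular on both charts, hence constant, and a constant has no part in t or s.
    This settles the case that degrees alone do not exclude. *)
Lemma tu_cs (u : K) c : u \in @R1 R -> t * u + s * cst R c \in @R2 R -> u = 0 /\ c = 0.
Proof.
move=> /R1P[a [b ->]] h2.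
have e : t * emb a b + s * cst R c = emb ('X * a) ('X * b + c%:P).
  by rewrite mulrC -[t]expr1 emb_t expr1 embX embC embM embD !mul0r !mulr0 !mul1r subr0 addr0 add0r.
have [d hd] : exists d, t * emb a b + s * cst R c = cst R d.
  by apply: R1_R2_cst h2; rewrite e; apply/R1P; eexists; eexists.
move: hd; rewrite e embC => /emb_inj[ea eb].
have eb' : 'X * b = (- c)%:P by rewrite polyCN -[LHS](addrK c%:P) eb add0r.
have [a0 b0] := polX_inj ea eb'.
split; first by rewrite a0 b0 emb0.
by move: eb; rewrite b0 mulr0 add0r => /eqP; rewrite polyC_eq0 => /eqP.
Qed.

(** A row of a morphism out of an odd block. For p > q + 1 both entries vanish by degree; for p = q
    + 1 the degree leaves a constant in w0, and the second equation takes the form of [tu_cs]. *)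
Lemma vanish_even_odd (p q : int) (u0 u1 w0 w1 : K) :
  u0 \in @R1 R -> u1 \in @R1 R -> w0 \in @R2 R -> w1 \in @R2 R -> q < p ->
  (- t) ^ p * u0 = w0 * (- t) ^ (q + 1) ->
  (- t) ^ p * u1 = w0 * (s * (- t) ^ q) + w1 * (- t) ^ q -> u0 = 0 /\ u1 = 0.
Proof.
move=> hu0 hu1 hw0 hw1 qp e0 e1.
have [pq|pq] := eqVneq p (q + 1); last first.
  have u00 : u0 = 0 by apply: tau_vanish hu0 hw0 _ e0; move: pq qp; lia.
  split=> //; have w00 : w0 = 0.
    by move: e0; rewrite u00 mulr0 => /esym/eqP; rewrite mulf_eq0 (negPf (ntX_neq0 _)) orbF => /eqP.
  by apply: tau_vanish hu1 hw1 qp _; rewrite e1 w00 mul0r add0r.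
rewrite pq in e0 e1; have [c uc wc] := tau_const hu0 hw0 e0.
have e2 : - t * u1 = w0 * s + w1.
  apply: (mulIf (ntX_neq0 q)); rewrite mulrDl -[w0 * s * _]mulrA -e1 expfzDr ?oppr_eq0 ?t_neq0 //.
  by rewrite expr1z mulrAC [- t * _]mulrC.
have [u10 c0] : u1 = 0 /\ c = 0.
  apply: tu_cs => //; rewrite -wc; have -> : t * u1 + s * w0 = - w1; last by rewrite rpredN.
  by move/eqP: e2; rewrite mulNr eqr_oppLR opprD => /eqP ->; rewrite [s * _]mulrC addrAC addNr add0r.
by split=> //; rewrite uc c0 rmorph0.
Qed.

(** A column of a morphism into an odd block. The case left open by degrees is p = q, with a
    constant in u1. *)
Lemma vanish_odd_even (p q : int) (u0 u1 w0 w1 : K) :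
  u0 \in @R1 R -> u1 \in @R1 R -> w0 \in @R2 R -> w1 \in @R2 R -> q <= p ->
  (- t) ^ (p + 1) * u0 + s * (- t) ^ p * u1 = w0 * (- t) ^ q ->
  (- t) ^ p * u1 = w1 * (- t) ^ q -> u0 = 0 /\ u1 = 0.
Proof.
move=> hu0 hu1 hw0 hw1 qp e0 e1.
have [pq|pq] := eqVneq p q; last first.
  have u10 : u1 = 0 by apply: tau_vanish hu1 hw1 _ e1; move: pq qp; lia.
  split=> //; apply: (@tau_vanish (p + 1) q u0 w0) => //; first by move: qp; lia.
  by rewrite -e0 u10 mulr0 addr0.
rewrite pq in e0 e1; have [c uc wc] := tau_const hu1 hw1 e1.
have e2 : - t * u0 + s * u1 = w0.
  apply: (mulIf (ntX_neq0 q)); rewrite -e0 mulrDl expfzDr ?oppr_eq0 ?t_neq0 // expr1z.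
  by rewrite mulrAC [- t * _]mulrC; congr (_ + _); rewrite mulrAC.
have [u00 c0] : - u0 = 0 /\ c = 0.
  by apply: tu_cs; rewrite ?rpredN // -uc mulrN -mulNr e2.
split; first by move/eqP: u00; rewrite oppr_eq0 => /eqP.
by rewrite uc c0 rmorph0.
Qed.

Lemma block_hom_zero (i j : int) (u w : nat -> nat -> K) : j < i ->
  (forall a b, u a b \in @R1 R) -> (forall a b, w a b \in @R2 R) ->
  (forall a b, (a < block_size i)%N -> (b < block_size j)%N ->
    \sum_(a' < block_size i) block_entry R i a a' * u a' b =
    \sum_(b' < block_size j) w a b' * block_entry R j b' b) ->
  forall a b, (a < block_size i)%N -> (b < block_size j)%N -> u a b = 0.
Proof.
move=> ji hu hw; rewrite /block_entry /block_size.
have pe (k : int) : (2 %| k)%Z = false -> ((k + 1) %/ 2)%Z = ((k - 1) %/ 2)%Z + 1 by lia.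
have [i2|i2] := boolP (2 %| i)%Z; have [j2|j2] := boolP (2 %| j)%Z => h.
- have := h 0%N 0%N isT isT; rewrite !big_ord_recl !big_ord0 /= !addr0 => h0.
  move=> [|//] [|//] _ _; apply: tau_vanish h0 => //; lia.
- have qp : ((j - 1) %/ 2)%Z < (i %/ 2)%Z by lia.
  rewrite (pe j (negPf j2)) in h.
  have := h 0%N 0%N isT isT; have := h 0%N 1%N isT isT.
  rewrite !big_ord_recl !big_ord0 /= !addr0 /bump /= mulr0 !addr0 => h1 h0.
  have [u0 u1] := vanish_even_odd (hu 0%N 0%N) (hu 0%N 1%N) (hw 0%N 0%N) (hw 0%N 1%N) qp h0 h1.
  by move=> [|//] [|[|//]].
- have qp : (j %/ 2)%Z <= ((i - 1) %/ 2)%Z by lia.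
  rewrite (pe i (negPf i2)) in h.
  have := h 0%N 0%N isT isT; have := h 1%N 0%N isT isT.
  rewrite !big_ord_recl !big_ord0 /= !addr0 /bump /= mul0r !add0r => h1 h0.
  have [u0 u1] := vanish_odd_even (hu 0%N 0%N) (hu 1%N 0%N) (hw 0%N 0%N) (hw 1%N 0%N) qp h0 h1.
  by move=> [|[|//]] [|//].
have qp : ((j - 1) %/ 2)%Z < ((i - 1) %/ 2)%Z by lia.
have qp1 : ((j - 1) %/ 2)%Z < ((i - 1) %/ 2)%Z + 1 by lia.
rewrite (pe j (negPf j2)) (pe i (negPf i2)) in h.
have := h 0%N 0%N isT isT; have := h 0%N 1%N isT isT.
have := h 1%N 0%N isT isT; have := h 1%N 1%N isT isT.
rewrite !big_ord_recl !big_ord0 /= !addr0 /bump /= !mul0r !add0r !mulr0 !addr0 => h11 h10 h01 h00.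
(* The lower row of the triangular block comes first; once it is zero, the upper row has the same
   shape. *)
have [u0 u1] := vanish_even_odd (hu 1%N 0%N) (hu 1%N 1%N) (hw 1%N 0%N) (hw 1%N 1%N) qp h10 h11.
rewrite u0 mulr0 addr0 in h00; rewrite u1 mulr0 addr0 in h01.
have [u2 u3] := vanish_even_odd (hu 0%N 0%N) (hu 0%N 1%N) (hw 0%N 0%N) (hw 0%N 1%N) qp1 h00 h01.
by move=> [|[|//]] [|[|//]].
Qed.

Lemma cmx_hom_zero l l' (U W : 'M[K]_(csz l, csz l')) :
  (forall x y, U x y \in @R1 R) -> (forall x y, W x y \in @R2 R) ->
  cmx R l *m U = W *m cmx R l' ->
  forall x y, l'`_(item_of y) < l`_(item_of x) -> U x y = 0.
Proof.
move=> hU hW e x y; have [k [a ->]] := pos_exists x; have [k' [b ->]] := pos_exists y.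
rewrite !item_pos => hlt.
pose u a b := at_pos 0 (fun x => at_pos 0 (fun y => U x y) k' b) k a.
pose w a b := at_pos 0 (fun x => at_pos 0 (fun y => W x y) k' b) k a.
have at_in (S : {pred K}) (c : 'I_(csz l) -> nat -> K) : True by [].
have -> : U (pos_of a) (pos_of b) = u a b by rewrite /u !at_posE.
have hu a' b' : u a' b' \in @R1 R.
  by rewrite /u /at_pos; do 4?[case: insubP => [? _ _|_]]; rewrite ?rpred0 ?hU.
have hw a' b' : w a' b' \in @R2 R.
  by rewrite /w /at_pos; do 4?[case: insubP => [? _ _|_]]; rewrite ?rpred0 ?hW.
apply: (block_hom_zero hlt hu hw) (ltn_ord a) (ltn_ord b) => {a b} a b ha hb.
have := congr1 (fun N : 'M_(_, _) => N (pos_of (Ordinal ha)) (pos_of (Ordinal hb))) e.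
rewrite !mxE !sum_pos (bigD1 k) //= [X in _ + X = _]big1 ?addr0; last first.
  by move=> k1 /negPf kk; apply: big1 => j _; rewrite cmxE eq_sym kk mul0r.
rewrite (bigD1 k') //= [X in _ = _ + X]big1 ?addr0; last first.
  by move=> k1 /negPf kk; apply: big1 => j _; rewrite cmxE kk mulr0.
move=> h; transitivity (\sum_(j < block_size l`_k) cmx R l (pos_of (Ordinal ha)) (pos_of j) * U (pos_of j) (pos_of (Ordinal hb))).
  by apply: eq_bigr => j _; rewrite cmxE eqxx /u at_posE -[b]/(nat_of_ord (Ordinal hb)) at_posE.
rewrite h; apply: eq_bigr => j _; rewrite cmxE eqxx /w -[a]/(nat_of_ord (Ordinal ha)) at_posE at_posE.
by [].
Qed.

(** The rows in A only meet the columns in B, so the corresponding submatrices still multiply to the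
    identity, and the rank gives the inequality. *)
Lemma zero_block_card (F : fieldType) p q (U : 'M[F]_(p, q)) (U' : 'M[F]_(q, p))
    (A : pred 'I_p) (B : pred 'I_q) : U *m U' = 1%:M ->
  (forall x y, A x -> ~~ B y -> U x y = 0) -> (#|A| <= #|B|)%N.
Proof.
move=> UU hz.
pose V := \matrix_(i < #|A|, j < #|B|) U (enum_val i) (enum_val j).
pose V' := \matrix_(j < #|B|, i < #|A|) U' (enum_val j) (enum_val i).
have VV : V *m V' = 1%:M.
  apply/matrixP => i i'; have := congr1 (fun N : 'M_p => N (enum_val i) (enum_val i')) UU.
  rewrite !mxE (inj_eq enum_val_inj) => <-.
  rewrite (bigID (mem B)) /= [X in _ + X]big1 ?addr0; last first.
    by move=> y yB; rewrite hz ?mul0r //; apply: (enum_valP i).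
  by rewrite [RHS]big_enum_val; apply: eq_bigr => j _; rewrite !mxE.
have := mxrankM_maxl V V'; rewrite VV mxrank1 => h.
exact: leq_trans h (rank_leq_col _).
Qed.

(** Blocks of index below th have no nonzero map to blocks of index at least th; this is the zero
    block of U. *)
Lemma count_ge_le l l' (U W : 'M[K]_(csz l, csz l')) (U' : 'M[K]_(csz l', csz l)) (th : int) :
  (forall x y, U x y \in @R1 R) -> (forall x y, W x y \in @R2 R) ->
  cmx R l *m U = W *m cmx R l' -> U *m U' = 1%:M ->
  (#|[pred x : 'I_(csz l) | (th <= l`_(item_of x))%R]| <= #|[pred y : 'I_(csz l') | (th <= l'`_(item_of y))%R]|)%N.
Proof.
move=> hU hW e UU; apply: zero_block_card UU _ => x y /= hx hy.
by apply: (cmx_hom_zero hU hW e); apply: lt_le_trans hx; rewrite ltNge.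
Qed.

Lemma card_ge l (th : int) : #|[pred x : 'I_(csz l) | (th <= l`_(item_of x))%R]| =
  (\sum_(i <- l) (if (th <= i)%R then block_size i else 0))%N.
Proof.
rewrite -sum1_card (big_mkcond _ (fun=> 1%N)) /= sum_pos (big_nth 0) big_mkord.
apply: eq_bigr => k _; rewrite -[if _ then _ else _]muln1.
transitivity (\sum_(j < block_size l`_k) (if (th <= l`_k)%R then 1 else 0))%N.
  by apply: eq_bigr => j _; rewrite inE /= item_pos.
by rewrite sum_nat_const card_ord; case: ifP; rewrite ?muln0 ?muln1.
Qed.

(** The counts for the thresholds i and i + 1 differ by the size of the block i times its
    multiplicity. *)
Lemma perm_of_card_ge l l' :
  (forall th, #|[pred x : 'I_(csz l) | (th <= l`_(item_of x))%R]| =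
     #|[pred x : 'I_(csz l') | (th <= l'`_(item_of x))%R]|) -> perm_eq l l'.
Proof.
move=> h; apply/allP => i _ /=; apply/eqP.
have cE (r : seq int) : (\sum_(j <- r) (if (i <= j)%R then block_size j else 0) =
   block_size i * count_mem i r + \sum_(j <- r) (if (i + 1 <= j)%R then block_size j else 0))%N.
  elim: r => [|j r IH]; first by rewrite !big_nil muln0.
  rewrite !big_cons IH /=; case: (eqVneq j i) => [->|ne] /=.
    rewrite lexx; have -> : (i + 1 <= i) = false by apply/negbTE; rewrite -ltNge ltzD1.
    by rewrite add0n mulnDr muln1 !addnA.
  rewrite add0n; have -> : (i <= j) = (i + 1 <= j) by rewrite lezD1 lt_neqAle eq_sym ne.
  by rewrite addnCA.
have := h i; rewrite !card_ge !cE -!card_ge h => /addIn /eqP.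
rewrite eqn_pmul2l; first by move/eqP.
by rewrite /block_size; case: ifP.
Qed.

Lemma basis_change (A : comNzRingType) (P : lmodType A) p q (e : 'I_p -> P) (f : 'I_q -> P) :
  module_basis e -> module_basis f -> exists (U : 'M[A]_(p, q)) (U' : 'M[A]_(q, p)),
    (forall j, f j = \sum_i U i j *: e i) /\ U *m U' = 1%:M.
Proof.
move=> he hf.
have /boolp.choice[U hU] j : exists u : 'rV[A]_p, f j = \sum_i u 0 i *: e i.
  by have [u [hu _]] := he (f j); exists u.
have /boolp.choice[U' hU'] i : exists u : 'rV[A]_q, e i = \sum_j u 0 j *: f j.
  by have [u [hu _]] := hf (e i); exists u.
exists (\matrix_(i, j) U j 0 i), (\matrix_(j, i) U' i 0 j); split.
  by move=> j; rewrite {1}hU; apply: eq_bigr => i _; rewrite mxE.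
apply/trmx_inj/row_matrixP => k.
have [u [_ uniq]] := he (e k).
rewrite -[LHS](uniq _ _) -?[RHS](uniq _ _) //.
  rewrite (bigD1 k) //= big1 ?addr0; first by rewrite !mxE eqxx scale1r.
  by move=> i /negPf ik; rewrite !mxE ik scale0r.
rewrite {1}hU' (eq_bigr (fun j => \sum_i (U' k 0 j * U j 0 i) *: e i)); last first.
  by move=> j _; rewrite {1}hU scaler_sumr; apply: eq_bigr => i _; rewrite scalerA.
rewrite exchange_big; apply: eq_bigr => i _; rewrite -scaler_suml !mxE; congr (_ *: _).
by apply: eq_bigr => j _; rewrite !mxE mulrC.
Qed.

Lemma shift_eq (F : fieldType) (x p z a : F) : z != 0 -> x * p * a = x * z^-1 * (a * z * p).
Proof. by move=> z0; field. Qed.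

Lemma ring12_num2 (a : ring12 R) : exists k (b : ring2 R), forall j, (k <= j)%N ->
  exists b : ring2 R, iota2 (z_y2 R ^+ j) * a = iota2 b.
Proof.
have /boolp.asboolP[j hj] := valP a; have [m hm] := R1_Fil hj; exists m, 0 => i mi.
have h2 : val a * t ^+ j / t ^+ m \in @R2 R by apply/R2P; exists m; rewrite divfK ?tX_neq0.
have h : val (z_y2 R ^+ i) * val a \in @R2 R.
  rewrite -(subnK mi) exprD.
  have -> : val (z_y2 R ^+ (i - m) * z_y2 R ^+ m) * val a =
      val (z_y2 R ^+ (i - m)) * val (z_y2 R ^+ j) * (val a * t ^+ j / t ^+ m).
    rewrite -[val (_ * _)]/(val (z_y2 R ^+ (i - m)) * val (z_y2 R ^+ m)) !val2_tX.
    exact: shift_eq (tX_neq0 R j).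
  rewrite rpredM ?h2 // rpredM //; [exact: (valP (z_y2 R ^+ (i - m))) | exact: (valP (z_y2 R ^+ j))].
by exists (Sub (val (z_y2 R ^+ i) * val a) h); apply: val_inj.
Qed.

(** A relation over the overlap becomes one over U_2 after multiplication by a power of z/y, which
    can be cancelled again. *)
Lemma res2_basis_free (V : vector_bundle R) n (e : 'I_n -> sec2 V) (a : 'I_n -> ring12 R) :
  module_basis e -> \sum_k a k *: res2 V (e k) = 0 -> forall k, a k = 0.
Proof.
move=> he ha.
have /boolp.choice[d hd] i := ring12_num2 (a i).
pose j := \max_i d i.
have /boolp.choice[b hb] i : exists b : ring2 R, iota2 (z_y2 R ^+ j) * a i = iota2 b.
  by have [_ h] := hd i; apply: h; apply: leq_bigmax.
have b0 : \sum_i b i *: e i = 0.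
  apply: res2_inj; rewrite linear_sum; under eq_bigr do rewrite res2Z -hb -scalerA.
  by rewrite -scaler_sumr ha scaler0.
have [u [_ uniq]] := he 0.
have u0 : u = 0 by apply: uniq; rewrite big1 // => i _; rewrite mxE scale0r.
have ub : u = \row_i b i by apply: uniq; rewrite -[LHS]b0; apply: eq_bigr => i _; rewrite mxE.
move=> k; apply: val_inj; have := congr1 (fun u : 'rV_n => val (iota2 (u 0 k))) ub.
rewrite u0 !mxE -hb; change (0 = val (z_y2 R ^+ j) * val (a k) -> val (a k) = 0).
by rewrite val2_tX => /esym/eqP; rewrite mulf_eq0 invr_eq0 (negPf (tX_neq0 _ _)) /= => /eqP.
Qed.

Theorem splitting_unique (V : vector_bundle R) m m' :
  describes (canonical_mx R m) V -> describes (canonical_mx R m') V -> m = m'.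
Proof.
suff main m1 m2 th : describes (canonical_mx R m1) V -> describes (canonical_mx R m2) V ->
  (#|[pred x : 'I_(csz (block_indices m1)) | (th <= (block_indices m1)`_(item_of x))%R]| <=
   #|[pred x : 'I_(csz (block_indices m2)) | (th <= (block_indices m2)`_(item_of x))%R]|)%N.
  by move=> h h'; apply/block_indices_inj/perm_of_card_ge => th; apply/eqP; rewrite eqn_leq !main.
move=> [M12 [e1 [e2 [ME he1 he2 hM]]]] [M12' [f1 [f2 [ME' hf1 hf2 hM']]]].
have [U [U' [fU UU]]] := basis_change he1 hf1.
have [W [W' [fW WW]]] := basis_change he2 hf2.
(* Both sides express the restrictions of the f1 in the basis e2 over the overlap. *)
have e : M12 *m map_mx (@iota1 R) U = map_mx (@iota2 R) W *m M12'.
  apply/matrixP => k j.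
  have : \sum_k (M12 *m map_mx (@iota1 R) U) k j *: res2 V (e2 k) =
      \sum_k (map_mx (@iota2 R) W *m M12') k j *: res2 V (e2 k).
    transitivity (res1 V (f1 j)).
      rewrite fU linear_sum; under [RHS]eq_bigr do rewrite res1Z hM scaler_sumr.
      rewrite exchange_big; apply: eq_bigr => k' _; rewrite mxE scaler_suml.
      by apply: eq_bigr => i _; rewrite mxE scalerA mulrC.
    rewrite hM'; under eq_bigr do rewrite fW linear_sum scaler_sumr.
    rewrite exchange_big; apply: eq_bigr => k' _; rewrite mxE scaler_suml.
    by apply: eq_bigr => i _; rewrite res2Z mxE scalerA mulrC.
  move/eqP; rewrite -subr_eq0 -sumrB; under eq_bigr do rewrite -scalerBl.
  by move/eqP/(res2_basis_free he2)/(_ k)/eqP; rewrite subr_eq0 => /eqP.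
have eK : cmx R (block_indices m1) *m map_mx val U = map_mx val W *m cmx R (block_indices m2).
  have /(congr1 (map_mx val)) := e; rewrite !map_mxM -!map_mx_comp !cmx_canonical ME ME'.
  by move=> h; apply: etrans h _.
apply: (count_ge_le (U' := map_mx val U') th _ _ eK) => [x y|x y|].
- by rewrite mxE; apply: valP.
- by rewrite mxE; apply: valP.
by rewrite -map_mxM UU map_mx1.
Qed.
End Uniqueness.

(** * Matrices of bases and multipliers *)

Lemma basis_change_inv (A : comNzRingType) (P : lmodType A) p q (e : 'I_p -> P) (f : 'I_q -> P)
    (U : 'M[A]_(p, q)) (U' : 'M[A]_(q, p)) : module_basis e ->
  (forall j, f j = \sum_i U i j *: e i) -> (forall i, e i = \sum_j U' j i *: f j) ->
  U *m U' = 1%:M.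
Proof.
move=> he hU hU'; apply/trmx_inj/row_matrixP => k; have [u [_ uniq]] := he (e k).
rewrite -[LHS](uniq _ _) -?[RHS](uniq _ _) //.
  rewrite (bigD1 k) //= big1 ?addr0; first by rewrite !mxE eqxx scale1r.
  by move=> i /negPf ik; rewrite !mxE ik scale0r.
rewrite {1}hU' (eq_bigr (fun j => \sum_i (U' j k * U i j) *: e i)); last first.
  by move=> j _; rewrite {1}hU scaler_sumr; apply: eq_bigr => i _; rewrite scalerA.
rewrite exchange_big; apply: eq_bigr => i _; rewrite -scaler_suml !mxE; congr (_ *: _).
by apply: eq_bigr => j _; rewrite mulrC.
Qed.

Lemma Wodd_ext (F : realFieldType) (A : comNzRingType) (c : {rmorphism F -> A}) (X : lmodType A)
    (S : graded c X) it it' k N u :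
  (forall i, (i < N)%N -> it i = it' i) -> Wodd S it k N u -> Wodd S it' k N u.
Proof.
move=> h [q hq]; exists q.
have -> : osum c it' k N q = osum c it k N q; last exact: hq.
by apply: eq_bigr => i _; rewrite h.
Qed.
Lemma Weven_ext (F : realFieldType) (A : comNzRingType) (c : {rmorphism F -> A}) (X : lmodType A)
    (S : graded c X) it it' k N u :
  (forall i, (i < N)%N -> it i = it' i) -> Weven S it k N u -> Weven S it' k N u.
Proof.
move=> h [q hq]; exists q.
have -> : esum c it' k N q = esum c it k N q; last exact: hq.
by apply: eq_bigr => i _; rewrite h.
Qed.

Section ColumnBasis.
Variables (A : comNzRingType) (n p : nat).
Variable f : 'I_p -> 'cV[A]_n.
Hypothesis hf : module_basis f.
Definition columns : 'M[A]_(n, p) := \matrix_(i, j) f j i 0.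

Lemma delta_basis : module_basis (fun i : 'I_n => delta_mx i 0 : 'cV[A]_n).
Proof.
move=> v; exists v^T; split.
  apply/matrixP => i j; rewrite ord1 summxE (bigD1 i) //= big1 ?addr0; first by rewrite !mxE !eqxx mulr1.
  by move=> k /negPf ki; rewrite !mxE eq_sym ki mulr0.
move=> c vc; apply/rowP => i; rewrite mxE vc summxE (bigD1 i) //= big1 ?addr0; first by rewrite !mxE !eqxx mulr1.
by move=> k /negPf ki; rewrite !mxE eq_sym ki mulr0.
Qed.

Lemma columns_inv : exists C : 'M[A]_(p, n), columns *m C = 1%:M /\ C *m columns = 1%:M.
Proof.
have /boolp.choice[c hc] (i : 'I_n) : exists c : 'rV[A]_p, delta_mx i 0 = \sum_j c 0 j *: f j.
  by have [c [hc _]] := hf (delta_mx i 0); exists c.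
pose C := \matrix_(j, i) c i 0 j.
have e1 j : f j = \sum_i columns i j *: (delta_mx i 0 : 'cV[A]_n).
  apply/matrixP => i k; rewrite ord1 summxE (bigD1 i) //= big1 ?addr0; first by rewrite !mxE !eqxx mulr1.
  by move=> l /negPf ki; rewrite !mxE eq_sym ki mulr0.
have e2 i : delta_mx i 0 = \sum_j C j i *: f j.
  by rewrite hc; apply: eq_bigr => j _; rewrite mxE.
exists C; split; first exact: basis_change_inv delta_basis e1 e2.
exact: basis_change_inv hf e2 e1.
Qed.

Lemma columns_size : p = n.
Proof.
have [C [h1 h2]] := columns_inv.
by apply/eqP; rewrite eqn_leq (mulmx1_min h1) (mulmx1_min h2).
Qed.
End ColumnBasis.

Lemma mulmx_inv_scale (F : fieldType) n (M : 'M[F]_n) p (w : 'cV[F]_n) : M \in unitmx ->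
  p *: w = M *m (p *: (invmx M *m w)).
Proof. by move=> hM; rewrite -scalemxAr mulmxA mulmxV // mul1mx. Qed.

Lemma castmx_mul3 (F : fieldType) n p (e : p = n) (L : 'M[F]_(p, n)) (M : 'M_n) (U : 'M_(n, p)) :
  castmx (e, erefl n) L *m M *m castmx (erefl n, e) U = castmx (e, e) (L *m M *m U).
Proof. by move: M L U; case: _ / e => M L U; rewrite !castmx_id. Qed.
Lemma castmx_inv (F : fieldType) n p (e : p = n) (L : 'M[F]_(p, n)) (U : 'M_(n, p)) :
  L *m U = 1%:M -> castmx (e, erefl n) L *m castmx (erefl n, e) U = 1%:M.
Proof. by move: L U; case: _ / e => L U; rewrite !castmx_id. Qed.

Lemma scaled_inverse (F : fieldType) n (B M : 'M[F]_n) p q : p != 0 -> q != 0 ->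
  p *: (M *m B) = q%:M -> p *: (B *m M) = q%:M.
Proof.
move=> p0 q0 h; have e : (M *m ((q^-1 * p) *: B)) = 1%:M.
  by rewrite -scalemxAr -scalerA h scale_scalar_mx mulVf.
have := mulmx1C e; rewrite -scalemxAl -scalerA => /(congr1 (fun N : 'M_n => q *: N)).
by rewrite [q *: (_ *: _)]scalerA mulfV // scale1r => ->; rewrite scale_scalar_mx mulr1.
Qed.

(** From a M B = b and M U = W C one gets a C (c B) = b L; a row of C with the single entry g
    isolates one row of L. *)
Lemma dual_row (F : fieldType) n p (M B : 'M[F]_n) (C : 'M_p) (c L : 'M_(p, n)) (U W : 'M_(n, p)) a b g x :
  a != 0 -> b != 0 -> a *: (M *m B) = b%:M -> M *m U = W *m C -> c *m U = 1%:M -> L *m W = 1%:M ->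
  W *m L = 1%:M ->
  (forall y, C x y = g * (x == y)%:R) -> forall i, g * a * (c *m B) x i = b * L x i.
Proof.
move=> a0 b0 hAB hMU cU LW WL hC i.
have h1 : a *: (c *m B *m W *m C) = b%:M.
  rewrite -mulmxA -hMU mulmxA -[c *m B *m M]mulmxA scalemxAl scalemxAr (scaled_inverse a0 b0 hAB).
  by rewrite mul_mx_scalar -scalemxAl cU scale_scalar_mx mulr1.
have h2 : a *: (C *m (c *m B *m W)) = b%:M by apply: scaled_inverse a0 b0 h1.
have h3 : a *: (C *m (c *m B)) = b *: L.
  transitivity (a *: (C *m (c *m B *m W)) *m L).
    by rewrite -scalemxAl -!mulmxA WL mulmx1.
  by rewrite h2 mul_scalar_mx.
have := congr1 (fun N : 'M_(p, n) => N x i) h3; rewrite mxE [X in a * X = _]mxE [RHS]mxE => <-.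
rewrite (bigD1 x) //= big1 ?addr0; last by move=> y /negPf xy; rewrite hC eq_sym xy mulr0 mul0r.
by rewrite hC eqxx mulr1 mulrA [a * g]mulrC.
Qed.

Lemma mul4 (A : comNzRingType) (k a b c : A) : k * a * (b * c) = k * (b * a) * c.
Proof. by ring. Qed.

Lemma tau_shift (F : fieldType) (x u w : F) (k : int) (a b : nat) : x != 0 ->
  (- x) ^ k * x ^+ a * u = x ^+ b * w ->
  (- x) ^ (k + a%:Z) * ((-1) ^+ a * u) = (-1) ^+ b * w * (- x) ^ (b%:Z).
Proof.
move=> x0; have sgnE m : x ^+ m = (-1) ^+ m * (- x) ^ (m%:Z).
  by rewrite -exprnP (exprNn x) signrMK.
move=> h; rewrite [RHS]mulrAC -(sgnE b) -h (sgnE a) expfzDr ?oppr_eq0 //.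
exact: mul4.
Qed.

(** * The bundle of a transition matrix and the degrees of its generators *)

Section MatrixBundle.
Variable R : realType.
Local Notation K := (ffield R).
Local Notation s := (x_z R).
Local Notation t := (y_z R).
Variables (n : nat) (M : 'M[K]_n) (d : nat).
Hypothesis hM : GL (@R12 R) M.
Hypothesis hd : forall i j, Fil (2 * d).+1 (t ^+ d * M i j).
Local Notation D := d.+1.
Local Notation e := (2 * d).+2.

(** Both charts are embedded in the trivialization over U_2. *)
Definition mk1 (v : 'cV[ring1 R]_n) : 'cV[K]_n := M *m map_mx val v.
Definition mk2 (w : 'cV[ring2 R]_n) : 'cV[K]_n := map_mx val w.

Lemma R12_den (I : finType) (f : I -> K) : (forall i, f i \in @R12 R) ->
  exists k, forall i, t ^+ k * f i \in @R1 R.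
Proof.
move=> h; have /boolp.choice[k hk] i : exists k, t ^+ k * f i \in @R1 R.
  by have /R12P[k hk] := h i; exists k; rewrite mulrC.
exists (\max_i k i) => i.
by rewrite -(subnK (leq_bigmax i : k i <= _)%N) exprD -mulrA rpredM ?rpredX ?y_z_R1.
Qed.

Lemma M_unit : M \in unitmx. Proof. by case: hM. Qed.

(** The matrix that the algorithm works with: it is regular on U_1 and has pole order at most e = 2
    d + 2. *)
Definition mA : 'M[K]_n := t ^+ D *: M.
Lemma mA_Fil i j : Fil e (mA i j).
Proof. by rewrite mxE exprS -mulrA; have := FilM (Fil_t R) (hd i j). Qed.

Lemma mA_inv : exists B : 'M[K]_n, (forall i j, Fil (4 * (n * e)) (B i j)) /\
  mA *m B = (t ^+ (2 * (n * e)))%:M.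
Proof.
have [_ _ hV] := hM.
have [k hk] := R12_den (fun ij : 'I_n * 'I_n => hV ij.1 ij.2).
apply: (@inverse_bound R n mA (t ^+ k *: invmx M) e (D + k) mA_Fil).
  by move=> i j; rewrite mxE; apply: (hk (i, j)).
by rewrite /mA -scalemxAl -scalemxAr mulmxV ?M_unit // scalerA -exprD scale_scalar_mx mulr1.
Qed.

Lemma val1_col (a : ring1 R) (u v : 'cV[ring1 R]_n) :
  map_mx val (a *: u + v) = val a *: map_mx val u + map_mx val v.
Proof. by apply/matrixP => i j; rewrite !mxE. Qed.
Lemma val2_col (a : ring2 R) (u v : 'cV[ring2 R]_n) :
  map_mx val (a *: u + v) = val a *: map_mx val u + map_mx val v.
Proof. by apply/matrixP => i j; rewrite !mxE. Qed.

Lemma matrix_gluing : gluing mk1 mk2 D.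
Proof.
split.
- by move=> a u v; rewrite /mk1 val1_col mulmxDr scalemxAr.
- exact: val2_col.
- move=> u /(congr1 (mulmx (invmx M))); rewrite mulmxA mulVmx ?M_unit // mul1mx mulmx0 => h.
  by apply/matrixP => i j; apply: val_inj; have := congr1 (fun v : 'cV[K]_n => v i j) h; rewrite !mxE.
- move=> w h; apply/matrixP => i j; apply: val_inj.
  by have := congr1 (fun v : 'cV[K]_n => v i j) h; rewrite !mxE.
- move=> v.
  have [k hk] : exists k, forall i, Fil k (t ^+ d * mk1 v i 0).
    have /boolp.choice[k hk] i := R1_Fil (valP (v i 0)).
    exists (\sum_j ((2 * d).+1 + k j))%N => i; rewrite mxE mulr_sumr; apply: Fil_sum => j _.
    rewrite mulrA; apply: (@Fil_le _ ((2 * d).+1 + k j)); first by rewrite (bigD1 j) //= leq_addr.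
    by apply: FilM (hd i j) _; rewrite mxE; apply: hk.
  have h2 i : mk1 v i 0 / t ^+ k \in @R2 R.
    apply/R2P; exists (d + k)%N; rewrite exprD mulrA mulrAC divfK ?tX_neq0 //.
    by rewrite mulrC; apply: Fil_le (hk i); apply: leq_addl.
  exists k, (\col_i (Sub (mk1 v i 0 / t ^+ k) (h2 i) : ring2 R)).
  apply/matrixP => i j; rewrite ord1 [RHS]mxE [X in _ * X]mxE [X in val X]mxE.
  by rewrite [val _]/= mulrC divfK ?tX_neq0.
- move=> w; have [_ _ hV] := hM.
  have [k hk] : exists k, forall i, t ^+ k * (invmx M *m mk2 w) i 0 \in @R1 R.
    apply: R12_den => i; rewrite mxE rpred_sum // => j _; rewrite rpredM ?hV //.
    by rewrite mxE; apply/R2_R12/(valP (w j 0)).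
  exists k, (\col_i (Sub (t ^+ k * (invmx M *m mk2 w) i 0) (hk i) : ring1 R)).
  rewrite /mk1; have -> : map_mx val (\col_i (Sub (t ^+ k * (invmx M *m mk2 w) i 0) (hk i) : ring1 R)) =
      t ^+ k *: (invmx M *m mk2 w).
    by apply/matrixP => i j; rewrite ord1 mxE [X in val X]mxE [RHS]mxE.
  exact: mulmx_inv_scale M_unit.
(* Here t^d M v is regular on U_1 and becomes regular on U_2 after one more factor t; this is why D
   is d + 1. *)
move=> v w h; have e0 i : (t ^+ d *: mk1 v) i 0 = 0.
  have h1 : (t ^+ d *: mk1 v) i 0 \in @R1 R.
    rewrite !mxE mulr_sumr rpred_sum // => j _; rewrite mulrA rpredM //.
      exact: Fil_R1 (hd i j).
    by rewrite mxE; apply: (valP (v j 0)).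
  apply: (@R1_divt_R2 R 0 _ (val (w i 0))) => //; first exact: (valP (w i 0)).
  have := congr1 (fun u : 'cV[K]_n => u i 0) h; rewrite [RHS]mxE => <-.
  by rewrite !mxE expr1 [RHS]mulrC exprSr mulrCA !mulrA mulrC.
have {e0} : mk1 v = 0.
  apply/matrixP => i j; rewrite ord1 [RHS]mxE; have /eqP := e0 i.
  by rewrite mxE mulf_eq0 (negPf (tX_neq0 R d)) /= => /eqP.
move=> /(congr1 (mulmx (invmx M))); rewrite mulmxA mulVmx ?M_unit // mul1mx mulmx0 => h'.
by apply/matrixP => i j; apply: val_inj; have := congr1 (fun v : 'cV[K]_n => v i j) h'; rewrite !mxE.
Qed.

Local Notation S := (glue_graded matrix_gluing).
Local Notation item := (item (pairmod 'cV[ring1 R]_n 'cV[ring2 R]_n)).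
Implicit Types it : nat -> item.

Section Multipliers.
Variables (it : nat -> item) (N : nat) (l : seq int).
Hypothesis lE : l = [seq item_index D (it i) | i <- iota 0 N].
Hypotheses (hi : independent it N) (hs : spanning it N).
Hypothesis hv : forall i, (i < N)%N -> valid S (it i).

Definition Ucol : 'M[K]_(n, csz l) := map_mx val (columns (@basis1 R _ _ it l)).
Definition Wcol : 'M[K]_(n, csz l) := map_mx val (columns (@basis2 R _ _ D it l)).

Lemma multipliers_transition : M *m Ucol = Wcol *m cmx R l.
Proof.
apply/matrixP => i y.
have := congr1 (fun v : 'cV[K]_n => v i 0) (basis_transition lE hv y).
rewrite summxE /mk1 => h.
transitivity ((M *m map_mx val (@basis1 R _ _ it l y)) i 0).
  by rewrite !mxE; apply: eq_bigr => j _; rewrite !mxE.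
by rewrite h mxE; apply: eq_bigr => x _; rewrite [Wcol _ _]mxE [X in val X]mxE [LHS]mxE mulrC [X in X * _]mxE.
Qed.

Lemma U_inverse : exists c : 'M[K]_(csz l, n), [/\ forall x i, c x i \in @R1 R,
  Ucol *m c = 1%:M & c *m Ucol = 1%:M].
Proof.
have [c [h1 h2]] := columns_inv (basis1_basis lE hi hs).
exists (map_mx val c); split; first by move=> x i; rewrite mxE; apply: valP.
  by rewrite -map_mxM h1 map_mx1.
by rewrite -map_mxM h2 map_mx1.
Qed.

Lemma W_inverse : exists c : 'M[K]_(csz l, n), [/\ forall x i, c x i \in @R2 R,
  Wcol *m c = 1%:M & c *m Wcol = 1%:M].
Proof.
have [c [h1 h2]] := columns_inv (basis2_basis lE hi hs).
exists (map_mx val c); split; first by move=> x i; rewrite mxE; apply: valP.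
  by rewrite -map_mxM h1 map_mx1.
by rewrite -map_mxM h2 map_mx1.
Qed.

Lemma csz_rank : csz l = n.
Proof. exact: columns_size (basis1_basis lE hi hs). Qed.

(** At a higher level, [dual_row] equates t^(2 n e) times a row of L with a strictly larger power of
    t times a row regular on U_1. Both rows vanish by degree, but L is invertible. The summand 1 is
    the drop of the exponent in the lower row of an odd block. *)
Lemma level_bound i : (i < N)%N -> (lev (it i) <= 2 * (n * e) + 1)%N.
Proof.
move=> iN; rewrite leqNgt; apply/negP => hlt.
have sl : size l = N by rewrite lE size_map size_iota.
have il : (i < size l)%N by rewrite sl.
pose k := Ordinal il.
have li : l`_k = item_index D (it i) by rewrite /= lE (nth_map 0%N) ?size_iota // nth_iota.
have bs : block_size l`_k = (isodd (it i)).+1 by rewrite li block_size_index.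
(* The last row of the block is chosen because it has a single nonzero entry. *)
have jl : (isodd (it i) < block_size l`_k)%N by rewrite bs.
pose x := pos_of (Ordinal jl).
pose kap : int := (lev (it i))%:Z - D%:Z - (isodd (it i))%:Z.
have hC y : cmx R l x y = (- t) ^ kap * (x == y)%:R.
  have [k' [b ->]] := pos_exists y; rewrite /x cmxE.
  have [e1|ne] := eqVneq k k'; last first.
    case: eqP => [/(congr1 (@item_of _))|_]; last by rewrite mulr0.
    by rewrite !item_pos => e1; rewrite e1 eqxx in ne.
  move: b; rewrite -e1 => b.
  have -> : block_entry R l`_k (Ordinal jl) b = block_entry R (item_index D (it i)) (isodd (it i)) b.
    by rewrite -li.
  rewrite /block_entry index_even /kap.
  have hb := ltn_ord b; rewrite {2}bs in hb.
  have [xb|/eqP xb] := eqVneq (pos_of (Ordinal jl)) (pos_of b).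
    have := congr1 (@part_of _) xb; rewrite !part_pos /= => <-.
    have [ho|ho] /= := boolP (isodd (it i)); rewrite mulr1; first by rewrite index_odd2.
    by rewrite index_even1 // subr0.
  have hne : nat_of_ord b != isodd (it i).
    by apply/eqP => h; case: xb; congr pos_of; apply: val_inj.
  rewrite mulr0; move: hne hb; case: (isodd (it i)) => /=; first by case: (nat_of_ord b) => [|[|]].
  by case: (nat_of_ord b).
have [c [cR cU1 cU]] := U_inverse; have [L [LR WL LW]] := W_inverse.
have [B [hB AB]] := mA_inv.
have hAB : t ^+ D *: (M *m B) = (t ^+ (2 * (n * e)))%:M by rewrite scalemxAl.
have key := dual_row (tX_neq0 R D) (tX_neq0 R _) hAB multipliers_transition cU LW WL hC.
have zero j : (c *m B) x j = 0.
  have h1 : (-1) ^+ D * (c *m B) x j \in @R1 R.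
    by rewrite rpredMsign mxE rpred_sum // => a _; rewrite rpredM ?cR // (Fil_R1 (hB _ _)).
  have h2 : (-1) ^+ (2 * (n * e)) * L x j \in @R2 R by rewrite rpredMsign.
  have h3 : (- t) ^ (kap + D%:Z) * ((-1) ^+ D * (c *m B) x j) =
      (-1) ^+ (2 * (n * e)) * L x j * (- t) ^ ((2 * (n * e))%:Z).
    exact: tau_shift (t_neq0 R) (key j).
  have := tau_vanish h1 h2 _ h3; move/(_ _)/eqP; rewrite mulf_eq0 signr_eq0 /= => h.
  by apply/eqP/h; rewrite /kap; move: hlt; case: (isodd (it i)) => /=; lia.
have L0 j : L x j = 0.
  have := key j; rewrite zero mulr0 => /esym/eqP.
  by rewrite mulf_eq0 (negPf (tX_neq0 _ _)) /= => /eqP.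
have := congr1 (fun N : 'M_(csz l) => N x x) LW; rewrite [RHS]mxE eqxx mxE big1.
  by move/eqP; rewrite eq_sym oner_eq0.
by move=> j _; rewrite L0 mul0r.
Qed.

Definition Umx : 'M[K]_n := castmx (erefl n, csz_rank) Ucol.
Definition Wmx : 'M[K]_n := castmx (erefl n, csz_rank) Wcol.

Lemma GL_Umx : GL (@R1 R) Umx.
Proof.
have [c [cR cU1 cU]] := U_inverse.
have e1 := castmx_inv csz_rank cU; have [e2 e3] := mulmx1_unit e1.
have eV : invmx Umx = castmx (csz_rank, erefl n) c.
  by rewrite -[LHS]mul1mx -e1 -mulmxA mulmxV // mulmx1.
split=> // i j; first by rewrite castmxE mxE; apply: valP.
by rewrite eV castmxE.
Qed.

Lemma GL_Lmx : GL (@R2 R) (invmx Wmx).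
Proof.
have [c [cR cU1 cU]] := W_inverse.
have e1 := castmx_inv csz_rank cU; have [e2 e3] := mulmx1_unit e1.
have eV : invmx Wmx = castmx (csz_rank, erefl n) c.
  by rewrite -[LHS]mul1mx -e1 -mulmxA mulmxV // mulmx1.
split=> [|i j|i j]; first by rewrite unitmx_inv.
  by rewrite eV castmxE.
by rewrite invmxK castmxE mxE; apply: valP.
Qed.

Lemma multipliers_mul : invmx Wmx *m M *m Umx = castmx (csz_rank, csz_rank) (cmx R l).
Proof.
have [c [cR cU1 cU]] := W_inverse.
have e1 := castmx_inv csz_rank cU; have [e2 e3] := mulmx1_unit e1.
have -> : invmx Wmx = castmx (csz_rank, erefl n) c.
  by rewrite -[LHS]mul1mx -e1 -mulmxA mulmxV // mulmx1.
by rewrite castmx_mul3 -mulmxA multipliers_transition mulmxA cU mul1mx.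
Qed.
End Multipliers.

(** A maximal extension could add an item only in the degrees allowed by [level_bound], where
    nothing is missing. *)
Theorem full_of_levels it N : good S it N ->
  (forall k u, (k <= 2 * (n * e) + 1)%N -> (P S k u -> Wodd S it k N u) /\ (G S k u -> Weven S it k N u)) ->
  full S it N.
Proof.
move=> hg hk; have [it' [N' [NN eit hg' hf']]] := full_exists (@good_bound _ _ _ _ _ _ _ matrix_gluing) hg.
move: NN; rewrite leq_eqVlt => /orP[/eqP NN|NN].
  have ext i : (i < N)%N -> it' i = it i by move/eit.
  move=> k u; have [h1 h2] := hf' k u; rewrite -NN in h1 h2.
  by split=> h; [apply: Wodd_ext ext (h1 h) | apply: Weven_ext ext (h2 h)].
have hl := level_bound erefl (good_independent hg') (full_spanning hg' hf') (fun i iN => (hg' i iN).1) NN.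
have [hv hW] := hg' N NN; have [h1 h2] := hk _ (g0 (it' N)) hl; exfalso; move: hW hv; rewrite /valid.
case: ifP => ho hW hv; apply: hW.
  by have [hP _ _ _] := quad_P hv; apply: Wodd_ext eit (h1 hP).
exact: Weven_ext eit (h2 hv).
Qed.
End MatrixBundle.

(** * A structured language for the machine *)

Inductive cexpr :=
  | CE of field_expr
  | CIf of test & cexpr & cexpr.

Inductive sprog :=
  | SSkip
  | SN of nat & nat_expr & nat_expr
  | SF of nat & nat_expr & cexpr
  | SSeq of sprog & sprog
  | SIf of test & sprog & sprog
  | SFor of nat & nat_expr & sprog.

Definition nvar (v : nat) : nat_expr := NRead v (NConst 0).

Section Semantics.
Variables (F : fieldType) (big : nat_expr).
Notation mem := (memory F).

Fixpoint ceval (s : mem) (x : cexpr) : F :=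
  match x with
  | CE e => feval s e
  | CIf b x1 x2 => if teval s b then ceval s x1 else ceval s x2
  end.

Definition setn (a k v : nat) (s : mem) : mem := Memory (update (nmem s) a k v) (fmem s).
Definition setf (a k : nat) (v : F) (s : mem) : mem := Memory (nmem s) (update (fmem s) a k v).

(** Truncated subtraction gives the minimum of e and [big]. Cutting off every loop makes the cost
    bound depend on the program text and [big] alone; that no loop is cut short belongs to the
    correctness proofs. *)
Definition bound (e : nat_expr) : nat_expr := NSub e (NSub e big).

Lemma neval_bound (s : mem) e : neval s (bound e) = minn (neval s e) (neval s big).
Proof. by rewrite /= minnE. Qed.

(** A total semantics, available because all loops are bounded. The array v of a loop holds the
    counter in cell 0 and the bound in cell 1. *)
Fixpoint sem (p : sprog) (s : mem) : mem :=
  match p with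
  | SSkip => s
  | SN a i e => setn a (neval s i) (neval s e) s
  | SF a i x => setf a (neval s i) (ceval s x) s
  | SSeq p q => sem q (sem p s)
  | SIf b p q => if teval s b then sem p s else sem q s
  | SFor v e p =>
      iter (neval s (bound e)) (fun s' => let s'' := sem p s' in setn v 0 (nmem s'' v 0).+1 s'')
        (setn v 0 0 (setn v 1 (neval s (bound e)) s))
  end.

Fixpoint compile_assign (a : nat) (i : nat_expr) (x : cexpr) : program :=
  match x with
  | CE e => FSet a i e
  | CIf b x1 x2 => If b (compile_assign a i x1) (compile_assign a i x2)
  end.

Fixpoint compile (p : sprog) : program :=
  match p with
  | SSkip => Skip
  | SN a i e => NSet a i e
  | SF a i x => compile_assign a i x
  | SSeq p q => Seq (compile p) (compile q)
  | SIf b p q => If b (compile p) (compile q)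
  | SFor v e p => Seq (NSet v (NConst 1) (bound e)) (Seq (NSet v (NConst 0) (NConst 0))
      (While (TLeq (NAdd (nvar v) (NConst 1)) (NRead v (NConst 1)))
        (Seq (compile p) (NSet v (NConst 0) (NAdd (nvar v) (NConst 1))))))
  end.

Fixpoint nwrites (p : sprog) : seq nat :=
  match p with
  | SN a _ _ => [:: a]
  | SSeq p q | SIf _ p q => nwrites p ++ nwrites q
  | SFor v _ p => v :: nwrites p
  | _ => [::]
  end.
Fixpoint fwrites (p : sprog) : seq nat :=
  match p with
  | SF a _ _ => [:: a]
  | SSeq p q | SIf _ p q => fwrites p ++ fwrites q
  | SFor _ _ p => fwrites p
  | _ => [::]
  end.

(* A loop body may change neither its own counter nor the arrays 0 and 1, in
   which the size of the input is kept. *)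
Fixpoint wf (p : sprog) : bool :=
  match p with
  | SN a _ _ => 1 < a
  | SSeq p q | SIf _ p q => wf p && wf q
  | SFor v _ p => [&& 1 < v, v \notin nwrites p & wf p]
  | _ => true
  end%N.

Lemma sem_nframe p (s : mem) a : a \notin nwrites p -> nmem (sem p s) a = nmem s a.
Proof.
elim: p s => //= [a' i e|p IHp q IHq|b p IHp q IHq|v e p IHp] s.
- by rewrite inE /setn /= /update => /negPf h; apply/boolp.funext => k; rewrite h.
- by rewrite mem_cat negb_or => /andP[hp hq]; rewrite IHq // IHp.
- by rewrite mem_cat negb_or => /andP[hp hq]; case: ifP => _; [apply: IHp | apply: IHq].
rewrite inE negb_or => /andP[/negPf av hp].
have hset k w s' : nmem (setn v k w s') a = nmem s' a.
  by apply/boolp.funext => j; rewrite /setn /= /update av.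
set s1 := setn v 0 0 _; have h1 : nmem s1 a = nmem s a by rewrite /s1 !hset.
move: s1 h1 => s1 h1; elim: (_ - _)%N => [|m IH] //.
by rewrite iterS hset IHp.
Qed.

Lemma sem_fframe p (s : mem) a : a \notin fwrites p -> fmem (sem p s) a = fmem s a.
Proof.
elim: p s => //= [a' i e|p IHp q IHq|b p IHp q IHq|v e p IHp] s.
- by rewrite inE /setf /= /update => /negPf h; apply/boolp.funext => k; rewrite h.
- by rewrite mem_cat negb_or => /andP[hp hq]; rewrite IHq // IHp.
- by rewrite mem_cat negb_or => /andP[hp hq]; case: ifP => _; [apply: IHp | apply: IHq].
move=> hp; set s1 := setn v 0 0 _; have h1 : fmem s1 a = fmem s a by [].
move: s1 h1 => s1 h1; elim: (_ - _)%N => [|m IH] //.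
by rewrite iterS /= IHp.
Qed.

Lemma wf_nwrites p a : wf p -> (a <= 1)%N -> a \notin nwrites p.
Proof.
move=> + a1; elim: p => //= [b i e|p IHp q IHq|b p IHp q IHq|v e p IHp].
- by move=> h; rewrite inE; apply/negP => /eqP ab; move: h; rewrite -ab ltnNge a1.
- by move=> /andP[/IHp h1 /IHq h2]; rewrite mem_cat negb_or h1.
- by move=> /andP[/IHp h1 /IHq h2]; rewrite mem_cat negb_or h1.
move=> /and3P[h1 _ /IHp h2]; rewrite inE negb_or h2 andbT.
by apply/negP => /eqP ab; move: h1; rewrite -ab ltnNge a1.
Qed.

(** The invariant rule. That the body does not write v keeps the counter, so it need not be part of
    the invariant. *)
Lemma for_ind (Inv : nat -> mem -> Prop) v e p (s : mem) : v \notin nwrites p ->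
  let B := neval s (bound e) in
  Inv 0%N (setn v 0 0 (setn v 1 B s)) ->
  (forall k s', (k < B)%N -> nmem s' v 0 = k -> Inv k s' -> Inv k.+1 (setn v 0 k.+1 (sem p s'))) ->
  Inv B (sem (SFor v e p) s).
Proof.
move=> hv B h0 hS; rewrite /sem -/sem -/B.
suff h m : (m <= B)%N -> let s' := iter m (fun s' => let s'' := sem p s' in setn v 0 (nmem s'' v 0).+1 s'')
    (setn v 0 0 (setn v 1 B s)) in nmem s' v 0 = m /\ Inv m s'.
  by case: (h B (leqnn B)).
elim: m => [|m IH] mB; first by split; rewrite // /setn /= /update !eqxx.
have [e1 h1] := IH (ltnW mB); rewrite iterS.
set s' := iter m _ _ in e1 h1 *.
have e2 : nmem (sem p s') v 0 = m by rewrite sem_nframe // e1.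
split; first by rewrite /setn /= /update !eqxx e2.
by rewrite /= e2; apply: hS.
Qed.

Fixpoint ccost (x : cexpr) : nat :=
  match x with
  | CE e => fcost e
  | CIf b x1 x2 => tcost b + (ccost x1 + ccost x2)
  end%N.

(** The field operations in the text, both branches of a test included. With [depth] nested loops
    the cost is at most weight times the [depth]-th power of big + 1. *)
Fixpoint weight (p : sprog) : nat :=
  match p with
  | SF _ _ x => ccost x
  | SSeq p q => weight p + weight q
  | SIf b p q => tcost b + (weight p + weight q)
  | SFor _ _ p => weight p
  | _ => 0
  end%N.
Fixpoint depth (p : sprog) : nat :=
  match p with
  | SSeq p q | SIf _ p q => maxn (depth p) (depth q)
  | SFor _ _ p => (depth p).+1
  | _ => 0
  end%N.

Lemma compile_assign_exec a i x (s : mem) : exists2 k, (k <= ccost x)%N &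
  exec (compile_assign a i x) s k (setf a (neval s i) (ceval s x) s).
Proof.
elim: x => [e|b x1 [k1 h1 e1] x2 [k2 h2 e2]] /=; first by exists (fcost e) => //; constructor.
have [hb|hb] := boolP (teval s b).
  exists (tcost b + k1)%N; first by rewrite leq_add2l (leq_trans h1) // leq_addr.
  by constructor; rewrite hb.
exists (tcost b + k2)%N; first by rewrite leq_add2l (leq_trans h2) // leq_addl.
by constructor; rewrite (negPf hb).
Qed.

Hypothesis big_input : forall s s' : mem, nmem s 0 = nmem s' 0 -> nmem s 1 = nmem s' 1 ->
  neval s big = neval s' big.

Lemma compile_exec p (s : mem) : wf p -> exists2 k,
  (k <= weight p * (neval s big).+1 ^ depth p)%N & exec (compile p) s k (sem p s).
Proof.
elim: p s => [|a i e|a i x|p IHp q IHq|b p IHp q IHq|v e p IHp] s /=.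
- by exists 0%N => //; constructor.
- by exists 0%N => //; constructor.
- by move=> _; have [k h1 h2] := compile_assign_exec a i x s; exists k; rewrite // muln1.
- move=> /andP[wp wq]; have [k h1 h2] := IHp s wp; have [l h3 h4] := IHq (sem p s) wq.
  exists (k + l)%N; last by apply: exec_seq h2 h4.
  have eb : neval (sem p s) big = neval s big by apply: big_input; rewrite sem_nframe // wf_nwrites.
  rewrite eb in h3; rewrite mulnDl leq_add //.
    by rewrite (leq_trans h1) // leq_mul2l leq_pexp2l ?leq_maxl ?orbT.
  by rewrite (leq_trans h3) // leq_mul2l leq_pexp2l ?leq_maxr ?orbT.
- move=> /andP[wp wq]; have B1 j : (0 < (neval s big).+1 ^ j)%N by rewrite expn_gt0.
  have [hb|hb] := boolP (teval s b).
    have [k h1 h2] := IHp s wp; exists (tcost b + k)%N; last by constructor; rewrite hb.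
    rewrite mulnDl leq_add ?leq_pmulr //.
    rewrite (leq_trans h1) // leq_mul ?leq_addr // leq_pexp2l ?leq_maxl //.
  have [k h1 h2] := IHq s wq; exists (tcost b + k)%N; last by constructor; rewrite (negPf hb).
  rewrite mulnDl leq_add ?leq_pmulr //.
  by rewrite (leq_trans h1) // leq_mul ?leq_addl // leq_pexp2l ?leq_maxr.
move=> /and3P[v1 vp wp].
set B := (neval s e - _)%N; set s1 := setn v 0 0 (setn v 1 B s).
set loop := While _ _; set step := fun s' : mem => setn _ _ _ _.
have hn (a k w : nat) (s' : mem) : nmem (setn a k w s') =2 update (nmem s') a k w by [].
have Bbig : (B <= neval s big)%N by rewrite /B -minnE geq_minr.
have inv m : (m <= B)%N -> [/\ nmem (iter m step s1) v 0 = m, nmem (iter m step s1) v 1 = B &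
    neval (iter m step s1) big = neval s big].
  elim: m => [|m IH] mB.
    rewrite /= /s1; split; rewrite ?hn /update ?eqxx //=.
    by apply: big_input; apply/boolp.funext => k; rewrite !hn /update !hn /update ltn_eqF // ltnW.
  have [e0 e1 e2] := IH (ltnW mB); rewrite iterS /step.
  have f0 k : nmem (sem p (iter m step s1)) v k = nmem (iter m step s1) v k by rewrite sem_nframe.
  split; rewrite ?hn /update ?eqxx /= ?f0 ?e0 //.
  rewrite -e2; apply: big_input; apply/boolp.funext => k;
    by rewrite hn /update ltn_eqF ?(ltnW v1) //= sem_nframe // wf_nwrites.
(* Induction on the number m of iterations still to come, because [exec_while] unfolds a loop from
   its front. *)
suff run m : (m <= B)%N -> exists2 k, (k <= m * (weight p * (neval s big).+1 ^ depth p))%N &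
    exec loop (iter (B - m) step s1) k (iter B step s1).
  have [k h1 h2] := run B (leqnn B); rewrite subnn /= in h2.
  exists (0 + (0 + k))%N; last by apply: exec_seq; [constructor | apply: exec_seq; [constructor | exact: h2]].
  by rewrite !add0n (leq_trans h1) // expnS mulnCA leq_mul // leq_mul // leqW.
elim: m => [|m IH] mB.
  rewrite subn0; have [e0 e1 _] := inv B (leqnn B).
  exists (0 + 0)%N => //; apply: exec_while; rewrite /= e0 e1 addn1 ltnn; constructor.
have mB' : (B - m.+1 < B)%N by rewrite ltn_subrL; apply: leq_ltn_trans mB.
have [e0 e1 e2] := inv _ (ltnW mB').
have [k h1 h2] := IH (ltnW mB); have [l h3 h4] := IHp (iter (B - m.+1) step s1) wp.
rewrite e2 in h3.
exists (0 + ((l + 0) + k))%N; last first.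
  apply: exec_while; rewrite /= e0 e1 addn1 mB' /=.
  apply: exec_seq; last exact: h2.
  apply: exec_seq; first exact: h4.
  have -> : (B - m)%N = (B - m.+1).+1 by rewrite subnSK.
  rewrite iterS {2}/step.
  set s' := sem p _; have -> : (nmem s' v 0).+1 = (nmem s' v 0 + 1)%N by rewrite addn1.
  exact: exec_nset.
by rewrite add0n addn0 mulSn leq_add.
Qed.

Lemma sem_seq p q (s : mem) : sem (SSeq p q) s = sem q (sem p s). Proof. by []. Qed.
End Semantics.

Declare Scope sprog_scope.
Delimit Scope sprog_scope with S.
Notation "p ;; q" := (SSeq p q) (at level 60, right associativity) : sprog_scope.

(* Meaningful on the expressions singled out by npolynomial below: differences
   and quotients are sent to 0. *)
Fixpoint nat_expr_poly (e : nat_expr) : {poly {poly nat}} :=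
  match e with
  | NConst k => k%:R
  | NRead a _ => if a == 0%N then 'X else 'X%:P
  | NAdd e1 e2 => nat_expr_poly e1 + nat_expr_poly e2
  | NMul e1 e2 => nat_expr_poly e1 * nat_expr_poly e2
  | _ => 0
  end.
Fixpoint npolynomial (e : nat_expr) : bool :=
  match e with
  | NConst _ => true
  | NRead a i => (a <= 1)%N && (if i is NConst 0 then true else false)
  | NAdd e1 e2 | NMul e1 e2 => npolynomial e1 && npolynomial e2
  | _ => false
  end.

Lemma npolyE (F : fieldType) (s : memory F) e : npolynomial e ->
  neval s e = (nat_expr_poly e).[(nmem s 0 0)%:P].[nmem s 1 0].
Proof.
elim: e => //= [k|a i IHi|e1 IH1 e2 IH2|e1 IH1 e2 IH2].
- by rewrite -polyC_natr hornerC -polyC_natr hornerC natn.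
- case: i IHi => [[|k]|||||] //=; rewrite ?andbF // => _; rewrite andbT.
  by case: a => [|[|a]] //= _; rewrite ?hornerX ?hornerC ?hornerX.
- by move=> /andP[/IH1 -> /IH2 ->]; rewrite !hornerD.
- by move=> /andP[/IH1 -> /IH2 ->]; rewrite !hornerM.
Qed.

Lemma npoly_input (F : fieldType) e : npolynomial e -> forall s s' : memory F,
  nmem s 0 = nmem s' 0 -> nmem s 1 = nmem s' 1 -> neval s e = neval s' e.
Proof. by move=> he s s' e0 e1; rewrite !npolyE // e0 e1. Qed.

(** * Linear systems over the chart ring *)

Definition xn0 : nat_expr := NRead 0 (NConst 0).
Definition xd0 : nat_expr := NRead 1 (NConst 0).
Definition NMod a b := NSub a (NMul (NDiv a b) b).

(* Every kernel vector of interest has polynomial coefficients of degree at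
   most 4 h + 3; the unknowns of a linear system are four vectors of length n
   over R_1, each entry with two polynomials. *)
Definition szh (n d : nat) : nat := (n * (2 * d + 2))%N.
Definition szE n d : nat := (4 * szh n d + 4)%N.
Definition szQ n d : nat := (2 * szE n d + 2)%N.
Definition szV n d : nat := (8 * (n * szE n d))%N.

Definition xh0 := NMul xn0 (NAdd (NMul (NConst 2) xd0) (NConst 2)).
Definition xE0 := NAdd (NMul (NConst 4) xh0) (NConst 4).
Definition xV0 := NMul (NConst 8) (NMul xn0 xE0).
(** The size expressions are locked so that simplifying an evaluated program does not expand
    them. *)
Definition xbig := locked (NMul xV0 xV0).
Definition xn := locked xn0.
Definition xd := locked xd0.
Definition xh := locked xh0.
Definition xE := locked xE0.
Definition xQ := locked (NAdd (NMul (NConst 2) xE0) (NConst 2)).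
Definition xV := locked xV0.

Section Sizes.
Variable (F : fieldType).
Notation mem := (memory F).

Lemma ceval_if (s : mem) b x1 x2 : ceval s (CIf b x1 x2) = if teval s b then ceval s x1 else ceval s x2.
Proof. by []. Qed.
Lemma feval_read (s : mem) a e : feval s (FRead a e) = fmem s a (neval s e). Proof. by []. Qed.
Lemma feval_sub (s : mem) a b : feval s (FSub a b) = feval s a - feval s b. Proof. by []. Qed.
Lemma fmem_setn a k v (s : mem) : fmem (setn a k v s) = fmem s. Proof. by []. Qed.
Definition feval0 (s : mem) : feval s FZero = 0 := erefl.
Definition sized n d (s : mem) := nmem s 0 0 = n /\ nmem s 1 0 = d.

Lemma neval_const (s : mem) k : neval s (NConst k) = k. Proof. by []. Qed.
Lemma neval_read (s : mem) a e : neval s (NRead a e) = nmem s a (neval s e). Proof. by []. Qed.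
Lemma neval_add (s : mem) a b : neval s (NAdd a b) = (neval s a + neval s b)%N. Proof. by []. Qed.
Lemma neval_sub (s : mem) a b : neval s (NSub a b) = (neval s a - neval s b)%N. Proof. by []. Qed.
Lemma neval_mul (s : mem) a b : neval s (NMul a b) = (neval s a * neval s b)%N. Proof. by []. Qed.
Lemma neval_div (s : mem) a b : neval s (NDiv a b) = (neval s a %/ neval s b)%N. Proof. by []. Qed.
Lemma neval_mod (s : mem) a b : neval s (NMod a b) = (neval s a %% neval s b)%N.
Proof. by rewrite /NMod /= {1}(divn_eq (neval s a) (neval s b)) addKn. Qed.

Lemma neval_n n d (s : mem) : sized n d s -> neval s xn = n. Proof. by case; rewrite /xn -lock. Qed.
Lemma neval_d n d (s : mem) : sized n d s -> neval s xd = d. Proof. by case; rewrite /xd -lock. Qed.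
Lemma neval_h n d (s : mem) : sized n d s -> neval s xh = szh n d.
Proof. by case=> h1 h2; rewrite /xh -lock /= h1 h2. Qed.
Lemma neval_E n d (s : mem) : sized n d s -> neval s xE = szE n d.
Proof. by case=> h1 h2; rewrite /xE -lock /= h1 h2. Qed.
Lemma neval_Q n d (s : mem) : sized n d s -> neval s xQ = szQ n d.
Proof. by case=> h1 h2; rewrite /xQ -lock /= h1 h2. Qed.
Lemma neval_V n d (s : mem) : sized n d s -> neval s xV = szV n d.
Proof. by case=> h1 h2; rewrite /xV -lock /= h1 h2. Qed.
Lemma neval_big n d (s : mem) : sized n d s -> neval s xbig = (szV n d * szV n d)%N.
Proof. by case=> h1 h2; rewrite /xbig -lock /= h1 h2. Qed.

Definition sizeE n d (s : mem) (h : sized n d s) :=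
  (neval_n h, neval_d h, neval_h h, neval_E h, neval_Q h, neval_V h).
Definition nevalE := (neval_mod, neval_const, neval_read, neval_add, neval_sub, neval_mul, neval_div).

Notation sem := (sem xbig).

Lemma sized_eq n d (s s' : mem) : nmem s' 0 = nmem s 0 -> nmem s' 1 = nmem s 1 ->
  sized n d s -> sized n d s'.
Proof. by rewrite /sized => -> ->. Qed.

Lemma sized_sem n d p (s : mem) : wf p -> sized n d s -> sized n d (sem p s).
Proof. by move=> wp; apply: sized_eq; rewrite sem_nframe // wf_nwrites. Qed.

Lemma neval_bound_small (s : mem) e : (neval s e <= neval s xbig)%N -> neval s (bound xbig e) = neval s e.
Proof. by move=> h; rewrite neval_bound; apply/minn_idPl. Qed.

Definition TAB (v a : nat) (N : nat_expr) (x : cexpr) : sprog := SFor v N (SF a (nvar v) x).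

(** The expression may read the array a itself at places not yet overwritten, which allows updates
    in place. *)
Lemma tab_spec v a N x (s : mem) (f : nat -> F) NN : neval s N = NN -> (NN <= neval s xbig)%N ->
  (forall s' k, (k < NN)%N -> (forall b, b != v -> nmem s' b = nmem s b) -> nmem s' v 0 = k ->
     (forall c, c != a -> fmem s' c = fmem s c) -> (forall j, (k <= j)%N -> fmem s' a j = fmem s a j) ->
     ceval s' x = f k) ->
  forall k, fmem (sem (TAB v a N x) s) a k = if (k < NN)%N then f k else fmem s a k.
Proof.
move=> hN hb hx.
pose Inv k (s' : mem) := [/\ (forall b, b != v -> nmem s' b = nmem s b),
  (forall c, c != a -> fmem s' c = fmem s c) &
  (forall j, fmem s' a j = if (j < k)%N then f j else fmem s a j)].
have set_other k w (s' : mem) b : b != v -> nmem (setn v k w s') b = nmem s' b.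
  by move=> /negPf bv; apply/boolp.funext => j; rewrite /setn /= /update bv.
suff : Inv (neval s (bound xbig N)) (sem (TAB v a N x) s).
  by rewrite neval_bound_small hN //; case.
apply: (for_ind (Inv := Inv)) => // [|k s' kN vk [i1 i2 i3]].
  by split=> // b bv; rewrite !set_other.
rewrite neval_bound_small hN // in kN.
split=> [b bv|c ca|j]; first by rewrite set_other //= i1.
- by rewrite /= /update; apply/boolp.funext => j; rewrite (negPf ca) i2.
rewrite /= /update eqxx /= vk; case: (eqVneq j k) => [->|jk].
  by rewrite ltnSn (hx s' k) // => j' kj; rewrite i3 ltnNge kj.
by rewrite i3 [in RHS]ltnS [in RHS]leq_eqVlt (negPf jk).
Qed.

Lemma tab_nframe v a N x (s : mem) b : b != v -> nmem (sem (TAB v a N x) s) b = nmem s b.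
Proof. by move=> bv; rewrite sem_nframe //= inE. Qed.
Lemma tab_fframe v a N x (s : mem) c : c != a -> fmem (sem (TAB v a N x) s) c = fmem s c.
Proof. by move=> ca; rewrite sem_fframe //= inE. Qed.
End Sizes.

(** * Elimination by one vector at a time *)

Definition mxof (F : fieldType) N (f : nat -> F) : 'M[F]_N := \matrix_(i < N, j < N) f (i * N + j)%N.
Definition cvof (F : fieldType) N (f : nat -> F) : 'cV[F]_N := \col_(i < N) f i.
Definition rvof (F : fieldType) N (f : nat -> F) : 'rV[F]_N := \row_(i < N) f i.

(* Field arrays: 12 is a vector b, 13 becomes K b, and 14 the row of K at the
   last place where K b does not vanish, normalized. *)
Definition STEP_DOT (K : nat) : sprog :=
  SFor 14 xV (SF 13 (nvar 13) (CE (FAdd (FRead 13 (nvar 13))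
    (FMul (FRead K (NAdd (NMul (nvar 13) xV) (nvar 14))) (FRead 12 (nvar 14)))))).
Definition STEP_VALUE (K : nat) : sprog :=
  SFor 13 xV (SSeq (SF 13 (nvar 13) (CE FZero)) (STEP_DOT K)).
Definition STEP_PIVOT : sprog :=
  SSeq (SN 16 (NConst 0) (NConst 0))
    (SFor 13 xV (SIf (TZero (FRead 13 (nvar 13))) SSkip (SN 16 (NConst 0) (nvar 13)))).
Definition STEP (K : nat) : sprog :=
  (STEP_VALUE K ;; STEP_PIVOT ;;
   TAB 13 14 xV (CE (FDiv (FRead K (NAdd (NMul (nvar 16) xV) (nvar 13))) (FRead 13 (nvar 16)))) ;;
   TAB 13 K (NMul xV xV) (CE (FSub (FRead K (nvar 13))
     (FMul (FRead 13 (NDiv (nvar 13) xV)) (FRead 14 (NMod (nvar 13) xV))))))%S.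

Section Step.
Variables (F : fieldType) (n d : nat).
Hypothesis n0 : (0 < n)%N.
Notation mem := (memory F).
Notation sem := (sem xbig).
Notation sized := (@sized F n d).
Local Notation N := (szV n d).

Lemma szV_gt0 : (0 < N)%N.
Proof. by rewrite /szV /szE !muln_gt0 n0 addn_gt0 orbT. Qed.

Lemma bound_V (s : mem) : sized s -> neval s (bound xbig xV) = N.
Proof.
move=> h; have b : (N <= N * N)%N by rewrite leq_pmulr // szV_gt0.
by rewrite neval_bound_small (neval_V h) // (neval_big h).
Qed.

Lemma step_value K (s : mem) : sized s -> K != 13%N -> K != 12%N ->
  let s' := sem (STEP_VALUE K) s in
  forall i, (i < N)%N -> fmem s' 13 i = \sum_(j < N) fmem s K (i * N + j) * fmem s 12 j.
Proof.
move=> hs K13 K12; rewrite /STEP_VALUE.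
pose Inv k (s' : mem) := [/\ sized s', fmem s' K = fmem s K, fmem s' 12 = fmem s 12 &
  forall i, (i < k)%N -> fmem s' 13 i = \sum_(j < N) fmem s K (i * N + j) * fmem s 12 j].
set p := SSeq _ _; suff : Inv (neval s (bound xbig xV)) (sem (SFor 13 xV p) s).
  by rewrite bound_V //; case.
apply: (for_ind (Inv := Inv)) => // k s' kN vk [i0 i1 i2 i3]; rewrite bound_V // in kN.
rewrite /p sem_seq; set s1 := sem (SF _ _ _) s'.
pose Inv2 l (s2 : mem) := [/\ sized s2, nmem s2 13 = nmem s' 13, fmem s2 K = fmem s K, fmem s2 12 = fmem s 12 &
  fmem s2 13 = update (fmem s') 13 k (\sum_(j < l) fmem s K (k * N + j) * fmem s 12 j) 13].
have h1 : sized s1 by [].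
suff : Inv2 (neval s1 (bound xbig xV)) (sem (STEP_DOT K) s1).
  rewrite bound_V //; set s2 := sem _ _; case=> a0 a1 a2 a3 a4; split=> // i.
  rewrite ltnS leq_eqVlt => /predU1P[->|ik]; first by rewrite /= a4 /update !eqxx.
  by rewrite /= a4 /update (ltn_eqF ik) andbF i3.
apply: (for_ind (Inv := Inv2)) => //.
  split=> //; apply/boolp.funext => j; rewrite /s1 /= /update ?eqxx ?(negPf K13) ?i1 ?i2 //.
  by rewrite big_ord0 vk.
move=> l s2 lN vl [a0 a1 a2 a3 a4].

split=> //.
  by apply/boolp.funext => j; rewrite /= /update (negPf K13) a2.
apply/boolp.funext => j; rewrite [sem _ _]/= /setf /setn [fmem _ _]/= /update eqxx /=.
rewrite a1 vk vl (sizeE a0) a2 a3 a4 /update eqxx /=.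
by case: (j == k) => //; rewrite big_ord_recr.
Qed.

Lemma step_pivot (s : mem) : sized s ->
  let s' := sem STEP_PIVOT s in
  (nmem s' 16 0 < N)%N /\
  (fmem s 13 (nmem s' 16 0) != 0 \/ forall i, (i < N)%N -> fmem s 13 i = 0).
Proof.
move=> hs; rewrite /STEP_PIVOT sem_seq.
set s0 := sem (SN 16 _ _) s.
have h0 : sized s0 by [].
pose Inv k (s' : mem) := [/\ sized s', fmem s' 13 = fmem s 13, (nmem s' 16 0 < N)%N &
  fmem s 13 (nmem s' 16 0) != 0 \/ forall i, (i < k)%N -> fmem s 13 i = 0].
set p := SIf _ _ _; suff : Inv (neval s0 (bound xbig xV)) (sem (SFor 13 xV p) s0).
  by rewrite bound_V //; case.
apply: (for_ind (Inv := Inv)) => // [|k s' kN vk [i0 i1 i2 i3]].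
  by split=> //; [rewrite /= szV_gt0 | right].
rewrite bound_V // in kN.
rewrite /p [sem _ _]/= vk i1; case: eqP => hk; split=> //.
- case: i3 => [|i3]; [by left | right=> i].
  by rewrite ltnS leq_eqVlt => /predU1P[->|/i3].
by left; apply/eqP.
Qed.

(** If K b = 0, the normalization divides by zero, which gives 0, and K is unchanged; the
    disjunction keeps this case apart. *)
Lemma step_spec K (s : mem) : sized s -> K \in [:: 15; 16]%N ->
  let k := mxof N (fmem s K) in let b := cvof N (fmem s 12) in
  let s' := sem (STEP K) s in
  exists p : 'I_N, [/\ nmem s' 16 0 = p, (k *m b) p 0 != 0 \/ k *m b = 0,
    fmem s' 13 p = (k *m b) p 0,
    rvof N (fmem s' 14) = ((k *m b) p 0)^-1 *: row p k &
    mxof N (fmem s' K) = k - (k *m b) *m (((k *m b) p 0)^-1 *: row p k)].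
Proof.
move=> hs hK k b.
have [K12 K13 K14] : [/\ K != 12%N, K != 13%N & K != 14%N].
  by move: hK; rewrite !inE => /orP[] /eqP ->.
rewrite /STEP sem_seq; set s1 := sem (STEP_VALUE K) s.
have hs1 : sized s1 by apply: sized_sem.
have f1 a : a != 13%N -> fmem s1 a = fmem s a.
  by move=> ha; rewrite sem_fframe //= !inE (negPf ha).
have v1 := step_value hs K13 K12; rewrite -/s1 in v1.
have vk i : fmem s1 13 (i : 'I_N) = (k *m b) i 0.
  rewrite (v1 i) // mxE; apply: eq_bigr => j _; by rewrite !mxE.
rewrite sem_seq; set s2 := sem STEP_PIVOT s1; rewrite sem_seq.
have hs2 : sized s2 by apply: sized_sem.
have f2 a : fmem s2 a = fmem s1 a by rewrite sem_fframe.
have [pN pV] := step_pivot hs1; rewrite -/s2 in pN pV.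
pose p := Ordinal pN.
set p3 := TAB 13 14 _ _; set s3 := sem p3 s2; set p4 := TAB 13 K _ _.
have hs3 : sized s3 by apply: sized_sem.
have VV : (N <= N * N)%N by rewrite leq_pmulr // szV_gt0.
have kp i : (i < N)%N -> fmem s1 K (p * N + i) = fmem s K (p * N + i) by move=> _; rewrite f1.
have v3 i : fmem s3 14 i = if (i < N)%N then fmem s K (p * N + i) / (k *m b) p 0 else fmem s2 14 i.
  apply: (tab_spec (NN := N) (f := fun i => fmem s K (p * N + i) / (k *m b) p 0));
    rewrite ?(sizeE hs2) ?(neval_big hs2) // => s' j jN g1 g2 g3 _.
  have hs' : sized s' by apply: sized_eq hs2; rewrite g1.
  by rewrite /= -!/(nvar _) (sizeE hs') /= g2 (g1 16%N) // !g3 // !f2 f1 // (vk p).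
have r3 : rvof N (fmem s3 14) = ((k *m b) p 0)^-1 *: row p k.
  by apply/rowP => j; rewrite mxE v3 ltn_ord [RHS]mxE [row _ _ _ _]mxE [X in _ = _ * X]mxE [RHS]mulrC.
have v4 i : fmem (sem p4 s3) K i = if (i < N * N)%N then
    fmem s K i - fmem s1 13 (i %/ N) * fmem s3 14 (i %% N) else fmem s3 K i.
  apply: (tab_spec (NN := N * N) (f := fun i => fmem s K i - fmem s1 13 (i %/ N) * fmem s3 14 (i %% N)));
    rewrite ?nevalE ?(sizeE hs3) ?(neval_big hs3) // => s' j jN g1 g2 g3 g4.
  have hs' : sized s' by apply: sized_eq hs3; rewrite g1.
  have f3 : fmem s3 K = fmem s K by rewrite tab_fframe // f2 f1.
  rewrite /ceval /feval -/feval /nvar !nevalE (sizeE hs') g2 g4 // f3 !g3 1?eq_sym //.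
  by rewrite tab_fframe // f2.
exists p; split.
- by rewrite !tab_nframe.
- case: pV => [|h0]; first by rewrite (vk p); left.
  by right; apply/colP => i; rewrite -vk h0 // mxE.
- by rewrite !tab_fframe // 1?eq_sym // f2 vk.
- by rewrite -r3; apply/rowP => j; rewrite !mxE tab_fframe // 1?eq_sym.
apply/matrixP => i j; rewrite -r3 mxE v4 (_ : (i * N + j < N * N)%N); last first.
  by rewrite (leq_trans (n := i.+1 * N)) ?leq_mul2r ?ltn_ord ?orbT // mulSn addnC ltn_add2r.
rewrite divnMDl ?szV_gt0 // modnMDl divn_small // modn_small // addn0.
by rewrite (vk i) !mxE big_ord1 !mxE.
Qed.
End Step.

Section StepAlgebra.
Variables (F : fieldType) (N : nat) (k : 'M[F]_N) (b : 'cV[F]_N) (p : 'I_N).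
Local Notation val := (k *m b).
Local Notation out := ((val p 0)^-1 *: row p k).
Local Notation k' := (k - val *m out).
Hypothesis hp : val p 0 != 0 \/ val = 0.

Lemma out_b : val != 0 -> out *m b = 1%:M.
Proof.
case: hp => [h _|->]; last by rewrite eqxx.
rewrite -scalemxAl -row_mul; apply/matrixP => i j.
by rewrite !ord1 mxE [row _ _ _ _]mxE mulVf // !mxE.
Qed.

(** The step read on the left: the row space of K is cut down to what b annihilates. With b an
    equation this solves a linear system. *)
Lemma step_rows (x : 'rV[F]_N) : (x <= k')%MS <-> (x <= k)%MS /\ x *m b = 0.
Proof.
have out_k : (out <= k)%MS by rewrite scalemx_sub // row_sub.
have [v0|v0] := eqVneq val 0.
  rewrite v0 mul0mx subr0; split=> [h|[]//]; split=> //.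
  by move/submxP: h => [y ->]; rewrite -mulmxA v0 mulmx0.
have ob := out_b v0.
split=> [/submxP[y ->]|[/submxP[y ->] yb]].
  split; first by rewrite mulmxBr addmx_sub ?submxMl // eqmx_opp mulmxA mulmx_sub.
  by rewrite mulmxBr mulmxBl -!mulmxA ob mulmx1 subrr.
apply/submxP; exists y; rewrite mulmxBr mulmxA [y *m val]mulmxA yb mul0mx subr0 //.
Qed.

(** The same step read on the right: the kernel of K grows by b. With b a vector this enlarges a
    span, and K b = 0 tests membership. *)
Lemma step_kernel (v : 'cV[F]_N) : k' *m v = 0 <-> exists a, k *m (v - a *: b) = 0.
Proof.
split=> [|[a]].
  rewrite mulmxBl -(mulmxA val) [out *m v]mx11_scalar => /eqP; rewrite subr_eq0 => /eqP h.
  by exists ((out *m v) 0 0); rewrite mulmxBr h -scalemxAr mul_mx_scalar subrr.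
rewrite mulmxBr -scalemxAr => /eqP; rewrite subr_eq0 => /eqP h.
rewrite mulmxBl -(mulmxA val) -scalemxAl -row_mul h.
case: hp => [hp1|->]; last by rewrite scaler0 mul0mx subr0.
have -> : (val p 0)^-1 *: row p (a *: val) = a%:M.
  apply/matrixP => i j; rewrite !ord1 mxE [row _ _ _ _]mxE [X in _ * X]mxE mulrCA mulVf //.
  by rewrite mulr1 mxE eqxx.
by rewrite mul_mx_scalar subrr.
Qed.
End StepAlgebra.

(* A system of equations over R_1 in 4 n unknowns has its coefficients in two
   field arrays, szQ coefficients for each entry.  The equation (r, h, q) says
   that the coefficient of x^h t^q in row r vanishes, where x^2 = - (1 + t^2). *)
Section Coefficients.
Variables (F : fieldType) (n d : nat) (y0 y1 : nat -> F).
Local Notation E := (szE n d).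
Local Notation Qn := (szQ n d).

Definition ycoef (y : nat -> F) (rc k q : nat) : F := if (k <= q)%N then y (rc * Qn + (q - k))%N else 0.

(** Indices in mixed radix: the equation is i = (2 r + h) Q + q and the unknown j = (2 c + h') E +
    p. For h = 0 and h' = 1 the square of x contributes two coefficients, at distance 2. *)
Definition bcoef (i j : nat) : F :=
  let q := (i %% Qn)%N in let h := ((i %/ Qn) %% 2)%N in let r := (i %/ Qn %/ 2)%N in
  let p := (j %% E)%N in let h' := ((j %/ E) %% 2)%N in let c := (j %/ E %/ 2)%N in
  let rc := (r * (4 * n) + c)%N in
  if h == 0%N then
    if h' == 0%N then ycoef y0 rc p q else - (ycoef y1 rc p q + ycoef y1 rc (p + 2) q)
  else if h' == 0%N then ycoef y1 rc p q else ycoef y0 rc p q.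
End Coefficients.

Lemma notin_all (l1 l2 : seq nat) a : all (mem l2) l1 -> a \notin l2 -> a \notin l1.
Proof. by move=> /allP h; apply: contra => /h. Qed.

Section Build.
Variables (y0 y1 : nat).
Local Notation i := (nvar 17).
Local Notation j := (nvar 13).
Let q := NMod i xQ.
Let p := NMod j xE.
Let base := NMul (NAdd (NMul (NDiv (NDiv i xQ) (NConst 2)) (NMul (NConst 4) xn)) (NDiv (NDiv j xE) (NConst 2))) xQ.
Let yread y k := FRead y (NAdd base (NSub q k)).
Let ytest y := CIf (TLeq p q) (CE (yread y p)) (CE FZero).
Let p2 := NAdd p (NConst 2).
Let hq := NMod (NDiv i xQ) (NConst 2).
Let hp := NMod (NDiv j xE) (NConst 2).

Definition BUILD : sprog := TAB 13 12 xV
  (CIf (TLeq hq (NConst 0))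
    (CIf (TLeq hp (NConst 0)) (ytest y0)
      (CIf (TLeq p2 q) (CE (FSub (FSub FZero (yread y1 p)) (yread y1 p2)))
        (CIf (TLeq p q) (CE (FSub FZero (yread y1 p))) (CE FZero))))
    (CIf (TLeq hp (NConst 0)) (ytest y1) (ytest y0))).

Lemma build_spec (F : fieldType) n d (s : memory F) k : (0 < n)%N -> sized n d s -> nmem s 17 0 = k ->
  y0 != 12%N -> y1 != 12%N ->
  cvof (szV n d) (fmem (sem xbig BUILD s) 12) =
    \col_(j < szV n d) bcoef n d (fmem s y0) (fmem s y1) k j.
Proof.
move=> n0 hs ik y012 y112; apply/colP => c; rewrite !mxE.
rewrite (@tab_spec _ 13 12 xV _ s (bcoef n d (fmem s y0) (fmem s y1) k) (szV n d)) ?ltn_ord ?(sizeE hs) //.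
  by rewrite (neval_big hs) leq_pmulr // szV_gt0.
move=> s' l _ g1 g2 g3 _; have hs' : sized n d s' by apply: sized_eq hs; rewrite g1.
have ei : nmem s' 17 0 = k by rewrite g1.
have eq : neval s' q = (k %% szQ n d)%N by rewrite /q !nevalE ei (sizeE hs').
have ep : neval s' p = (l %% szE n d)%N by rewrite /p !nevalE g2 (sizeE hs').
have eh : neval s' hq = ((k %/ szQ n d) %% 2)%N by rewrite /hq !nevalE ei (sizeE hs').
have eh' : neval s' hp = ((l %/ szE n d) %% 2)%N by rewrite /hp !nevalE g2 (sizeE hs').
have eb : neval s' base = ((k %/ szQ n d %/ 2 * (4 * n) + l %/ szE n d %/ 2) * szQ n d)%N.
  by rewrite /base !nevalE ei g2 !(sizeE hs').
have ey y e : y != 12%N -> feval s' (yread y e) = fmem s y (neval s' base + (neval s' q - neval s' e)).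
  by move=> hy; rewrite /yread /feval !nevalE g3.
have ey2 y : y != 12%N -> ceval s' (ytest y) = ycoef n d (fmem s y)
    (k %/ szQ n d %/ 2 * (4 * n) + l %/ szE n d %/ 2) (l %% szE n d) (k %% szQ n d).
  by move=> hy; rewrite /ytest /ceval /teval ey // ep eq eb.
have e2 : neval s' p2 = (l %% szE n d + 2)%N by rewrite /p2 nevalE ep.
set X := CIf (TLeq p2 q) _ _.
have e3 : ceval s' X = - (ycoef n d (fmem s y1) (k %/ szQ n d %/ 2 * (4 * n) + l %/ szE n d %/ 2) (l %% szE n d) (k %% szQ n d) +
   ycoef n d (fmem s y1) (k %/ szQ n d %/ 2 * (4 * n) + l %/ szE n d %/ 2) (l %% szE n d + 2) (k %% szQ n d)).
  rewrite /X !ceval_if /ceval !feval_sub !ey // /teval e2 ep eq eb /ycoef sub0r.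
  case: leqP => [h2|_]; last by case: ifP => _; rewrite ?addr0 ?oppr0 ?sub0r.
  by rewrite (leq_trans _ h2) ?leq_addr // opprD.
rewrite /bcoef -!ey2 // in e3 *; rewrite -e3 -[LHS]/(if teval s' (TLeq hq (NConst 0))
  then (if teval s' (TLeq hp (NConst 0)) then ceval s' (ytest y0) else ceval s' X)
  else (if teval s' (TLeq hp (NConst 0)) then ceval s' (ytest y1) else ceval s' (ytest y0))).
by rewrite /teval eh eh' !leqn0.
Qed.

Fixpoint guard (l : seq test) (pr : sprog) : sprog :=
  if l is b :: l' then SIf b (guard l' pr) pr else SSkip.

Lemma guardE (F : fieldType) l pr (s : memory F) :
  sem xbig (guard l pr) s = if all (teval s) l then s else sem xbig pr s.
Proof. by elim: l => //= b l ->; case: ifP. Qed.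

Lemma guard_nwrites l pr : {subset nwrites (guard l pr) <= nwrites pr}.
Proof.
elim: l => //= b l IH a; rewrite mem_cat => /orP[/IH|] //.
Qed.
Lemma guard_fwrites l pr : {subset fwrites (guard l pr) <= fwrites pr}.
Proof.
elim: l => //= b l IH a; rewrite mem_cat => /orP[/IH|] //.
Qed.
Lemma guard_wf l pr : wf pr -> wf (guard l pr).
Proof. by move=> h; elim: l => //= b l ->. Qed.

Definition IDENTITY (K : nat) : sprog := TAB 13 K (NMul xV xV)
  (CIf (TLeq (NDiv j xV) (NMod j xV)) (CIf (TLeq (NMod j xV) (NDiv j xV)) (CE FOne) (CE FZero)) (CE FZero)).

Lemma identity_spec (F : fieldType) n d K (s : memory F) : (0 < n)%N -> sized n d s ->
  mxof (szV n d) (fmem (sem xbig (IDENTITY K) s) K) = 1%:M.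
Proof.
move=> n0 hs; set N := szV n d; have N0 : (0 < N)%N by apply: szV_gt0.
apply/matrixP => a b; rewrite !mxE.
have ab : (a * N + b < N * N)%N.
  by rewrite (leq_trans (n := a.+1 * N)) ?leq_mul2r ?ltn_ord ?orbT // mulSn addnC ltn_add2r.
rewrite (@tab_spec _ 13 K (NMul xV xV) _ s (fun l => (l %/ N == l %% N)%N%:R) (N * N)%N)
  ?nevalE ?(sizeE hs) ?(neval_big hs) //; last first.
  move=> s' l _ g1 g2 g3 _; have hs' : sized n d s' by apply: sized_eq hs; rewrite g1.
  rewrite /ceval /teval /feval !nevalE g2 (sizeE hs') -/N eqn_leq.
  by do 2 case: (_ <= _)%N.
by rewrite ab divnMDl // modnMDl divn_small // modn_small // addn0.
Qed.

(** The rows of array 16 start as the identity, whose row space is everything, and are cut down by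
    one equation at a time; equations for which all tests in [skip] hold are left out. *)
Definition KER (rows : nat_expr) (skip : seq test) : sprog :=
  (IDENTITY 16 ;; SFor 17 (NMul rows (NMul (NConst 2) xQ)) (guard skip (BUILD ;; STEP 16)))%S.

Lemma KER_nwrites rows skip : {subset nwrites (KER rows skip) <= [:: 13; 14; 16; 17]%N}.
Proof.
move=> a; rewrite /KER /= !inE => /orP[->//|/orP[->|/guard_nwrites]]; first by rewrite !orbT.
by rewrite /= !inE => /or4P[]; repeat (case/orP || (move=> -> ; rewrite ?orbT)).
Qed.
Lemma KER_fwrites rows skip : {subset fwrites (KER rows skip) <= [:: 12; 13; 14; 16]%N}.
Proof.
move=> a; rewrite /KER /= !inE => /orP[->|/guard_fwrites]; first by rewrite !orbT.
by rewrite /= !inE => /or4P[]; repeat (case/orP || (move=> -> ; rewrite ?orbT)).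
Qed.
Lemma KER_wf rows skip : wf (KER rows skip).
Proof.
rewrite /KER /= guard_wf // andbT; apply/negP => /guard_nwrites; by [].
Qed.

Lemma ker_spec (F : fieldType) n d (s : memory F) rows skip m (sk : pred nat) :
  (0 < n)%N -> sized n d s -> y0 \notin [:: 12; 13; 14; 16]%N -> y1 \notin [:: 12; 13; 14; 16]%N ->
  (forall s' : memory F, sized n d s' -> neval s' rows = m) ->
  (m * (2 * szQ n d) <= szV n d * szV n d)%N ->
  (forall (s' : memory F) i, (forall a, a \notin [:: 13; 14; 16; 17]%N -> nmem s' a = nmem s a) ->
     nmem s' 17 0 = i -> all (teval s') skip = sk i) ->
  forall x : 'rV[F]_(szV n d), (x <= mxof (szV n d) (fmem (sem xbig (KER rows skip) s) 16))%MS <->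
    forall i, (i < m * (2 * szQ n d))%N -> ~~ sk i ->
      \sum_j x 0 j * bcoef n d (fmem s y0) (fmem s y1) i j = 0.
Proof.
move=> n0 hs hy0 hy1 hrows hm hsk x; set N := szV n d; set T := (m * _)%N.
rewrite /KER sem_seq; set s1 := sem _ _ s; set body := guard _ _.
have hs1 : sized n d s1 by apply: sized_sem.
have nm (s' : memory F) k w : nmem (setn 17 k w s') = update (nmem s') 17 k w by [].
have nset k w (s' : memory F) a : a != 17%N -> nmem (setn 17 k w s') a = nmem s' a.
  by move=> /negPf bv; apply/boolp.funext => l; rewrite /setn /= /update bv.
pose Inv k (s' : memory F) := [/\ (forall a, a \notin [:: 13; 14; 16; 17]%N -> nmem s' a = nmem s a),
  (forall a, a \notin [:: 12; 13; 14; 16]%N -> fmem s' a = fmem s a) &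
  forall x : 'rV[F]_N, (x <= mxof N (fmem s' 16))%MS <->
    forall i, (i < k)%N -> ~~ sk i -> \sum_j x 0 j * bcoef n d (fmem s y0) (fmem s y1) i j = 0].
have hT : neval s1 (bound xbig (NMul rows (NMul (NConst 2) xQ))) = T.
  by rewrite neval_bound_small ?nevalE ?(hrows _ hs1) ?(sizeE hs1) ?(neval_big hs1).
suff : Inv (neval s1 (bound xbig (NMul rows (NMul (NConst 2) xQ)))) (sem xbig (SFor 17 (NMul rows (NMul (NConst 2) xQ)) body) s1).
  by rewrite hT => -[_ _]; apply.
apply: (for_ind (Inv := Inv)).
- by apply/negP => /guard_nwrites.
- split=> [a ha|a ha|y]; last by rewrite identity_spec // submx1.
    by rewrite !nset; [rewrite /s1 tab_nframe // |..]; apply: contraNneq ha => ->.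
  by rewrite /= /s1 tab_fframe //; apply: contraNneq ha => ->.
rewrite hT => k s' kT vk [i1 i2 i3].
have hs' : sized n d s' by apply: sized_eq hs; rewrite i1.
rewrite /body guardE (hsk s' k) //.
have next (P : nat -> Prop) : (forall i, (i < k.+1)%N -> ~~ sk i -> P i) <->
    (forall i, (i < k)%N -> ~~ sk i -> P i) /\ (~~ sk k -> P k).
  split=> [h|[h1 h2] i]; first by split=> [i ik|]; apply: h; rewrite // ltnS ltnW.
  by rewrite ltnS leq_eqVlt => /predU1P[->//|]; apply: h1.
case: ifP => skk.
  split=> [a ha|a ha|y]; first by rewrite nset ?i1 //; apply: contraNneq ha => ->.
    by rewrite /= i2.
  by rewrite fmem_setn i3 next; split=> [h|[]//]; split; rewrite ?skk.
rewrite sem_seq; set s2 := sem _ BUILD s'; have hs2 : sized n d s2 by apply: sized_sem.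
have f2 a : a != 12%N -> fmem s2 a = fmem s' a by move=> ha; rewrite /s2 tab_fframe.
have [|piv [_ hpiv _ _ e]] := step_spec n0 hs2 (K := 16%N); first by [].
split=> [a ha|a ha|y].
- rewrite nset; last by apply: contraNneq ha => ->.
  rewrite sem_nframe; last exact: notin_all ha.
  by rewrite /s2 tab_nframe ?i1 //; apply: contraNneq ha => ->.
- rewrite fmem_setn sem_fframe; last exact: notin_all ha.
  by rewrite f2 ?i2 //; apply: contraNneq ha => ->.
rewrite fmem_setn e step_rows // f2 // i3 next // skk.
rewrite (build_spec n0 hs' vk) ?i2 //; last 2 first.
- by apply: contraNneq hy0 => ->.
- by apply: contraNneq hy1 => ->.
have -> : (y *m \col_j0 bcoef n d (fmem s y0) (fmem s y1) k j0 = 0) <->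
    (\sum_j y 0 j * bcoef n d (fmem s y0) (fmem s y1) k j = 0).
  have ex : (y *m \col_j0 bcoef n d (fmem s y0) (fmem s y1) k j0) 0 0 =
      \sum_j y 0 j * bcoef n d (fmem s y0) (fmem s y1) k j.
    by rewrite mxE; apply: eq_bigr => l _; rewrite mxE.
  rewrite -ex; split=> [->|h]; first by rewrite mxE.
  by apply/matrixP => a b; rewrite !ord1 h mxE.
by split=> [[h1 h2]|[h1 h2]]; split=> //; apply: h2.
Qed.
End Build.

(** * Decoding of vectors and equations *)

Lemma sum_nat_digits (V : nmodType) a b (f : nat -> V) :
  \sum_(0 <= j < a * b) f j = \sum_(0 <= i < a) \sum_(0 <= p < b) f (i * b + p)%N.
Proof.
elim: a => [|a IH]; first by rewrite mul0n !big_geq.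
rewrite big_nat_recr //= -IH mulSn addnC (@big_cat_nat _ _ _ (a * b)) ?leq_addr //=.
congr (_ + _); rewrite -[X in \sum_(X <= _ < _) _]add0n big_addn addKn.
by apply: eq_bigr => i _; rewrite addnC.
Qed.

Lemma big_nat2 (V : nmodType) (f : nat -> V) : \sum_(0 <= h < 2) f h = f 0%N + f 1%N.
Proof. by rewrite big_nat_recr // big_nat1. Qed.

Lemma divn_digit a b m : (b < m)%N -> ((a * m + b) %/ m)%N = a.
Proof. by move=> bm; rewrite divnMDl ?divn_small ?addn0 // (leq_ltn_trans _ bm). Qed.
Lemma modn_digit a b m : (b < m)%N -> ((a * m + b) %% m)%N = b.
Proof. by move=> bm; rewrite modnMDl modn_small.
Qed.

Lemma coefM_nat (A : nzRingType) (y x : {poly A}) m q : (size x <= m)%N ->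
  (y * x)`_q = \sum_(0 <= p < m) (if (p <= q)%N then y`_(q - p) * x`_p else 0).
Proof.
move=> xm; rewrite coefMr -big_mkcond /=.
rewrite [RHS](eq_bigl (fun p : nat => (p < q.+1)%N)) //.
rewrite -(big_mkord xpredT (fun p => y`_(q - p) * x`_p)).
have h c (k : nat) : (m <= k)%N -> y`_c * x`_k = 0.
  by move=> mk; rewrite [x`_k]nth_default ?mulr0 // (leq_trans xm).
case: (leqP m q.+1) => mq.
  rewrite (@big_cat_nat _ _ _ m) //= [X in _ + X]big1_seq ?addr0; last first.
    by move=> p; rewrite mem_index_iota => /= /andP[mp _]; apply: h.
  rewrite big_nat_cond [RHS]big_nat_cond; apply: eq_bigl => p; case: (ltnP p m) => // pm.
  by rewrite (leq_trans pm).
rewrite [RHS](@big_cat_nat _ _ _ q.+1) ?(ltnW mq) //= [X in _ = _ + X]big1_seq ?addr0; last first.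
  by move=> p; rewrite mem_index_iota => /andP[pq /andP[]]; rewrite leqNgt pq.
by rewrite big_nat_cond [RHS]big_nat_cond; apply: eq_bigl => p; case: (ltnP p q.+1); rewrite ?andbF ?andbT.
Qed.

Section Decoding.
Variables (R : realType) (n d : nat).
Hypothesis n0 : (0 < n)%N.
Local Notation K := (ffield R).
Local Notation E := (szE n d).
Local Notation Qn := (szQ n d).
Local Notation N := (szV n d).

Definition coord_half (f : nat -> R) (c h : nat) : {poly R} := \poly_(p < E) f ((c * 2 + h) * E + p)%N.
Definition dec (f : nat -> R) (c : nat) : K := emb (coord_half f c 0) (coord_half f c 1).
Definition entry_half (y : nat -> R) (r c : nat) : {poly R} :=
  \poly_(p < Qn) y ((r * (4 * n) + c) * Qn + p)%N.
Definition entry (y0 y1 : nat -> R) (r c : nat) : K := emb (entry_half y0 r c) (entry_half y1 r c).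

Lemma E_gt0 : (0 < E)%N. Proof. by rewrite /szE addn_gt0 orbT. Qed.
Lemma Q_gt0 : (0 < Qn)%N. Proof. by rewrite /szQ addn_gt0 orbT. Qed.
Lemma NE : N = (4 * n * 2 * E)%N. Proof. by rewrite /szV; lia. Qed.

Lemma entry_halfE y r c q : (q < Qn)%N -> (entry_half y r c)`_q = y ((r * (4 * n) + c) * Qn + q)%N.
Proof. by move=> h; rewrite coef_poly h. Qed.

Lemma ycoefE y r c k q : (q < Qn)%N ->
  ycoef n d y (r * (4 * n) + c) k q = if (k <= q)%N then (entry_half y r c)`_(q - k) else 0.
Proof.
by move=> qQ; rewrite /ycoef; case: ifP => // _; rewrite entry_halfE // (leq_ltn_trans (leq_subr _ _)).
Qed.

Lemma sum_coords (f : nat -> R) (g : nat -> R) :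
  \sum_(0 <= j < N) f j * g j =
  \sum_(0 <= c < 4 * n) \sum_(0 <= h < 2) \sum_(0 <= p < E) f ((c * 2 + h) * E + p)%N * g ((c * 2 + h) * E + p)%N.
Proof. by rewrite NE !sum_nat_digits; apply: eq_bigr => c _. Qed.

Lemma system_coef (y0 y1 f : nat -> R) r h q : (h < 2)%N -> (q < Qn)%N ->
  \sum_(0 <= j < N) f j * bcoef n d y0 y1 ((r * 2 + h) * Qn + q) j =
  (\sum_(0 <= c < 4 * n)
    if h == 0%N then entry_half y0 r c * coord_half f c 0 - (1 + 'X^2) * entry_half y1 r c * coord_half f c 1
    else entry_half y0 r c * coord_half f c 1 + entry_half y1 r c * coord_half f c 0)`_q.
Proof.
move=> h2 qQ; rewrite sum_coords coef_sum big_nat [RHS]big_nat; apply: eq_bigr => c /= cn.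
have idx h' p : (h' < 2)%N -> (p < E)%N -> bcoef n d y0 y1 ((r * 2 + h) * Qn + q) ((c * 2 + h') * E + p) =
  if h == 0%N then
    if h' == 0%N then ycoef n d y0 (r * (4 * n) + c) p q
    else - (ycoef n d y1 (r * (4 * n) + c) p q + ycoef n d y1 (r * (4 * n) + c) (p + 2) q)
  else if h' == 0%N then ycoef n d y1 (r * (4 * n) + c) p q else ycoef n d y0 (r * (4 * n) + c) p q.
  by move=> hh pE; rewrite /bcoef !(divn_digit _ qQ) !(modn_digit _ qQ) !(divn_digit _ pE) !(modn_digit _ pE)
    !(divn_digit _ h2) !(modn_digit _ h2) !(divn_digit _ hh) !(modn_digit _ hh).
have sz h' : (size (coord_half f c h') <= E)%N by rewrite size_poly.
have hc h' p : (p < E)%N -> (coord_half f c h')`_p = f ((c * 2 + h') * E + p)%N by move=> pE; rewrite coef_poly pE.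
have prod y h' : (entry_half y r c * coord_half f c h')`_q =
   \sum_(0 <= p < E) f ((c * 2 + h') * E + p)%N * ycoef n d y (r * (4 * n) + c) p q.
  rewrite (coefM_nat _ _ (sz h')); apply: eq_big_nat => p /= pE.
  by rewrite ycoefE // hc //; case: ifP => _; rewrite ?mulr0 // mulrC.
have prod2 h' : ((1 + 'X^2) * entry_half y1 r c * coord_half f c h')`_q =
   \sum_(0 <= p < E) f ((c * 2 + h') * E + p)%N *
     (ycoef n d y1 (r * (4 * n) + c) p q + ycoef n d y1 (r * (4 * n) + c) (p + 2) q).
  rewrite -mulrA mulrDl mul1r coefD prod coefXnM.
  rewrite [RHS](eq_bigr (fun p => f ((c * 2 + h') * E + p)%N * ycoef n d y1 (r * (4 * n) + c) p q +
    f ((c * 2 + h') * E + p)%N * ycoef n d y1 (r * (4 * n) + c) (p + 2) q)); last by move=> p _; rewrite mulrDr.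
  rewrite big_split /=; congr (_ + _); case: ltnP => q2.
    rewrite big1 // => p _; rewrite ycoefE // ifF ?mulr0 //.
    by apply/negbTE; rewrite -ltnNge (leq_trans q2) // leq_addl.
  rewrite (coefM_nat _ _ (sz h')); apply: eq_big_nat => p /= pE.
  rewrite ycoefE // hc //; have -> : (q - 2 - p = q - (p + 2))%N by lia.
  have -> : (p <= q - 2)%N = (p + 2 <= q)%N by lia.
  by case: ifP => _; rewrite ?mulr0 // mulrC.
rewrite big_nat2.
have -> : \sum_(0 <= p < E) f ((c * 2 + 0) * E + p)%N * bcoef n d y0 y1 ((r * 2 + h) * Qn + q) ((c * 2 + 0) * E + p) =
    \sum_(0 <= p < E) f ((c * 2 + 0) * E + p)%N * (if h == 0%N then ycoef n d y0 (r * (4 * n) + c) p q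
   else ycoef n d y1 (r * (4 * n) + c) p q).
  by apply: eq_big_nat => p /= pE; rewrite idx.
have -> : \sum_(0 <= p < E) f ((c * 2 + 1) * E + p)%N * bcoef n d y0 y1 ((r * 2 + h) * Qn + q) ((c * 2 + 1) * E + p) =
    \sum_(0 <= p < E) f ((c * 2 + 1) * E + p)%N * (if h == 0%N then
   - (ycoef n d y1 (r * (4 * n) + c) p q + ycoef n d y1 (r * (4 * n) + c) (p + 2) q)
   else ycoef n d y0 (r * (4 * n) + c) p q).
  by apply: eq_big_nat => p /= pE; rewrite idx.
case: ifP => _.
  rewrite coefB prod prod2; congr (_ + _); rewrite -sumrN; apply: eq_bigr => p _; rewrite mulrN //.
by rewrite coefD !prod addrC.
Qed.

Definition row_value (y0 y1 f : nat -> R) (r : nat) : K := \sum_(0 <= c < 4 * n) entry y0 y1 r c * dec f c.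

(** Both factors have size at most E, so even with the factor 1 + t^2 the size stays within Q = 2 E
    + 2, and the equations see every coefficient. *)
Lemma row_value_emb (y0 y1 f : nat -> R) r :
  (forall c, (c < 4 * n)%N -> (size (entry_half y0 r c) <= E)%N /\ (size (entry_half y1 r c) <= E)%N) ->
  exists p0 p1, [/\ row_value y0 y1 f r = emb p0 p1, (size p0 <= Qn)%N, (size p1 <= Qn)%N &
    forall h q, (h < 2)%N -> (q < Qn)%N ->
    \sum_(0 <= j < N) f j * bcoef n d y0 y1 ((r * 2 + h) * Qn + q) j = if h == 0%N then p0`_q else p1`_q].
Proof.
move=> hy.
exists (\sum_(0 <= c < 4 * n) (entry_half y0 r c * coord_half f c 0 - (1 + 'X^2) * entry_half y1 r c * coord_half f c 1)).
exists (\sum_(0 <= c < 4 * n) (entry_half y0 r c * coord_half f c 1 + entry_half y1 r c * coord_half f c 0)).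
have sz c h : (size (coord_half f c h) <= E)%N by rewrite size_poly.
have szM (p q : {poly R}) a b : (size p <= a)%N -> (size q <= b)%N -> (size (p * q)%R <= a + b)%N.
  by move=> pa qb; apply: leq_trans (size_polyMleq _ _) _; lia.
have szD (p q : {poly R}) a : (size p <= a)%N -> (size q <= a)%N -> (size (p + q)%R <= a)%N.
  by move=> pa qb; apply: leq_trans (size_polyD _ _) _; rewrite geq_max pa.
have szsum (G : nat -> {poly R}) m : (forall c, (c < 4 * n)%N -> (size (G c) <= m)%N) ->
    (size (\sum_(0 <= c < 4 * n) G c)%R <= m)%N.
  move=> hG; rewrite big_nat; elim/big_ind: _ => [|p q|c /andP[_]]; [by rewrite size_poly0|exact: szD|exact: hG].

have QE : Qn = (2 * E + 2)%N by [].
split.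
- rewrite /row_value -emb_sum; apply: eq_bigr => c _; by rewrite /entry /dec embM.
- apply: szsum => c /hy[h0 h1]; apply: szD; first by apply: leq_trans (szM _ _ _ _ h0 (sz c 0%N)) _; lia.
  rewrite size_polyN -mulrA; apply: leq_trans (size_polyMleq _ _) _.
  rewrite size_1X2 addSn /= QE; apply: leq_trans (leq_add (leqnn 2) (szM _ _ _ _ h1 (sz c 1%N))) _; lia.
- apply: szsum => c /hy[h0 h1]; apply: szD; first by apply: leq_trans (szM _ _ _ _ h0 (sz c 1%N)) _; lia.
  by apply: leq_trans (szM _ _ _ _ h1 (sz c 0%N)) _; lia.
move=> h q h2 qQ; rewrite system_coef //; case: ifP => _ //.
Qed.

Section Row.
Variables (y0 y1 f : nat -> R) (r : nat).
Hypothesis hy : forall c, (c < 4 * n)%N ->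
  (size (entry_half y0 r c) <= E)%N /\ (size (entry_half y1 r c) <= E)%N.
Local Notation eqn h q := (\sum_(0 <= j < N) f j * bcoef n d y0 y1 ((r * 2 + h) * Qn + q) j).

Lemma row_zero : (forall h q, (h < 2)%N -> (q < Qn)%N -> eqn h q = 0) <-> row_value y0 y1 f r = 0.
Proof.
have [p0 [p1 [-> s0 s1 he]]] := row_value_emb f hy.
split=> [h|/emb_eq0[e0 e1] h q h2 qQ]; last by rewrite he // e0 e1 coef0; case: ifP.
have z (p : {poly R}) k : (k < 2)%N -> (size p <= Qn)%N -> (forall q, (q < Qn)%N -> eqn k q = p`_q) -> p = 0.
  move=> k2 sp hp; apply/polyP => q; rewrite coef0; case: (ltnP q Qn) => qQ; last by rewrite nth_default // (leq_trans sp).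
  by rewrite -hp // h.
have e0 : p0 = 0 by apply: (z p0 0%N) => // q qQ; rewrite he.
have e1 : p1 = 0 by apply: (z p1 1%N) => // q qQ; rewrite he.
by rewrite e0 e1 emb0.
Qed.

Lemma row_unit T : (T < Qn)%N ->
  (forall h q, (h < 2)%N -> (q < Qn)%N -> eqn h q = ((h == 0%N) && (q == T))%:R) <-> row_value y0 y1 f r = y_z R ^+ T.
Proof.
move=> TQ; have [p0 [p1 [-> s0 s1 he]]] := row_value_emb f hy.
have -> : y_z R ^+ T = emb 'X^T 0 by rewrite -polX -rmorphXn /emb rmorph0 mul0r addr0.
split=> [h|/emb_inj[e0 e1] h q h2 qQ]; last by rewrite he // e0 e1 coefXn coef0; case: ifP.
have z (p : {poly R}) k (c : {poly R}) : (k < 2)%N -> (size p <= Qn)%N -> (forall q, (q < Qn)%N -> eqn k q = p`_q) ->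
    (size c <= Qn)%N -> (forall q, (q < Qn)%N -> c`_q = ((k == 0%N) && (q == T))%:R) -> p = c.
  move=> k2 sp hp sc hc; apply/polyP => q; case: (ltnP q Qn) => qQ; last by rewrite !nth_default // (leq_trans _ qQ).
  by rewrite -hp // h // hc.
have e0 : p0 = 'X^T by apply: (z p0 0%N) => // [q qQ||q qQ]; rewrite ?he ?size_polyXn ?coefXn.
have e1 : p1 = 0 by apply: (z p1 1%N) => // [q qQ||q qQ]; rewrite ?he ?size_poly0 ?coef0.
by rewrite e0 e1.
Qed.

(** A bound on the pole order is a set of linear equations: t^q s^h has a pole of order q + h. *)
Lemma row_fil k : (forall h q, (h < 2)%N -> (q < Qn)%N -> (k < q + h)%N -> eqn h q = 0) <->
  Fil k (row_value y0 y1 f r).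
Proof.
have [p0 [p1 [-> s0 s1 he]]] := row_value_emb f hy.
split=> [h|[a [b [/emb_inj[ea eb] sa sb]]] h q h2 qQ kq]; last first.
  rewrite -ea in sa; rewrite -eb in sb; rewrite he //; case: h h2 kq => [|[|//]] _; rewrite ?addn0 ?addn1 => kq /=; rewrite nth_default //; [exact: leq_trans sa kq | exact: leq_trans sb kq].
exists p0, p1; split=> //; apply/leq_sizeP => q kq; case: (ltnP q Qn) => qQ; try by rewrite nth_default // (leq_trans _ qQ).
  by have := he 0%N q isT qQ => /= <-; rewrite h // addn0.
by have := he 1%N q isT qQ => /= <-; rewrite h // addn1.
Qed.
End Row.

Lemma dec_lin f g a c : dec (fun j => a * f j + g j) c = cst R a * dec f c + dec g c.
Proof.
have hl h : coord_half (fun j => a * f j + g j) c h = a%:P * coord_half f c h + coord_half g c h.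
  by apply/polyP => p; rewrite coefD coefCM !coef_poly; case: ifP; rewrite ?mulr0 ?addr0.
by rewrite /dec !hl -embD -polC embMpol.
Qed.

Lemma dec_ext f g c : (c < 4 * n)%N -> (forall j, (j < N)%N -> f j = g j) -> dec f c = dec g c.
Proof.
move=> cn h; have hh k : (k < 2)%N -> coord_half f c k = coord_half g c k.
  move=> k2; apply/polyP => p; rewrite !coef_poly; case: ifP => // pE; apply: h.
  rewrite NE; have : ((c * 2 + k).+1 * E <= 4 * n * 2 * E)%N by rewrite leq_mul2r; apply/orP; right; lia.
  by rewrite mulSn; lia.
by rewrite /dec !hh.
Qed.

Lemma dec_surj (g : nat -> K) : (forall c, exists a b, [/\ g c = emb a b, (size a <= E)%N & (size b <= E)%N]) ->
  exists f, forall c, dec f c = g c.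
Proof.
move=> hg; have [a ha] := boolp.choice hg; have [b hb] := boolp.choice ha.
exists (fun j => (if ((j %/ E) %% 2 == 0)%N then a (j %/ E %/ 2)%N else b (j %/ E %/ 2)%N)`_(j %% E)) => c.
have [-> sa sb] := hb c; congr emb; apply/polyP => p; rewrite coef_poly; case: ltnP => pE.
- by rewrite (divn_digit _ pE) (modn_digit _ pE) modn_digit // divn_digit.
- by rewrite nth_default // (leq_trans sa).
- by rewrite (divn_digit _ pE) (modn_digit _ pE) modn_digit // divn_digit.
- by rewrite nth_default // (leq_trans sb).
Qed.

Lemma dec_coords_inj f g c h p : dec f c = dec g c -> (h < 2)%N -> (p < E)%N ->
  f ((c * 2 + h) * E + p)%N = g ((c * 2 + h) * E + p)%N.
Proof.
move=> /emb_inj[e0 e1] h2 pE; have e : coord_half f c h = coord_half g c h by case: h h2 => [|[|]].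
by move/(congr1 (fun q : {poly R} => q`_p)): e; rewrite !coef_poly pE.
Qed.

Lemma dec_R1 f c : dec f c \in @R1 R.
Proof. by apply/R1P; exists (coord_half f c 0), (coord_half f c 1). Qed.
End Decoding.

(** * Assembly of the linear systems *)

Definition TEq (a b : nat_expr) : test := TLeq (NAdd (NSub a b) (NSub b a)) (NConst 0).

Lemma teval_eq (F : fieldType) (s : memory F) a b : teval s (TEq a b) = (neval s a == neval s b).
Proof. by rewrite /= leqn0 addn_eq0 !subn_eq0 eqn_leq. Qed.
Lemma teval_leq (F : fieldType) (s : memory F) a b : teval s (TLeq a b) = (neval s a <= neval s b)%N.
Proof. by []. Qed.

Lemma ceval_ce (F : fieldType) (s : memory F) e : ceval s (CE e) = feval s e.
Proof. by []. Qed.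

(* The input shifted by one power of t, as the matrix t^(d + 1) M over R_1. *)
Definition PREPARE (h : nat) : sprog :=
  let p := NMod (nvar 13) xQ in let ij := NDiv (nvar 13) xQ in
  let w := NAdd (NMul (NConst 2) xd) (NConst 1) in
  TAB 13 (28 + h) (NMul (NMul xn xn) xQ)
    (CIf (TLeq p (NConst 0)) (CE FZero) (CIf (TLeq p w)
      (CE (FRead h (NAdd (NMul ij w) (NSub p (NConst 1))))) (CE FZero))).

Lemma prepare_spec (F : fieldType) n d (s : memory F) h ij p : sized n d s -> (h < 28)%N ->
  (ij < n * n)%N -> (p < szQ n d)%N ->
  fmem (sem xbig (PREPARE h) s) (28 + h) (ij * szQ n d + p) =
  if (0 < p <= 2 * d + 1)%N then fmem s h (ij * (2 * d + 1) + (p - 1))%N else 0.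
Proof.
move=> hs h28 ijn pQ; set Qn := szQ n d.
have lt : (ij * Qn + p < n * n * Qn)%N.
  by rewrite (leq_trans (n := ij.+1 * Qn)) ?leq_mul2r ?ijn ?orbT // mulSn addnC ltn_add2r.
rewrite (@tab_spec _ 13 (28 + h) _ _ s (fun k => if (0 < k %% Qn <= 2 * d + 1)%N then
   fmem s h (k %/ Qn * (2 * d + 1) + (k %% Qn - 1))%N else 0) (n * n * Qn)%N).
- by rewrite lt modn_digit // divn_digit.
- by rewrite !nevalE !(sizeE hs).
- rewrite (neval_big hs) /szV /Qn /szQ; have : (4 <= szE n d)%N by rewrite /szE leq_addl.
  by move: (szE n d) => E hE; nia.
move=> s' k _ g1 g2 g3 _; have hs' : sized n d s' by apply: sized_eq hs; rewrite g1.
rewrite !ceval_if !teval_leq /ceval feval_read !nevalE g2 !(sizeE hs') g3 -/Qn; last by rewrite neq_ltn ltn_addr.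
by rewrite leqn0 lt0n; case: eqP => //= _.
Qed.

(* The entries of the coefficient matrix of a system, in n x n blocks: t^(d + 1) M,
   its transpose, the matrix of the vectors stored in the array 19, and plus
   or minus x^h t^p. *)
Inductive code := CA | CT | CW | CU of bool & bool & bool.
Definition system := seq (nat * nat * code).
Fixpoint lookup (l : system) (r c : nat) : option code :=
  if l is (r', c', k) :: l' then if (r == r') && (c == c') then Some k else lookup l' r c else None.

Section Setup.
Local Notation idx := (nvar 13).
Let p := NMod idx xQ.
Let rc := NDiv idx xQ.
Let c := NMod rc (NMul (NConst 4) xn).
Let r := NDiv rc (NMul (NConst 4) xn).
Let i := NMod r xn.
Let j := NMod c xn.

Definition code_expr (h : nat) (k : code) : cexpr :=
  match k with
  | CA => CE (FRead (28 + h) (NAdd (NMul (NAdd (NMul i xn) j) xQ) p))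
  | CT => CE (FRead (28 + h) (NAdd (NMul (NAdd (NMul j xn) i) xQ) p))
  | CW => CIf (TLeq (NAdd p (NConst 1)) xE)
      (CE (FRead 19 (NAdd (NMul (NAdd (NMul (NAdd (NMul i xn) j) (NConst 2)) (NConst h)) xE) p))) (CE FZero)
  | CU hh pp neg => if (hh : nat) == h then
      CIf (TEq i j) (CIf (TEq p (NConst pp)) (CE (if neg then FSub FZero FOne else FOne)) (CE FZero)) (CE FZero)
      else CE FZero
  end.

Fixpoint system_expr (h : nat) (l : system) : cexpr :=
  if l is (r', c', k) :: l' then
    CIf (TEq (NDiv r xn) (NConst r')) (CIf (TEq (NDiv c xn) (NConst c')) (code_expr h k) (system_expr h l'))
      (system_expr h l')
  else CE FZero.

Definition code_coef (F : fieldType) n d (s : memory F) (h : nat) (k : code) (i j p : nat) : F :=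
  match k with
  | CA => fmem s (28 + h) ((i * n + j) * szQ n d + p)%N
  | CT => fmem s (28 + h) ((j * n + i) * szQ n d + p)%N
  | CW => if (p < szE n d)%N then fmem s 19 (((i * n + j) * 2 + h) * szE n d + p)%N else 0
  | CU hh pp neg => if [&& (hh : nat) == h, i == j & p == pp] then (if neg then -1 else 1) else 0
  end.

Definition SYSTEM (y blocks : nat) (l : system) (h : nat) : sprog :=
  TAB 13 y (NMul (NMul (NMul (NConst blocks) xn) (NMul (NConst 4) xn)) xQ) (system_expr h l).

Lemma system_spec (F : fieldType) n d (s : memory F) y blocks l h r0 c0 p0 : sized n d s -> (0 < n)%N ->
  (h < 2)%N -> (blocks <= 5)%N -> y \notin [:: 19; 28; 29]%N ->
  (r0 < blocks * n)%N -> (c0 < 4 * n)%N -> (p0 < szQ n d)%N ->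
  fmem (sem xbig (SYSTEM y blocks l h) s) y ((r0 * (4 * n) + c0) * szQ n d + p0) =
  if lookup l (r0 %/ n) (c0 %/ n) is Some k then code_coef n d s h k (r0 %% n) (c0 %% n) p0 else 0.
Proof.
move=> hs n0 h2 b5 hy hr hc hp; set Qn := szQ n d.
have n4 : (0 < 4 * n)%N by rewrite muln_gt0.
have lt : ((r0 * (4 * n) + c0) * Qn + p0 < blocks * n * (4 * n) * Qn)%N.
  have h1 : (r0 * (4 * n) + c0 < blocks * n * (4 * n))%N.
    by rewrite (leq_trans (n := r0.+1 * (4 * n))) ?leq_mul2r ?hr ?orbT // mulSn addnC ltn_add2r.
  by rewrite (leq_trans (n := (r0 * (4 * n) + c0).+1 * Qn)) ?leq_mul2r ?h1 ?orbT // mulSn addnC ltn_add2r.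
rewrite (@tab_spec _ 13 y _ _ s (fun k => let rc := (k %/ Qn)%N in
  if lookup l (rc %/ (4 * n) %/ n) (rc %% (4 * n) %/ n) is Some k' then
    code_coef n d s h k' (rc %/ (4 * n) %% n) (rc %% (4 * n) %% n) (k %% Qn) else 0) (blocks * n * (4 * n) * Qn)%N).
- by rewrite lt /= modn_digit // divn_digit // modn_digit // divn_digit.
- by rewrite !nevalE !(sizeE hs).
- rewrite (neval_big hs) /szV /Qn /szQ; have : (4 <= szE n d)%N by rewrite /szE leq_addl.
  move: (szE n d) => E hE; apply: (@leq_trans (5 * n * (4 * n) * (2 * E + 2))%N); last by nia.
  by rewrite !leq_mul2r b5 !orbT.
move=> s' k _ g1 g2 g3 _; have hs' : sized n d s' by apply: sized_eq hs; rewrite g1.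
have g3' a : a \in [:: 19; 28; 29]%N -> fmem s' a = fmem s a.
  by move=> ha; apply: g3; apply: contraNneq hy => <-.
have ep : neval s' p = (k %% Qn)%N by rewrite /p !nevalE g2 (sizeE hs').
have erc : neval s' rc = (k %/ Qn)%N by rewrite /rc !nevalE g2 (sizeE hs').
have er : neval s' r = (k %/ Qn %/ (4 * n))%N by rewrite /r neval_div erc !nevalE (sizeE hs').
have ec : neval s' c = (k %/ Qn %% (4 * n))%N by rewrite /c neval_mod erc !nevalE (sizeE hs').
have ei : neval s' i = (k %/ Qn %/ (4 * n) %% n)%N by rewrite /i neval_mod er (sizeE hs').
have ej : neval s' j = (k %/ Qn %% (4 * n) %% n)%N by rewrite /j neval_mod ec (sizeE hs').
have A2 : (28 + h)%N \in [:: 19; 28; 29]%N by case: (h) h2 => [|[|]].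
have hk k' : ceval s' (code_expr h k') = code_coef n d s h k'
    (k %/ Qn %/ (4 * n) %% n) (k %/ Qn %% (4 * n) %% n) (k %% Qn).
  case: k' => [|||hh pp neg].
  - by rewrite /code_expr ceval_ce feval_read neval_add neval_mul neval_add neval_mul ei ej ep !(sizeE hs') g3'.
  - by rewrite /code_expr ceval_ce feval_read neval_add neval_mul neval_add neval_mul ei ej ep !(sizeE hs') g3'.
  - rewrite /code_expr ceval_if teval_leq !ceval_ce feval_read 2!neval_add ep (sizeE hs') neval_const addn1 /code_coef.
    by rewrite neval_mul neval_add neval_mul neval_add neval_mul ei ej !(sizeE hs') !neval_const g3'.
  rewrite /code_expr /code_coef; case: eqP => // _.
  rewrite !ceval_if !teval_eq ei ej ep neval_const andTb.
  by case: eqP => // _; case: eqP => // _; case: neg; rewrite ceval_ce /= ?sub0r.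
elim: l => // -[[r' c'] k'] l IH.
have -> : ceval s' (system_expr h ((r', c', k') :: l)) =
    if teval s' (TEq (NDiv r xn) (NConst r')) then
      if teval s' (TEq (NDiv c xn) (NConst c')) then ceval s' (code_expr h k') else ceval s' (system_expr h l)
    else ceval s' (system_expr h l) by [].
have er2 : neval s' (NDiv r xn) = (k %/ Qn %/ (4 * n) %/ n)%N by rewrite neval_div er (sizeE hs').
have ec2 : neval s' (NDiv c xn) = (k %/ Qn %% (4 * n) %/ n)%N by rewrite neval_div ec (sizeE hs').
rewrite !teval_eq er2 ec2 !neval_const IH hk /=.
by case: eqP => _ //; case: eqP => _ //.
Qed.
End Setup.

Lemma all_pair (T : Type) (p : pred T) a b : all p [:: a; b] = p a && p b.
Proof. by rewrite /= andbT. Qed.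

Section Systems.
Variables (R : realType) (n d : nat).
Hypothesis n0 : (0 < n)%N.
Local Notation K := (ffield R).
Local Notation E := (szE n d).
Local Notation Qn := (szQ n d).
Local Notation N := (szV n d).
Local Notation mem := (memory R).
Implicit Types (s : mem) (A W : 'M[K]_n) (f : nat -> R).

Definition unit_entry (hh pp neg : bool) : K :=
  (if neg then -1 else 1) * (if hh then x_z R else 1) * (if pp then y_z R else 1).

Definition code_mx A W (k : code) : 'M[K]_n :=
  match k with
  | CA => A
  | CT => A^T
  | CW => W
  | CU hh pp neg => (unit_entry hh pp neg)%:M
  end.
Definition block_mx_of A W (l : system) (r c : nat) : 'M[K]_n :=
  if lookup l r c is Some k then code_mx A W k else 0.

Definition dv f (b : nat) : 'cV[K]_n := \col_j dec n d f (b * n + j).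
Definition sys A W l f (r : nat) : 'cV[K]_n := \sum_(0 <= b < 4) block_mx_of A W l r b *m dv f b.

Definition array_poly (s : mem) (a i j : nat) : {poly R} := \poly_(p < Qn) fmem s a ((i * n + j) * Qn + p)%N.
Definition matrix_in s A := forall i j : 'I_n,
  A i j = emb (array_poly s 28 i j) (array_poly s 29 i j) /\
  (size (array_poly s 28 i j) <= E)%N /\ (size (array_poly s 29 i j) <= E)%N.
Definition vectors_in s W := forall i j : 'I_n, W i j = dec n d (fmem s 19) (i * n + j).

Definition system_in s y0 y1 blocks A W l := forall r b (i j : 'I_n), (r < blocks)%N -> (b < 4)%N ->
  let h0 := entry_half n d (fmem s y0) (r * n + i) (b * n + j) in
  let h1 := entry_half n d (fmem s y1) (r * n + i) (b * n + j) in
  [/\ emb h0 h1 = block_mx_of A W l r b i j, (size h0 <= E)%N & (size h1 <= E)%N].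

Lemma digit_bound r i m k : (r < k)%N -> (i < m)%N -> (r * m + i < k * m)%N.
Proof.
by move=> rk im; rewrite (leq_trans (n := r.+1 * m)) ?leq_mul2r ?rk ?orbT // mulSn addnC ltn_add2r.
Qed.

Lemma E_ge4 : (4 <= E)%N. Proof. by rewrite /szE leq_addl. Qed.
Lemma E_le_Q : (E <= Qn)%N. Proof. by rewrite /szQ; lia. Qed.

Lemma emb_unit (hh pp neg : bool) : unit_entry hh pp neg =
  emb (if hh then 0 else (if neg then -1 else 1) *: 'X^pp) (if hh then (if neg then -1 else 1) *: 'X^pp else 0).
Proof.
have hX : pol R ((if neg then -1 else 1) *: 'X^pp) = (if neg then -1 else 1) * (if pp then y_z R else 1).
  rewrite -mul_polyC rmorphM polC; congr (_ * _).
    by case: neg; rewrite ?rmorphN rmorph1.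
  by case: pp; rewrite ?expr1 ?polX ?expr0 ?rmorph1.
by rewrite /unit_entry /emb; case: hh; rewrite hX rmorph0 ?add0r ?mul0r ?addr0 ?mulr1 // mulrAC.
Qed.

Lemma SYSTEM_in s A W y0 y1 blocks l : sized n d s -> (blocks <= 5)%N -> y0 != y1 ->
  y0 \notin [:: 19; 28; 29]%N -> y1 \notin [:: 19; 28; 29]%N -> matrix_in s A -> vectors_in s W ->
  system_in (sem xbig (SSeq (SYSTEM y0 blocks l 0) (SYSTEM y1 blocks l 1)) s) y0 y1 blocks A W l.
Proof.
move=> hs b5 y01 hy0 hy1 hA hW r b i j rb b4; rewrite sem_seq; set s1 := sem _ _ s; set s2 := sem _ _ s1.
have hs1 : sized n d s1 by apply: sized_sem.
have f1 a : a \in [:: 19; 28; 29]%N -> fmem s1 a = fmem s a.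
  by move=> ha; rewrite /s1 tab_fframe //; apply: contraNneq hy0 => <-.
have cc h k p i' j' : (h < 2)%N -> code_coef n d s1 h k i' j' p = code_coef n d s h k i' j' p.
  by case: k => [|||hh pp neg] //= h2; rewrite f1 //; case: h h2 => [|[|]].
have div_ij (k : nat) (o : 'I_n) : ((k * n + o) %/ n = k)%N by rewrite divn_digit.
have mod_ij (k : nat) (o : 'I_n) : ((k * n + o) %% n = o)%N by rewrite modn_digit.
have rn : (r * n + i < blocks * n)%N by apply: digit_bound.
have cn : (b * n + j < 4 * n)%N by apply: digit_bound.
have e0 p : (p < Qn)%N -> fmem s2 y0 (((r * n + i) * (4 * n) + (b * n + j)) * Qn + p)%N =
    if lookup l r b is Some k then code_coef n d s 0 k i j p else 0.
  move=> pQ; rewrite /s2 tab_fframe // /s1 (system_spec l hs n0) // div_ij div_ij mod_ij mod_ij.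
  by [].
have e1 p : (p < Qn)%N -> fmem s2 y1 (((r * n + i) * (4 * n) + (b * n + j)) * Qn + p)%N =
    if lookup l r b is Some k then code_coef n d s 1 k i j p else 0.
  move=> pQ; rewrite /s2 (system_spec l hs1 n0) // div_ij div_ij mod_ij mod_ij.
  by case: lookup => // k; rewrite cc.
have poly_eq (y : nat) (g : nat -> R) (P : {poly R}) :
    (forall p, (p < Qn)%N -> fmem s2 y (((r * n + i) * (4 * n) + (b * n + j)) * Qn + p)%N = g p) ->
    (forall p, (p < Qn)%N -> g p = P`_p) -> (size P <= Qn)%N ->
    entry_half n d (fmem s2 y) (r * n + i) (b * n + j) = P.
  move=> h1 h2 h3; apply/polyP => p; rewrite coef_poly; case: ltnP => pQ; first by rewrite h1 // h2.
  by rewrite nth_default // (leq_trans h3).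
have szX (a : R) (pp : bool) : (size (a *: 'X^pp)%R <= E)%N.
  apply: leq_trans (size_scale_leq _ _) _; rewrite size_polyXn; apply: leq_trans E_ge4.
  by case: pp.
rewrite /block_mx_of; case El : lookup => [k|]; rewrite El in e0 e1; last first.
  rewrite (poly_eq y0 (fun=> 0) 0) ?(poly_eq y1 (fun=> 0) 0) ?size_poly0 // => [|p _|p _]; rewrite ?coef0 //.
  by rewrite emb0 mxE.
case: k El e0 e1 => [|||hh pp neg] _ e0 e1.
- have [hA1 [hA2 hA3]] := hA i j.
  rewrite (poly_eq y0 _ (array_poly s 28 i j) e0) ?(poly_eq y1 _ (array_poly s 29 i j) e1) //.
  + by move=> p pQ; rewrite coef_poly pQ.
  + exact: leq_trans hA3 E_le_Q.
  + by move=> p pQ; rewrite coef_poly pQ.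
  + exact: leq_trans hA2 E_le_Q.
- have [hA1 [hA2 hA3]] := hA j i.
  rewrite (poly_eq y0 _ (array_poly s 28 j i) e0) ?(poly_eq y1 _ (array_poly s 29 j i) e1) //.
  + by split=> //=; rewrite mxE.
  + by move=> p pQ; rewrite coef_poly pQ.
  + exact: leq_trans hA3 E_le_Q.
  + by move=> p pQ; rewrite coef_poly pQ.
  + exact: leq_trans hA2 E_le_Q.
- have sz h : (size (coord_half n d (fmem s 19) (i * n + j) h) <= E)%N by rewrite size_poly.
  rewrite (poly_eq y0 _ (coord_half n d (fmem s 19) (i * n + j) 0) e0) ?(poly_eq y1 _ (coord_half n d (fmem s 19) (i * n + j) 1) e1) //.
  + by move=> p pQ; rewrite coef_poly.
  + exact: leq_trans (sz 1%N) E_le_Q.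
  + by move=> p pQ; rewrite coef_poly.
  + exact: leq_trans (sz 0%N) E_le_Q.
pose P h : {poly R} := if (hh == h :> nat) && (i == j) then (if neg then -1 else 1) *: 'X^pp else 0.
have szP h : (size (P h) <= E)%N by rewrite /P; case: ifP => _; rewrite ?size_poly0 ?szX.
have cP h p : code_coef n d s h (CU hh pp neg) i j p = (P h)`_p.
  rewrite /code_coef /P; case: (hh == h :> nat); rewrite ?coef0 //= -val_eqE.
  by case: (val i == val j); rewrite ?coef0 //= coefZ coefXn; case: eqP; rewrite ?mulr1 ?mulr0.
rewrite (poly_eq y0 _ (P 0%N) e0) ?(poly_eq y1 _ (P 1%N) e1) //.
- split=> //; rewrite /code_mx mxE emb_unit /P.
  case: (i == j); rewrite ?andbF ?andbT ?mulr1n ?mulr0n ?emb0 //.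
  by case: (hh).
- exact: leq_trans (szP 1%N) E_le_Q.
- exact: leq_trans (szP 0%N) E_le_Q.
Qed.

Lemma row_value_sys s y0 y1 blocks A W l f r (i : 'I_n) : system_in s y0 y1 blocks A W l -> (r < blocks)%N ->
  row_value n d (fmem s y0) (fmem s y1) f (r * n + i) = sys A W l f r i 0.
Proof.
move=> hsys rb; rewrite /row_value sum_nat_digits /sys summxE; apply: eq_big_nat => b /= b4.
rewrite big_mkord mxE; apply: eq_bigr => j _.
by have [e _ _] := hsys r b i j rb b4; rewrite /entry e !mxE.
Qed.

Lemma system_sizes s y0 y1 blocks A W l r (i : 'I_n) : system_in s y0 y1 blocks A W l -> (r < blocks)%N ->
  forall c, (c < 4 * n)%N -> (size (entry_half n d (fmem s y0) (r * n + i) c) <= E)%N /\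
    (size (entry_half n d (fmem s y1) (r * n + i) c) <= E)%N.
Proof.
move=> hsys rb c cn; have b4 : (c %/ n < 4)%N by rewrite ltn_divLR.
have jn : (c %% n < n)%N by rewrite ltn_mod.
by have [_] := hsys r (c %/ n)%N i (Ordinal jn) rb b4; rewrite /= -divn_eq.
Qed.

Definition kernel_in s (P : (nat -> R) -> Prop) :=
  forall f, (rvof N f <= mxof N (fmem s 16))%MS <-> P f.

Lemma sum_rvof f (g : nat -> R) : \sum_j (rvof N f) 0 j * g j = \sum_(0 <= j < N) f j * g j.
Proof. by rewrite big_mkord; apply: eq_bigr => j _; rewrite mxE. Qed.

Lemma KER_kernel y0 y1 s rows skip blocks A W l (skr : nat -> nat -> nat -> bool) :
  sized n d s -> (blocks <= 5)%N -> y0 \notin [:: 12; 13; 14; 16]%N -> y1 \notin [:: 12; 13; 14; 16]%N ->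
  system_in s y0 y1 blocks A W l ->
  (forall s' : mem, sized n d s' -> neval s' rows = (blocks * n)%N) ->
  (forall s' i, (forall a, a \notin [:: 13; 14; 16; 17]%N -> nmem s' a = nmem s a) -> sized n d s' ->
     nmem s' 17 0 = i -> all (teval s') skip = skr (i %/ Qn %/ 2)%N ((i %/ Qn) %% 2)%N (i %% Qn)%N) ->
  kernel_in (sem xbig (KER y0 y1 rows skip) s)
    (fun f => forall r (i : 'I_n), (r < blocks)%N -> forall h q, (h < 2)%N -> (q < Qn)%N ->
       ~~ skr (r * n + i)%N h q ->
       \sum_(0 <= j < N) f j * bcoef n d (fmem s y0) (fmem s y1) (((r * n + i) * 2 + h) * Qn + q) j = 0).
Proof.
move=> hs b5 hy0 hy1 hsys hrows hsk f.
have Q0 : (0 < Qn)%N by apply: Q_gt0.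
rewrite (@ker_spec y0 y1 _ n d s rows skip (blocks * n) (fun i => skr (i %/ Qn %/ 2)%N ((i %/ Qn) %% 2)%N (i %% Qn)%N)) //.
- split=> [h r i rb h' q h2 qQ nsk|h k kb nsk].
    have := h (((r * n + i) * 2 + h') * Qn + q)%N; rewrite !(divn_digit _ qQ) !(modn_digit _ qQ) divn_digit // modn_digit //.
    rewrite sum_rvof; apply=> //; rewrite mulnA; apply: digit_bound => //; apply: digit_bound => //.
    exact: digit_bound.
  rewrite sum_rvof; pose r := (k %/ Qn %/ 2)%N.
  have rb : (r < blocks * n)%N by rewrite /r -divnMA ltn_divLR ?muln_gt0 ?Q0 //= mulnC [(Qn * 2)%N]mulnC mulnC.
  have rn : (r %% n < n)%N by rewrite ltn_mod.
  have := h (r %/ n)%N (Ordinal rn) _ ((k %/ Qn) %% 2)%N (k %% Qn)%N; rewrite /= -!divn_eq.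
  by move=> hh; apply: hh; rewrite ?ltn_mod // ltn_divLR.
- rewrite /szV /szQ; have := E_ge4; move: E => e he; apply: (@leq_trans (5 * n * (2 * (2 * e + 2)))%N); last by nia.
  by rewrite !leq_mul2r b5 !orbT.
move=> s' i g1 g2; apply: hsk => //; apply: sized_eq hs; by rewrite g1.
Qed.

(* Rows in the first B blocks are only required to have level k. *)
Definition LEVEL_SKIP (B : nat) : seq test :=
  [:: TLeq (NAdd (NDiv (NDiv (nvar 17) xQ) (NConst 2)) (NConst 1)) (NMul (NConst B) xn);
      TLeq (NAdd (NMod (nvar 17) xQ) (NMod (NDiv (nvar 17) xQ) (NConst 2))) (nvar 9)].

Lemma KER_level y0 y1 s B blocks A W l k :
  sized n d s -> (blocks <= 5)%N -> y0 \notin [:: 12; 13; 14; 16]%N -> y1 \notin [:: 12; 13; 14; 16]%N ->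
  system_in s y0 y1 blocks A W l -> nmem s 9 0 = k ->
  kernel_in (sem xbig (KER y0 y1 (NMul (NConst blocks) xn) (LEVEL_SKIP B)) s)
    (fun f => forall r, (r < blocks)%N ->
       if (r < B)%N then forall i, Fil k (sys A W l f r i 0) else sys A W l f r = 0).
Proof.
move=> hs b5 hy0 hy1 hsys hk f.
rewrite (@KER_kernel y0 y1 s _ _ blocks A W l (fun r h q => (r < B * n)%N && (q + h <= k)%N) hs b5 hy0 hy1 hsys); first last.
- move=> s' i g1 hs' g2; rewrite /LEVEL_SKIP all_pair !teval_leq.
  by rewrite !nevalE g2 !(sizeE hs') addn1 g1 // hk.
- by move=> s' hs'; rewrite !nevalE (sizeE hs').
have bnd r (i : 'I_n) : (r * n + i < B * n)%N = (r < B)%N.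
  apply/idP/idP => [h|rB]; last exact: digit_bound.
  by rewrite ltnNge; apply/negP => Br; move: h; rewrite ltnNge (leq_trans (leq_mul Br (leqnn n))) ?leq_addr.
split=> [h r rb|h r i rb h' q h2 qQ].
  case: ifP => rB.
    move=> i; rewrite -(row_value_sys f i hsys rb); apply: (row_fil n0 f (system_sizes i hsys rb) k).1.
    by move=> h' q h2 qQ kq; apply: h => //; rewrite bnd rB -ltnNge.
  apply/colP => i; rewrite mxE -(row_value_sys f i hsys rb); apply: (row_zero n0 f (system_sizes i hsys rb)).1.
  by move=> h' q h2 qQ; apply: h => //; rewrite bnd rB.
rewrite bnd; have := h r rb; case: ifP => rB hr; last first.
  move=> _; move: (hr) => /(congr1 (fun v : 'cV_n => v i 0)); rewrite mxE -(row_value_sys f i hsys rb) => hv.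
  by apply: (row_zero n0 f (system_sizes i hsys rb)).2.
rewrite -ltnNge /= => kq; have := hr i; rewrite -(row_value_sys f i hsys rb) => hv.
by apply: (row_fil n0 f (system_sizes i hsys rb) k).2.
Qed.
End Systems.

(** * Incremental spans and the table of columns *)

Definition xB : nat_expr := locked (NDiv xV (NConst 4)).
Definition szB n d : nat := (n * 2 * szE n d)%N.
Lemma neval_B (F : fieldType) n d (s : memory F) : sized n d s -> neval s xB = szB n d.
Proof.
by move=> hs; rewrite /xB -lock !nevalE (sizeE hs) /szV (_ : 8 * _ = szB n d * 4)%N ?mulnK // /szB; lia.
Qed.

Definition COPY (a : nat) (base : nat_expr) (x : cexpr) : sprog := SFor 13 xB (SF a (NAdd base (nvar 13)) x).

Lemma copy_spec (F : fieldType) n d a base x (s : memory F) (f : nat -> F) m : (0 < n)%N -> sized n d s ->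
  (forall s' k, (k < szB n d)%N -> (forall b, b != 13%N -> nmem s' b = nmem s b) -> nmem s' 13 0 = k ->
     (forall c, c != a -> fmem s' c = fmem s c) -> neval s' base = m /\ ceval s' x = f k) ->
  forall k, fmem (sem xbig (COPY a base x) s) a k =
    if (m <= k < m + szB n d)%N then f (k - m)%N else fmem s a k.
Proof.
move=> n0 hs hx.
pose Inv k (s' : memory F) := [/\ (forall b, b != 13%N -> nmem s' b = nmem s b),
  (forall c, c != a -> fmem s' c = fmem s c) &
  (forall j, fmem s' a j = if (m <= j < m + k)%N then f (j - m)%N else fmem s a j)].
have set_other k w (s' : memory F) b : b != 13%N -> nmem (setn 13 k w s') b = nmem s' b.
  by move=> /negPf bv; apply/boolp.funext => j; rewrite /setn /= /update bv.
have hB : neval s (bound xbig xB) = szB n d.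
  rewrite neval_bound_small (neval_B hs) // (neval_big hs) /szV /szB.
  by have := E_ge4 n d; move: (szE n d) => e he; nia.
suff : Inv (neval s (bound xbig xB)) (sem xbig (COPY a base x) s) by rewrite hB; case.
apply: (for_ind (Inv := Inv)) => // [|k s' kN vk [i1 i2 i3]].
  split=> // [b bv|j]; first by rewrite !set_other.
  by rewrite addn0 [X in if X then _ else _]andbC ltnNge; case: leqP.
rewrite hB // in kN; have [hb hc] := hx s' k kN i1 vk i2.
split=> [b bv|c ca|j]; first by rewrite set_other //= i1.
  by rewrite /= /update; apply/boolp.funext => j; rewrite (negPf ca) i2.
rewrite fmem_setn [sem _ _ _]/= /setf [fmem _ _]/= /update eqxx hb vk hc /= i3.
case: (eqVneq j (m + k)%N) => [->|jk]; first by rewrite leq_addr addnS ltnSn addKn.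
by rewrite addnS [in RHS]ltnS [(j <= m + k)%N]leq_eqVlt (negPf jk).
Qed.

Lemma copy_nframe (F : fieldType) a base x (s : memory F) b : b != 13%N ->
  nmem (sem xbig (COPY a base x) s) b = nmem s b.
Proof. by move=> bv; rewrite sem_nframe //= inE. Qed.
Lemma copy_fframe (F : fieldType) a base x (s : memory F) c : c != a ->
  fmem (sem xbig (COPY a base x) s) c = fmem s c.
Proof. by move=> ca; rewrite sem_fframe //= inE. Qed.

(** A row of array 16 is a solution made of four vectors with [xB] coefficients each. *)
Definition row_block (m : nat) : field_expr :=
  FRead 16 (NAdd (NMul (nvar 18) xV) (NAdd (NMul (NConst m) xB) (nvar 13))).
Definition LOAD (m : nat) : sprog := TAB 13 12 xV
  (CIf (TLeq (NAdd (nvar 13) (NConst 1)) xB) (CE (row_block m)) (CE FZero)).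
(** Array 15 holds a matrix whose kernel is the current span, by [step_kernel]. *)
Definition INS (m : nat) : sprog := SSeq (LOAD m) (STEP 15).
(** After [INS] this test holds when the vector was already in the span: its image vanishes at the
    pivot. *)
Definition NEW : test := TZero (FRead 13 (nvar 16)).

(* The array 10 counts the columns found so far; their kinds and levels are in
   the arrays 11 and 12, and their vectors in the field arrays 18 and 19.  The
   kind is 0 for the generator of an even item, 1 and 2 for the two generators
   of an odd one. *)
Definition COL (kind mu mt : nat) (neg : bool) : sprog :=
  let x m := CE (if neg then FSub FZero (row_block m) else row_block m) in
  (SN 11 (nvar 10) (NConst kind) ;; SN 12 (nvar 10) (nvar 9) ;;
   COPY 18 (NMul (nvar 10) xB) (x mu) ;; COPY 19 (NMul (nvar 10) xB) (x mt) ;;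
   SN 10 (NConst 0) (NAdd (nvar 10) (NConst 1)))%S.

Section Columns.
Variables (R : realType) (n d : nat).
Hypothesis n0 : (0 < n)%N.
Local Notation K := (ffield R).
Local Notation E := (szE n d).
Local Notation N := (szV n d).
Local Notation B := (szB n d).
Local Notation mem := (memory R).
Local Notation sem := (sem xbig).
Implicit Types (s : mem) (f : nat -> R) (T : 'cV[K]_n -> Prop).

Definition row_of s (r : nat) : nat -> R := fun j => fmem s 16 (r * N + j)%N.
Definition blk (m : nat) f : nat -> R := fun j => if (j < B)%N then f (m * B + j)%N else 0.
(** Only vectors supported in the first of the four blocks are tracked; [LOAD] moves every candidate
    there. *)
Definition tracks s T := forall f, (forall j, (B <= j)%N -> f j = 0) ->
  (mxof N (fmem s 15) *m cvof N f = 0 <-> T (dv n d f 0)).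

Lemma NB : N = (4 * B)%N. Proof. by rewrite /szV /szB; lia. Qed.

Lemma local_lt c h p : (c < n)%N -> (h < 2)%N -> (p < E)%N -> ((c * 2 + h) * E + p < B)%N.
Proof. by move=> cn h2 pE; apply: digit_bound => //; apply: digit_bound. Qed.

Lemma dec_shift f g m c : (c < n)%N -> (forall j, (j < B)%N -> g j = f (m * B + j)%N) ->
  dec n d g c = dec n d f (m * n + c).
Proof.
move=> cn hg; have e h : (h < 2)%N -> coord_half n d g c h = coord_half n d f (m * n + c) h.
  move=> h2; apply/polyP => p; rewrite !coef_poly; case: ifP => // pE.
  rewrite hg ?local_lt //; congr f; rewrite /szB; lia.
by rewrite /dec !e.
Qed.

Lemma dv_blk m f : dv n d (blk m f) 0 = dv n d f m.
Proof.
apply/colP => j; rewrite !mxE mul0n add0n; apply: dec_shift => // i iB.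
by rewrite /blk iB.
Qed.

Lemma dv_lin a f g b : dv n d (fun j => a * f j + g j) b = cst R a *: dv n d f b + dv n d g b.
Proof. by apply/colP => j; rewrite !mxE dec_lin. Qed.

Lemma dec0 c : dec n d (fun=> 0 : R) c = 0.
Proof.
have e h : coord_half n d (fun=> 0 : R) c h = 0 by apply/polyP => p; rewrite coef_poly coef0 if_same.
by rewrite /dec !e emb0.
Qed.

Lemma dv0_eq0 f : (forall j, (B <= j)%N -> f j = 0) -> dv n d f 0 = 0 -> forall j, f j = 0.
Proof.
move=> hf h j; case: (ltnP j B) => [jB|/hf//].
have E0 := E_gt0 n d.
have pE : (j %% E < E)%N by rewrite ltn_mod.
have h2 : ((j %/ E) %% 2 < 2)%N by rewrite ltn_mod.
have cn : (j %/ E %/ 2 < n)%N by rewrite -divnMA ltn_divLR ?muln_gt0 ?E0 // mulnC [(E * 2)%N]mulnC mulnC mulnA.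
have := congr1 (fun v : 'cV_n => v (Ordinal cn) 0) h; rewrite !mxE mul0n add0n /=.
have <- : dec n d (fun=> 0 : R) (j %/ E %/ 2) = 0.
  by rewrite dec0.
by move=> e; have := dec_coords_inj e h2 pE; rewrite -!divn_eq.
Qed.

Lemma load_spec s m r : sized n d s -> nmem s 18 0 = r ->
  forall j, (j < N)%N -> fmem (sem (LOAD m) s) 12 j = blk m (row_of s r) j.
Proof.
move=> hs hr j jN.
rewrite (@tab_spec _ 13 12 xV _ s (blk m (row_of s r)) N) ?jN ?(sizeE hs) //.
  by rewrite (neval_big hs) leq_pmulr // szV_gt0.
move=> s' k kN g1 g2 g3 _; have hs' : sized n d s' by apply: sized_eq hs; rewrite g1.
rewrite ceval_if teval_leq !ceval_ce /row_block feval_read !nevalE (g1 18%N) // hr g2 (sizeE hs') (neval_B hs') g3 //.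
by rewrite addn1.
Qed.

Lemma ins_spec s m r T : sized n d s -> nmem s 18 0 = r -> tracks s T ->
  let s' := sem (INS m) s in
  (teval s' NEW <-> T (dv n d (row_of s r) m)) /\
  tracks s' (fun v => exists a, T (v - cst R a *: dv n d (row_of s r) m)).
Proof.
move=> hs hr hT s'; rewrite /s' /INS sem_seq; set s1 := sem (LOAD m) s.
have hs1 : sized n d s1 by apply: sized_sem.
have eb : cvof N (fmem s1 12) = cvof N (blk m (row_of s r)).
  by apply/colP => j; rewrite !mxE (load_spec m hs hr).
have f15 : fmem s1 15 = fmem s 15 by rewrite /s1 tab_fframe.
have hblk j : (B <= j)%N -> blk m (row_of s r) j = 0 by move=> h; rewrite /blk ltnNge h.
have [|p [hp1 hp2 hp3 _ hp5]] := step_spec n0 hs1 (K := 15%N); first by [].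
split.
  rewrite /NEW /= -/(sem (STEP 15) s1) hp1 hp3 f15 eb -(dv_blk m) -(hT _ hblk).
  rewrite f15 eb in hp2; split=> [/eqP h|->]; last by rewrite mxE.
  by case: hp2 => //; rewrite h eqxx.
move=> f hf; rewrite hp5 step_kernel // f15 eb.
have key a : mxof N (fmem s 15) *m (cvof N f - a *: cvof N (blk m (row_of s r))) = 0 <->
    T (dv n d f 0 - cst R a *: dv n d (row_of s r) m).
  rewrite -(dv_blk m).
  have -> : dv n d f 0 - cst R a *: dv n d (blk m (row_of s r)) 0 =
      dv n d (fun j => - a * blk m (row_of s r) j + f j) 0 by rewrite dv_lin rmorphN scaleNr addrC.
  rewrite -hT; last by move=> j jB; rewrite hblk // mulr0 add0r hf.
  have -> : cvof N f - a *: cvof N (blk m (row_of s r)) = cvof N (fun j => - a * blk m (row_of s r) j + f j).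
    by apply/colP => j; rewrite !mxE addrC mulNr.
  by [].
by split=> -[a /key h]; exists a.
Qed.

Lemma ins_frame s m : [/\ forall a, a \notin [:: 13; 14; 16]%N -> nmem (sem (INS m) s) a = nmem s a &
  forall a, a \notin [:: 12; 13; 14; 15]%N -> fmem (sem (INS m) s) a = fmem s a].
Proof.
split=> a ha; first by rewrite sem_nframe //; apply: notin_all ha.
by rewrite sem_fframe //; apply: notin_all ha.
Qed.

Lemma tracks_id s : sized n d s -> tracks (sem (IDENTITY 15) s) (fun v => v = 0).
Proof.
move=> hs f hf; rewrite identity_spec // mul1mx; split=> [h|/(dv0_eq0 hf) h].
  apply/colP => j; rewrite !mxE; have e i : f i = 0.
    case: (ltnP i B) => [iB|/hf//]; have iN : (i < N)%N by rewrite NB; lia.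
    by have := congr1 (fun v : 'cV_N => v (Ordinal iN) 0) h; rewrite !mxE.
  by rewrite (boolp.funext e) dec0.
by apply/colP => j; rewrite !mxE h.
Qed.

Record column := Column { ckind : nat; clev : nat; cu : 'cV[K]_n; ct : 'cV[K]_n }.

Definition colvec s (a b : nat) : 'cV[K]_n := \col_j dec n d (fmem s a) (b * n + j).
Definition column_in s b (c : column) :=
  [/\ nmem s 11 b = ckind c, nmem s 12 b = clev c, colvec s 18 b = cu c & colvec s 19 b = ct c].
Definition stored s (cols : nat -> column) (N0 : nat) :=
  nmem s 10 0 = N0 /\ forall b, (b < N0)%N -> column_in s b (cols b).

Lemma stored_eq s s' cols N0 : nmem s' 10 = nmem s 10 -> nmem s' 11 = nmem s 11 -> nmem s' 12 = nmem s 12 ->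
  fmem s' 18 = fmem s 18 -> fmem s' 19 = fmem s 19 -> stored s cols N0 -> stored s' cols N0.
Proof. by rewrite /stored /column_in /colvec => -> -> -> -> ->. Qed.

Lemma colvec_copy s s' a b k (sg : R) f m :
  (forall j, fmem s' a j = if (k * B <= j < k * B + B)%N then sg * f (m * B + (j - k * B))%N else fmem s a j) ->
  colvec s' a b = if b == k then cst R sg *: dv n d f m else colvec s a b.
Proof.
move=> h; case: eqVneq => [->|bk]; apply/colP => j; rewrite !mxE.
  rewrite -(@dec_shift (fmem s' a) (fun j => sg * f (m * B + j)%N)) //; last first.
    by move=> i iB; rewrite h leq_addr ltn_add2l iB addKn.
  have -> : (fun j => sg * f (m * B + j)%N) = (fun j => sg * (fun j => f (m * B + j)%N) j + (fun=> 0) j).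
    by apply/boolp.funext => i; rewrite addr0.
  rewrite dec_lin (@dec_shift f (fun j => f (m * B + j)%N) m) //.
  by rewrite dec0 addr0.
rewrite -(@dec_shift (fmem s' a) (fun j => fmem s' a (b * B + j)%N)) // -(@dec_shift (fmem s a) (fun j => fmem s a (b * B + j)%N)) //.
have e i : (i < B)%N -> fmem s' a (b * B + i)%N = fmem s a (b * B + i)%N.
  move=> iB; rewrite h ifF //; apply/negbTE; rewrite negb_and -leqNgt -ltnNge.
  move: bk; rewrite neq_ltn => /orP[lt|lt]; apply/orP; [left|right].
    by apply: (@leq_trans (b.+1 * B)); rewrite ?leq_mul2r ?lt ?orbT // mulSn addnC ltn_add2r.
  by rewrite (leq_trans (n := k.+1 * B)) ?mulSn ?[(B + _)%N]addnC // -?mulSnr (leq_trans (n := b * B)) ?leq_mul2r ?lt ?orbT ?leq_addr.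
have eh h' : (h' < 2)%N -> coord_half n d (fun j => fmem s' a (b * B + j)%N) j h' = coord_half n d (fun j => fmem s a (b * B + j)%N) j h'.
  by move=> h2; apply/polyP => p; rewrite !coef_poly; case: ifP => // pE; rewrite e // local_lt.
by rewrite /dec !eh.
Qed.

Lemma col_spec s kind mu mt neg r k cols N0 : sized n d s -> nmem s 18 0 = r -> nmem s 9 0 = k ->
  stored s cols N0 ->
  let s' := sem (COL kind mu mt neg) s in
  let sg := if neg then -1 else 1 in
  stored s' (fun b => if b == N0 then Column kind k (sg *: dv n d (row_of s r) mu) (sg *: dv n d (row_of s r) mt)
                      else cols b) N0.+1.
Proof.
move=> hs hr hk [hN hc] s' sg; rewrite /s'.
pose sR : R := if neg then -1 else 1.
have sgE : sg = cst R sR by rewrite /sg /sR; case: (neg); rewrite ?rmorphN rmorph1.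
rewrite /COL sem_seq; set s1 := sem (SN 11 _ _) s; rewrite sem_seq; set s2 := sem (SN 12 _ _) s1.
rewrite sem_seq; set s3 := sem (COPY 18 _ _) s2; rewrite sem_seq; set s4 := sem (COPY 19 _ _) s3.
set s5 := sem _ s4.
have hs2 : sized n d s2 by apply: sized_sem => //; apply: sized_sem.
have hs3 : sized n d s3 by apply: sized_sem.
have n2 a : a \notin [:: 11; 12]%N -> nmem s2 a = nmem s a.
  move=> ha; rewrite /s2 sem_nframe; last by apply: notin_all ha.
  by rewrite /s1 sem_nframe //; apply: notin_all ha.
have f2 : fmem s2 = fmem s by [].
have n4 a : a \notin [:: 13]%N -> nmem s4 a = nmem s2 a.
  by rewrite inE => ha; rewrite /s4 copy_nframe // /s3 copy_nframe.
have val s0 m : (forall b, b != 13%N -> nmem s0 b = nmem s2 b) -> sized n d s0 -> fmem s0 16 = fmem s 16 ->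
    ceval s0 (CE (if neg then FSub FZero (row_block m) else row_block m)) = sR * row_of s r (m * B + nmem s0 13 0)%N.
  move=> h1 h2 h3; have e : feval s0 (row_block m) = row_of s r (m * B + nmem s0 13 0)%N.
    by rewrite /row_block feval_read !nevalE h1 // n2 // hr (sizeE h2) (neval_B h2) h3.
  by rewrite ceval_ce /sR; case: (neg); rewrite ?feval_sub ?feval0 e ?mul1r // mulN1r sub0r.
have base s0 : (forall b, b != 13%N -> nmem s0 b = nmem s2 b) -> sized n d s0 -> neval s0 (NMul (nvar 10) xB) = (N0 * B)%N.
  by move=> h1 h2; rewrite !nevalE h1 // n2 // hN (neval_B h2).
have c18 j : fmem s3 18 j = if (N0 * B <= j < N0 * B + B)%N then sR * row_of s r (mu * B + (j - N0 * B))%N else fmem s 18 j.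
  rewrite /s3 (@copy_spec _ n d 18 _ _ s2 (fun k => sR * row_of s r (mu * B + k)%N) (N0 * B)%N) //.
  move=> s0 i iB g1 g2 g3; have hs0 : sized n d s0 by apply: sized_eq hs2; rewrite g1.
  by rewrite base // val // ?g2 // g3.
have c19 j : fmem s4 19 j = if (N0 * B <= j < N0 * B + B)%N then sR * row_of s r (mt * B + (j - N0 * B))%N else fmem s 19 j.
  rewrite /s4 (@copy_spec _ n d 19 _ _ s3 (fun k => sR * row_of s r (mt * B + k)%N) (N0 * B)%N) //.
    by rewrite /s3 copy_fframe.
  have n3 b : b != 13%N -> nmem s3 b = nmem s2 b by move=> hb; rewrite /s3 copy_nframe.
  move=> s0 i iB g1 g2 g3; have hs0 : sized n d s0 by apply: sized_eq hs3; rewrite g1.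
  have n3' b : b != 13%N -> nmem s0 b = nmem s2 b by move=> hb; rewrite g1 // n3.
  by rewrite base // val // ?g2 // g3 // /s3 copy_fframe.
have f5 a : fmem s5 a = fmem s4 a by [].
have n5 a b : a != 10%N -> nmem s5 a b = nmem s4 a b by move=> /negPf ha; rewrite /s5 /= /update ha.
split; first by rewrite /s5 /= /update eqxx /= n4 // n2 // hN addn1.
move=> b bN; have e18 : colvec s5 18 b = if b == N0 then cst R sR *: dv n d (row_of s r) mu else colvec s 18 b.
  by apply: colvec_copy => j; rewrite f5 /s4 copy_fframe // c18.
have e19 : colvec s5 19 b = if b == N0 then cst R sR *: dv n d (row_of s r) mt else colvec s 19 b.
  by apply: colvec_copy => j; rewrite f5 c19.
have e11 : nmem s5 11 b = if b == N0 then kind else nmem s 11 b.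
  by rewrite n5 // n4 // /s2 /s1 /= /update /= hN.
have e12 : nmem s5 12 b = if b == N0 then k else nmem s 12 b.
  by rewrite n5 // n4 // /s2 /s1 /= /update /= hN hk.
rewrite /column_in e18 e19 e11 e12 -sgE; case: eqVneq => [//|bN0].
by apply: hc; rewrite ltn_neqAle bN0.
Qed.

Lemma col_frame s kind mu mt neg :
  [/\ forall a, a \notin [:: 10; 11; 12; 13]%N -> nmem (sem (COL kind mu mt neg) s) a = nmem s a &
  forall a, a \notin [:: 18; 19]%N -> fmem (sem (COL kind mu mt neg) s) a = fmem s a].
Proof.
split=> a ha; first by rewrite sem_nframe //; apply: notin_all ha.
by rewrite sem_fframe //; apply: notin_all ha.
Qed.
End Columns.

Section Rows.
Variables (R : realType) (n d : nat).
Hypothesis n0 : (0 < n)%N.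
Local Notation K := (ffield R).
Local Notation N := (szV n d).
Local Notation mem := (memory R).
Local Notation sem := (sem xbig).
Implicit Types (s : mem) (f : nat -> R) (T : 'cV[K]_n -> Prop).

(** The rule for a pass over all solutions: the body must preserve the solution matrix, the row
    index and the degree. *)
Lemma rows_loop body s (Phi : nat -> mem -> Prop) : sized n d s ->
  wf body -> 18%N \notin nwrites body -> 9%N \notin nwrites body -> 16%N \notin fwrites body ->
  (forall k v s', Phi k s' -> Phi k (setn 18 0 v s')) -> (forall k v s', Phi k s' -> Phi k (setn 18 1 v s')) ->
  Phi 0%N s ->
  (forall k s', (k < N)%N -> sized n d s' -> nmem s' 18 0 = k -> nmem s' 9 = nmem s 9 ->
     fmem s' 16 = fmem s 16 -> Phi k s' -> Phi k.+1 (sem body s')) ->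
  Phi N (sem (SFor 18 xV body) s).
Proof.
move=> hs wb b18 b9 b16 st0 st1 h0 hS.
pose Inv k (s' : mem) := [/\ sized n d s', nmem s' 9 = nmem s 9, fmem s' 16 = fmem s 16 & Phi k s'].
have hN : neval s (bound xbig xV) = N by apply: bound_V.
suff : Inv (neval s (bound xbig xV)) (sem (SFor 18 xV body) s) by rewrite hN; case.
apply: (for_ind (Inv := Inv)) => // [|k s' kN vk [i1 i2 i3 i4]].
  by split=> //; apply/st0/st1.
rewrite hN in kN; split; last by apply: st0; apply: hS.
- exact: (@sized_sem _ n d body s' wb i1).
- by rewrite -i2 -(@sem_nframe _ xbig body s' 9 b9).
by rewrite fmem_setn sem_fframe.
Qed.

Definition lin T := T 0 /\ forall a u v, T u -> T v -> T (cst R a *: u + v).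
Definition insert T (v : 'cV[K]_n) : 'cV[K]_n -> Prop := fun w => exists a, T (w - cst R a *: v).

Lemma lin_insert T v : lin T -> lin (insert T v).
Proof.
move=> [h0 h1]; split; first by exists 0; rewrite rmorph0 scale0r subr0.
move=> a u w [p hp] [q hq]; exists (a * p + q); rewrite rmorphD rmorphM scalerDl -scalerA.
have -> : cst R a *: u + w - (cst R a *: (cst R p *: v) + cst R q *: v) =
   cst R a *: (u - cst R p *: v) + (w - cst R q *: v) by rewrite scalerBr addrACA -opprD.
exact: h1.
Qed.

Lemma insert_sub T v w : T w -> insert T v w.
Proof. by exists 0; rewrite rmorph0 scale0r subr0. Qed.
Lemma insert_self T v : lin T -> insert T v v.
Proof. by case=> h _; exists 1; rewrite rmorph1 scale1r subrr. Qed.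
Lemma insert_least T T' v : lin T' -> (forall w, T w -> T' w) -> T' v -> forall w, insert T v w -> T' w.
Proof.
move=> [h0 h1] hT hv w [a /hT h]; have := h1 a v (w - cst R a *: v) hv h.
by rewrite addrC subrK.
Qed.

Lemma tracks_ext s T T' : (forall v, T v <-> T' v) -> tracks d s T -> tracks d s T'.
Proof. by move=> h hT f hf; rewrite hT. Qed.
Lemma tracks_mem s s' T : fmem s' 15 = fmem s 15 -> tracks d s T -> tracks d s' T.
Proof. by rewrite /tracks => ->. Qed.

Lemma lin_sum T m (c : nat -> R) (g : nat -> 'cV[K]_n) : lin T -> (forall r, (r < m)%N -> T (g r)) ->
  T (\sum_(r < m) cst R (c r) *: g r).
Proof.
move=> [h0 h1] hg; elim: m hg => [|m IH] hg; first by rewrite big_ord0.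
rewrite big_ord_recr /= addrC; apply: h1; first exact: hg.
by apply: IH => r rm; apply: hg; rewrite ltnS ltnW.
Qed.

Lemma dv_sum m (c : nat -> R) (g : nat -> nat -> R) b :
  dv n d (fun j => \sum_(r < m) c r * g r j) b = \sum_(r < m) cst R (c r) *: dv n d (g r) b.
Proof.
elim: m => [|m IH].
  by rewrite big_ord0; apply/colP => j; rewrite !mxE -(dec0 R n d (b * n + j)); congr dec; apply/boolp.funext => i; rewrite big_ord0.
rewrite big_ord_recr /= -IH addrC -dv_lin; congr dv; apply/boolp.funext => j.
by rewrite big_ord_recr /= addrC.
Qed.

Lemma kernel_row s P r : kernel_in n d s P -> (r < N)%N -> P (row_of n d s r).
Proof.
move=> hP rN; apply/hP; have -> : rvof N (row_of n d s r) = row (Ordinal rN) (mxof N (fmem s 16)).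
  by apply/rowP => j; rewrite !mxE.
exact: row_sub.
Qed.

(** The rows span all solutions, so it is enough that a subspace contains block m of each row. *)
Lemma kernel_span s P T m f : kernel_in n d s P -> lin T -> (m < 4)%N ->
  (forall r, (r < N)%N -> T (dv n d (row_of n d s r) m)) -> P f -> T (dv n d f m).
Proof.
move=> hP hT m4 hr /hP /submxP[D hD].
pose c (r : nat) : R := if insub r is Some r' then D 0 r' else 0.
have cE (r : 'I_N) : c r = D 0 r by rewrite /c valK.
have -> : dv n d f m = dv n d (fun j => \sum_(r < N) c r * row_of n d s r j) m.
  apply/colP => i; rewrite !mxE; apply: (dec_ext n0); first exact: digit_bound.
  move=> j jN; have := congr1 (fun v : 'rV_N => v 0 (Ordinal jN)) hD; rewrite !mxE => ->.
  by apply: eq_bigr => r _; rewrite cE mxE.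
rewrite dv_sum; exact: (lin_sum c (g := fun r => dv n d (row_of n d s r) m) hT hr).
Qed.
End Rows.

(** * The computation of the generators *)

(* The unknowns are (g, t g, s g, 0). *)
Definition even_system : system :=
  [:: (0, 0, CA); (1, 0, CU false true false); (1, 1, CU false false true);
      (2, 0, CU true false false); (2, 2, CU false false true); (3, 3, CU false false true)]%N.
(* The unknowns are (g0, g1, g2, g3) with g2 = s g0 - t g1 and g3 = t g0 + s g1. *)
Definition odd_system : system :=
  [:: (0, 0, CA); (1, 1, CA); (2, 2, CA);
      (3, 0, CU true false false); (3, 1, CU false true true); (3, 2, CU false false true);
      (4, 0, CU false true false); (4, 1, CU true false false); (4, 3, CU false false true)]%N.

Lemma big_nat4 (V : nmodType) (g : nat -> V) : \sum_(0 <= b < 4) g b = g 0%N + g 1%N + g 2%N + g 3%N.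
Proof. by rewrite !big_nat_recr ?big_geq //= add0r. Qed.

Section SystemRows.
Variables (R : realType) (n d : nat).
Local Notation K := (ffield R).
Variables (A W : 'M[K]_n) (f : nat -> R).
Local Notation v := (dv n d f).
Local Notation row l r := (sys d A W l f r).

Lemma sys4 l r : row l r = block_mx_of A W l r 0 *m v 0 + block_mx_of A W l r 1 *m v 1 +
  block_mx_of A W l r 2 *m v 2 + block_mx_of A W l r 3 *m v 3.
Proof. exact: big_nat4. Qed.

Lemma block_lookup l r b k : lookup l r b = k ->
  block_mx_of A W l r b *m v b = if k is Some c then code_mx A W c *m v b else 0.
Proof. by rewrite /block_mx_of => ->; case: k => //; rewrite mul0mx. Qed.

Lemma code_unit hh pp neg (w : 'cV[K]_n) : code_mx A W (CU hh pp neg) *m w = unit_entry R hh pp neg *: w.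
Proof. by rewrite mul_scalar_mx. Qed.

Lemma unit_t : unit_entry R false true false = y_z R. Proof. by rewrite /unit_entry !mul1r. Qed.
Lemma unit_nt : unit_entry R false true true = - y_z R. Proof. by rewrite /unit_entry mulr1 mulN1r. Qed.
Lemma unit_s : unit_entry R true false false = x_z R. Proof. by rewrite /unit_entry mul1r mulr1. Qed.
Lemma unit_n1 : unit_entry R false false true = -1. Proof. by rewrite /unit_entry !mulr1. Qed.

Lemma code_A (w : 'cV[K]_n) : code_mx A W CA *m w = A *m w. Proof. by []. Qed.

Definition rowE := (code_A, code_unit, unit_t, unit_nt, unit_s, unit_n1, scaleN1r, scaleNr).

Ltac lookup_row l r :=
  rewrite (sys4 l r);
  let k0 := eval vm_compute in (lookup l r 0) in let k1 := eval vm_compute in (lookup l r 1) in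
  let k2 := eval vm_compute in (lookup l r 2) in let k3 := eval vm_compute in (lookup l r 3) in
  rewrite (@block_lookup l r 0 k0 erefl) (@block_lookup l r 1 k1 erefl)
    (@block_lookup l r 2 k2 erefl) (@block_lookup l r 3 k3 erefl) ?rowE ?addr0 ?add0r.

Lemma even_rows : [/\ row even_system 0 = A *m v 0, row even_system 1 = y_z R *: v 0 - v 1,
  row even_system 2 = x_z R *: v 0 - v 2 & row even_system 3 = - v 3].
Proof.
split; [lookup_row even_system 0%N | lookup_row even_system 1%N | lookup_row even_system 2%N |
  lookup_row even_system 3%N]; reflexivity.
Qed.

Lemma odd_rows : [/\ row odd_system 0 = A *m v 0, row odd_system 1 = A *m v 1, row odd_system 2 = A *m v 2,
  row odd_system 3 = x_z R *: v 0 - y_z R *: v 1 - v 2 & row odd_system 4 = y_z R *: v 0 + x_z R *: v 1 - v 3].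
Proof.
split; [lookup_row odd_system 0%N | lookup_row odd_system 1%N | lookup_row odd_system 2%N |
  lookup_row odd_system 3%N | lookup_row odd_system 4%N]; reflexivity.
Qed.
End SystemRows.

(** * Appending an item to a family *)

Lemma sub_four (V : zmodType) (u o a b c d : V) : u - (o + (a + b + c + d)) = u - d - c - b - a - o.
Proof. by rewrite !opprD !addrA (ACl (1*6*5*4*3*2)%AC). Qed.

Section GradedExtension.
Variables (F : realFieldType) (A : comNzRingType) (c : {rmorphism F -> A}) (X : lmodType A) (S : graded c X).
Implicit Types (it : nat -> item X).

Lemma osum_recr it k N q : osum c it k N.+1 q = osum c it k N q +
  (if isodd (it N) && (lev (it N) == k) then ocomb c (it N) (q N) else 0).
Proof. by rewrite /osum big_ord_recr. Qed.
Lemma esum_recr it k N q : esum c it k N.+1 q = esum c it k N q +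
  (if ~~ isodd (it N) && (lev (it N) == k) then c (q N) *: g0 (it N) else 0).
Proof. by rewrite /esum big_ord_recr. Qed.
Lemma osum_ext it it' k N q q' : (forall i, (i < N)%N -> it i = it' i /\ q i = q' i) ->
  osum c it k N q = osum c it' k N q'.
Proof. by move=> h; apply: eq_bigr => i _; have [-> ->] := h i (ltn_ord i). Qed.
Lemma esum_ext it it' k N q q' : (forall i, (i < N)%N -> it i = it' i /\ q i = q' i) ->
  esum c it k N q = esum c it' k N q'.
Proof. by move=> h; apply: eq_bigr => i _; have [-> ->] := h i (ltn_ord i). Qed.

Lemma Wodd_recr it k N u : Wodd S it k N u -> Wodd S it k N.+1 u.
Proof.
move=> [q hq]; exists (fun i j => if i == N then 0 else q i j); rewrite osum_recr.
rewrite (@osum_ext it it k N _ q) => [|i iN]; last by split=> //; apply/boolp.funext => j; rewrite ltn_eqF.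
by case: ifP => _; rewrite /ocomb ?eqxx ?rmorph0 ?scale0r ?addr0.
Qed.
Lemma Weven_recr it k N u : Weven S it k N u -> Weven S it k N.+1 u.
Proof.
move=> [q hq]; exists (fun i => if i == N then 0 else q i); rewrite esum_recr.
rewrite (@esum_ext it it k N _ q) => [|i iN]; last by split=> //; rewrite ltn_eqF.
by case: ifP => _; rewrite ?eqxx ?rmorph0 ?scale0r ?addr0.
Qed.

Lemma Q_x k u : G S k u -> Q S k.+1 (gx S *: u).
Proof. by move=> hu; exists u, 0, 0; split; rewrite ?scaler0 ?addr0 //; apply: Gz0. Qed.
Lemma Q_y k u : G S k u -> Q S k.+1 (gy S *: u).
Proof. by move=> hu; exists 0, u, 0; split; rewrite ?scaler0 ?add0r ?addr0 //; apply: Gz0. Qed.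
Lemma Q_z k u : G S k u -> Q S k.+1 (gz S *: u).
Proof. by move=> hu; exists 0, 0, u; split; rewrite ?scaler0 ?add0r //; apply: Gz0. Qed.

Lemma Wodd_start it k N u : (forall i, (i < N)%N -> isodd (it i) -> lev (it i) != k) -> Wodd S it k N u -> Q S k u.
Proof.
move=> h [q]; rewrite /osum big1 ?subr0 // => i _; case: ifP => // /andP[io /eqP lk].
by have := h i (ltn_ord i) io; rewrite lk eqxx.
Qed.
Lemma Weven_start it k N u : (forall i, (i < N)%N -> ~~ isodd (it i) -> lev (it i) != k) -> Weven S it k N u -> P S k u.
Proof.
move=> h [q]; rewrite /esum big1 ?subr0 // => i _; case: ifP => // /andP[io /eqP lk].
by have := h i (ltn_ord i) io; rewrite lk eqxx.
Qed.

Lemma Wodd_P it k N u : (forall i, (i < N)%N -> valid S (it i)) -> Wodd S it k N u -> P S k u.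
Proof.
move=> hv [q hq]; rewrite -(subrK (osum c it k N q) u); apply: PD; first exact: Q_P.
by have [q1 [q2 [q3 /quad_P[]]]] := @osum_quad F A c X S it k N q hv.
Qed.
Lemma Weven_G it k N u : (forall i, (i < N)%N -> valid S (it i)) -> Weven S it k N u -> G S k u.
Proof.
move=> hv [q [hq _]]; rewrite -(subrK (esum c it k N q) u); apply: GD => //; apply: Gsum => i _.
case: ifP => [/andP[_ /eqP <-]|_]; last exact: Gz0.
by apply: GZ; apply: valid_g0; apply: hv.
Qed.

Definition append it r (x : item X) : nat -> item X := fun i => if i == r then x else it i.

Lemma append_lt it r x i : (i < r)%N -> append it r x i = it i.
Proof. by move=> ir; rewrite /append ltn_eqF. Qed.
Lemma append_eq it r x : append it r x r = x. Proof. by rewrite /append eqxx. Qed.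

Lemma Wodd_append_inv it r k x u : isodd x -> lev x = k -> Wodd S (append it r x) k r.+1 u ->
  exists a0 a1 a2 a3, Wodd S it k r (u - c a3 *: g3 x - c a2 *: g2 x - c a1 *: g1 x - c a0 *: g0 x).
Proof.
move=> ox lx [q]; rewrite osum_recr append_eq ox lx eqxx /=.
rewrite (@osum_ext (append it r x) it k r q q) => [|i ir]; last by rewrite append_lt.
rewrite /ocomb sub_four => hq; exists (q r 0%N), (q r 1%N), (q r 2%N), (q r 3%N).
by exists q.
Qed.
Lemma Wodd_append it r k x u a0 a1 a2 a3 : isodd x -> lev x = k -> Wodd S it k r u ->
  Wodd S (append it r x) k r.+1 (u + c a0 *: g0 x + c a1 *: g1 x + c a2 *: g2 x + c a3 *: g3 x).
Proof.
move=> ox lx [q hq]; exists (fun i => if i == r then nth 0 [:: a0; a1; a2; a3] else q i).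
rewrite osum_recr append_eq ox lx eqxx.
rewrite (@osum_ext _ it k r _ q) => [|i ir]; last by rewrite append_lt // ltn_eqF.
by rewrite /ocomb sub_four /= eqxx /= !addrK.
Qed.
Lemma Weven_append_inv it r k x u : ~~ isodd x -> lev x = k -> Weven S (append it r x) k r.+1 u ->
  exists a, Weven S it k r (u - c a *: g0 x).
Proof.
move=> ox lx [q]; rewrite esum_recr append_eq ox lx eqxx /=.
rewrite (@esum_ext (append it r x) it k r q q) => [|i ir]; last by rewrite append_lt.
move=> hq; exists (q r), q; rewrite -addrA -opprD.
by rewrite [_ *: _ + _]addrC.
Qed.
Lemma Weven_append it r k x u a : ~~ isodd x -> lev x = k -> Weven S it k r u ->
  Weven S (append it r x) k r.+1 (u + c a *: g0 x).
Proof.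
move=> ox lx [q hq]; exists (fun i => if i == r then a else q i).
rewrite esum_recr append_eq ox lx !eqxx /=.
rewrite (@esum_ext _ it k r _ q) => [|i ir]; last by rewrite append_lt // ltn_eqF.
by rewrite opprD [- esum _ _ _ _ _ + _]addrC addrA addrK.
Qed.
Lemma Wodd_append_ext it r k x u : Wodd S it k r u -> Wodd S (append it r x) k r.+1 u.
Proof. by move=> hu; apply: Wodd_recr; apply: Wodd_ext hu => i ir; rewrite append_lt. Qed.
Lemma Weven_append_ext it r k x u : Weven S it k r u -> Weven S (append it r x) k r.+1 u.
Proof. by move=> hu; apply: Weven_recr; apply: Weven_ext hu => i ir; rewrite append_lt. Qed.

Lemma good_append_generic it r x : good S it r -> valid S x ->
  (if isodd x then ~ Wodd S it (lev x) r (g0 x) else ~ Weven S it (lev x) r (g0 x)) ->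
  good S (append it r x) r.+1.
Proof.
move=> hg hv hx; have hg' := good_extend (fun i ir => esym (append_lt it x ir)) hg.
move=> i; rewrite ltnS leq_eqVlt => /predU1P[->|ir]; last exact: hg'.
rewrite append_eq; split=> //; case: ifP hx => _ hx hW; apply: hx.
  by apply: Wodd_ext hW => i' i'r; rewrite append_lt.
by apply: Weven_ext hW => i' i'r; rewrite append_lt.
Qed.
End GradedExtension.

(** * Homogeneous sections as columns over R_1 *)

Section Semantics.
Variables (R : realType) (n : nat) (M : 'M[ffield R]_n) (d : nat).
Hypothesis hM : GL (@R12 R) M.
Hypothesis hd : forall i j, Fil (2 * d).+1 (y_z R ^+ d * M i j).
Hypothesis n0 : (0 < n)%N.
Local Notation K := (ffield R).
Local Notation s := (x_z R).
Local Notation t := (y_z R).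
Local Notation X := (pairmod 'cV[ring1 R]_n 'cV[ring2 R]_n).
Local Notation item := (item X).
Local Notation S := (glue_graded (matrix_gluing hM hd)).
Local Notation A := (mA M d).
Local Notation h := (szh n d).
Local Notation E := (szE n d).
Implicit Types (it : nat -> item) (u : X) (v : 'cV[K]_n).

(** The component over U_1 determines a section of given degree, so the algorithm handles columns
    over R_1 only; z acts on them as 1. *)
Definition vl (u : X) : 'cV[K]_n := map_mx val u.1.

Lemma szhE : h = (n * (2 * d).+2)%N. Proof. by rewrite /szh addn2. Qed.

Lemma vl_lin a (u w : X) : vl ((cpair a : ring_pair R) *: u + w) = cst R a *: vl u + vl w.
Proof. by case: u w => u1 u2 [w1 w2]; rewrite /vl pairZ; apply: val1_col. Qed.
Lemma vlD (u w : X) : vl (u + w) = vl u + vl w.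
Proof. by apply/colP => i; rewrite !mxE. Qed.
Lemma vlZ a (u : X) : vl ((cpair a : ring_pair R) *: u) = cst R a *: vl u.
Proof. by apply/colP => i; rewrite !mxE. Qed.
Lemma vlB (u w : X) : vl (u - w) = vl u - vl w.
Proof. by apply/colP => i; rewrite !mxE. Qed.
Lemma vl0 : vl 0 = 0.
Proof. by apply/colP => i; rewrite !mxE. Qed.
Lemma vl_x (u : X) : vl (px R *: u) = s *: vl u.
Proof. by apply/colP => i; rewrite !mxE. Qed.
Lemma vl_y (u : X) : vl (py R *: u) = t *: vl u.
Proof. by apply/colP => i; rewrite !mxE. Qed.
Lemma vl_z (u : X) : vl (pz R *: u) = vl u.
Proof. by case: u => u1 u2; rewrite /vl pairZ scale1r. Qed.

Lemma vl_R1 u i : vl u i 0 \in @R1 R.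
Proof. by rewrite mxE; apply: (valP (u.1 i 0)). Qed.

Lemma mA_R1 i j : A i j \in @R1 R. Proof. exact: Fil_R1 (mA_Fil hd i j). Qed.

Lemma mA_glued k u : G S k u <-> A *m vl u = t ^+ k *: map_mx val u.2.
Proof.
rewrite -[G S k u]/(t ^+ d.+1 *: mk1 M u.1 = t ^+ k *: mk2 u.2) /mk1 /mk2 /vl /mA scalemxAl.
by [].
Qed.

Lemma G_level k u : G S k u -> forall i, Fil k ((A *m vl u) i 0).
Proof.
move=> hu i; have e := (mA_glued k u).1 hu.
apply: (@R1_tR2 R k _ (val (u.2 i 0))); last by rewrite e !mxE mulrC.
  by rewrite mxE rpred_sum // => j _; rewrite rpredM ?mA_R1 ?vl_R1.
exact: (valP (u.2 i 0)).
Qed.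

(** The component over U_2 is A v / t^k, regular there by the pole order. With [G_level] this
    describes G_k by linear equations. *)
Lemma G_lift k v : (forall i, v i 0 \in @R1 R) -> (forall i, Fil k ((A *m v) i 0)) ->
  exists u, G S k u /\ vl u = v.
Proof.
move=> h1 h2.
have [z ez] : exists z, z = A *m v by exists (A *m v).
rewrite -ez in h2.
have h3 i : z i 0 / t ^+ k \in @R2 R by apply/R2P; exists k; rewrite divfK ?tX_neq0.
pose u : X := (\col_i insubd (0 : ring1 R) (v i 0), \col_i insubd (0 : ring2 R) (z i 0 / t ^+ k)).
have e2 : map_mx val u.2 = t ^- k *: z by apply/colP => i; rewrite !mxE insubdK // mulrC.
have e : vl u = v by apply/colP => i; rewrite !mxE insubdK.
exists u; split; last exact: e.
apply: (mA_glued k u).2; rewrite e e2 -ez scalerA (divff (tX_neq0 R k)) scale1r; reflexivity.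
Qed.

Lemma vl_inj k u w : G S k u -> G S k w -> vl u = vl w -> u = w.
Proof.
move=> hu hw e; apply/eqP; rewrite -subr_eq0; apply/eqP; apply: (@chart1_inj _ _ _ _ _ _ _ (matrix_gluing hM hd) k).
  exact: GB.
apply/colP => i; apply: val_inj; have := congr1 (fun v : 'cV_n => v i 0) e; rewrite !mxE => ei.
by rewrite [LHS]/= -/(val (u.1 i 0)) ei; apply/eqP; rewrite subr_eq0.
Qed.

(** From v = t^(- 2 h) B (A v), with B of pole order at most 4 h and A v at most k. For k <= 2 h + 1
    this gives 4 h + 1, and 4 h + 3 leaves room for the products by s and t. *)
Lemma G_bound k u : G S k u -> forall i, Fil (2 * h + k) (vl u i 0).
Proof.
move=> hu; have [B [hB hAB]] := mA_inv hM hd; have ht : t ^+ (2 * h) != 0 := tX_neq0 R _.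
rewrite -szhE in hB hAB.
have hBA : B *m A = (t ^+ (2 * h))%:M.
  have := @scaled_inverse K n B A 1 (t ^+ (2 * h)) (oner_neq0 _) ht; rewrite !scale1r.
  exact.
move=> i; apply: (@Fil_divt R (2 * h)); first exact: vl_R1.
have -> : vl u i 0 * t ^+ (2 * h) = (B *m (A *m vl u)) i 0.
  by rewrite mulmxA hBA mul_scalar_mx [RHS]mxE mulrC.
rewrite mxE; apply: Fil_sum => j _; apply: Fil_le (FilM (hB i j) (G_level hu j)).
by rewrite addnA -mulnDl.
Qed.
End Semantics.

(** [INIT] inserts g, t g and s g for all g of degree k, which span z G_k + y G_k + x G_k. [ODD]
    records g0 and - g1 of each new quadruple, the latter with its companion - g2 over U_2, and
    inserts all four vectors. [EVEN] continues with the span left by [ODD]. *)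
Definition INIT : sprog := (IDENTITY 15 ;; SFor 18 xV (INS 0 ;; INS 1 ;; INS 2))%S.
Definition ODD : sprog := SFor 18 xV (INS 0 ;;
  SIf NEW SSkip (COL 1 0 0 false ;; COL 2 1 2 true ;; INS 1 ;; INS 2 ;; INS 3))%S.
Definition EVEN : sprog := SFor 18 xV (SSeq (INS 0) (SIf NEW SSkip (COL 0 0 0 false))).

Section Kernels.
Variables (R : realType) (n : nat) (M : 'M[ffield R]_n) (d : nat).
Hypothesis hM : GL (@R12 R) M.
Hypothesis hd : forall i j, Fil (2 * d).+1 (y_z R ^+ d * M i j).
Hypothesis n0 : (0 < n)%N.
Local Notation K := (ffield R).
Local Notation s := (x_z R).
Local Notation t := (y_z R).
Local Notation X := (pairmod 'cV[ring1 R]_n 'cV[ring2 R]_n).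
Local Notation item := (item X).
Local Notation S := (glue_graded (matrix_gluing hM hd)).
Local Notation A := (mA M d).
Local Notation h := (szh n d).
Local Notation E := (szE n d).
Local Notation N := (szV n d).
Local Notation mem := (memory R).
Local Notation sem := (sem xbig).
Local Notation dv := (dv n d).
Local Notation vl := (@vl R n).
Implicit Types (it : nat -> item) (u : X) (v : 'cV[K]_n) (m : mem).

Lemma dv_surj (vb : nat -> 'cV[K]_n) : (forall b i, Fil (4 * h + 3) (vb b i 0)) -> exists f, forall b, dv f b = vb b.
Proof.
move=> hv.
have hg c : exists a b, [/\ (if insub (c %% n)%N is Some j then vb (c %/ n)%N j 0 else 0) = emb a b,
    (size a <= E)%N & (size b <= E)%N].
  case: insubP => [j _ _|_]; last by exists 0, 0; rewrite emb0 !size_poly0.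
  have [a [b [e sa sb]]] := hv (c %/ n)%N j; exists a, b.
  by split=> //; rewrite /szE; [apply: leq_trans sa _ | apply: leq_trans sb _]; lia.
have [f hf] := dec_surj hg; exists f => b; apply/colP => j.
by rewrite mxE hf modn_digit // divn_digit // valK.
Qed.

Lemma Fil_ts k v a : (forall i, Fil k (v i 0)) -> a = s \/ a = t -> forall i, Fil k.+1 ((a *: v) i 0).
Proof.
by move=> hv ha i; rewrite mxE; apply: (@FilM R 1); last exact: hv; case: ha => ->; [apply: Fil_s | apply: Fil_t].
Qed.

Definition evenP k f := exists u, [/\ G S k u, dv f 0 = vl u, dv f 1 = t *: vl u, dv f 2 = s *: vl u & dv f 3 = 0].
Definition oddP k f := exists a b c e, [/\ quad S k a b c e, dv f 0 = vl a, dv f 1 = vl b, dv f 2 = vl c & dv f 3 = vl e].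

Lemma dv_R1 f b i : dv f b i 0 \in @R1 R. Proof. by rewrite mxE dec_R1. Qed.

Lemma even_kernel W k f : (forall r, (r < 4)%N ->
    if (r < 1)%N then forall i, Fil k (sys d A W even_system f r i 0) else sys d A W even_system f r = 0) <-> evenP k f.
Proof.
have [e0 e1 e2 e3] := even_rows d A W f.
split=> [hr|[u [hu d0 d1 d2 d3]] r r4].
  have h0 := hr 0%N isT; have h1 := hr 1%N isT; have h2 := hr 2%N isT; have h3 := hr 3%N isT.
  rewrite /= e0 in h0; rewrite /= e1 in h1; rewrite /= e2 in h2; rewrite /= e3 in h3.
  have [u [hu eu]] := G_lift hM hd (dv_R1 f 0) h0; exists u; rewrite eu; split; [exact: hu|reflexivity|..].
  - by symmetry; apply: subr0_eq.
  - by symmetry; apply: subr0_eq.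
  - by apply: oppr_inj; rewrite h3 oppr0.
case: r r4 => [|[|[|[|//]]]] _ /=.
- by rewrite e0 d0; apply: G_level hu.
- by rewrite e1 d0 d1 subrr.
- by rewrite e2 d0 d2 subrr.
by rewrite e3 d3 oppr0.
Qed.

(** Only the relations defining g2 and g3 are imposed; the others of [quad], and the degree of g3,
    follow by [quad_complete]. *)
Lemma odd_kernel W k f : (forall r, (r < 5)%N ->
    if (r < 3)%N then forall i, Fil k (sys d A W odd_system f r i 0) else sys d A W odd_system f r = 0) <-> oddP k f.
Proof.
have [e0 e1 e2 e3 e4] := odd_rows d A W f.
split=> [hr|[a [b [c [e [[[ha hb hc he] [q1 q2 _ _]] d0 d1 d2 d3]]]]] r r5].
  have h0 := hr 0%N isT; have h1 := hr 1%N isT; have h2 := hr 2%N isT; have h3 := hr 3%N isT; have h4 := hr 4%N isT.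
  rewrite /= e0 in h0; rewrite /= e1 in h1; rewrite /= e2 in h2; rewrite /= e3 in h3; rewrite /= e4 in h4.
  have [a [ha ea]] := G_lift hM hd (dv_R1 f 0) h0.
  have [b [hb eb]] := G_lift hM hd (dv_R1 f 1) h1.
  have [c [hc ec]] := G_lift hM hd (dv_R1 f 2) h2.
  have hq : gx S *: a = gy S *: b + gz S *: c.
    apply: (@vl_inj _ _ _ _ hM hd k.+1); [exact: Gx | by apply: GD; [exact: Gy | exact: Gz] |].
    rewrite vlD [LHS]vl_x vl_y vl_z ea eb ec; apply/eqP; rewrite -subr_eq0 opprD addrA; exact/eqP.
  have [e hq2] := quad_complete ha hb hc hq; exists a, b, c, e; split=> //.
  have [_ [_ q2 _ _]] := hq2; have := congr1 vl q2.
  rewrite [LHS]vl_x vlD -scaleN1r -[-1 *: _]/((-1 : ring_pair R) *: _) => q.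
  have qe : vl e = s *: vl b + t *: vl a.
    have := congr1 vl q2; rewrite [LHS]vl_x -[X in _ = vl X]addrC vlB vl_y vl_z => ->.
    by rewrite subrK.
  by rewrite qe ea eb; apply/esym/eqP; rewrite -subr_eq0 addrC; apply/eqP; rewrite addrC [X in X - _]addrC h4.
have v1 : s *: vl a = t *: vl b + vl c by rewrite -vl_x q1 vlD vl_y vl_z.
have v2 : vl e = t *: vl a + s *: vl b.
  have := congr1 vl q2; rewrite [LHS]vl_x -[X in _ = vl X]addrC vlB vl_y vl_z => ->.
  by rewrite addrC subrK.
case: r r5 => [|[|[|[|[|//]]]]] _ /=.
- by rewrite e0 d0; apply: G_level ha.
- by rewrite e1 d1; apply: G_level hb.
- by rewrite e2 d2; apply: G_level hc.
- by rewrite e3 d0 d1 d2 v1 [t *: _ + _]addrC addrK subrr.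
by rewrite e4 d0 d1 d3 v2 subrr.
Qed.

Lemma even_exists k u : (k <= 2 * h + 1)%N -> G S k u -> exists f, evenP k f /\ dv f 0 = vl u.
Proof.
move=> kb hu; have hb i : Fil (4 * h + 1) (vl u i 0) by apply: (Fil_le _ (G_bound hu i)); lia.
pose vb b := nth 0 [:: vl u; t *: vl u; s *: vl u] b.
have [f hf] : exists f, forall b, dv f b = vb b.
  apply: dv_surj => b i; rewrite /vb; case: b => [|[|[|b]]] /=.
  - by apply: Fil_le (hb i); lia.
  - by apply: Fil_le (Fil_ts hb (or_intror erefl) i); lia.
  - by apply: Fil_le (Fil_ts hb (or_introl erefl) i); lia.
  - by rewrite nth_nil mxE; apply: Fil0.
exists f; split; last exact: (hf 0%N).
by exists u; split; [exact: hu | exact: (hf 0%N) | exact: (hf 1%N) | exact: (hf 2%N) | exact: (hf 3%N)].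
Qed.

Lemma odd_exists k a b c e : (k <= 2 * h + 1)%N -> quad S k a b c e -> exists f, oddP k f /\ dv f 0 = vl a.
Proof.
move=> kb hq; have [[ha hb hc he] _] := hq.
have bd u : G S k u -> forall i, Fil (4 * h + 3) (vl u i 0) by move=> hu i; apply: (Fil_le _ (G_bound hu i)); lia.
pose vb j := nth 0 [:: vl a; vl b; vl c; vl e] j.
have [f hf] : exists f, forall j, dv f j = vb j.
  apply: dv_surj => j i; rewrite /vb; case: j => [|[|[|[|j]]]] /=; try by apply: bd.
  by rewrite nth_nil mxE; apply: Fil0.
exists f; split; last exact: (hf 0%N).
by exists a, b, c, e; split; [exact: hq | exact: (hf 0%N) | exact: (hf 1%N) | exact: (hf 2%N) | exact: (hf 3%N)].
Qed.

Definition VQ k v := exists u, Q S k u /\ vl u = v.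
Definition VO it r k v := exists u, Wodd S it k r u /\ vl u = v.
Definition VE it r k v := exists u, Weven S it k r u /\ vl u = v.

Lemma lin_image (Pu : X -> Prop) : Pu 0 ->
  (forall a u w, Pu u -> Pu w -> Pu ((cpair a : ring_pair R) *: u + w)) -> lin (fun v => exists u, Pu u /\ vl u = v).
Proof.
move=> h0 h1; split; first by exists 0; split=> //; apply: vl0.
move=> a v w [u [hu <-]] [u' [hu' <-]]; exists ((cpair a : ring_pair R) *: u + u'); split; first exact: h1.
exact: vl_lin.
Qed.

Lemma lin_VQ k : lin (VQ k).
Proof. by apply: lin_image; [apply: Q0 | move=> a u w hu hw; apply: QD => //; apply: QZ]. Qed.
Lemma lin_VO it r k : lin (VO it r k).
Proof. by apply: lin_image; [apply: Q_Wodd; apply: Q0 | move=> a u w; apply: Wodd_lin]. Qed.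
Lemma lin_VE it r k : lin (VE it r k).
Proof. by apply: lin_image; [apply: P_Weven; apply: P0 | move=> a u w; apply: Weven_lin]. Qed.

Lemma VO_start it r k v : (forall i, (i < r)%N -> isodd (it i) -> lev (it i) != k) -> VO it r k v <-> VQ k v.
Proof.
move=> hl; split=> -[u [hu <-]]; exists u; split=> //; first exact: Wodd_start hl hu.
exact: Q_Wodd.
Qed.
(** Once the odd items exhaust P_k, the span tracked so far is also the initial span of the even
    phase, so nothing is recomputed. *)
Lemma VE_start it r k v : (forall i, (i < r)%N -> valid S (it i)) ->
  (forall i, (i < r)%N -> ~~ isodd (it i) -> lev (it i) != k) ->
  (forall u, P S k u -> Wodd S it k r u) -> VO it r k v <-> VE it r k v.
Proof.
move=> hv hl hP; split=> -[u [hu <-]]; exists u; split=> //.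
  by apply: P_Weven; apply: Wodd_P hu.
by apply: hP; apply: Weven_start hl hu.
Qed.

Lemma VO_append it r k x v : isodd x -> lev x = k ->
  VO (append it r x) r.+1 k v <->
  insert (insert (insert (insert (VO it r k) (vl (g0 x))) (vl (g1 x))) (vl (g2 x))) (vl (g3 x)) v.
Proof.
move=> ox lx; split.
  move=> [u [hu <-]]; have [a0 [a1 [a2 [a3 hw]]]] := Wodd_append_inv ox lx hu.
  by exists a3, a2, a1, a0; exists (u - cpair a3 *: g3 x - cpair a2 *: g2 x - cpair a1 *: g1 x - cpair a0 *: g0 x);
    split; [exact: hw | rewrite vlB vlZ vlB vlZ vlB vlZ vlB vlZ].
move=> [a3 [a2 [a1 [a0 [u [hw hu]]]]]].
exists (u + cpair a0 *: g0 x + cpair a1 *: g1 x + cpair a2 *: g2 x + cpair a3 *: g3 x).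
split; first exact: Wodd_append.
by rewrite vlD vlZ vlD vlZ vlD vlZ vlD vlZ hu !subrK.
Qed.

Lemma VE_append it r k x v : ~~ isodd x -> lev x = k ->
  VE (append it r x) r.+1 k v <-> insert (VE it r k) (vl (g0 x)) v.
Proof.
move=> ox lx; split.
  move=> [u [hu <-]]; have [a0 hw] := Weven_append_inv ox lx hu.
  by exists a0; exists (u - cpair a0 *: g0 x); split; [exact: hw | rewrite vlB vlZ].
move=> [a0 [u [hw hu]]]; exists (u + cpair a0 *: g0 x); split; first exact: Weven_append.
by rewrite vlD vlZ hu subrK.
Qed.

Lemma VO_ext it r k x v : VO it r k v -> VO (append it r x) r.+1 k v.
Proof. by move=> [u [hu hv]]; exists u; split; [exact: Wodd_append_ext | exact: hv]. Qed.
Lemma VE_ext it r k x v : VE it r k v -> VE (append it r x) r.+1 k v.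
Proof. by move=> [u [hu hv]]; exists u; split; [exact: Weven_append_ext | exact: hv]. Qed.

Lemma good_append it r x : good S it r -> valid S x ->
  (if isodd x then ~ VO it r (lev x) (vl (g0 x)) else ~ VE it r (lev x) (vl (g0 x))) ->
  good S (append it r x) r.+1.
Proof.
move=> hg hv hx; apply: good_append_generic => //; case: ifP hx => _ hx hW; apply: hx; exists (g0 x);
  by split; [exact: hW | reflexivity].
Qed.

Lemma init_spec m k : sized n d m -> (k <= 2 * h + 1)%N -> kernel_in n d m (evenP k) ->
  tracks d (sem INIT m) (VQ k.+1).
Proof.
move=> hs kb hk; rewrite /INIT sem_seq; set m1 := sem (IDENTITY 15) m; set body := SSeq _ _.
have hs1 : sized n d m1 by apply: sized_sem.
have f16 : fmem m1 16 = fmem m 16 by rewrite /m1 tab_fframe.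
have hin r : (r < N)%N -> exists u, [/\ G S k u, dv (row_of n d m r) 0 = vl u,
    dv (row_of n d m r) 1 = t *: vl u & dv (row_of n d m r) 2 = s *: vl u].
  by move=> rN; have [u [h1 h2 h3 h4 _]] := kernel_row hk rN; exists u.
have hQ u : G S k u -> [/\ VQ k.+1 (vl u), VQ k.+1 (t *: vl u) & VQ k.+1 (s *: vl u)].
  move=> hu; split.
  - by exists (pz R *: u); split; [exact: Q_z hu | exact: vl_z].
  - by exists (py R *: u); split; [exact: Q_y hu | exact: vl_y].
  - by exists (px R *: u); split; [exact: Q_x hu | exact: vl_x].
(* The intermediate spans have no intrinsic description; only an upper bound and the vectors already
   inserted are recorded. *)
pose Phi r (m' : mem) := exists T, [/\ tracks d m' T, lin T, forall v, T v -> VQ k.+1 v &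
  forall r', (r' < r)%N -> forall b, (b < 3)%N -> T (dv (row_of n d m r') b)].
suff [T [hT lT TQ hr]] : Phi N (sem (SFor 18 xV body) m1).
  apply: tracks_ext hT => v; split=> [/TQ//|[u [[a [b [c [ha hb hc ->]]]] <-]]].
  have inT a' : G S k a' -> [/\ T (vl a'), T (t *: vl a') & T (s *: vl a')].
    move=> ha'; have [f [hf e0]] := even_exists kb ha'; have [u' [hu' d0 d1 d2 _]] := hf.
    have sp b' : (b' < 3)%N -> T (dv f b').
      move=> b3; apply: (kernel_span n0 (m := b') hk lT) hf; first exact: ltnW.
      by move=> r rN; apply: hr.
    by rewrite -e0; split; [apply: sp | rewrite e0 -e0 d0 -d1; apply: sp | rewrite d0 -d2; apply: sp].
  have [_ _ Ta] := inT a ha; have [_ Tb _] := inT b hb; have [Tc _ _] := inT c hc.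
  rewrite !vlD vl_x vl_y vl_z; have [_ lT'] := lT.
  by have := lT' 1 _ _ (lT' 1 _ _ Ta Tb) Tc; rewrite rmorph1 !scale1r.
apply: (rows_loop n0) => //.
  exists (fun v => v = 0); split=> //; first exact: tracks_id.
    by split=> // a u v -> ->; rewrite scaler0 addr0.
  by move=> v ->; have [] := lin_VQ k.+1.
move=> r m2 rN hs2 r18 _ f16' [T [hT lT TQ hr]].
have erow m' : fmem m' 16 = fmem m1 16 -> row_of n d m' r = row_of n d m r.
  by rewrite /row_of => ->; rewrite f16.
rewrite /body sem_seq sem_seq; set m3 := sem (INS 0) m2; set m4 := sem (INS 1) m3.
have [nf3 ff3] := ins_frame m2 0; have [nf4 ff4] := ins_frame m3 1; rewrite -/m3 in nf3 ff3; rewrite -/m4 in nf4 ff4.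
have hs3 : sized n d m3 by apply: sized_sem.
have hs4 : sized n d m4 by apply: sized_sem.
have [_ t3] := ins_spec n0 0 hs2 r18 hT; rewrite -/m3 (erow m2) // in t3.
have r18' : nmem m3 18 0 = r by rewrite nf3.
have [_ t4] := ins_spec n0 1 hs3 r18' t3; rewrite -/m4 (erow m3) in t4; last by rewrite ff3.
have r18'' : nmem m4 18 0 = r by rewrite nf4.
have [_ t5] := ins_spec n0 2 hs4 r18'' t4; rewrite (erow m4) in t5; last by rewrite ff4 // ff3.
have l3 := lin_insert (dv (row_of n d m r) 0) lT; have l4 := lin_insert (dv (row_of n d m r) 1) l3.
have l5 := lin_insert (dv (row_of n d m r) 2) l4.
exists (insert (insert (insert T (dv (row_of n d m r) 0)) (dv (row_of n d m r) 1)) (dv (row_of n d m r) 2)).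
split=> //.
  have [u [hu -> -> ->]] := hin r rN; have [q1 q2 q3] := hQ u hu; have lQ := lin_VQ k.+1.
  by apply: insert_least => //; apply: insert_least => //; apply: insert_least.
move=> r'; rewrite ltnS leq_eqVlt => /predU1P[->|r'r] b b3; last by do 3 apply: insert_sub; apply: hr.
case: b b3 => [|[|[|//]]] _.
- by do 2 apply: insert_sub; apply: insert_self.
- by apply: insert_sub; apply: insert_self.
- exact: insert_self.
Qed.
End Kernels.

(** * The odd and the even phase in one degree *)

Section Phases.
Variables (R : realType) (n : nat) (M : 'M[ffield R]_n) (d : nat).
Hypothesis hM : GL (@R12 R) M.
Hypothesis hd : forall i j, Fil (2 * d).+1 (y_z R ^+ d * M i j).
Hypothesis n0 : (0 < n)%N.
Local Notation K := (ffield R).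
Local Notation s := (x_z R).
Local Notation t := (y_z R).
Local Notation X := (pairmod 'cV[ring1 R]_n 'cV[ring2 R]_n).
Local Notation item := (item X).
Local Notation S := (glue_graded (matrix_gluing hM hd)).
Local Notation A := (mA M d).
Local Notation h := (szh n d).
Local Notation N := (szV n d).
Local Notation mem := (memory R).
Local Notation sem := (sem xbig).
Local Notation dv := (dv n d).
Local Notation vl := (@vl R n).
Implicit Types (it : nat -> item) (x : item) (u : X) (v : 'cV[K]_n) (m : mem).

(** The second vector of a column is its companion, which leads to the basis over U_2: g0 for itself
    and - g2 for - g1, with the signs of [uvec] and [wvec]. *)
Definition item_cols x : seq (column R n) :=
  if isodd x then [:: Column 1 (lev x) (vl (g0 x)) (vl (g0 x)); Column 2 (lev x) (- vl (g1 x)) (- vl (g2 x))]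
  else [:: Column 0 (lev x) (vl (g0 x)) (vl (g0 x))].
Definition all_cols it r : seq (column R n) := flatten [seq item_cols (it i) | i <- iota 0 r].
Definition no_column : column R n := Column 0 0 0 0.
Definition stored_cols m (L : seq (column R n)) := stored d m (nth no_column L) (size L).

(* The index of the block belonging to the item is this key minus (2 D + 1). *)
Definition key x : nat := (2 * lev x + ~~ isodd x)%N.
Definition ordered it r := forall i j, (i <= j)%N -> (j < r)%N -> (key (it i) <= key (it j))%N.
(** In degree k the odd items, of key 2 k, are found before the even ones, of key 2 k + 1. So the
    table is sorted as it is filled, and b is the last key. *)
Definition grown it r it' r' b := [/\ (r <= r')%N, forall i, (i < r)%N -> it i = it' i, good S it' r',
  ordered it' r' & forall i, (i < r')%N -> (key (it' i) <= b)%N].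

Lemma all_cols_append it r x : all_cols (append it r x) r.+1 = all_cols it r ++ item_cols x.
Proof.
rewrite /all_cols -[in iota 0 r.+1]addn1 iotaD map_cat flatten_cat /= cats0 append_eq; congr (flatten _ ++ _).
by apply/eq_in_map => i; rewrite mem_iota => /= ir; rewrite append_lt.
Qed.

Lemma stored_rcons m L c : stored d m (fun b => if b == size L then c else nth no_column L b) (size L).+1 ->
  stored_cols m (rcons L c).
Proof.
move=> [e hb]; split=> [|b]; first by rewrite size_rcons.
rewrite size_rcons => bL; rewrite nth_rcons; have := hb b bL.
by case: eqVneq => [->|bn]; [rewrite ltnn | rewrite ltn_neqAle bn -ltnS bL].
Qed.

Lemma col_cols kind mu mt (neg : bool) r k m L : sized n d m -> nmem m 18 0 = r -> nmem m 9 0 = k ->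
  stored_cols m L ->
  let u := dv (row_of n d m r) mu in let w := dv (row_of n d m r) mt in
  stored_cols (sem (COL kind mu mt neg) m)
    (rcons L (if neg then Column kind k (- u) (- w) else Column kind k u w)).
Proof.
move=> hs hr hk hL u w; have [e hb] := col_spec n0 kind mu mt neg hs hr hk hL.
apply: stored_rcons; split=> // b bL; have := hb b bL.
by case: eqVneq => // _; rewrite -/u -/w; case: neg {e hb}; rewrite ?scaleN1r ?scale1r.
Qed.

Lemma stored_cols_eq m m' L : nmem m' 10 = nmem m 10 -> nmem m' 11 = nmem m 11 -> nmem m' 12 = nmem m 12 ->
  fmem m' 18 = fmem m 18 -> fmem m' 19 = fmem m 19 -> stored_cols m L -> stored_cols m' L.
Proof. exact: stored_eq. Qed.

Lemma stored_cols_frame m m' L (l1 l2 : seq nat) : (forall a, a \notin l1 -> nmem m' a = nmem m a) ->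
  (forall a, a \notin l2 -> fmem m' a = fmem m a) -> all [predC l1] [:: 10; 11; 12]%N -> all [predC l2] [:: 18; 19]%N ->
  stored_cols m L -> stored_cols m' L.
Proof.
by move=> h1 h2 /and4P[a b c _] /and3P[e f _]; apply: stored_cols_eq; rewrite ?h1 ?h2.
Qed.

Lemma grown_append it r it' r' x b : grown it r it' r' b -> key x = b -> valid S x ->
  (if isodd x then ~ VO hM hd it' r' (lev x) (vl (g0 x)) else ~ VE hM hd it' r' (lev x) (vl (g0 x))) ->
  grown it r (append it' r' x) r'.+1 b.
Proof.
move=> [h1 h2 h3 h4 h5] kx vx nx; split.
- exact: leqW.
- by move=> i ir; rewrite append_lt ?h2 // (leq_trans ir).
- exact: good_append.
- move=> i j ij; rewrite ltnS leq_eqVlt => /predU1P[ej|jr]; last by rewrite !append_lt ?h4 // (leq_ltn_trans ij).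
  rewrite ej append_eq kx; move: ij; rewrite ej leq_eqVlt => /predU1P[->|ir]; first by rewrite append_eq kx.
  by rewrite append_lt // h5.
by move=> i; rewrite ltnS leq_eqVlt => /predU1P[->|ir]; rewrite ?append_eq ?kx // append_lt // h5.
Qed.

Lemma sem_if m b p q : sem (SIf b p q) m = if teval m b then sem p m else sem q m.
Proof. by []. Qed.

Lemma odd_spec m k it r : sized n d m -> (k <= 2 * h + 1)%N -> kernel_in n d m (oddP hM hd k) -> nmem m 9 0 = k ->
  tracks d m (VQ hM hd k) -> grown it r it r (2 * k).-1 -> (0 < k)%N -> stored_cols m (all_cols it r) ->
  exists it' r', [/\ grown it r it' r' (2 * k), stored_cols (sem ODD m) (all_cols it' r'),
    tracks d (sem ODD m) (VO hM hd it' r' k) & forall u, P S k u -> Wodd S it' k r' u].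
Proof.
move=> hs kb hk m9 hT hg k0 hst; rewrite /ODD; set body := SSeq _ _.
pose Phi p (m' : mem) := exists it' r', [/\ grown it r it' r' (2 * k), stored_cols m' (all_cols it' r'),
    tracks d m' (VO hM hd it' r' k) & forall p', (p' < p)%N -> VO hM hd it' r' k (dv (row_of n d m p') 0)].
suff [it' [r' [h1 h2 h3 h4]]] : Phi N (sem (SFor 18 xV body) m).
  exists it', r'; split=> // u hu; have [gu [u' [u'' [gu' gu'' e]]]] := hu.
  (* Every element of P_k is the g0 of a solution of the odd system, hence in the final span. *)
  have [u3 hq] := quad_complete gu gu' gu'' e.
  have [f [hf ef]] := odd_exists n0 kb hq.
  have : VO hM hd it' r' k (dv f 0) by apply: (kernel_span n0 hk (lin_VO hM hd it' r' k) _ h4 hf).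
  rewrite ef => -[w [hw ew]].
  have hv i : (i < r')%N -> valid S (it' i) by case: h1 => _ _ hgood _ _ /hgood[].
  have [gw _] := Wodd_P hv hw.
  by rewrite -(vl_inj gw gu ew).
have hkeys i : (i < r)%N -> (key (it i) <= (2 * k).-1)%N by case: hg => _ _ _ _; apply.
apply: (rows_loop n0) => //.
  exists it, r; split=> //.
    by case: hg => g1 g2 g3 g4 g5; split=> // i ir; apply: leq_trans (g5 i ir) (leq_pred _).
  apply: tracks_ext hT => v; symmetry; apply: VO_start => i ir _; apply/eqP => e.
  by have := hkeys i ir; rewrite /key e; lia.
move=> p m2 pN hs2 p18 m29 f16 [it' [r' [hgr hst' hT' hrow]]].
have erow m' : fmem m' 16 = fmem m 16 -> row_of n d m' p = row_of n d m p by rewrite /row_of => ->.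
rewrite /body sem_seq sem_if; set m3 := sem (INS 0) m2.
have [nf3 ff3] := ins_frame m2 0; rewrite -/m3 in nf3 ff3.
have hs3 : sized n d m3 by apply: sized_sem.
have [new t3] := ins_spec n0 0 hs2 p18 hT'; rewrite -/m3 (erow m2) // in new t3.
have st3 : stored_cols m3 (all_cols it' r') by apply: (stored_cols_frame nf3 ff3).
have lO := lin_VO hM hd it' r' k.
have next it2 r2 : (forall v, VO hM hd it' r' k v -> VO hM hd it2 r2 k v) -> VO hM hd it2 r2 k (dv (row_of n d m p) 0) ->
    forall p', (p' < p.+1)%N -> VO hM hd it2 r2 k (dv (row_of n d m p') 0).
  move=> hsub hp p'; rewrite ltnS leq_eqVlt => /predU1P[->//|p'p]; apply: hsub; exact: hrow.
(* In the first case the vector is already in the span, and inserting it has changed nothing. *)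
case: ifP => isnew.
  have hin := new.1 isnew; exists it', r'; split=> //; last by apply: next.
  apply: tracks_ext t3 => v; split; last exact: insert_sub.
  by apply: insert_least.
have hnew : ~ VO hM hd it' r' k (dv (row_of n d m p) 0) by move=> /(new.2); rewrite isnew.
have [a [b [c [e [hq d0 d1 d2 d3]]]]] := kernel_row hk pN.
pose x : item := Item k true a b c e.
have hgr' : grown it r (append it' r' x) r'.+1 (2 * k).
  apply: grown_append hgr _ _ _; first by rewrite /key /= addn0.
  - exact: hq.
  - by rewrite -[isodd x]/true -[lev x]/k -[g0 x]/a -d0.
have r18 : nmem m3 18 0 = p by rewrite nf3.
have r9 : nmem m3 9 0 = k by rewrite nf3 // m29.
have e3 : row_of n d m3 p = row_of n d m p by apply: erow; rewrite ff3.
rewrite 4!sem_seq; set m4 := sem (COL 1 0 0 false) m3; set m5 := sem (COL 2 1 2 true) m4.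
set m6 := sem (INS 1) m5; set m7 := sem (INS 2) m6; set m8 := sem (INS 3) m7.
have [nf4 ff4] := col_frame m3 1 0 0 false; rewrite -/m4 in nf4 ff4.
have [nf5 ff5] := col_frame m4 2 1 2 true; rewrite -/m5 in nf5 ff5.
have [nf6 ff6] := ins_frame m5 1; rewrite -/m6 in nf6 ff6.
have [nf7 ff7] := ins_frame m6 2; rewrite -/m7 in nf7 ff7.
have [nf8 ff8] := ins_frame m7 3; rewrite -/m8 in nf8 ff8.
have hs4 : sized n d m4 by apply: sized_sem.
have hs5 : sized n d m5 by apply: sized_sem.
have hs6 : sized n d m6 by apply: sized_sem.
have hs7 : sized n d m7 by apply: sized_sem.
have e4 : row_of n d m4 p = row_of n d m p by apply: erow; rewrite ff4 // ff3.
have e5 : row_of n d m5 p = row_of n d m p by apply: erow; rewrite ff5 // ff4 // ff3.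
have e6 : row_of n d m6 p = row_of n d m p by apply: erow; rewrite ff6 // ff5 // ff4 // ff3.
have e7 : row_of n d m7 p = row_of n d m p by apply: erow; rewrite ff7 // ff6 // ff5 // ff4 // ff3.
have st4 := col_cols 1 0 0 false hs3 r18 r9 st3; rewrite -/m4 e3 d0 in st4.
have r18' : nmem m4 18 0 = p by rewrite nf4.
have r9' : nmem m4 9 0 = k by rewrite nf4.
have st5 := col_cols 2 1 2 true hs4 r18' r9' st4; rewrite -/m5 e4 d1 d2 in st5.
have st8 : stored_cols m8 (all_cols (append it' r' x) r'.+1).
  rewrite all_cols_append -[item_cols x]/[:: Column 1 k (vl a) (vl a); Column 2 k (- vl b) (- vl c)].
  rewrite -cat_rcons -cat_rcons cats0.
  by apply: (stored_cols_frame nf8 ff8) => //; apply: (stored_cols_frame nf7 ff7) => //; apply: (stored_cols_frame nf6 ff6).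
have t5 : tracks d m5 (insert (VO hM hd it' r' k) (vl a)).
  by rewrite d0 in t3; apply: tracks_mem t3; rewrite ff5 // ff4.
have r5 : nmem m5 18 0 = p by rewrite nf5.
have r6 : nmem m6 18 0 = p by rewrite nf6.
have r7 : nmem m7 18 0 = p by rewrite nf7.
have [_ t6] := ins_spec n0 1 hs5 r5 t5; rewrite -/m6 e5 d1 in t6.
have [_ t7] := ins_spec n0 2 hs6 r6 t6; rewrite -/m7 e6 d2 in t7.
have [_ t8] := ins_spec n0 3 hs7 r7 t7; rewrite -/m8 e7 d3 in t8.
have t8' : tracks d m8 (VO hM hd (append it' r' x) r'.+1 k).
  by apply: tracks_ext t8 => v; symmetry; apply: (@VO_append _ _ _ _ hM hd it' r' k x).
exists (append it' r' x), r'.+1; split=> //; apply: next; first by move=> v; apply: VO_ext.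
apply: (@VO_append _ _ _ _ hM hd it' r' k x _ erefl erefl).2; rewrite d0.
by do 3 apply: insert_sub; apply: insert_self.
Qed.

Lemma even_spec m k it r : sized n d m -> (k <= 2 * h + 1)%N -> kernel_in n d m (evenP hM hd k) -> nmem m 9 0 = k ->
  tracks d m (VO hM hd it r k) -> (forall u, P S k u -> Wodd S it k r u) ->
  grown it r it r (2 * k) -> stored_cols m (all_cols it r) ->
  exists it' r', [/\ grown it r it' r' (2 * k).+1, stored_cols (sem EVEN m) (all_cols it' r')
    & forall u, G S k u -> Weven S it' k r' u].
Proof.
move=> hs kb hk m9 hT hP hg hst; rewrite /EVEN; set body := SSeq _ _.
pose Phi p (m' : mem) := exists it' r', [/\ grown it r it' r' (2 * k).+1, stored_cols m' (all_cols it' r'),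
    tracks d m' (VE hM hd it' r' k) & forall p', (p' < p)%N -> VE hM hd it' r' k (dv (row_of n d m p') 0)].
suff [it' [r' [h1 h2 h3 h4]]] : Phi N (sem (SFor 18 xV body) m).
  exists it', r'; split=> // u hu.
  have [f [hf ef]] := even_exists n0 kb hu.
  have : VE hM hd it' r' k (dv f 0) by apply: (kernel_span n0 hk (lin_VE hM hd it' r' k) _ h4 hf).
  rewrite ef => -[w [hw ew]].
  have hv i : (i < r')%N -> valid S (it' i) by case: h1 => _ _ hgood _ _ /hgood[].
  by rewrite -(vl_inj (Weven_G hv hw) hu ew).
apply: (rows_loop n0) => //.
  exists it, r; split=> //.
    by case: hg => g1 g2 g3 g4 g5; split=> // i ir; apply: leqW; apply: g5.
  have hv i : (i < r)%N -> valid S (it i) by case: hg => _ _ hgood _ _ /hgood[].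
  apply: tracks_ext hT => v; apply: VE_start => // i ir oi; apply/eqP => e.
  by case: hg => _ _ _ _ /(_ i ir); rewrite /key e oi; lia.
move=> p m2 pN hs2 p18 m29 f16 [it' [r' [hgr hst' hT' hrow]]].
have erow m' : fmem m' 16 = fmem m 16 -> row_of n d m' p = row_of n d m p by rewrite /row_of => ->.
rewrite /body sem_seq sem_if; set m3 := sem (INS 0) m2.
have [nf3 ff3] := ins_frame m2 0; rewrite -/m3 in nf3 ff3.
have hs3 : sized n d m3 by apply: sized_sem.
have [new t3] := ins_spec n0 0 hs2 p18 hT'; rewrite -/m3 (erow m2) // in new t3.
have st3 : stored_cols m3 (all_cols it' r') by apply: (stored_cols_frame nf3 ff3).
have lE := lin_VE hM hd it' r' k.
have next it2 r2 : (forall v, VE hM hd it' r' k v -> VE hM hd it2 r2 k v) -> VE hM hd it2 r2 k (dv (row_of n d m p) 0) ->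
    forall p', (p' < p.+1)%N -> VE hM hd it2 r2 k (dv (row_of n d m p') 0).
  move=> hsub hp p'; rewrite ltnS leq_eqVlt => /predU1P[->//|p'p]; apply: hsub; exact: hrow.
case: ifP => isnew.
  have hin := new.1 isnew; exists it', r'; split=> //; last by apply: next.
  apply: tracks_ext t3 => v; split; last exact: insert_sub.
  by apply: insert_least.
have hnew : ~ VE hM hd it' r' k (dv (row_of n d m p) 0) by move=> /(new.2); rewrite isnew.
have [a [ha d0 _ _ _]] := kernel_row hk pN.
pose x : item := Item k false a 0 0 0.
have hgr' : grown it r (append it' r' x) r'.+1 (2 * k).+1.
  apply: grown_append hgr _ _ _; first by rewrite /key /= addn1.
  - exact: ha.
  - by rewrite -[isodd x]/false -[lev x]/k -[g0 x]/a -d0.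
have r18 : nmem m3 18 0 = p by rewrite nf3.
have r9 : nmem m3 9 0 = k by rewrite nf3 // m29.
have e3 : row_of n d m3 p = row_of n d m p by apply: erow; rewrite ff3.
set m4 := sem (COL 0 0 0 false) m3.
have [nf4 ff4] := col_frame m3 0 0 0 false; rewrite -/m4 in nf4 ff4.
have st4 := col_cols 0 0 0 false hs3 r18 r9 st3; rewrite -/m4 e3 d0 in st4.
have st4' : stored_cols m4 (all_cols (append it' r' x) r'.+1).
  by rewrite all_cols_append -[item_cols x]/[:: Column 0 k (vl a) (vl a)] cats1.
have t4 : tracks d m4 (VE hM hd (append it' r' x) r'.+1 k).
  apply: (@tracks_mem R n d m3 m4); first by rewrite ff4.
  by apply: tracks_ext t3 => v; symmetry; rewrite d0; apply: (@VE_append _ _ _ _ hM hd it' r' k x).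
exists (append it' r' x), r'.+1; split=> //; apply: next; first by move=> v; apply: VE_ext.
apply: (@VE_append _ _ _ _ hM hd it' r' k x _ erefl erefl).2; rewrite d0.
exact: insert_self.
Qed.
End Phases.

Definition EVEN_KERNEL : sprog := KER 20 21 (NMul (NConst 4) xn) (LEVEL_SKIP 1).
Definition ODD_KERNEL : sprog := KER 22 23 (NMul (NConst 5) xn) (LEVEL_SKIP 3).
(** With loop counter p, the solutions in degree p give the span of Q in degree p + 1, from which
    the odd and the even items of degree p + 1 are extracted. The even system is solved again
    because array 16 holds one solution space at a time. *)
Definition LEVEL : sprog :=
  (SN 9 (NConst 0) (nvar 8) ;; EVEN_KERNEL ;; INIT ;;
   SN 9 (NConst 0) (NAdd (nvar 8) (NConst 1)) ;; ODD_KERNEL ;; ODD ;; EVEN_KERNEL ;; EVEN)%S.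
(** The counter runs from 0 to 2 h, so the degrees 1 to 2 h + 1 are treated; G_0 is zero. *)
Definition xL : nat_expr := locked (NAdd (NMul (NConst 2) xh) (NConst 1)).
Definition LEVELS : sprog := SFor 8 xL LEVEL.
Definition SYSTEMS : sprog :=
  (PREPARE 0 ;; PREPARE 1 ;; SSeq (SYSTEM 20 4 even_system 0) (SYSTEM 21 4 even_system 1) ;;
   SSeq (SYSTEM 22 5 odd_system 0) (SYSTEM 23 5 odd_system 1) ;; SN 10 (NConst 0) (NConst 0))%S.

(** * The storage format and the loop over the degrees *)

Section PolynomialForm.
Variable R : realType.
Local Notation K := (ffield R).
Local Notation s := (x_z R).
Local Notation t := (y_z R).

Lemma pol_poly m (c : nat -> R) : pol R (\poly_(k < m) c k) = \sum_(k < m) cst R (c k) * t ^+ k.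
Proof.
rewrite poly_def rmorph_sum; apply: eq_bigr => k _.
by rewrite -mul_polyC rmorphM polC rmorphXn polX.
Qed.

Lemma exprz_shift (F : fieldType) (x : F) (e k : nat) : x != 0 -> x ^+ e * x ^ (k%:Z - e%:Z) = x ^+ k.
Proof. by move=> x0; rewrite [x ^+ e]exprnP -expfzDr // addrC subrK. Qed.

Lemma emb_stored (F : fieldType) m (x y : F) (e : nat) (a b : 'I_m -> F) : x != 0 ->
  x ^+ e * (\sum_(k < m) (a k + b k * y) * x ^ ((k : nat)%:Z - e%:Z)) =
  (\sum_(k < m) a k * x ^+ k) + (\sum_(k < m) b k * x ^+ k) * y.
Proof.
move=> x0; rewrite mulr_sumr mulr_suml -big_split; apply: eq_bigr => k _ /=.
by rewrite mulrCA exprz_shift // mulrDl mulrAC.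
Qed.

Definition stored_poly (f : nat -> R) (e pos : nat) : {poly R} := \poly_(k < (2 * e).+1) f (pos * (2 * e).+1 + k)%N.

Lemma stores_emb (m : memory R) q n (M : 'M[K]_n) (e : nat) : nmem m 1 q = e ->
  stores m q M <-> forall i j : 'I_n,
    t ^+ e * M i j = emb (stored_poly (fmem m (2 * q)) e (i * n + j)) (stored_poly (fmem m (2 * q).+1) e (i * n + j)).
Proof.
move=> he; rewrite /stores he /emb; split=> hM i j.
  by rewrite hM emb_stored ?t_neq0 // !pol_poly.
apply: (mulfI (tX_neq0 R e)); rewrite hM emb_stored ?t_neq0 // !pol_poly.
reflexivity.
Qed.
End PolynomialForm.

Section Monotone.
Variables (F : realFieldType) (A : comNzRingType) (c : {rmorphism F -> A}) (X : lmodType A) (S : graded c X).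

Lemma Wodd_mono it it' k r r' u : (r <= r')%N -> (forall i, (i < r)%N -> it i = it' i) ->
  Wodd S it k r u -> Wodd S it' k r' u.
Proof.
move=> rr e hu; have {hu} : Wodd S it' k r u := Wodd_ext e hu.
elim: r' rr => [|r' IH]; rewrite leq_eqVlt => /predU1P[-> //|rr hu]; first by [].
by apply: Wodd_recr; apply: IH.
Qed.
Lemma Weven_mono it it' k r r' u : (r <= r')%N -> (forall i, (i < r)%N -> it i = it' i) ->
  Weven S it k r u -> Weven S it' k r' u.
Proof.
move=> rr e hu; have {hu} : Weven S it' k r u := Weven_ext e hu.
elim: r' rr => [|r' IH]; rewrite leq_eqVlt => /predU1P[-> //|rr hu]; first by [].
by apply: Weven_recr; apply: IH.
Qed.
End Monotone.

Section Levels.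
Variables (R : realType) (n : nat) (M : 'M[ffield R]_n) (d : nat).
Hypothesis hM : GL (@R12 R) M.
Hypothesis hd : forall i j, Fil (2 * d).+1 (y_z R ^+ d * M i j).
Hypothesis n0 : (0 < n)%N.
Local Notation K := (ffield R).
Local Notation s := (x_z R).
Local Notation t := (y_z R).
Local Notation X := (pairmod 'cV[ring1 R]_n 'cV[ring2 R]_n).
Local Notation item := (item X).
Local Notation S := (glue_graded (matrix_gluing hM hd)).
Local Notation A := (mA M d).
Local Notation h := (szh n d).
Local Notation mem := (memory R).
Local Notation sem := (sem xbig).
Implicit Types (it : nat -> item) (m : mem).

Lemma neval_L m : sized n d m -> neval m xL = (2 * h + 1)%N.
Proof. by move=> hs; rewrite /xL -lock !nevalE (sizeE hs). Qed.

Definition complete it r k := forall u, (P S k u -> Wodd S it k r u) /\ (G S k u -> Weven S it k r u).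
Definition systems_in m := exists W, system_in d m 20 21 4 A W even_system /\ system_in d m 22 23 5 A W odd_system.
Definition levels_done m p := exists it r, [/\ grown hM hd it r it r (2 * p).+1, stored_cols d m (all_cols it r) &
  forall k, (k <= p)%N -> complete it r k].

Lemma systems_frame m m' (l : seq nat) : (forall a, a \notin l -> fmem m' a = fmem m a) ->
  all [predC l] [:: 20; 21; 22; 23]%N -> systems_in m -> systems_in m'.
Proof.
move=> hf /and5P[a b c e _] [W [h1 h2]]; exists W.
by rewrite /system_in !hf.
Qed.

Lemma grown_self it r it' r' b : grown hM hd it r it' r' b -> grown hM hd it' r' it' r' b.
Proof. by case=> _ _ h3 h4 h5; split. Qed.

Lemma level_step m p : sized n d m -> systems_in m -> (p <= 2 * h)%N -> nmem m 8 0 = p ->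
  levels_done m p -> systems_in (sem LEVEL m) /\ levels_done (sem LEVEL m) p.+1.
Proof.
move=> hs hW pb m8 [it [r [hg hst hc]]]; rewrite /LEVEL 7!sem_seq.
have kerN y0 y1 rows skip (m' : mem) a : a \notin [:: 13; 14; 16; 17]%N -> nmem (sem (KER y0 y1 rows skip) m') a = nmem m' a.
  by move=> ha; rewrite sem_nframe //; apply: contra ha; apply: KER_nwrites.
have kerF y0 y1 rows skip (m' : mem) a : a \notin [:: 12; 13; 14; 16]%N -> fmem (sem (KER y0 y1 rows skip) m') a = fmem m' a.
  by move=> ha; rewrite sem_fframe //; apply: contra ha; apply: KER_fwrites.
have kerS y0 y1 rows skip (m' : mem) : sized n d m' -> sized n d (sem (KER y0 y1 rows skip) m').
  by apply: sized_sem; apply: KER_wf.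
have n_row (pr : sprog) (m' : mem) (a : nat) (l : seq nat) : all (fun b => b \in l) (nwrites pr) -> a \notin l -> nmem (sem pr m') a = nmem m' a.
  by move=> h1 h2; rewrite sem_nframe //; apply: notin_all h2.
have f_row (pr : sprog) (m' : mem) (a : nat) (l : seq nat) : all (fun b => b \in l) (fwrites pr) -> a \notin l -> fmem (sem pr m') a = fmem m' a.
  by move=> h1 h2; rewrite sem_fframe //; apply: notin_all h2.
pose lf := [:: 12; 13; 14; 15; 16; 18; 19]%N.
set m1 := sem (SN 9 _ _) m.
have hs1 : sized n d m1 by apply: sized_sem.
have hW1 : systems_in m1 by apply: (systems_frame (l := lf)) hW.
have st1 : stored_cols d m1 (all_cols it r) by apply: stored_cols_eq hst.
set m2 := sem EVEN_KERNEL m1.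
have hs2 : sized n d m2 by apply: kerS.
have hW2 : systems_in m2.
  by apply: (systems_frame (l := lf)) hW1 => // a ha; rewrite kerF //; apply: (@notin_all _ lf).
have st2 : stored_cols d m2 (all_cols it r) by apply: stored_cols_eq st1; rewrite ?kerN ?kerF.
have k2 : kernel_in n d m2 (evenP hM hd p).
  have [W [hW1' _]] := hW1; move=> f.
  rewrite (@KER_level R n d n0 20 21 m1 1 4 A W even_system p) //.
  exact: even_kernel.
set m3 := sem INIT m2.
have hs3 : sized n d m3 by apply: sized_sem.
have hW3 : systems_in m3 by apply: (systems_frame (l := lf)) hW2 => // a ha; rewrite (f_row _ _ _ lf).
have st3 : stored_cols d m3 (all_cols it r).
  by apply: stored_cols_eq st2; first [exact: (n_row _ _ _ [:: 13; 14; 16; 18]%N) |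
    exact: (f_row _ _ _ [:: 12; 13; 14; 15]%N)].
have pb' : (p <= 2 * h + 1)%N by apply: leq_trans pb _; rewrite leq_addr.
have t3 : tracks d m3 (VQ hM hd p.+1) by apply: init_spec.
have m38 : nmem m3 8 0 = p.
  by rewrite (n_row _ _ _ [:: 13; 14; 16; 18]%N) // kerN.
set m4 := sem (SN 9 _ _) m3.
have hs4 : sized n d m4 by apply: sized_sem.
have hW4 : systems_in m4 by apply: (systems_frame (l := lf)) hW3.
have st4 : stored_cols d m4 (all_cols it r) by apply: stored_cols_eq st3.
have t4 : tracks d m4 (VQ hM hd p.+1) by apply: tracks_mem t3.
have m49 : nmem m4 9 0 = p.+1 by rewrite /m4 /= /update eqxx /= m38 addn1.
set m5 := sem ODD_KERNEL m4.
have hs5 : sized n d m5 by apply: kerS.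
have hW5 : systems_in m5.
  by apply: (systems_frame (l := lf)) hW4 => // a ha; rewrite kerF //; apply: (@notin_all _ lf).
have st5 : stored_cols d m5 (all_cols it r) by apply: stored_cols_eq st4; rewrite ?kerN ?kerF.
have t5 : tracks d m5 (VQ hM hd p.+1) by apply: tracks_mem t4; rewrite kerF.
have m59 : nmem m5 9 0 = p.+1 by rewrite kerN.
have k5 : kernel_in n d m5 (oddP hM hd p.+1).
  have [W [_ hW4']] := hW4; move=> f.
  rewrite (@KER_level R n d n0 22 23 m4 3 5 A W odd_system p.+1) //.
  exact: odd_kernel.
have kb : (p.+1 <= 2 * h + 1)%N by rewrite addn1 ltnS.
have hg5 : grown hM hd it r it r (2 * p.+1).-1 by rewrite mulnS add2n.
have [it1 [r1 [hg1 st6 t6 hP]]] := odd_spec n0 hs5 kb k5 m59 t5 hg5 (ltn0Sn _) st5.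
set m6 := sem ODD m5 in st6 t6 *.
have hs6 : sized n d m6 by apply: sized_sem.
have m69 : nmem m6 9 0 = p.+1 by rewrite (n_row _ _ _ [:: 10; 11; 12; 13; 14; 16; 18]%N).
have hW6 : systems_in m6 by apply: (systems_frame (l := lf)) hW5 => // a ha; rewrite (f_row _ _ _ lf).
set m7 := sem EVEN_KERNEL m6.
have hs7 : sized n d m7 by apply: kerS.
have hW7 : systems_in m7.
  by apply: (systems_frame (l := lf)) hW6 => // a ha; rewrite kerF //; apply: (@notin_all _ lf).
have st7 : stored_cols d m7 (all_cols it1 r1) by apply: stored_cols_eq st6; rewrite ?kerN ?kerF.
have t7 : tracks d m7 (VO hM hd it1 r1 p.+1) by apply: tracks_mem t6; rewrite kerF.
have m79 : nmem m7 9 0 = p.+1 by rewrite kerN.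
have k7 : kernel_in n d m7 (evenP hM hd p.+1).
  have [W [hW6' _]] := hW6; move=> f.
  rewrite (@KER_level R n d n0 20 21 m6 1 4 A W even_system p.+1) //.
  exact: even_kernel.
have [it2 [r2 [hg2 st8 hG]]] := even_spec n0 hs7 kb k7 m79 t7 hP (grown_self hg1) st7.
split; first by apply: (systems_frame (l := lf)) hW7 => // a ha; rewrite (f_row _ _ _ lf).
have [r12 e12 _ _ _] := hg2; have [r01 e01 _ _ _] := hg1.
exists it2, r2; split=> //.
  by have := grown_self hg2; case=> g1 g2 g3 g4 g5; split=> // i ir; apply: leq_trans (g5 i ir) _; rewrite ltnS leq_mul2l leqnn orbT.
move=> k; rewrite leq_eqVlt => /predU1P[->|kp] u; first by split=> [/hP|/hG//]; apply: Wodd_mono.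
have [h1 h2] := hc k kp u.
by split=> [/h1|/h2] hu; [apply: (Wodd_mono r12 e12); apply: (Wodd_mono r01 e01) | apply: (Weven_mono r12 e12); apply: (Weven_mono r01 e01)].
Qed.

Lemma level0 it r : complete it r 0.
Proof.
move=> u; split=> [[/G0 -> _]|/G0 ->]; first by apply: Q_Wodd; apply: Q0.
by apply: P_Weven; apply: P0.
Qed.

Lemma levels_spec m : sized n d m -> systems_in m -> nmem m 10 0 = 0%N ->
  levels_done (sem LEVELS m) (2 * h + 1) /\ sized n d (sem LEVELS m).
Proof.
move=> hs hW m10; have hs' : sized n d (sem LEVELS m).
  by apply: sized_sem hs.
split=> //; rewrite /LEVELS.
pose Inv p (m' : mem) := [/\ sized n d m', systems_in m' & levels_done m' p].
have hB : neval m (bound xbig xL) = (2 * h + 1)%N.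
  rewrite neval_bound_small (neval_L hs) // (neval_big hs) /szV /szE.
  by move: h => x; nia.
suff : Inv (neval m (bound xbig xL)) (sem (SFor 8 xL LEVEL) m) by rewrite hB; case.
apply: (for_ind (Inv := Inv)) => // [|p m' pb m8 [i1 i2 i3]].
  split=> //; pose x0 : item := Item 0 false 0 0 0 0.
  exists (fun=> x0), 0%N; split; [by split | | by case=> // _; apply: level0].
  by split.
rewrite hB addn1 ltnS in pb.
have [h1 h2] := level_step i1 i2 pb m8 i3.
split; first exact: (sized_sem _ i1).
  by apply: (systems_frame (l := [::])) h1.
by have [it [r [hg hst hc]]] := h2; exists it, r.
Qed.


Lemma prepare_matrix m : sized n d m -> stores m 0 M ->
  matrix_in d (sem (PREPARE 1) (sem (PREPARE 0) m)) A.
Proof.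
move=> hs hst; have m1d : nmem m 1 0 = d by case: hs.
have /(stores_emb M m1d) hemb := hst.
set m1 := sem (PREPARE 0) m; set m2 := sem (PREPARE 1) m1.
have hs1 : sized n d m1 by apply: sized_sem.
have QE : szQ n d = (2 * szE n d + 2)%N by [].
have EE : (2 * d + 2 <= szE n d)%N by rewrite /szE /szh; nia.
have coefA (a : nat) (i j : 'I_n) : (a < 2)%N ->
    array_poly n d m2 (28 + a) i j = 'X * stored_poly (fmem m a) d (i * n + j).
  move=> a2; apply/polyP => p; rewrite coefXM !coef_poly.
  have f0 p' : (p' < szQ n d)%N -> fmem m2 (28 + a) ((i * n + j) * szQ n d + p') =
     if (0 < p' <= 2 * d + 1)%N then fmem m a ((i * n + j) * (2 * d + 1) + (p' - 1))%N else 0.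
    move=> p'Q; have ijn : (i * n + j < n * n)%N by apply: digit_bound.
    case: a a2 => [|[|//]] _.
      by rewrite /m2 tab_fframe // /m1 prepare_spec.
    by rewrite /m2 prepare_spec // /m1 tab_fframe.
  case: ltnP => pQ; last first.
    by case: p pQ => [|p] //= pQ; rewrite ifF //; apply/negbTE; rewrite -leqNgt; lia.
  rewrite f0 //; case: p pQ => [|p] //= pQ; by rewrite subn1 /= addn1 ltnS.
move=> i j; rewrite (coefA 0%N) // (coefA 1%N) //.
have sz a : (size ('X * stored_poly (fmem m a) d (i * n + j))%R <= szE n d)%N.
  apply: leq_trans (size_polyMleq _ _) _; rewrite size_polyX addSn /= add1n.
  by apply: leq_ltn_trans (size_poly _ _) _; apply: leq_trans EE; lia.
split; last by split.
by rewrite mxE exprS -mulrA hemb mulrC; have := @emb_t R 1 (stored_poly (fmem m 0) d (i * n + j)) (stored_poly (fmem m 1) d (i * n + j)); rewrite !expr1.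
Qed.

Lemma systems_spec m : sized n d m -> stores m 0 M ->
  [/\ systems_in (sem SYSTEMS m), nmem (sem SYSTEMS m) 10 0 = 0%N & sized n d (sem SYSTEMS m)].
Proof.
move=> hs hst; have hA := prepare_matrix hs hst.
rewrite /SYSTEMS sem_seq; set m1 := sem (PREPARE 0) m in hA *; rewrite sem_seq.
set m2 := sem (PREPARE 1) m1 in hA *.
have hs2 : sized n d m2 by do 2 apply: sized_sem => //.
pose W : 'M[K]_n := \matrix_(i, j) dec n d (fmem m2 19) (i * n + j).
have hW2 : vectors_in d m2 W by move=> i j; rewrite mxE.
rewrite sem_seq; set m3 := sem (SSeq (SYSTEM 20 _ _ _) _) m2.
have he := @SYSTEM_in R n d n0 m2 A W 20 21 4 even_system hs2 isT isT isT isT hA hW2; rewrite -/m3 in he.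
have hs3 : sized n d m3 by apply: sized_sem.
have f3 a : a \notin [:: 20; 21]%N -> fmem m3 a = fmem m2 a.
  by move=> ha; rewrite /m3 sem_fframe //; apply: notin_all ha.
have hA3 : matrix_in d m3 A by rewrite /matrix_in /array_poly !f3.
have hW3 : vectors_in d m3 W by rewrite /vectors_in f3.
rewrite sem_seq; set m4 := sem (SSeq (SYSTEM 22 _ _ _) _) m3.
have ho := @SYSTEM_in R n d n0 m3 A W 22 23 5 odd_system hs3 isT isT isT isT hA3 hW3; rewrite -/m4 in ho.
have hs4 : sized n d m4 by apply: sized_sem.
have f4 a : a \notin [:: 22; 23]%N -> fmem m4 a = fmem m3 a.
  by move=> ha; rewrite /m4 sem_fframe //; apply: notin_all ha.
split=> //; exists W; split; last exact: ho.
by move: he; rewrite /system_in -!(f4 20%N) // -!(f4 21%N).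
Qed.
End Levels.

(** * The canonical matrix and the multipliers *)

Lemma size_flatten_iota (T : Type) (f : nat -> seq T) r :
  size (flatten [seq f i | i <- iota 0 r]) = (\sum_(i < r) size (f i))%N.
Proof.
elim: r => [|r IH]; first by rewrite big_ord0.
by rewrite -[in LHS]addn1 iotaD map_cat flatten_cat size_cat IH big_ord_recr /= cats0.
Qed.

Lemma nth_flatten_iota (T : Type) (z : T) (f : nat -> seq T) r k j : (k < r)%N -> (j < size (f k))%N ->
  nth z (flatten [seq f i | i <- iota 0 r]) (\sum_(i < k) size (f i) + j) = nth z (f k) j.
Proof.
move=> kr js; have -> : r = (k + (r - k.+1).+1)%N by lia.
rewrite iotaD map_cat flatten_cat nth_cat size_flatten_iota ltnNge leq_addr /= add0n.
by rewrite addKn nth_cat js.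
Qed.

Section Positions.
Variables (R : realType) (n d : nat).
Local Notation K := (ffield R).
Local Notation s := (x_z R).
Local Notation t := (y_z R).
Local Notation X := (pairmod 'cV[ring1 R]_n 'cV[ring2 R]_n).
Local Notation item := (item X).
Variables (it : nat -> item) (r : nat) (l : seq int).
Hypothesis lE : l = [seq item_index d.+1 (it i) | i <- iota 0 r].
Local Notation cols := (all_cols it r).

Lemma size_item_cols (x : item) : size (item_cols x) = (isodd x).+1.
Proof. by rewrite /item_cols; case: (isodd x). Qed.

Lemma pos_val (k : 'I_(size l)) (j : 'I_(block_size l`_k)) :
  pos_of j = (\sum_(i < k) size (item_cols (it i)) + j)%N :> nat.
Proof.
rewrite /pos_of tagnat.RankEsum; congr addn.
rewrite -(big_ord_widen_cond (size l) (fun=> true) (fun i => block_size l`_i)) 1?ltnW //.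
apply: eq_bigr => i _; rewrite (size_odd_l lE) ?size_item_cols //.
by apply: ltn_trans (ltn_ord i) (ltn_ord k).
Qed.

Lemma nth_cols (x : 'I_(csz l)) :
  nth (no_column R n) cols x = nth (no_column R n) (item_cols (it (item_of x))) (part_of x).
Proof.
have [k [j ->]] := pos_exists x; rewrite item_pos part_pos pos_val nth_flatten_iota //.
  by rewrite -(size_l lE).
by rewrite size_item_cols -(size_odd_l lE).
Qed.

Lemma size_cols : size cols = csz l.
Proof.
rewrite size_flatten_iota /csz -(size_l lE).
by apply: eq_bigr => i _; rewrite size_item_cols (size_odd_l lE).
Qed.

(** Half of the kind, rounded down, is 1 only for the second column of an odd block, where the
    exponent is one lower. *)
Definition col_power (c : column R n) : K :=
  (- t) ^ ((clev c)%:Z - d.+1%:Z - ((ckind c)./2)%:Z).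
(** An entry computed from the record of its column alone: the s-term stands just above the
    diagonal, in a column of kind 2. *)
Definition col_entry (i : nat) (c : column R n) (j : nat) : K :=
  if i == j then col_power c
  else if (i.+1 == j) && (ckind c == 2%N) then s * col_power c else 0.

Lemma cmx_cols (x y : 'I_(csz l)) : cmx R l x y = col_entry x (nth (no_column R n) cols y) y.
Proof.
have [k [j ->]] := pos_exists x; have [k' [j' ->]] := pos_exists y.
rewrite cmxE nth_cols item_pos part_pos /col_entry !pos_val.
have jk : (j < (isodd (it k)).+1)%N by rewrite -(size_odd_l lE (ltn_ord k)).
have jk' : (j' < (isodd (it k')).+1)%N by rewrite -(size_odd_l lE (ltn_ord k')).
have [kk|kn] := eqVneq k k'.
  subst k'.
  rewrite -addnS !eqn_add2l; move: (nat_of_ord j) (nat_of_ord j') jk jk' => a b.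
  rewrite /block_entry (nth_l lE) -?(size_l lE) // (index_even d.+1) /item_cols /col_power.
  case: (boolP (isodd (it k))) => hi /=.
    rewrite index_odd1 // index_odd2 //.
    by move: a b => [|[|//]] [|[|//]] _ _ /=; rewrite ?subr0.
  by rewrite index_even1 //; move: a b => [|//] [|//] _ _ /=; rewrite subr0.
have step (a b : nat) : (a < b)%N -> (\sum_(i < a) size (item_cols (it i)) + size (item_cols (it a)) <=
    \sum_(i < b) size (item_cols (it i)))%N.
  move=> ab; rewrite -(big_ord_recr a (fun i => size (item_cols (it i)))) /=.
  rewrite (big_ord_widen_cond b (fun=> true) (fun i => size (item_cols (it i)))) //.
  by rewrite [leqRHS](bigID (fun i : 'I_b => (i < a.+1)%N)) /= leq_addr.
have kn' : (k : nat) != k' by [].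

case: (ltngtP k k') kn' => // [/step hkk|/step hkk] _; rewrite !size_item_cols in hkk.
- have lt_pos : (\sum_(i < k) size (item_cols (it i)) + j < \sum_(i < k') size (item_cols (it i)))%N.
    by apply: leq_trans hkk; rewrite ltn_add2l.
  rewrite ifF; last by apply/negbTE; rewrite ltn_eqF // (leq_trans lt_pos) ?leq_addr.
  rewrite ifF //; apply/negbTE/negP => /andP[/eqP e1 /eqP e2]; move: e2 jk'.
  have j0 : nat_of_ord j' = 0%N.
    by apply/eqP; rewrite -leqn0 -(leq_add2l (\sum_(i < k') size (item_cols (it i)))) addn0 -e1.
  by rewrite j0 /item_cols; case: (isodd (it k')).
- have lt_pos : (\sum_(i < k') size (item_cols (it i)) + j' < \sum_(i < k) size (item_cols (it i)))%N.
    by apply: leq_trans hkk; rewrite ltn_add2l.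
  have lt2 := leq_trans lt_pos (leq_addr j _).
  rewrite ifF; last by apply/eqP => e; rewrite e ltnn in lt2.
  rewrite ifF //; apply/negbTE/negP => /andP[/eqP e1 _].
  by move: lt2; rewrite -e1 ltnNge leqnSn.
Qed.
End Positions.

(** The half-width of the output is (2 h + 1) + (d + 1), the largest level plus the twist D. *)
Definition xO : nat_expr := NAdd (NMul (NConst 2) xh) (NAdd xd (NConst 2)).
Definition szO n d : nat := (2 * szh n d + (d + 2))%N.
Section CanonicalOutput.
Let width := NAdd (NMul (NConst 2) xO) (NConst 1).
Let k := NMod (nvar 13) width.
Let i := NDiv (NDiv (nvar 13) width) xn.
Let j := NMod (NDiv (nvar 13) width) xn.
Let half := NDiv (NRead 11 j) (NConst 2).
Let exponent := NSub (NAdd (NRead 12 j) xL) half.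
Let sign := NMod (NAdd (NRead 12 j) (NAdd xd (NAdd (NConst 1) half))) (NConst 2).
Let term := CIf (TEq k exponent) (CIf (TEq sign (NConst 0)) (CE FOne) (CE (FSub FZero FOne))) (CE FZero).
Definition CANONICAL (h : nat) : sprog := TAB 13 (2 + h) (NMul (NMul xn xn) width)
  (if h == 0%N then CIf (TEq i j) term (CE FZero)
   else CIf (TEq (NAdd i (NConst 1)) j) (CIf (TEq half (NConst 1)) term (CE FZero)) (CE FZero)).

Variables (R : realType) (n d : nat).
Local Notation K := (ffield R).
Local Notation mem := (memory R).
Implicit Types (m : mem) (c : column R n).

(** After multiplication by the power of t that is the half-width, [col_power] is one monomial; its
    sign comes from the base - t. *)
Definition col_coef c (p : nat) : R :=
  if p == (clev c + (2 * szh n d + 1) - ckind c %/ 2)%N then (-1) ^+ (clev c + (d + (1 + ckind c %/ 2))) else 0.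

Lemma szO_width : (n * n * (2 * szO n d + 1) <= szV n d * szV n d)%N.
Proof.
case: (posnP n) => [->|n0]; first by [].
have hE : (2 * szO n d + 1 <= szE n d * szE n d)%N.
  rewrite /szO /szE; have : (d <= szh n d)%N by rewrite /szh; nia.
  by move: (szh n d) => h dh; nia.
by rewrite /szV mulnACA -[X in (_ <= X)%N]mul1n -[X in (_ <= 1 * X)%N]mulnA mulnACA; nia.
Qed.

Lemma canonical_spec m (cols : nat -> column R n) h : sized n d m -> (h < 2)%N ->
  (forall b, (b < n)%N -> column_in d m b (cols b)) ->
  forall a b p, (a < n)%N -> (b < n)%N -> (p < 2 * szO n d + 1)%N ->
  fmem (sem xbig (CANONICAL h) m) (2 + h) ((a * n + b) * (2 * szO n d + 1) + p) =
  if h == 0%N then (if a == b then col_coef (cols b) p else 0)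
  else if a.+1 == b then (if (ckind (cols b) %/ 2 == 1)%N then col_coef (cols b) p else 0) else 0.
Proof.
move=> hs h2 hc a b p an bn pW.
rewrite (tab_spec (NN := (n * n * (2 * szO n d + 1))%N)
  (f := fun x => let b := (x %/ (2 * szO n d + 1) %% n)%N in let a := (x %/ (2 * szO n d + 1) %/ n)%N in
    let p := (x %% (2 * szO n d + 1))%N in
    if h == 0%N then (if a == b then col_coef (cols b) p else 0)
    else if a.+1 == b then (if (ckind (cols b) %/ 2 == 1)%N then col_coef (cols b) p else 0) else 0)).
- rewrite digit_bound //; last by rewrite digit_bound.
  by cbv zeta; rewrite divn_digit // modn_digit // divn_digit // modn_digit.
- by rewrite /width /xO !nevalE !(sizeE hs).
- by rewrite (neval_big hs) szO_width.
- move=> s' x xN hn hx hf hfa.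
  have hs' : sized n d s' by apply: sized_eq hs; apply: hn.
  have n0 : (0 < n)%N by apply: leq_ltn_trans an.
  set q := (x %/ (2 * szO n d + 1))%N.
  have [e1 e2 _ _] := hc (q %% n)%N (ltn_pmod q n0).
  have kE : neval s' k = (x %% (2 * szO n d + 1))%N.
    by rewrite /k /width /xO !nevalE !(sizeE hs') hx.
  have iE : neval s' i = (q %/ n)%N by rewrite /i /width /xO !nevalE !(sizeE hs') hx.
  have jE : neval s' j = (q %% n)%N by rewrite /j /width /xO !nevalE !(sizeE hs') hx.
  have halfE : neval s' half = (ckind (cols (q %% n)%N) %/ 2)%N.
    by rewrite /half neval_div neval_read jE hn // e1.
  have expE : neval s' exponent = (clev (cols (q %% n)%N) + (2 * szh n d + 1) - ckind (cols (q %% n)%N) %/ 2)%N.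
    by rewrite /exponent neval_sub neval_add neval_read jE halfE (neval_L hs') hn // e2.
  have termE : ceval s' term = col_coef (cols (q %% n)%N) (x %% (2 * szO n d + 1))%N.
    rewrite /term !ceval_if !teval_eq kE expE /col_coef; case: eqP => // _.
    have -> : neval s' sign = ((clev (cols (q %% n)%N) + (d + (1 + ckind (cols (q %% n)%N) %/ 2))) %% 2)%N.
      rewrite /sign neval_mod neval_add neval_read jE hn // e2 neval_add (neval_d hs') neval_add halfE.
      by rewrite !neval_const.
    rewrite neval_const modn2 !ceval_ce.
    by case hb : (odd _); rewrite /= ?sub0r -signr_odd hb.
  cbv zeta; case: (h == 0%N); rewrite ceval_if teval_eq ?neval_add iE jE.
    by rewrite termE; case: eqP.
  rewrite (ceval_if _ (TEq half _)) teval_eq halfE termE !neval_const addn1.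
  by case: eqP => // _; case: eqP.
Qed.
End CanonicalOutput.

Lemma power_shift (F : fieldType) (x : F) (l L D b : nat) : x != 0 -> (b <= L)%N ->
  x ^+ (L + D) * (- x) ^ (l%:Z - D%:Z - b%:Z) = (-1) ^+ (l + (D + b)) * x ^+ (l + L - b).
Proof.
move=> x0 bL; have -> : l%:Z - D%:Z - b%:Z = l%:Z - (D + b)%N%:Z by rewrite PoszD opprD addrA.
have /(congr1 ( *%R^~ ((-1) ^+ (l + (D + b))))) := tau_sign l (D + b) x0.
rewrite -mulrA -expr2 sqrr_sign mulr1 => ->.
have -> : (l + L - b = l + (L - b))%N by lia.
have hx : x ^+ (L + D) = x ^+ (L - b) * x ^+ (D + b) by rewrite -exprD; congr (x ^+ _); lia.
rewrite hx mulrA [RHS]mulrC; congr (_ * _).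
by rewrite [x ^+ (l + _)]exprD mulrACA divff ?expf_neq0 // mulr1 mulrC.
Qed.

Section CanonicalSpec.
Variables (R : realType) (n d : nat).
Local Notation K := (ffield R).
Local Notation t := (y_z R).
Local Notation mem := (memory R).
Implicit Types (m : mem) (c : column R n).

Definition col_small c := [&& ckind c <= 2, 0 < clev c & clev c <= 2 * szh n d + 1]%N.

Lemma poly_single (p k0 : nat) (a : R) : (k0 < p)%N ->
  \poly_(k < p) (if k == k0 then a else 0) = a%:P * 'X^k0.
Proof.
move=> k0p; apply/polyP => k; rewrite coef_poly coefCM coefXn.
by case: eqVneq => [->|_]; rewrite ?k0p ?mulr1 ?mulr0 ?if_same.
Qed.

Lemma col_power_emb c : col_small c ->
  t ^+ szO n d * col_power d c = pol R (\poly_(k < (2 * szO n d).+1) col_coef d c k).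
Proof.
case/and3P => ck _ cl.
have hb : (ckind c %/ 2 <= 1)%N by rewrite (leq_div2r 2 ck).
rewrite poly_single; last by rewrite /szO; lia.
rewrite (rmorphM (pol R)) (rmorphXn (pol R)) polX polC rmorph_sign /col_power -divn2.
have -> : szO n d = (2 * szh n d + 1 + d.+1)%N by rewrite /szO; lia.
rewrite power_shift ?t_neq0 //; last by rewrite (leq_trans hb) ?leq_addl.
by congr (_ ^+ _ * _); lia.
Qed.

Theorem canonical_stores m (cols : nat -> column R n) (C : 'M[K]_n) : sized n d m ->
  (forall b, (b < n)%N -> column_in d m b (cols b) /\ col_small (cols b)) ->
  (forall i j : 'I_n, C i j = col_entry d i (cols j) j) ->
  stores (setn 1 1 (szO n d) (sem xbig (SSeq (CANONICAL 0) (CANONICAL 1)) m)) 1 C.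
Proof.
move=> hs hc hC; set m1 := sem xbig (CANONICAL 0) m.
have hs1 : sized n d m1 by apply: sized_sem.
have hc1 b : (b < n)%N -> column_in d m1 b (cols b).
  by move=> bn; have [[e1 e2 e3 e4] _] := hc b bn; split; rewrite /colvec /m1 ?tab_nframe ?tab_fframe.
set m2 := sem xbig _ m.
have e1 : nmem (setn 1 1 (szO n d) m2) 1 1 = szO n d by [].
apply: (proj2 (stores_emb C e1)) => i j.
have c0 : stored_poly (fmem (setn 1 1 (szO n d) (sem xbig (SSeq (CANONICAL 0) (CANONICAL 1)) m)) (2 * 1)) (szO n d) (i * n + j) =
   if (i : nat) == j then \poly_(k < (2 * szO n d).+1) col_coef d (cols j) k else 0.
  apply/polyP => p; rewrite coef_poly fmem_setn sem_seq tab_fframe // -[(2 * szO n d).+1]addn1.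
  case: ltnP => pW; last first.
    by case: eqP => _; rewrite ?coef0 // coef_poly ltnNge -addn1 pW.
  rewrite (canonical_spec (h := 0) hs _ (fun b bn => proj1 (hc b bn))) //=.
  by case: eqP => _; rewrite ?coef0 // coef_poly pW.
have c1 : stored_poly (fmem (setn 1 1 (szO n d) (sem xbig (SSeq (CANONICAL 0) (CANONICAL 1)) m)) (2 * 1).+1) (szO n d) (i * n + j) =
   if ((i : nat).+1 == j) && (ckind (cols j) %/ 2 == 1)%N then \poly_(k < (2 * szO n d).+1) col_coef d (cols j) k else 0.
  apply/polyP => p; rewrite coef_poly fmem_setn sem_seq -[(2 * szO n d).+1]addn1.
  case: ltnP => pW; last first.
    by case: ifP => _; rewrite ?coef0 // coef_poly ltnNge -addn1 pW.
  rewrite (canonical_spec (h := 1) hs1 _ hc1) //=.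
  by case: eqP => _ /=; rewrite ?coef0 //; case: eqP => _ /=; rewrite ?coef0 // coef_poly pW.
have [_ hsm] := hc j (ltn_ord j); have hp := col_power_emb hsm.
rewrite c0 c1 hC /col_entry /emb; have [ij|ij] := eqVneq (i : nat) j.
  by rewrite ij ifF ?rmorph0 ?mul0r ?addr0 // gtn_eqF.
rewrite rmorph0 add0r; have hk : (ckind (cols j) %/ 2 == 1)%N = (ckind (cols j) == 2)%N.
  by case/and3P: hsm; case: (ckind _) => [|[|[|]]].
rewrite hk; case: ifP => _; last by rewrite mulr0 rmorph0 mul0r.
by rewrite mulrCA hp mulrC.
Qed.
End CanonicalSpec.

(** * The cost, and the algorithm for the canonical matrix *)

Section Cost.
Definition cost_poly (p : sprog) : {poly {poly nat}} :=
  (weight p)%:R * (nat_expr_poly (NMul xV0 xV0) + 1) ^+ depth p.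

Lemma eval_add (P Q : {poly {poly nat}}) n d : (P + Q).[n%:P].[d] = (P.[n%:P].[d] + Q.[n%:P].[d])%N.
Proof. by rewrite !hornerD. Qed.
Lemma eval_mul (P Q : {poly {poly nat}}) n d : (P * Q).[n%:P].[d] = (P.[n%:P].[d] * Q.[n%:P].[d])%N.
Proof. by rewrite !hornerM. Qed.
Lemma eval_exp (P : {poly {poly nat}}) k n d : (P ^+ k).[n%:P].[d] = (P.[n%:P].[d] ^ k)%N.
Proof.
elim: k => [|k IH]; first by rewrite expr0 !hornerC.
by rewrite exprS eval_mul IH expnS.
Qed.
Lemma eval_nat (k : nat) n d : (k%:R : {poly {poly nat}}).[n%:P].[d] = k.
Proof.
elim: k => [|k IH]; first by rewrite !hornerC.
by rewrite -addn1 natrD eval_add IH !hornerC.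
Qed.

Lemma machine_cost (F : fieldType) n d p (s : memory F) : wf p -> sized n d s ->
  exists2 k, (k <= (cost_poly p).[n%:P].[d])%N & exec (compile xbig p) s k (sem xbig p s).
Proof.
move=> hw [hn hd].
have hb : forall s s' : memory F, nmem s 0 = nmem s' 0 -> nmem s 1 = nmem s' 1 -> neval s xbig = neval s' xbig.
  by rewrite /xbig -lock; apply: npoly_input.
have [k hk he] := compile_exec hb s hw; exists k => //.
apply: leq_trans hk _; rewrite /cost_poly eval_mul eval_exp eval_add eval_nat !hornerC -hn -hd.
by rewrite -npolyE // addn1 /xbig -lock.
Qed.
End Cost.

Section Result.
Variables (R : realType) (n : nat) (M : 'M[ffield R]_n) (d : nat).
Hypothesis hM : GL (@R12 R) M.
Hypothesis hd : forall i j, Fil (2 * d).+1 (y_z R ^+ d * M i j).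
Hypothesis n0 : (0 < n)%N.
Local Notation K := (ffield R).
Local Notation X := (pairmod 'cV[ring1 R]_n 'cV[ring2 R]_n).
Local Notation item := (item X).
Local Notation S := (glue_graded (matrix_gluing hM hd)).
Local Notation h := (szh n d).
Local Notation mem := (memory R).
Implicit Types (it : nat -> item) (m : mem).

Lemma item_index_key (x : item) : item_index d.+1 x = (key x)%:Z - (2 * d.+1 + 1)%N%:Z.
Proof. by rewrite /item_index /key; case: (isodd x); lia. Qed.

Lemma ordered_indices it r : ordered it r ->
  exists q, block_indices q = [seq item_index d.+1 (it i) | i <- iota 0 r].
Proof.
move=> ho; apply: block_indices_sort; apply/(sortedP 0) => i; rewrite size_map size_iota => ir.
rewrite !(nth_map 0%N) ?size_iota ?(ltnW ir) // !nth_iota ?(ltnW ir) // !add0n !item_index_key.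
by rewrite lerD2r lez_nat; apply: ho.
Qed.

Definition computed m it r := forall b, (b < n)%N ->
  column_in d m b (nth (no_column R n) (all_cols it r) b) /\ col_small d (nth (no_column R n) (all_cols it r) b).

(** By [full_of_levels] the visited degrees suffice for fullness, so the computed family gives bases
    on both charts. *)
Lemma levels_result m : levels_done hM hd m (2 * h + 1) ->
  exists it r, [/\ independent it r, spanning it r, forall i, (i < r)%N -> valid S (it i),
    exists q, block_indices q = [seq item_index d.+1 (it i) | i <- iota 0 r] & computed m it r].
Proof.
move=> [it [r [[_ _ hg ho hk] [_ hc] hcm]]]; exists it, r.
have hfull : full S it r.
  apply: full_of_levels => // k u kb; apply: hcm.
  by apply: leq_trans kb _; rewrite szhE.
have hi := good_independent hg; have hsp := full_spanning hg hfull.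
have hv i : (i < r)%N -> valid S (it i) by move=> /hg[].
have [q hq] := ordered_indices ho.
split=> //; first by exists q.
have sz := csz_rank hq hi hsp.
have szc := size_cols hq.
move=> b bn; split; first by apply: hc; rewrite szc sz.
have bn' : (b < csz (block_indices q))%N by rewrite sz.
rewrite (nth_cols hq (Ordinal bn')); set x := Ordinal bn'.
have xr : (item_of x < r)%N by rewrite -(size_l hq).
have l0 := good_lev hg xr.
have := hk _ xr; have [jb] : exists2 j, part_of x = j & (j < (isodd (it (item_of x))).+1)%N.
  by exists (part_of x) => //; have [k [j ->]] := pos_exists x; rewrite item_pos part_pos -(size_odd_l hq (ltn_ord k)).
move=> -> jlt; rewrite /key /item_cols /col_small; move: jlt l0.
by case: (isodd _) => /=; case: jb => [|[|//]] //= _ l0 kb; rewrite l0 /=; lia.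
Qed.
End Result.

Section Algorithm.
Variable R : realType.
Local Notation mem := (memory R).

Definition levels_program : sprog := SSeq SYSTEMS LEVELS.

(** The order is 2 d + 1 rather than 2 d because of the factor s in the second array. *)
Lemma stores_Fil n (M : 'M[ffield R]_n) (m : mem) d : nmem m 1 0 = d -> stores m 0 M ->
  forall i j, Fil (2 * d).+1 (y_z R ^+ d * M i j).
Proof.
move=> md /(stores_emb M md) hM i j; rewrite hM.
eexists; eexists; split; first by reflexivity.
  by apply: leq_trans (size_poly _ _) _.
by apply: size_poly.
Qed.

Lemma levels_program_spec n d (M : 'M[ffield R]_n) (m : mem) (hM : GL (@R12 R) M)
    (hd : forall i j, Fil (2 * d).+1 (y_z R ^+ d * M i j)) : (0 < n)%N -> sized n d m -> stores m 0 M ->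
  let m' := sem xbig levels_program m in sized n d m' /\
  exists it r, [/\ independent it r, spanning it r,
    forall i, (i < r)%N -> valid (glue_graded (matrix_gluing hM hd)) (it i),
    exists q, block_indices q = [seq item_index d.+1 (it i) | i <- iota 0 r] & computed d m' it r].
Proof.
move=> n0 hs hst m'; have [h1 h2 h3] := systems_spec n0 hs hst.
have [h4 h5] := levels_spec hM hd n0 h3 h1 h2.
rewrite /m' /levels_program sem_seq; split; first exact: h5.
exact: levels_result h4.
Qed.

Definition canonical_program : sprog := (levels_program ;; CANONICAL 0 ;; CANONICAL 1)%S.

Theorem canonical_computable :
  exists (A : program) (P : {poly {poly nat}}),
    forall (n : nat) (M : 'M[ffield R]_n) (s : memory R),
      (1 <= n)%N -> GL (@R12 R) M -> input M s ->
      exists (k : nat) (s' : memory R) (m : {fsfun int -> nat with 0%N})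
             (size_m : canonical_size m = n),
        [/\ exec A s k s',
            (k <= P.[n%:P].[d_w (map_mx (@phi_pull R) M)])%N,
            stores s' 1 (castmx (size_m, size_m) (canonical_mx R m)) &
            exists L U : 'M[ffield R]_n,
              [/\ GL (@R2 R) L, GL (@R1 R) U &
                  L *m M *m U = castmx (size_m, size_m) (canonical_mx R m)]].
Proof.
(* The width of the output is written at the end, outside the structured program, which may not
   write array 1. *)
exists (Seq (compile xbig canonical_program) (NSet 1 (NConst 1) xO)), (cost_poly canonical_program).
move=> n M s n0 hM [h0 h1 hst]; set d := d_w _ in h1 *.
have hs : sized n d s by [].
have hd := stores_Fil h1 hst.
have [hs1 [it [r [hi hsp hv [q hq] hc]]]] := levels_program_spec hM hd n0 hs hst.
have wfp : wf canonical_program by [].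
have [k hk he] := machine_cost wfp hs.
have hs2 := sized_sem (p := canonical_program) wfp hs.
set m1 := sem xbig levels_program s in hs1 hc.
set m2 := sem xbig canonical_program s in he hs2.
exists k, (setn 1 1 (szO n d) m2), q, (csz_rank hq hi hsp); split=> //.
- rewrite -[k in exec _ _ k _]addn0; apply: exec_seq he _.
  have -> : setn 1 1 (szO n d) m2 = setn 1 (neval m2 (NConst 1)) (neval m2 xO) m2.
    by rewrite /xO !nevalE !(sizeE hs2).
  exact: exec_nset.
- apply: (canonical_stores hs1 hc) => i j.
  by rewrite castmxE /= -cmx_canonical (cmx_cols hq).
- exists (invmx (Wmx hq hi hsp)), (Umx hq hi hsp); split.
  + exact: GL_Lmx.
  + exact: GL_Umx.
  + by rewrite (multipliers_mul hq hi hsp hv) cmx_canonical.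
Qed.
End Algorithm.

(** * The dual systems and the left multiplier *)

Lemma power_shift0 (F : fieldType) (x : F) (l D b : nat) : x != 0 -> (b <= l)%N ->
  x ^+ D * (- x) ^ (l%:Z - D%:Z - b%:Z) = (-1) ^+ (l + (D + b)) * x ^+ (l - b).
Proof.
move=> x0 bl; apply: (mulfI (expf_neq0 b x0)); rewrite mulrA -exprD power_shift //.
by rewrite mulrCA -exprD; congr (_ * _ ^+ _); lia.
Qed.

(* The unknowns are (x, y, 0, 0) with y = A^T x. *)
Definition dual_system : system := [:: (0, 0, CT); (0, 1, CU false false true); (1, 1, CW)]%N.

Lemma dual_rows (R : realType) n d (A W : 'M[ffield R]_n) (f : nat -> R) :
  sys d A W dual_system f 0 = A^T *m dv n d f 0 - dv n d f 1 /\
  sys d A W dual_system f 1 = W *m dv n d f 1.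
Proof.
split; rewrite sys4.
  rewrite (@block_lookup R n d A W f dual_system 0 0 (Some CT) erefl).
  rewrite (@block_lookup R n d A W f dual_system 0 1 (Some (CU false false true)) erefl).
  rewrite (@block_lookup R n d A W f dual_system 0 2 None erefl).
  rewrite (@block_lookup R n d A W f dual_system 0 3 None erefl).
  by rewrite code_unit unit_n1 scaleN1r !addr0.
rewrite (@block_lookup R n d A W f dual_system 1 0 None erefl).
rewrite (@block_lookup R n d A W f dual_system 1 1 (Some CW) erefl).
rewrite (@block_lookup R n d A W f dual_system 1 2 None erefl).
rewrite (@block_lookup R n d A W f dual_system 1 3 None erefl).
by rewrite add0r !addr0.
Qed.

(** The target equation: in row n + b, the part without s, the coefficient of t^(2 h + lev) for the
    level of column b. *)
Definition xT : nat_expr := NAdd (NMul (NMul (NAdd xn (nvar 7)) (NConst 2)) xQ)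
  (NAdd (NMul (NConst 2) xh) (NRead 12 (nvar 7))).
(** The homogeneous equations are solved with the target left out. The elimination step at the
    target then puts into array 14 a solution with value 1 there. The final copy removes the sign of
    [dual]. *)
Definition DUAL : sprog :=
  (KER 24 25 (NMul (NConst 2) xn) [:: TEq (nvar 17) xT] ;; SN 17 (NConst 0) xT ;; BUILD 24 25 ;; STEP 16 ;;
   COPY 26 (NMul (nvar 7) xB)
     (CIf (TEq (NMod (NAdd (NRead 12 (nvar 7)) (NAdd xd (NConst 1))) (NConst 2)) (NConst 0))
       (CE (FRead 14 (nvar 13))) (CE (FSub FZero (FRead 14 (nvar 13))))))%S.
Definition DUALS : sprog := SFor 7 xn DUAL.

Section Dual.
Variables (R : realType) (n : nat) (M : 'M[ffield R]_n) (d : nat).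
Hypothesis hM : GL (@R12 R) M.
Hypothesis hd : forall i j, Fil (2 * d).+1 (y_z R ^+ d * M i j).
Hypothesis n0 : (0 < n)%N.
Local Notation K := (ffield R).
Local Notation t := (y_z R).
Local Notation X := (pairmod 'cV[ring1 R]_n 'cV[ring2 R]_n).
Local Notation item := (item X).
Local Notation S := (glue_graded (matrix_gluing hM hd)).
Local Notation A := (mA M d).
Local Notation h := (szh n d).
Variables (it : nat -> item) (r : nat) (l : seq int).
Hypothesis lE : l = [seq item_index d.+1 (it i) | i <- iota 0 r].
Hypotheses (hi : independent it r) (hs : spanning it r).
Hypothesis hv : forall i, (i < r)%N -> valid S (it i).
Local Notation c b := (nth (no_column R n) (all_cols it r) b).
Hypothesis small : forall b, (b < n)%N -> col_small d (c b).
Local Notation W := (Wmx lE hi hs).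
Local Notation U := (Umx lE hi hs).
Local Notation L := (invmx W).
Local Notation C := (castmx (csz_rank lE hi hs, csz_rank lE hi hs) (cmx R l)).

Lemma part_lt (x : 'I_(csz l)) : (part_of x < (isodd (it (item_of x))).+1)%N.
Proof. by have [k [j ->]] := pos_exists x; rewrite item_pos part_pos -(size_odd_l lE (ltn_ord k)). Qed.

Lemma U_col (b i : 'I_n) : U i b = cu (c b) i 0.
Proof.
have [x hx] : exists x : 'I_(csz l), x = cast_ord (esym (csz_rank lE hi hs)) b by eexists.
have xb : b = x :> nat by rewrite hx.
rewrite castmxE /= -hx !mxE xb (nth_cols lE) /basis1 cast_ord_id /item_cols /uvec.
have := part_lt x; case: (isodd _) => /=; case: (part_of x) => [|[|//]] //= _; rewrite !mxE //.
Qed.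

Lemma map_val_scale m (a : ring2 R) (v : 'cV[ring2 R]_m) : map_mx val (a *: v) = val a *: map_mx val v.
Proof. by apply/colP => i; rewrite !mxE. Qed.
Lemma map_val_opp m (v : 'cV[ring2 R]_m) : map_mx val (- v) = - map_mx val v.
Proof. by apply/colP => i; rewrite !mxE. Qed.
Lemma twin_glued k (u : X) : G S k u ->
  A *m vl u = ((-1) ^+ (k + d.+1) * t ^+ k) *: map_mx val (((-1) ^+ (k + d.+1) : ring2 R) *: u.2).
Proof.
move=> hu; rewrite ((mA_glued hM hd k u).1 hu) map_val_scale scalerA.
have -> : val ((-1) ^+ (k + d.+1) : ring2 R) = (-1) ^+ (k + d.+1) :> K.
  by elim: (_ + _)%N => [|j IH]; [rewrite !expr0 | rewrite !exprS -IH].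
by rewrite mulrAC -expr2 sqrr_sign mul1r.
Qed.

Lemma item_twin (z : item) j : valid S z -> (j < (isodd z).+1)%N ->
  let e := nth (no_column R n) (item_cols z) j in
  A *m ct e = ((-1) ^+ (clev e + d.+1) * t ^+ clev e) *: map_mx val (wvec d.+1 z j).
Proof.
move=> hz; have h0 := twin_glued (valid_g0 hz).
rewrite /item_cols /wvec; case: (boolP (isodd z)) => ho; case: j => [|[|j]] jlt; try by case/negP: jlt.
- exact: h0.
- change (A *m (- vl (g2 z)) = ((-1) ^+ (lev z + d.+1) * t ^+ lev z) *: map_mx val (- (sgn2 d.+1 z *: (g2 z).2))).
  rewrite mulmxN map_val_opp scalerN; congr (- _).
  exact: (twin_glued (valid_g2 hz ho)).
- exact: h0.
Qed.

Definition col_sign (b : nat) : K := (-1) ^+ (clev (c b) + d.+1).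
(** The companion is the U_1-component of a section whose U_2-component is the column of W up to
    sign. So the columns of W are accessible through data over R_1. *)
Lemma W_twin (b : 'I_n) : A *m ct (c b) = (col_sign b * t ^+ clev (c b)) *: col b W.
Proof.
have [x hx] : exists x : 'I_(csz l), x = cast_ord (esym (csz_rank lE hi hs)) b by eexists.
have xb : b = x :> nat by rewrite hx.
have -> : col b W = map_mx val (basis2 d.+1 it x).
  by apply/colP => i; rewrite mxE castmxE /= -hx !mxE cast_ord_id.
have xr : (item_of x < r)%N by rewrite -(size_l lE).
rewrite /col_sign xb (nth_cols lE) /basis2.
exact: (item_twin (hv xr) (part_lt x)).
Qed.

Lemma W_unit : W \in unitmx.
Proof. by have [] := GL_Lmx lE hi hs; rewrite unitmx_inv. Qed.

Lemma sign_sq b : col_sign b * col_sign b = 1.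
Proof. by rewrite -expr2 sqrr_sign. Qed.

(** The factor t^(2 h) makes the row regular on U_1, and the sign cancels the one in [W_twin]. *)
Definition dual (b : 'I_n) : 'cV[K]_n := (col_sign b * t ^+ (2 * h)) *: (row b L)^T.

(* The row b of L, scaled into R_1, is determined by its products with the
   twin columns. *)
Lemma dual_twin (b i : 'I_n) :
  ((dual b)^T *m (A *m ct (c i))) = (if i == b then t ^+ (2 * h + clev (c b)) else 0)%:M.
Proof.
rewrite W_twin -scalemxAr /dual [X in X *m _]linearZ /= trmxK -scalemxAl.
have -> : row b L *m col i W = (b == i)%:R%:M.
  have /matrixP/(_ b i) := mulVmx W_unit; rewrite mxE [RHS]mxE => e.
  apply/matrixP => x y; rewrite !ord1 mxE [RHS]mxE eqxx mulr1n -e.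
  by apply: eq_bigr => z _; rewrite !mxE.
rewrite scalerA scale_scalar_mx eq_sym; case: eqVneq => [->|_]; last by rewrite mulr0.
by rewrite mulr1 mulrACA sign_sq mul1r addnC exprD.
Qed.

(** The columns of W form a basis, so a row is determined by its products with them. *)
Lemma dual_unique (b : 'I_n) (x : 'cV[K]_n) :
  (forall i : 'I_n, x^T *m (A *m ct (c i)) = (if i == b then t ^+ (2 * h + clev (c b)) else 0)%:M) -> x = dual b.
Proof.
move=> hx; apply/eqP; rewrite -subr_eq0; apply/eqP; set z := x - dual b.
have hz i : z^T *m col i W = 0.
  have : z^T *m (A *m ct (c i)) = 0 by rewrite /z linearB /= mulmxBl hx dual_twin subrr.
  rewrite W_twin -scalemxAr => /eqP; rewrite scaler_eq0 mulf_eq0 signr_eq0 /= (negPf (tX_neq0 R _)) /=.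
  by move/eqP.
have : z^T *m W = 0.
  apply/rowP => i; have := hz i; rewrite [col i _]colE mulmxA -colE => /colP/(_ 0).
  by rewrite mxE [RHS]mxE => ->; rewrite mxE.
move/(congr1 (mulmx^~ L)); rewrite mulmxK ?W_unit // mul0mx => /(congr1 trmx).
by rewrite trmxK trmx0.
Qed.

Lemma col_power_pole b : (b < n)%N -> t ^+ d.+1 * col_power d (c b) \in @R1 R.
Proof.
move=> bn; have /and3P[k2 l0 _] := small bn; rewrite /col_power -divn2.
have hk : (ckind (c b) %/ 2 <= 1)%N by rewrite (leq_div2r 2 k2).
have lk : (ckind (c b) %/ 2 <= clev (c b))%N by apply: leq_trans hk l0.
rewrite (power_shift0 _ (t_neq0 R) lk) rpredM ?rpredX ?y_z_R1 //.
by rewrite rpredN1.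
Qed.

Lemma canonical_pole i j : t ^+ d.+1 * C i j \in @R1 R.
Proof.
rewrite castmxE /= (cmx_cols lE) /= /col_entry.
have hp := col_power_pole (ltn_ord j).
case: eqP => _; first exact: hp.
case: ifP => _; last by rewrite mulr0 rpred0.
by rewrite mulrCA rpredM // x_z_R1.
Qed.

(** The identity t^(2 h) L = t^(d + 1) C U^(-1) B shows regularity on U_1, since t^(d + 1) clears
    the poles of C. As L is regular on U_2, only t^(2 h) contributes poles along z = 0. *)
Lemma dual_level (b i : 'I_n) : Fil (2 * h) (dual b i 0).
Proof.
have [B [hB AB]] := mA_inv hM hd.
have hmul := multipliers_mul lE hi hs hv.
have LE : t ^+ (2 * h) *: L = t ^+ d.+1 *: C *m invmx U *m B.
  have [uU _ _] := GL_Umx lE hi hs.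
  have LM : L *m M = C *m invmx U by rewrite -hmul mulmxK.
  have tE : t ^+ (2 * h) *: L = L *m (A *m B) by rewrite AB szhE mul_mx_scalar.
  by rewrite tE mulmxA /mA -scalemxAr LM scalemxAl.
have hR1 : (t ^+ (2 * h) *: L) b i \in @R1 R.
  have [_ _ hU] := GL_Umx lE hi hs.
  rewrite LE mxE rpred_sum // => j _; rewrite rpredM ?(Fil_R1 (hB _ _)) //.
  rewrite mxE rpred_sum // => k _; rewrite rpredM ?hU //.
  by rewrite mxE canonical_pole.
have [_ hL _] := GL_Lmx lE hi hs.
apply: (@R1_tR2 R _ _ (col_sign b * L b i)).
- by rewrite !mxE -mulrA rpredM ?rpredX ?rpredN1 //; move: hR1; rewrite mxE.
- by rewrite rpredM ?rpredX ?rpredN1.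
- by rewrite !mxE mulrAC.
Qed.

Definition twins : 'M[K]_n := \matrix_(i, j) ct (c i) j 0.
Lemma twins_mul (i : 'I_n) (y : 'cV[K]_n) : (twins *m y) i 0 = (y^T *m ct (c i)) 0 0.
Proof. by rewrite !mxE; apply: eq_bigr => j _; rewrite !mxE mulrC. Qed.

(** The first block of rows says that the second vector is A^T times the first; the second block
    prescribes its products with the companions. All coefficients are 0 except the target. *)
Lemma dual_equations (m : memory R) f (b : 'I_n) :
  system_in d m 24 25 2 A twins dual_system ->
  let eqn e := \sum_(0 <= j < szV n d) f j * bcoef n d (fmem m 24) (fmem m 25) e j in
  let T := (2 * h + clev (c b))%N in
  let tg := ((n + b) * 2 * szQ n d + T)%N in
  ((forall r (i : 'I_n), (r < 2)%N -> forall h q, (h < 2)%N -> (q < szQ n d)%N ->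
     (((r * n + i) * 2 + h) * szQ n d + q != tg)%N -> eqn (((r * n + i) * 2 + h) * szQ n d + q)%N = 0) /\
   eqn tg = 1) <-> dv n d f 0 = dual b /\ dv n d f 1 = A^T *m dual b.
Proof.
move=> hsys eqn T tg.
have TQ : (T < szQ n d)%N.
  by have /and3P[_ _ lb] := small (ltn_ord b); rewrite /T /szQ /szE; lia.
have rowP a (i : 'I_n) : (a < 2)%N -> row_value n d (fmem m 24) (fmem m 25) f (a * n + i) = sys d A twins dual_system f a i 0.
  by move=> a2; apply: (row_value_sys f i hsys a2).
have tgE : tg = (((1 * n + b) * 2 + 0) * szQ n d + T)%N by rewrite mul1n addn0.
have digits a (i : 'I_n) h' q : (a < 2)%N -> (h' < 2)%N -> (q < szQ n d)%N ->
    (((a * n + i) * 2 + h') * szQ n d + q == tg)%N = [&& a == 1%N, i == b, h' == 0%N & q == T].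
  move=> a2 h2 qQ; apply/eqP/and4P => [e|[/eqP -> /eqP -> /eqP -> /eqP ->]]; last by rewrite tgE.
  have := congr1 (modn^~ (szQ n d)) e; rewrite tgE !modn_digit // => ->.
  have := congr1 (divn^~ (szQ n d)) e; rewrite tgE !divn_digit // => e2.
  have := congr1 (modn^~ 2) e2; rewrite !modn_digit // => ->.
  have := congr1 (divn^~ 2) e2; rewrite !divn_digit // => e3.
  have := congr1 (modn^~ n) e3; rewrite !modn_digit // => e4.
  have := congr1 (divn^~ n) e3; rewrite !divn_digit // => ->.
  by split=> //; apply/eqP/val_inj.
have [d0 d1] := dual_rows d A twins f.
have sz a (i : 'I_n) (a2 : (a < 2)%N) := system_sizes n0 i hsys a2.
split=> [[h0 h1]|[h0 h1]].
  have hA : dv n d f 1 = A^T *m dv n d f 0.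
    apply/eqP; rewrite eq_sym -subr_eq0 -d0; apply/eqP/colP => i; rewrite [RHS]mxE -rowP //.
    by apply: (row_zero n0 f (sz 0%N i isT)).1 => h' q h2 qQ; apply: h0 => //; rewrite digits.
  have hd0 : dv n d f 0 = dual b.
    apply: dual_unique => i; apply/matrixP => x y; rewrite !ord1 [RHS]mxE eqxx mulr1n.
    have -> : (dv n d f 0)^T *m (A *m ct (c i)) = (dv n d f 1)^T *m ct (c i).
      by rewrite hA trmx_mul trmxK mulmxA.
    rewrite -twins_mul -d1 -rowP //; case: (eqVneq i b) => [->|ib].
      apply: (row_unit n0 f (sz 1%N b isT) TQ).1 => h' q h2 qQ.
      have [/andP[/eqP -> /eqP ->]|ne] := boolP ((h' == 0%N) && (q == T)).
        by rewrite -tgE; exact: h1.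
      by apply: (h0 1%N b isT h' q h2 qQ); rewrite digits // !eqxx.
    apply: (row_zero n0 f (sz 1%N i isT)).1 => h' q h2 qQ.
    by apply: h0 => //; rewrite digits // (negPf ib).
  clear -hA hd0.
  split; first exact hd0.
  rewrite hA.
  congr (_ *m _); exact hd0.
have tw (i : 'I_n) : row_value n d (fmem m 24) (fmem m 25) f (1 * n + i) = if i == b then t ^+ T else 0.
  rewrite rowP // d1 twins_mul h1 trmx_mul trmxK -mulmxA dual_twin mxE eqxx mulr1n.
  by [].
have z0 (i : 'I_n) : row_value n d (fmem m 24) (fmem m 25) f (0 * n + i) = 0.
  by rewrite rowP // d0 h0 h1 subrr mxE.
split=> [a i a2 h' q h2 qQ|].
  rewrite digits //; case: a a2 => [|[|//]] a2 ne.
    by apply: (row_zero n0 f (sz 0%N i a2)).2.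
  case: (eqVneq i b) ne => [->|ib] ne.
    have := tw b; rewrite eqxx => /(row_unit n0 f (sz 1%N b a2) TQ).2 hu.
    by apply: etrans (hu h' q h2 qQ) _; move: ne; rewrite eqxx /= => /negbTE ->.
  by apply: (row_zero n0 f (sz 1%N i a2)).2 => //; rewrite tw (negPf ib).
have := tw b; rewrite eqxx => /(row_unit n0 f (sz 1%N b isT) TQ).2 hu.
by rewrite tgE; apply: etrans (hu 0%N T isT TQ) _; rewrite !eqxx.
Qed.

Lemma dual_exists (b : 'I_n) : exists f, dv n d f 0 = dual b /\ dv n d f 1 = A^T *m dual b.
Proof.
pose vb (k : nat) : 'cV[K]_n := if k == 0%N then dual b else if k == 1%N then A^T *m dual b else 0.
have hh : ((2 * d).+2 <= h)%N by rewrite szhE; apply: leq_pmull.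
have hvb k i : Fil (4 * h + 3) (vb k i 0).
  rewrite /vb; case: eqP => _; first by apply: Fil_le (dual_level b i); lia.
  case: eqP => _; last by rewrite mxE; apply: Fil0.
  rewrite mxE; apply: Fil_sum => j _; rewrite mxE.
  by apply: Fil_le (FilM (mA_Fil hd j i) (dual_level b j)); lia.
by have [f hf] := dv_surj n0 hvb; exists f; rewrite !hf.
Qed.

Lemma dual_step (m : memory R) (b : 'I_n) : sized n d m -> system_in d m 24 25 2 A twins dual_system ->
  nmem m 7 0 = b -> nmem m 12 b = clev (c b) ->
  forall b', colvec n d (sem xbig DUAL m) 26 b' =
    if b' == b :> nat then col_sign b *: dual b else colvec n d m 26 b'.
Proof.
move=> hs0 hsys h7 h12; set T := (2 * h + clev (c b))%N; set tg := ((n + b) * 2 * szQ n d + T)%N.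
rewrite /DUAL sem_seq; set m1 := sem xbig (KER _ _ _ _) m; rewrite sem_seq; set m2 := sem xbig (SN _ _ _) m1.
rewrite sem_seq; set m3 := sem xbig (BUILD _ _) m2; rewrite sem_seq; set m4 := sem xbig (STEP 16) m3.
have hs1 : sized n d m1 by apply: sized_sem => //; apply: KER_wf.
have n1 a : a \notin [:: 13; 14; 16; 17]%N -> nmem m1 a = nmem m a.
  move=> ha; rewrite /m1 sem_nframe //; apply: contra ha; exact: KER_nwrites.
have f1 a : a \notin [:: 12; 13; 14; 16]%N -> fmem m1 a = fmem m a.
  move=> ha; rewrite /m1 sem_fframe //; apply: contra ha; exact: KER_fwrites.
have tgE s' : sized n d s' -> nmem s' 7 = nmem m 7 -> nmem s' 12 = nmem m 12 -> neval s' xT = tg.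
  by move=> hs' e7 e12; rewrite /xT !nevalE !(sizeE hs') e7 h7 e12 h12.
have hs2 : sized n d m2 by apply: sized_sem.
have hs3 : sized n d m3 by apply: sized_sem.
have hs4 : sized n d m4 by apply: sized_sem.
have h17 : nmem m2 17 0 = tg by change (neval m1 xT = tg); apply: tgE; rewrite ?n1.
have f2 : fmem m2 = fmem m1 by [].
have hK := @KER_kernel R n d n0 24 25 m (NMul (NConst 2) xn) [:: TEq (nvar 17) xT] 2 A twins dual_system
  (fun r h q => (r * 2 + h) * szQ n d + q == tg)%N hs0 isT isT isT hsys.
have {hK} hK : kernel_in n d m1 (fun f => forall r (i : 'I_n), (r < 2)%N -> forall h q, (h < 2)%N -> (q < szQ n d)%N ->
     (((r * n + i) * 2 + h) * szQ n d + q != tg)%N ->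
     \sum_(0 <= j < szV n d) f j * bcoef n d (fmem m 24) (fmem m 25) (((r * n + i) * 2 + h) * szQ n d + q) j = 0).
  apply: hK; first by move=> s' hs'; rewrite !nevalE (sizeE hs').
  move=> s' i g1 hs' g2; transitivity (teval s' (TEq (nvar 17) xT)); first by rewrite /all andbT.
  by rewrite teval_eq tgE ?g1 // !nevalE g2 -divn_eq -divn_eq.
have hB : cvof (szV n d) (fmem m3 12) = \col_j bcoef n d (fmem m 24) (fmem m 25) tg j.
  by rewrite /m3 (build_spec n0 hs2 h17) // f2 !f1.
set B := cvof _ _ in hB.
have f3 a : a != 12%N -> fmem m3 a = fmem m1 a by move=> ha; rewrite /m3 tab_fframe.
have [p [_ hp _ hout _]] := step_spec n0 hs3 (isT : 16%N \in [:: 15; 16]%N).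
rewrite -/B -/m4 f3 // in hp hout; set k := mxof _ _ in hp hout.
have dotB f : (rvof (szV n d) f *m B) 0 0 = \sum_(0 <= j < szV n d) f j * bcoef n d (fmem m 24) (fmem m 25) tg j.
  by rewrite hB big_mkord mxE; apply: eq_bigr => j _; rewrite !mxE.
have [f [e0 e1]] := dual_exists b.
have [hf1 hf2] := (dual_equations f b hsys).2 (conj e0 e1).
have fk : (rvof (szV n d) f <= k)%MS by apply/hK.
(* The solution given by [dual_exists] has value 1 at the target, so the pivot is nonzero. *)
have kB : k *m B != 0.
  apply/eqP => z; case/submxP: fk => D fD; have := dotB f; rewrite fD -mulmxA z mulmx0 mxE hf2 => /esym/eqP.
  by rewrite oner_eq0.
have hpB : (k *m B) p 0 != 0 by case: hp => // z; rewrite z eqxx in kB.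
have outk : (rvof (szV n d) (fmem m4 14) <= k)%MS by rewrite hout scalemx_sub // row_sub.
have outB : rvof (szV n d) (fmem m4 14) *m B = 1%:M by rewrite hout; apply: (out_b hp kB).
have [o0 _] : dv n d (fmem m4 14) 0 = dual b /\ dv n d (fmem m4 14) 1 = A^T *m dual b.
  apply/(dual_equations _ _ hsys); split; first by apply/hK.
  by rewrite -/tg -dotB outB mxE.
pose sg : R := (-1) ^+ (clev (c b) + d.+1).
have -> : col_sign b = cst R sg by rewrite /col_sign /sg rmorph_sign.
have nm4 a : a \notin [:: 13; 14; 16; 17]%N -> nmem m4 a = nmem m a.
  move=> ha; rewrite /m4 sem_nframe; last by apply: notin_all ha.
  rewrite /m3 sem_nframe; last by apply: notin_all ha.
  by rewrite /m2 sem_nframe ?n1 //; apply: notin_all ha.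
have f426 : fmem m4 26 = fmem m 26.
  by rewrite /m4 sem_fframe // f3 // f1.
clear hf1 hf2 fk kB hpB outk outB hK dotB => b'; rewrite (@colvec_copy R n d n0 m4 _ 26 b' b sg (fmem m4 14) 0).
  rewrite o0 /colvec f426; case: (b' == b :> nat); reflexivity.
move=> j; rewrite (@copy_spec _ n d 26 _ _ m4 (fun k => sg * fmem m4 14 k) (b * szB n d)%N) //.
move=> s' i iB g1 g2 g3.
have hs' : sized n d s' by apply: (@sized_eq _ n d m4 s') hs4; apply: g1.
split; first by rewrite neval_mul neval_read g1 // nm4 // neval_const h7 (neval_B hs').
have g7 : neval s' (NRead 12 (nvar 7)) = clev (c b).
  by rewrite neval_read neval_read neval_const !g1 // !nm4 // h7.
have g13 : feval s' (FRead 14 (nvar 13)) = fmem m4 14 i by rewrite feval_read neval_read neval_const g2 g3.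
rewrite ceval_if teval_eq neval_mod neval_add g7 neval_add (neval_d hs') !neval_const addn1 modn2 !ceval_ce.
rewrite feval_sub feval0 g13 /sg -signr_odd.
by case: (odd _); rewrite ?expr1 ?expr0 ?mul1r ?mulN1r ?sub0r.
Qed.

Lemma duals_spec (m : memory R) : sized n d m -> system_in d m 24 25 2 A twins dual_system ->
  (forall b, (b < n)%N -> nmem m 12 b = clev (c b)) ->
  forall b : 'I_n, colvec n d (sem xbig DUALS m) 26 b = col_sign b *: dual b.
Proof.
move=> hs0 hsys h12.
pose Inv k (s' : memory R) := [/\ sized n d s', fmem s' 24 = fmem m 24, fmem s' 25 = fmem m 25,
  nmem s' 12 = nmem m 12 & forall b : 'I_n, (b < k)%N -> colvec n d s' 26 b = col_sign b *: dual b].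
have bE : neval m (bound xbig xn) = n.
  by rewrite neval_bound_small (neval_n hs0) // (neval_big hs0) /szV /szE; nia.
suff : Inv n (sem xbig DUALS m) by case=> _ _ _ _ hb b; apply: hb.
rewrite -{1}bE; apply: (@for_ind R xbig Inv) => [//||].
  by split=> //; apply: (@sized_eq _ n d m) hs0.
move=> k s'; rewrite bE => kn s7 [g1 g2 g3 g4 g5].
have hsys' : system_in d s' 24 25 2 A twins dual_system by move: hsys; rewrite /system_in g2 g3.
have hD a : a \notin [:: 12; 13; 14; 16; 26]%N -> fmem (sem xbig DUAL s') a = fmem s' a.
  by move=> ha; rewrite sem_fframe //; apply: notin_all ha.
have hstep := @dual_step s' (Ordinal kn) g1 hsys' s7 (etrans (congr1 (@^~ k) g4) (h12 k kn)).
split.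
- by apply: (@sized_eq _ n d (sem xbig DUAL s')) => //; apply: sized_sem.
- by rewrite fmem_setn hD.
- by rewrite fmem_setn hD.
- change (nmem (sem xbig DUAL s') 12 = nmem m 12); rewrite sem_nframe ?g4 //.
- move=> b bk; have -> : colvec n d (setn 7 0 k.+1 (sem xbig DUAL s')) 26 b = colvec n d (sem xbig DUAL s') 26 b by [].
  rewrite hstep; case: eqVneq => [e|ne]; first by have -> : b = Ordinal kn by apply: val_inj.
  by apply: g5; rewrite ltn_neqAle ne -ltnS.
Qed.
End Dual.

(** * Output of the multipliers *)

Section Output.
Variables (a q : nat) (tr : bool) (shift : nat_expr).
Let width := NSub (NMul (NConst 2) xE) (NConst 1).
Let k := NMod (nvar 13) width.
Let i := NDiv (NDiv (nvar 13) width) xn.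
Let j := NMod (NDiv (nvar 13) width) xn.
Let pos := if tr then NAdd (NMul j xn) i else NAdd (NMul i xn) j.
(* The degree 2 E - 1 makes room for the shifts by up to E - 1. *)
Definition OUTPUT (h : nat) : sprog := TAB 13 (2 * q + h) (NMul (NMul xn xn) width)
  (CIf (TLeq shift k) (CIf (TLeq (NAdd (NSub k shift) (NConst 1)) xE)
    (CE (FRead a (NAdd (NMul (NAdd (NMul pos (NConst 2)) (NConst h)) xE) (NSub k shift)))) (CE FZero)) (CE FZero)).

Variables (R : realType) (n d : nat).
Local Notation K := (ffield R).
Local Notation t := (y_z R).
Local Notation mem := (memory R).
Local Notation E := (szE n d).
Variable v : nat.
Hypothesis shiftE : forall m : mem, sized n d m -> neval m shift = v.
Hypothesis v_small : (v + E <= 2 * E - 1)%N.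
Hypothesis a_out : a != (2 * q)%N /\ a != (2 * q + 1)%N.

Lemma output_coef (m : mem) h x y p : (h < 2)%N -> sized n d m -> (x < n)%N -> (y < n)%N -> (p < 2 * E - 1)%N ->
  fmem (sem xbig (OUTPUT h) m) (2 * q + h) ((x * n + y) * (2 * E - 1) + p) =
  if (v <= p)%N && (p - v < E)%N then
    fmem m a (((if tr then y * n + x else x * n + y) * 2 + h) * E + (p - v))%N else 0.
Proof.
move=> h2 hs xn yn pW; have n0 : (0 < n)%N by apply: leq_ltn_trans xn.
rewrite (tab_spec (NN := (n * n * (2 * E - 1))%N)
  (f := fun z => let x := (z %/ (2 * E - 1) %/ n)%N in let y := (z %/ (2 * E - 1) %% n)%N in
    let p := (z %% (2 * E - 1))%N in if (v <= p)%N && (p - v < E)%N then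
    fmem m a (((if tr then y * n + x else x * n + y) * 2 + h) * E + (p - v))%N else 0)).
- rewrite digit_bound //; last by rewrite digit_bound.
  by cbv zeta; rewrite divn_digit // modn_digit // divn_digit // modn_digit.
- by rewrite /width !nevalE !(sizeE hs).
- rewrite (neval_big hs) /szV; nia.
- move=> s' z zN hn hz hf _; cbv zeta.
  have hs' : sized n d s' by apply: sized_eq hs; apply: hn.
  set g := (z %/ (2 * E - 1))%N.
  have kE : neval s' k = (z %% (2 * E - 1))%N by rewrite /k /width !nevalE !(sizeE hs') hz.
  have iE : neval s' i = (g %/ n)%N by rewrite /i /width !nevalE !(sizeE hs') hz.
  have jE : neval s' j = (g %% n)%N by rewrite /j /width !nevalE !(sizeE hs') hz.
  have posE : neval s' pos = (if tr then g %% n * n + g %/ n else g %/ n * n + g %% n)%N.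
    by rewrite /pos; case: tr; rewrite !(neval_add, neval_mul) iE jE (neval_n hs').
  have ha : a != (2 * q + h)%N by move: h2 a_out; clear; case: h => [|[|]] // _ [h1 h2]; rewrite ?addn0.
  rewrite ceval_if teval_leq (shiftE hs') kE; case: (leqP v _) => [vp|_]; last by [].
  rewrite andTb.
  rewrite ceval_if teval_leq neval_add neval_sub (shiftE hs') kE neval_const (neval_E hs') addn1.
  case: (ltnP (_ - v)%N E) => [pE|_]; last by [].
  rewrite ceval_ce feval_read hf // neval_add neval_mul neval_add neval_mul posE.
  by rewrite !neval_const (neval_E hs') neval_sub (shiftE hs') kE.
Qed.

Lemma output_stores (m m' : mem) (M : 'M[K]_n) : sized n d m -> nmem m' 1 q = (E - 1)%N ->
  fmem m' (2 * q) = fmem (sem xbig (SSeq (OUTPUT 0) (OUTPUT 1)) m) (2 * q) ->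
  fmem m' (2 * q).+1 = fmem (sem xbig (SSeq (OUTPUT 0) (OUTPUT 1)) m) (2 * q).+1 ->
  (forall x y : 'I_n, t ^+ (E - 1) * M x y =
    t ^+ v * dec n d (fmem m a) (if tr then y * n + x else x * n + y)%N) -> stores m' q M.
Proof.
move=> hs hq h0 h1 hM; apply: (proj2 (stores_emb M hq)) => x y.
have E0 : (0 < E)%N by rewrite /szE addn4.
have w1 : (2 * (E - 1)).+1 = (2 * E - 1)%N by lia.
have hc (f : nat -> R) h : (h < 2)%N -> (forall p, (p < 2 * E - 1)%N -> f ((x * n + y) * (2 * E - 1) + p)%N =
    if (v <= p)%N && (p - v < E)%N then
      fmem m a (((if tr then y * n + x else x * n + y) * 2 + h) * E + (p - v))%N else 0) ->
    stored_poly f (E - 1) (x * n + y) = 'X^v * coord_half n d (fmem m a) (if tr then y * n + x else x * n + y)%N h.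
  move=> h2 hf; apply/polyP => p; rewrite coef_poly w1 coefXnM coef_poly.
  case: ltnP => pW; first by rewrite hf // ltnNge; case: leqP.
  by rewrite ifN ?ifN // -leqNgt; lia.
rewrite hM /dec mulrC emb_t; congr emb; apply/esym; apply: hc => // p pW.
  rewrite h0 sem_seq tab_fframe; last by rewrite addn1 neq_ltn ltnSn.
  have := @output_coef m 0 x y p isT hs (ltn_ord x) (ltn_ord y) pW.
  by rewrite [X in fmem _ X](addn0 (2 * q)) => ->.
rewrite h1 -[X in fmem _ X]addn1 sem_seq.
have hs1 : sized n d (sem xbig (OUTPUT 0) m) by apply: sized_sem.
rewrite (@output_coef _ 1 x y p isT hs1 (ltn_ord x) (ltn_ord y) pW).
by rewrite tab_fframe // addn0; case: a_out.
Qed.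
End Output.

(** The multipliers are stored with e = E - 1 = 4 h + 3. The computed rows are t^(2 h) L, which
    leaves the shift 2 h + 3; the columns of U carry no power of t and need the full shift. *)
Definition shift_dual : nat_expr := NAdd (NMul (NConst 2) xh) (NConst 3).
Definition shift_full : nat_expr := NSub xE (NConst 1).
Definition SYSTEM_DUAL : sprog := SSeq (SYSTEM 24 2 dual_system 0) (SYSTEM 25 2 dual_system 1).
Definition OUTPUT_L : sprog := SSeq (OUTPUT 26 1 false shift_dual 0) (OUTPUT 26 1 false shift_dual 1).
Definition OUTPUT_U : sprog := SSeq (OUTPUT 18 2 true shift_full 0) (OUTPUT 18 2 true shift_full 1).
Definition multiplier_program : sprog :=
  (levels_program ;; PREPARE 0 ;; PREPARE 1 ;; SYSTEM_DUAL ;; DUALS ;; OUTPUT_L ;; OUTPUT_U)%S.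

Lemma wf_multiplier : wf multiplier_program. Proof. by []. Qed.

Lemma multiplier_sem (F : fieldType) (s : memory F) : sem xbig multiplier_program s =
  sem xbig OUTPUT_U (sem xbig OUTPUT_L (sem xbig DUALS (sem xbig SYSTEM_DUAL
    (sem xbig (PREPARE 1) (sem xbig (PREPARE 0) (sem xbig levels_program s)))))).
Proof.
rewrite /multiplier_program; move: levels_program (PREPARE 0) (PREPARE 1) SYSTEM_DUAL DUALS OUTPUT_L OUTPUT_U.
by move=> *; rewrite !sem_seq.
Qed.

Theorem multipliers_computable (R : realType) :
  exists (A : program) (P : {poly {poly nat}}),
    forall (n : nat) (M : 'M[ffield R]_n) (s : memory R),
      (1 <= n)%N -> GL (@R12 R) M -> input M s ->
      exists (k : nat) (s' : memory R) (m : {fsfun int -> nat with 0%N})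
             (size_m : canonical_size m = n) (L U : 'M[ffield R]_n),
        [/\ exec A s k s',
            (k <= P.[n%:P].[d_w (map_mx (@phi_pull R) M)])%N,
            stores s' 1 L /\ stores s' 2 U,
            GL (@R2 R) L /\ GL (@R1 R) U &
            L *m M *m U = castmx (size_m, size_m) (canonical_mx R m)].
Proof.
exists (Seq (compile xbig multiplier_program) (Seq (NSet 1 (NConst 1) shift_full) (NSet 1 (NConst 2) shift_full))).
exists (cost_poly multiplier_program).
move=> n M s n0 hM [h0 h1 hst]; set d := d_w _ in h1 *.
have hs : sized n d s by [].
have hd := stores_Fil h1 hst.
have [hs1 [it [r [hi hsp hv [q hq] hc]]]] := levels_program_spec hM hd n0 hs hst.
have [k hk he] := machine_cost wf_multiplier hs.
have hsL := sized_sem (p := multiplier_program) wf_multiplier hs.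
have hmul := multipliers_mul hq hi hsp hv.
move: hmul; set W := Wmx hq hi hsp; set U := Umx hq hi hsp => hmul.
set m1 := sem xbig levels_program s in hs1 hc.
have st1 : stores m1 0 M.
  have e0 : fmem m1 0 = fmem s 0 by rewrite /m1 sem_fframe.
  have e1 : fmem m1 1 = fmem s 1 by rewrite /m1 sem_fframe.
  have e2 : nmem m1 1 = nmem s 1 by rewrite /m1 sem_nframe.
  by move: hst; rewrite /stores e0 e1 e2.
have hA := prepare_matrix n0 hs1 st1.
set m2 := sem xbig (PREPARE 0) m1 in hA; set m3 := sem xbig (PREPARE 1) m2 in hA.
have hs3 : sized n d m3 by do 2 apply: sized_sem => //.
have f3 a : a \notin [:: 28; 29]%N -> fmem m3 a = fmem m1 a.
  move=> ha; rewrite /m3 sem_fframe; last by apply: notin_all ha.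
  by rewrite /m2 sem_fframe //; apply: notin_all ha.
have n3 a : a != 13%N -> nmem m3 a = nmem m1 a.
  by move=> ha; rewrite /m3 tab_nframe // /m2 tab_nframe.
have small b : (b < n)%N -> col_small d (nth (no_column R n) (all_cols it r) b) by case/hc.
have hW : vectors_in d m3 (twins it r).
  move=> i j; have [[_ _ _ e19] _] := hc i (ltn_ord i); rewrite mxE -e19 mxE f3 //.
have hsys := @SYSTEM_in R n d n0 m3 (mA M d) (twins it r) 24%N 25%N 2 dual_system hs3 isT isT isT isT hA hW.
set m4 := sem xbig SYSTEM_DUAL m3; rewrite -/SYSTEM_DUAL -/m4 in hsys.
have hs4 : sized n d m4 by apply: sized_sem.
have f4 a : a \notin [:: 24; 25]%N -> fmem m4 a = fmem m3 a.
  by move=> ha; rewrite /m4 sem_fframe //; apply: notin_all ha.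
have n4 a : a != 13%N -> nmem m4 a = nmem m3 a.
  by move=> ha; rewrite /m4 sem_nframe //= !inE negb_or ha.
have lev4 b : (b < n)%N -> nmem m4 12 b = clev (nth (no_column R n) (all_cols it r) b).
  by move=> bn; have [[_ e _ _] _] := hc b bn; rewrite n4 // n3.
have hdual := duals_spec n0 hq hi hsp hv small hs4 hsys lev4.
set m5 := sem xbig DUALS m4 in hdual.
have hs5 : sized n d m5 by apply: sized_sem.
have f518 : fmem m5 18 = fmem m1 18 by rewrite /m5 sem_fframe // f4 // f3.
set m6 := sem xbig OUTPUT_L m5; have hs6 : sized n d m6 by apply: sized_sem.
set m7 := sem xbig OUTPUT_U m6; have hs7 : sized n d m7 by apply: sized_sem.
have e7 : sem xbig multiplier_program s = m7 := multiplier_sem s.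
rewrite e7 in he.
have shE (m' : memory R) : sized n d m' -> neval m' shift_full = (szE n d - 1)%N.
  by move=> hs'; rewrite /shift_full !nevalE (neval_E hs').
have shD (m' : memory R) : sized n d m' -> neval m' shift_dual = (2 * szh n d + 3)%N.
  by move=> hs'; rewrite /shift_dual !nevalE (neval_h hs').
have E0 : (0 < szE n d)%N by rewrite /szE addn4.
pose m8 := setn 1 1 (szE n d - 1)%N m7; pose m9 := setn 1 2 (szE n d - 1)%N m8.
exists k, m9, q, (csz_rank hq hi hsp), (invmx W), U; split=> //.
- rewrite -[k in exec _ _ k _]addn0; apply: exec_seq he _.
  rewrite -[X in exec _ _ X _](addn0 0).
  apply: (@exec_seq _ _ _ m7 0 m8 0 m9); first by rewrite /m8 -(shE m7 hs7); exact: exec_nset.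
  have hs8 : sized n d m8 by [].
  by rewrite /m9 -{1}(shE m8 hs8); exact: exec_nset.
- split.
    apply: (@output_stores 26 1 false shift_dual R n d (2 * szh n d + 3) shD _ _ m5 m9).
    + by rewrite /szE; lia.
    + by [].
    + exact: hs5.
    + by [].
    + by rewrite /m9 /m8 !fmem_setn /m7 sem_fframe.
    + by rewrite /m9 /m8 !fmem_setn /m7 sem_fframe.
    (* The two signs cancel, and the shift completes t^(2 h) to t^(E - 1). *)
    move=> x y; have /colP/(_ y) := hdual x; rewrite mxE => ->.
    rewrite /dual scalerA mulrA /col_sign -expr2 sqrr_sign mul1r !mxE mulrA -exprD; congr (_ ^+ _ * _).
    by rewrite /szE; lia.
  apply: (@output_stores 18 2 true shift_full R n d (szE n d - 1) shE _ _ m6 m9).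
  + by lia.
  + by [].
  + exact: hs6.
  + by [].
  + by rewrite /m9 /m8 !fmem_setn.
  + by rewrite /m9 /m8 !fmem_setn.
  move=> x y; have [[_ _ e18 _] _] := hc y (ltn_ord y).
  by rewrite U_col -e18 mxE /m6 sem_fframe // f518.
- by split; [exact: GL_Lmx | exact: GL_Umx].
Qed.

Theorem theoremB (R : realType) :
  [/\ (forall V : vector_bundle R,
         exists! m : {fsfun int -> nat with 0%N}, describes (canonical_mx R m) V),
      (exists (A : program) (P : {poly {poly nat}}),
         forall (n : nat) (M : 'M[ffield R]_n) (s : memory R),
           (1 <= n)%N -> GL (@R12 R) M -> input M s ->
           exists (k : nat) (s' : memory R) (m : {fsfun int -> nat with 0%N})
                  (size_m : canonical_size m = n),
             [/\ exec A s k s',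
                 (k <= P.[n%:P].[d_w (map_mx (@phi_pull R) M)])%N,
                 stores s' 1 (castmx (size_m, size_m) (canonical_mx R m)) &
                 exists L U : 'M[ffield R]_n,
                   [/\ GL (@R2 R) L, GL (@R1 R) U &
                       L *m M *m U = castmx (size_m, size_m) (canonical_mx R m)]])
    & (exists (A : program) (P : {poly {poly nat}}),
         forall (n : nat) (M : 'M[ffield R]_n) (s : memory R),
           (1 <= n)%N -> GL (@R12 R) M -> input M s ->
           exists (k : nat) (s' : memory R) (m : {fsfun int -> nat with 0%N})
                  (size_m : canonical_size m = n) (L U : 'M[ffield R]_n),
             [/\ exec A s k s',
                 (k <= P.[n%:P].[d_w (map_mx (@phi_pull R) M)])%N,
                 stores s' 1 L /\ stores s' 2 U,
                 GL (@R2 R) L /\ GL (@R1 R) U &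
                 L *m M *m U = castmx (size_m, size_m) (canonical_mx R m)])].
Proof.
split; [|exact: canonical_computable|exact: multipliers_computable] => V.
have [m hm] := splitting_exists V; exists m; split=> // m' hm'.
exact: splitting_unique hm hm'.
Qed.
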